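(* Let $\Sigma^k$ be a closed, connected, totally umbilical submanifold of $(\mathbb CP^m,g_0)$, with $k\ge2$, let $\sigma$ be its second fundamental form and $L=\Delta+|\sigma|^2+k$. Then the following statements hold. (1) If $\Sigma=\mathbb CP^\ell\subset\mathbb CP^m$, $k=2\ell$, is a totally geodesic complex projective subspace, then $\lambda_2(L)=k+4$. (2) If $\Sigma=\mathbb RP^k\subset\mathbb CP^m$ is the standard totally geodesic totally real projective subspace, then $\lambda_2(L)=k+2$. (3) If the immersion is the double covering $S^k\to\mathbb RP^k\subset\mathbb CP^m$, then $\lambda_2(L)=0$. (4) If $\Sigma=S^k(r)\subset\mathbb RP^{k+1}\subset\mathbb CP^m$, $0<r<\frac\pi2$, is a non-totally-geodesic extrinsic sphere, then $\lambda_2(L)=0$.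
   Context: $g_0$ is the Fubini–Study metric on $\mathbb CP^m$ of constant holomorphic sectional curvature $4$, i.e. the quotient metric of the unit sphere $\mathbb S^{2m+1}\subset\mathbb C^{m+1}$ by unit complex scalars. The standard subspaces are: $\mathbb CP^\ell$, the lines contained in $\mathbb C^{\ell+1}\times\{0\}$; $\mathbb RP^k$, the classes of real vectors in $\mathbb R^{k+1}\times\{0\}$, a totally geodesic, totally real (i.e. $J(T_p\mathbb RP^k)\perp T_p\mathbb RP^k$) submanifold of constant curvature $1$. $S^k\to\mathbb RP^k$ is the antipodal covering from the unit sphere. $S^k(r)\subset\mathbb RP^{k+1}$ is the geodesic sphere of radius $r$, i.e. the set of points at distance $r$ from a fixed point of the totally geodesic totally real $\mathbb RP^{k+1}$. Each $\Sigma$ carries the induced metric, and $\Delta=\operatorname{div}\nabla$ is its Laplacian. The eigenvalues of $L$ are the $\lambda$ with $Lu+\lambda u=0$ for some $u\ne0$ (i.e. the eigenvalues of $-L$), enumerated increasingly with multiplicity as $\lambda_1(L),\lambda_2(L),\dots$. Totally umbilical means $\sigma(X,Y)=g_0(X,Y)\vec H$ with $\vec H=\frac1k\operatorname{tr}\sigma$. *)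

(* Defs.v *)
From HB Require Import structures.
From mathcomp Require Import all_boot all_order all_algebra.
From mathcomp Require Import all_classical all_reals all_analysis.
From mathcomp Require Import complex.

Set Implicit Arguments.
Unset Strict Implicit.
Unset Printing Implicit Defensive.
Import Order.TTheory GRing.Theory Num.Theory.
Import numFieldNormedType.Exports.
Local Open Scope classical_set_scope.
Local Open Scope ring_scope.

Section Coordinates.
Context {R : realType}.

Definition partial {k : nat} (i : 'I_k) (f : 'rV[R]_k -> R) : 'rV[R]_k -> R :=
  fun x => 'D_(delta_mx 0 i) f x.

(* f is of class C^n on U; only meant for open U. *)
Fixpoint class_C {k : nat} (n : nat) (U : set 'rV[R]_k) (f : 'rV[R]_k -> R) : Prop :=
  match n with
  | 0%N => forall x, U x -> {for x, continuous f}
  | n'.+1 => (forall x, U x -> differentiable f x) /\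
             (forall i, class_C n' U (partial i f))
  end.

Definition smooth_on {k : nat} (U : set 'rV[R]_k) (f : 'rV[R]_k -> R) : Prop :=
  forall n, class_C n U f.

Definition christoffel {n : nat} (g : 'rV[R]_n -> 'M[R]_n) (a b c : 'I_n)
    (x : 'rV[R]_n) : R :=
  2^-1 * \sum_(d < n) invmx (g x) a d *
    (partial b (fun y => g y d c) x + partial c (fun y => g y d b) x
     - partial d (fun y => g y b c) x).

Definition grad {n : nat} (g : 'rV[R]_n -> 'M[R]_n) (u : 'rV[R]_n -> R)
    (x : 'rV[R]_n) : 'rV[R]_n :=
  \row_i \sum_(j < n) invmx (g x) i j * partial j u x.

(* The trace of the Levi-Civita covariant derivative of X. *)
Definition div {n : nat} (g : 'rV[R]_n -> 'M[R]_n) (X : 'rV[R]_n -> 'rV[R]_n)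
    (x : 'rV[R]_n) : R :=
  \sum_(i < n) (partial i (fun y => X y 0 i) x
                + \sum_(j < n) christoffel g i i j x * X x 0 j).

Definition laplacian {n : nat} (g : 'rV[R]_n -> 'M[R]_n) (u : 'rV[R]_n -> R) :=
  div g (grad g u).

Section Immersion.
(* W is an immersion of an open subset of R^k into an open subset of R^n
   carrying the Riemannian metric G. *)
Context {k n : nat} (G : 'rV[R]_n -> 'M[R]_n) (W : 'rV[R]_k -> 'rV[R]_n).

(* Row i is the i-th partial derivative of W. *)
Definition jac (x : 'rV[R]_k) : 'M[R]_(k, n) :=
  \matrix_(i, a) partial i (fun y => W y 0 a) x.

Definition induced_metric (x : 'rV[R]_k) : 'M[R]_k :=
  jac x *m G (W x) *m (jac x)^T.

(* The Levi-Civita derivative, in the metric G, of the field dW(e_j) along W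
   in the direction dW(e_i). *)
Definition ambient_deriv (i j : 'I_k) (x : 'rV[R]_k) : 'rV[R]_n :=
  \row_a (partial i (partial j (fun y => W y 0 a)) x
          + \sum_(b < n) \sum_(c < n)
              christoffel G a b c (W x) * jac x i b * jac x j c).

(* v minus its G-orthogonal projection onto the row space of the Jacobian. *)
Definition normal_part (x : 'rV[R]_k) (v : 'rV[R]_n) : 'rV[R]_n :=
  v - v *m G (W x) *m (jac x)^T *m invmx (induced_metric x) *m jac x.

Definition second_ff (x : 'rV[R]_k) (i j : 'I_k) : 'rV[R]_n :=
  normal_part x (ambient_deriv i j x).

Definition second_ff_sqnorm (x : 'rV[R]_k) : R :=
  let h := invmx (induced_metric x) in
  \sum_(i < k) \sum_(j < k) \sum_(i' < k) \sum_(j' < k)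
    h i i' * h j j' *
    (second_ff x i j *m G (W x) *m (second_ff x i' j')^T) 0 0.

Definition mean_curvature (x : 'rV[R]_k) : 'rV[R]_n :=
  k%:R^-1 *: \sum_(i < k) \sum_(j < k)
    invmx (induced_metric x) i j *: second_ff x i j.

End Immersion.
End Coordinates.

Section ProjectiveSpace.
Context {R : realType} {m : nat}.

Definition CP : Type := {L : {vspace 'rV[R[i]]_m.+1} | \dim L == 1%N}.

Definition is_class (p : CP) (z : 'rV[R[i]]_m.+1) : Prop := val p = <[z]>%VS.

Definition herm (z w : 'rV[R[i]]_m.+1) : R[i] :=
  \sum_(i < m.+1) z 0 i * conjc (w 0 i).

Definition horizontal (z v : 'rV[R[i]]_m.+1) : 'rV[R[i]]_m.+1 :=
  v - (herm v z / herm z z) *: z.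

(* The Fubini-Study metric evaluated at d[.]_z(v), d[.]_z(w), where z <> 0 and
   [.] is the projection of C^{m+1} \ {0} onto CP^m.  The horizontal lift of
   d[.]_z(v) at the point z/|z| of the unit sphere is (horizontal z v)/|z|. *)
Definition fubini_study (z v w : 'rV[R[i]]_m.+1) : R :=
  complex.Re (herm (horizontal z v) (horizontal z w)) / complex.Re (herm z z).

(* Put c at place j and the m complex numbers x + iy at the other places,
   where x and y are the two halves of the real vector (x, y). *)
Definition insert_at (j : 'I_m.+1) (c : R[i]) (w : 'rV[R]_(m + m)) :
    'rV[R[i]]_m.+1 :=
  \row_i (if unlift j i is Some i'
          then Complex (w 0 (lshift m i')) (w 0 (rshift m i')) else c).

Definition in_chart (j : 'I_m.+1) (p : CP) : bool := vpick (val p) 0 j != 0.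

(* The inhomogeneous coordinates z_i / z_j, i <> j. *)
Definition coord (j : 'I_m.+1) (p : CP) : 'rV[R]_(m + m) :=
  let q := fun i : 'I_m => vpick (val p) 0 (lift j i) / vpick (val p) 0 j in
  row_mx (\row_i complex.Re (q i)) (\row_i complex.Im (q i)).

(* g_0 in the j-th affine chart. *)
Definition fs_chart (j : 'I_m.+1) (w : 'rV[R]_(m + m)) : 'M[R]_(m + m) :=
  \matrix_(a, b) fubini_study (insert_at j 1 w)
    (insert_at j 0 (delta_mx 0 a)) (insert_at j 0 (delta_mx 0 b)).

Definition standard_CP (l : nat) : set CP :=
  [set p : CP | forall z : 'rV[R[i]]_m.+1, z \in val p ->
     forall i : 'I_m.+1, (l < i)%N -> z 0 i = 0].

Definition complexify (x : 'rV[R]_m.+1) : 'rV[R[i]]_m.+1 :=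
  map_mx (fun t : R => Complex t 0) x.

(* Classes of the nonzero vectors of R^{k+1} x {0} *)
Definition standard_RP (k : nat) : set CP :=
  [set p : CP | exists x : 'rV[R]_m.+1,
     [/\ x != 0, forall i : 'I_m.+1, (k < i)%N -> x 0 i = 0
       & is_class p (complexify x)]].

(* The unit sphere of R^{k+1} x {0} *)
Definition standard_sphere (k : nat) : set 'rV[R]_m.+1 :=
  [set x : 'rV[R]_m.+1 | \sum_(i < m.+1) x 0 i ^+ 2 = 1 /\
           forall i : 'I_m.+1, (k < i)%N -> x 0 i = 0].

Section Distance.

Definition curve_coord (gamma : R -> CP) (j : 'I_m.+1) (a : 'I_(m + m)) : R -> R :=
  fun t => coord j (gamma t) 0 a.

Definition C1_curve (gamma : R -> CP) : Prop :=
  forall t : R, 0 <= t <= 1 -> exists j, \forall s \near t,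
    in_chart j (gamma s) /\
    forall a, derivable (curve_coord gamma j a) s 1 /\
              {for s, continuous (derive1 (curve_coord gamma j a))}.

Definition chart_at (p : CP) : 'I_m.+1 := odflt ord0 [pick j | in_chart j p].

Definition speed (gamma : R -> CP) (t : R) : R :=
  let j := chart_at (gamma t) in
  let v := \row_a derive1 (curve_coord gamma j a) t in
  Num.sqrt ((v *m fs_chart j (coord j (gamma t)) *m v^T) 0 0).

Definition curve_length (gamma : R -> CP) : R :=
  \int[lebesgue_measure]_(t in `[0, 1]) speed gamma t.

(* Riemannian distance of a connected submanifold S of CP^m *)
Definition intrinsic_dist (S : set CP) (p q : CP) : R :=
  inf [set s | exists gamma : R -> CP,
    [/\ C1_curve gamma, gamma 0 = p, gamma 1 = q,
        forall t : R, 0 <= t <= 1 -> S (gamma t) & s = curve_length gamma]].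

Definition geodesic_sphere (S : set CP) (p : CP) (r : R) : set CP :=
  [set q | S q /\ intrinsic_dist S p q = r].

End Distance.
End ProjectiveSpace.
Arguments CP : clear implicits.

Section Submanifold.
Context {R : realType} {m : nat} (k : nat) {M : topologicalType} (f : M -> CP R m).

(* A homeomorphism par from an open subset dom of R^k onto an open subset of M
   such that f \o par takes its values in one affine chart of CP^m and is there
   a smooth immersion. *)
Record local_param := LocalParam {
  chart : 'I_m.+1;
  dom : set 'rV[R]_k;
  par : 'rV[R]_k -> M;
  dom_open : open dom;
  par_continuous : {within dom, continuous par};
  par_inj : set_inj dom par;
  par_open : forall V, V `<=` dom -> open V -> open (par @` V);
  par_chart : forall x, dom x -> in_chart chart (f (par x));
  par_smooth : forall a, smooth_on dom (fun x => coord chart (f (par x)) 0 a);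
  par_immersion : forall x, dom x ->
    row_free (jac (fun y => coord chart (f (par y))) x)
}.

(* f is an immersion of a k-dimensional manifold.  The smooth structure of M is
   not a separate datum: the maps par of any two local parametrizations are
   smoothly compatible, so f determines it. *)
Definition immersed_submanifold : Prop :=
  hausdorff_space M /\
  forall p, exists P : local_param, (par P @` dom P) p.

(* Compact without boundary *)
Definition closed_submanifold : Prop :=
  immersed_submanifold /\ compact [set: M].

Section Local.
Variable P : local_param.

Let G := fs_chart (R := R) (chart P).

Definition immersion (x : 'rV[R]_k) : 'rV[R]_(m + m) := coord (chart P) (f (par P x)).

Definition metric : 'rV[R]_k -> 'M[R]_k := induced_metric G immersion.
Definition sigma : 'rV[R]_k -> 'I_k -> 'I_k -> 'rV[R]_(m + m) := second_ff G immersion.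
Definition sigma_sqnorm : 'rV[R]_k -> R := second_ff_sqnorm G immersion.
Definition Hvec : 'rV[R]_k -> 'rV[R]_(m + m) := mean_curvature G immersion.

End Local.

Definition totally_umbilical : Prop :=
  forall (P : local_param) x, dom P x -> forall i j,
    sigma P x i j = metric P x i j *: Hvec P x.

Definition smooth_function (u : M -> R) : Prop :=
  forall P : local_param, smooth_on (dom P) (u \o par P).

(* v = L u, where L = Delta + |sigma|^2 + k *)
Definition is_L (u v : M -> R) : Prop :=
  forall (P : local_param) x, dom P x ->
    v (par P x) = laplacian (metric P) (u \o par P) x
                  + (sigma_sqnorm P x + k%:R) * u (par P x).

(* u solves L u + lam u = 0; the function u = 0 is allowed. *)
Definition in_eigenspace (lam : R) (u : M -> R) : Prop :=
  smooth_function u /\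
  exists2 v, is_L u v & forall p, v p + lam * u p = 0.

(* lam is the n-th term, n >= 1, of the increasing enumeration, with
   multiplicity, of the eigenvalues of L: l_1 <= ... <= l_n are its first n
   terms, u_1, ..., u_n are corresponding independent eigenfunctions, and
   they exhaust the eigenspaces of all eigenvalues below l_n = lam. *)
Definition is_nth_eigenvalue (n : nat) (lam : R) : Prop :=
  exists (l : nat -> R) (u : nat -> M -> R),
  [/\ forall i, (1 <= i <= n)%N -> in_eigenspace (l i) (u i),
      forall c : nat -> R,
        (forall p, \sum_(1 <= i < n.+1) c i * u i p = 0) ->
        forall i, (1 <= i <= n)%N -> c i = 0,
      forall i j, (1 <= i)%N -> (i <= j)%N -> (j <= n)%N -> l i <= l j,
      forall mu w, mu < l n -> in_eigenspace mu w ->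
        exists c : nat -> R, forall p,
          w p = \sum_(1 <= i < n.+1 | l i == mu) c i * u i p
    & l n = lam].

(* f is injective with image S.  As M is compact, f is then an embedding. *)
Definition embedded_onto (S : set (CP R m)) : Prop :=
  injective f /\ range f = S.

(* M is identified by h with the unit sphere of R^{k+1}, and f with the
   restriction to that sphere of x |-> [x].  A continuous bijection of the
   compact sphere onto the Hausdorff space M is a homeomorphism. *)
Definition is_double_cover : Prop :=
  exists h : 'rV[R]_m.+1 -> M,
    [/\ {within standard_sphere k, continuous h},
        set_bij (standard_sphere k) [set: M] h
      & forall x, standard_sphere k x -> is_class (f (h x)) (complexify x)].

End Submanifold.

(* Main.v *)
(* A submanifold of CP^m occurring in (1)-(4) lifts, up to the Hopf fibration, to
   the points a + be (x/|x|) B of the unit sphere, where x runs through R^N \ {0}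
   and B is an isometric embedding; functions on it become 0-homogeneous functions
   F on R^N \ {0}.  In this picture the metric is be^2 times the (horizontal) round
   metric, Delta becomes be^-2 |x|^2 times the Euclidean Laplacian, and
   |sigma|^2 = k (be^-2 - 1), so an eigenvalue mu of the sphere gives the eigenvalue
   (mu - k) / be^2 of L.

   If |x|^2 lap F = - mu F, then |x|^s F is harmonic for s (s + N - 2) = mu.  Its
   derivatives are harmonic and homogeneous of degree s - 1, and the maximum
   principle kills harmonic functions of degree in (2 - N, 0).  Hence the first
   positive mu is N - 1 (degree s = 1), and 2 N (degree s = 2) if F is even.  If F
   is harmonic of degree 0, let Q be the sum of the squares of its rotation
   derivatives: lap Q <= 0 at a maximum point forces the gradient of F, hence Q, to
   vanish there, so F is constant.

   In (4) the intrinsic distance between [a] and [b] is arccos |<a, b>|: for a curve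
   with rank-one projectors P(t), the angle arccos sqrt(<P(t) a, a>) has derivative
   at most the speed, which is |P'(t)| up to a constant factor, and the great circle
   through a and b attains the bound. *)
Require Import Defs.
From HB Require Import structures.
From mathcomp Require Import all_boot all_order all_algebra.
From mathcomp Require Import all_classical all_reals all_analysis.
From mathcomp Require Import complex ring lra.
Import Order.TTheory GRing.Theory Num.Theory.
Import numFieldNormedType.Exports.
Local Open Scope classical_set_scope.
Local Open Scope ring_scope.
Set Implicit Arguments.
Unset Strict Implicit.
Unset Printing Implicit Defensive.

(** * Partial derivatives and smooth functions *)

(** The definitions show M only through local parametrizations in affine charts, while the spectral
    argument is global. The link is a map [Psi] from R^N minus the origin onto M: a function u on M
    is studied through its pullback by [Psi], a single smooth function in flat coordinates.
    Smoothness must pass in both directions, so [Psi] has to be continuous and every parametrization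
    needs a smooth unit lift nearby. Unit lifts are determined only up to a phase; where M is a
    sphere this becomes the problem of a locally constant sign. Points of CP^m are compared by their
    projectors, which depend on no chart.

    Being second means that everything below is known, negative mu included: constants give mu = 0,
    hence the eigenvalue -k / be^2, and nothing else may occur before the next value mu2. In (1) and
    (2) be = 1 and mu2 = 2 N, with N = k + 2 and N = k + 1, whence k + 4 and k + 2. In (3) and (4)
    mu2 = N - 1 = k, whence 0 for every be.

    Degree 0 with mu = 0 is the case of equality in the maximum principle, which is why constancy
    needs its own argument. *)

Section Partial.
Context {R : realType}.
Implicit Types (k N n : nat).

Lemma differentiable_rV (V : normedModType R) N (phi : V -> 'rV[R]_N) (x : V) :
  (forall a, differentiable (fun y => phi y 0 a) x) -> differentiable phi x.
Proof.
move=> h.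
have -> : phi = \sum_(a < N) (fun y => phi y 0 a *: (delta_mx 0 a : 'rV[R]_N)).
  apply/funext => y; rewrite fct_sumE; exact: row_sum_delta.
apply: differentiable_sum => a; apply: differentiableZl; exact: h.
Qed.

Lemma partialE k (i : 'I_k) (f : 'rV[R]_k -> R) (x : 'rV[R]_k) :
  differentiable f x -> partial i f x = 'd f x (delta_mx 0 i).
Proof. by move=> df; rewrite /partial deriveE. Qed.

Lemma partial_near k (i : 'I_k) (f g : 'rV[R]_k -> R) (x : 'rV[R]_k) :
  (\forall y \near x, f y = g y) -> partial i f x = partial i g x.
Proof.
move=> fg; rewrite /partial.
(* [near_eq_derive] asks for a nonzero direction; a zero direction gives derivative 0 on both
   sides. *)
have [->|d0] := eqVneq (delta_mx 0 i : 'rV[R]_k) 0.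
  by rewrite !derive0.
exact: near_eq_derive.
Qed.

Lemma partialD k (i : 'I_k) (f g : 'rV[R]_k -> R) (x : 'rV[R]_k) :
  differentiable f x -> differentiable g x ->
  partial i (fun y => f y + g y) x = partial i f x + partial i g x.
Proof. by move=> df dg; rewrite /partial deriveD//; exact: diff_derivable. Qed.

Lemma partialM k (i : 'I_k) (f g : 'rV[R]_k -> R) (x : 'rV[R]_k) :
  differentiable f x -> differentiable g x ->
  partial i (fun y => f y * g y) x = f x * partial i g x + g x * partial i f x.
Proof.
move=> df dg; rewrite /partial.
rewrite (_ : (fun y => f y * g y) = f * g)//.
by rewrite deriveM//; exact: diff_derivable.
Qed.

Lemma partial_cst k (i : 'I_k) (c : R) (x : 'rV[R]_k) : partial i (fun=> c) x = 0.
Proof. exact: derive_cst. Qed.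

Lemma partialZ k (i : 'I_k) (c : R) (f : 'rV[R]_k -> R) (x : 'rV[R]_k) :
  differentiable f x -> partial i (fun y => c * f y) x = c * partial i f x.
Proof.
move=> df; rewrite partialM//.
by rewrite partial_cst mulr0 addr0.
Qed.

Lemma partialB k (i : 'I_k) (f g : 'rV[R]_k -> R) (x : 'rV[R]_k) :
  differentiable f x -> differentiable g x ->
  partial i (fun y => f y - g y) x = partial i f x - partial i g x.
Proof. by move=> df dg; rewrite /partial deriveB//; exact: diff_derivable. Qed.

Lemma differentiable_bigsum (V : normedModType R) (I : Type) (r : seq I) (f : I -> V -> R) (x : V) :
  (forall a, differentiable (f a) x) -> differentiable (fun y => \sum_(a <- r) f a y) x.
Proof.
move=> df; elim: r => [|a r ih].
  rewrite (_ : (fun y => _) = cst 0); first exact: differentiable_cst.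
  by apply/funext => y; rewrite big_nil.
rewrite (_ : (fun y => _) = (fun y => f a y) + (fun y => \sum_(a <- r) f a y)).
  exact: differentiableD.
by apply/funext => y; rewrite big_cons.
Qed.

Lemma partial_sum k (i : 'I_k) (I : Type) (r : seq I) (f : I -> 'rV[R]_k -> R) (x : 'rV[R]_k) :
  (forall a, differentiable (f a) x) ->
  partial i (fun y => \sum_(a <- r) f a y) x = \sum_(a <- r) partial i (f a) x.
Proof.
move=> df; elim: r => [|a r ih].
  rewrite big_nil (_ : (fun y => _) = fun=> 0) ?partial_cst//.
  by apply/funext => y; rewrite big_nil.
rewrite big_cons -ih -partialD//; last exact: differentiable_bigsum.
by congr partial; apply/funext => y; rewrite big_cons.
Qed.

Lemma differentiable_entry k (j : 'I_k) (x : 'rV[R]_k) :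
  differentiable (fun y : 'rV[R]_k => y 0 j) x.
Proof. exact: differentiable_coord. Qed.

Lemma partial_entry k (i j : 'I_k) (x : 'rV[R]_k) :
  partial i (fun y : 'rV[R]_k => y 0 j) x = (i == j)%:R.
Proof.
rewrite /partial deriveE; last exact: differentiable_entry.
have lf : linear (fun y : 'rV[R]_k => y 0 j : R^o).
  by move=> c u v; rewrite !mxE.
pose L := GRing.isLinear.Build _ _ _ _ _ lf.
pose f : {linear 'rV[R]_k -> R^o} := HB.pack (fun y : 'rV[R]_k => y 0 j : R^o) L.
have -> : (fun y : 'rV[R]_k => y 0 j) = f :> (_ -> R) by [].
rewrite (@diff_lin _ _ R^o f); last exact: coord_continuous.
by rewrite /f /= mxE eqxx /= eq_sym.
Qed.

Lemma diff_sum_partial N (f : 'rV[R]_N -> R) (x v : 'rV[R]_N) :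
  differentiable f x -> 'd f x v = \sum_a v 0 a * partial a f x.
Proof.
move=> df; rewrite {1}(row_sum_delta v) linear_sum; apply: eq_bigr => a _.
by rewrite linearZ partialE.
Qed.

Lemma partial_comp k N (i : 'I_k) (f : 'rV[R]_N -> R) (phi : 'rV[R]_k -> 'rV[R]_N) (x : 'rV[R]_k) :
  differentiable f (phi x) -> (forall a, differentiable (fun y => phi y 0 a) x) ->
  partial i (fun y => f (phi y)) x =
  \sum_a partial a f (phi x) * partial i (fun y => phi y 0 a) x.
Proof.
move=> df dphi; have dp : differentiable phi x by exact: differentiable_rV.
rewrite partialE; last exact: differentiable_comp.
rewrite diff_comp//= diff_sum_partial//; apply: eq_bigr => a _.
rewrite mulrC; congr (_ * _).
have -> : (fun y => phi y 0 a) = (fun z : 'rV[R]_N => z 0 a) \o phi by [].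
rewrite partialE; last by apply: differentiable_comp => //; exact: differentiable_entry.
have da := differentiable_entry a (phi x).
have := diff_comp dp da => /(congr1 (fun h => h (delta_mx 0 i))) -> /=.
rewrite (@diff_sum_partial N (fun z => z 0 a))//.
rewrite (bigD1 a)//= partial_entry eqxx mulr1 big1 ?addr0// => b ba.
by rewrite partial_entry (negbTE ba) mulr0.
Qed.

Lemma differentiable_comp1 (V : normedModType R) (g : R -> R) (f : V -> R) (x : V) :
  derivable g (f x) 1 -> differentiable f x -> differentiable (fun y => g (f y)) x.
Proof. by move=> /derivable1_diffP dg df; exact: differentiable_comp. Qed.

Lemma partial_comp1 k (i : 'I_k) (g : R -> R) (f : 'rV[R]_k -> R) (x : 'rV[R]_k) :
  derivable g (f x) 1 -> differentiable f x ->
  partial i (fun y => g (f y)) x = derive1 g (f x) * partial i f x.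
Proof.
move=> dg df; have dg' : differentiable g (f x) by exact/derivable1_diffP.
rewrite partialE; last exact: differentiable_comp.
by rewrite diff_comp//= deriv1E// /= partialE// mulrC.
Qed.

End Partial.

Section Eps.
Context {R : realType} {V W : normedModType R}.
Implicit Types (f : V -> W) (x : V).

(** This and [eps_diff] trade the little-o of the differential for explicit inequalities, so that
    several first-order estimates at one point can be combined by linear arithmetic. *)
Lemma diff_eps f x : differentiable f x -> forall e, 0 < e ->
  \forall y \near x, `|f y - f x - 'd f x (y - x)| <= e * `|y - x|.
Proof.
move=> /diff_locally/eqaddoP h e e0; have := h e e0 => H.
rewrite (near_shift 0 x)/= subr0.
near=> y => /=.
have : `|f (y + x) - (f x + 'd f x y)| <= e * `|y| by near: y.
by rewrite !addrK opprD addrA.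
Unshelve. all: by end_near. Qed.

Lemma eps_diff f x (L : {linear V -> W}) : continuous L ->
  (forall e, 0 < e -> \forall y \near x, `|f y - f x - L (y - x)| <= e * `|y - x|) ->
  differentiable f x.
Proof.
move=> cL H.
have E : f \o shift x = cst (f x) + L +o_ 0 id.
  apply/eqaddoP => e e0; have := H e e0.
  rewrite (near_shift 0 x)/= subr0 => H1.
  near=> y => /=.
  have : `|f (y + x) - f x - L (y + x - x)| <= e * `|y + x - x|.
    by near: y.
  by rewrite !addrK opprD addrA.
by apply/diff_locallyP; rewrite (diff_unique cL E).
Unshelve. all: by end_near. Qed.

End Eps.

Section Smooth.
Context {R : realType}.
Implicit Types (k N n : nat).

Lemma near_eq_differentiable (V : normedModType R) (f g : V -> R) (x : V) :
  (\forall y \near x, f y = g y) -> differentiable f x -> differentiable g x.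
Proof.
move=> fg df; apply: (@eps_diff _ _ _ _ _ ('d f x)); first exact: diff_continuous.
move=> e e0; have := diff_eps df e0 => H.
have fgx : f x = g x by exact: nbhs_singleton fg.
near=> y; rewrite -fgx; have <- : f y = g y by near: y.
by near: y.
Unshelve. all: by end_near. Qed.

Lemma continuous_mx (T : topologicalType) m n (f : T -> 'M[R]_(m, n)) (x : T) :
  (forall a b, {for x, continuous (fun y => f y a b)}) -> {for x, continuous f}.
Proof.
move=> h; apply/cvgrPdist_le => /= e e0; near=> y.
rewrite /Num.Def.normr/= mx_normrE (bigmax_le _ (ltW e0))//= => i _.
rewrite !mxE/=; move: i; near: y; apply: filter_forall => /= i.
by move/cvgrPdist_le : (h i.1 i.2); apply.
Unshelve. all: by end_near. Qed.

Lemma class_C_sub k n (U V : set 'rV[R]_k) f : V `<=` U -> class_C n U f -> class_C n V f.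
Proof.
move=> VU; elim: n f => [|n ih] f /=; first by move=> h x /VU/h.
by move=> [h1 h2]; split => [x /VU/h1//|i]; exact: ih.
Qed.

Lemma class_C_local k n (U : set 'rV[R]_k) f :
  (forall x, U x -> exists V, V x /\ class_C n V f) -> class_C n U f.
Proof.
elim: n f => [|n ih] f /= h.
  by move=> x /h[V [Vx]]; exact.
split => [x /h[V [Vx [+ _]]]|i]; first exact.
by apply: ih => x /h[V [Vx [_ hp]]]; exists V.
Qed.

Lemma class_C_pred k n (U : set 'rV[R]_k) f : class_C n.+1 U f -> class_C n U f.
Proof.
elim: n f => [|n ih] f /= [h1 h2].
  by move=> x /h1 df; exact: (differentiable_continuous df).
by split => // i; apply: ih; exact: h2.
Qed.

Lemma class_C_eq k n (U : set 'rV[R]_k) f g : open U -> (forall x, U x -> f x = g x) ->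
  class_C n U f -> class_C n U g.
Proof.
move=> oU; elim: n f g => [|n ih] f g fg /=.
  move=> h x Ux.
  have E : \forall y \near x, f y = g y.
    by apply: filterS (open_nbhs_nbhs (conj oU Ux)) => y /fg.
  change (g @ x --> g x); rewrite -(fg _ Ux).
  by apply: cvg_trans (h x Ux); exact: (@near_eq_cvg _ _ (nbhs x) _ f g E).
move=> [h1 h2].
have E x : U x -> \forall y \near x, f y = g y.
  by move=> Ux; apply: filterS (open_nbhs_nbhs (conj oU Ux)) => y /fg.
split => [x Ux|i].
  exact: near_eq_differentiable (E x Ux) (h1 x Ux).
apply: ih (h2 i) => x Ux; apply: partial_near; exact: E.
Qed.

Lemma smooth_diff k (U : set 'rV[R]_k) f x : smooth_on U f -> U x -> differentiable f x.
Proof. by move=> /(_ 1%N)[h _] /h. Qed.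

Lemma smooth_continuous k (U : set 'rV[R]_k) f x : smooth_on U f -> U x -> {for x, continuous f}.
Proof. by move=> /(_ 0%N) h /h. Qed.

Lemma smooth_partial k (U : set 'rV[R]_k) f (i : 'I_k) : smooth_on U f -> smooth_on U (partial i f).
Proof. by move=> h n; case: (h n.+1) => _; exact. Qed.

Lemma smooth_sub k (U V : set 'rV[R]_k) f : V `<=` U -> smooth_on U f -> smooth_on V f.
Proof. by move=> VU h n; exact: class_C_sub VU (h n). Qed.

Lemma smooth_eq k (U : set 'rV[R]_k) f g : open U -> (forall x, U x -> f x = g x) ->
  smooth_on U f -> smooth_on U g.
Proof. by move=> oU fg h n; exact: class_C_eq fg (h n). Qed.

Lemma smooth_local k (U : set 'rV[R]_k) f :
  (forall x, U x -> exists V, V x /\ smooth_on V f) -> smooth_on U f.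
Proof.
move=> h n; apply: class_C_local => x /h[V [Vx hV]]; exists V; split => //; exact: hV.
Qed.

Lemma class_C_cst k n (U : set 'rV[R]_k) (c : R) : class_C n U (fun=> c).
Proof.
elim: n c => [|n ih] c /=; first by move=> x _; exact: cst_continuous.
split => [x _|i]; first exact: (@differentiable_cst _ _ _ (c : R^o)).
rewrite (_ : partial i _ = fun=> 0); first exact: ih.
by apply/funext => x; exact: partial_cst.
Qed.

Lemma class_C_entry k n (U : set 'rV[R]_k) (j : 'I_k) : class_C n U (fun x : 'rV[R]_k => x 0 j).
Proof.
case: n => [|n] /=; first by move=> x _; exact: coord_continuous.
split => [x _|i]; first exact: differentiable_entry.
rewrite (_ : partial i _ = fun=> (i == j)%:R); first exact: class_C_cst.
by apply/funext => x; exact: partial_entry.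
Qed.

Lemma class_C_D k n (U : set 'rV[R]_k) f g : open U -> class_C n U f -> class_C n U g ->
  class_C n U (fun x => f x + g x).
Proof.
move=> oU; elim: n f g => [|n ih] f g /=.
  by move=> hf hg x Ux; apply: continuousD; [exact: hf|exact: hg].
move=> [f1 f2] [g1 g2]; split => [x Ux|i].
  by apply: differentiableD; [exact: f1|exact: g1].
apply: class_C_eq (ih _ _ (f2 i) (g2 i)) => // x Ux.
by rewrite partialD//; [exact: f1|exact: g1].
Qed.

Lemma class_C_M k n (U : set 'rV[R]_k) f g : open U -> class_C n U f -> class_C n U g ->
  class_C n U (fun x => f x * g x).
Proof.
move=> oU; elim: n f g => [|n ih] f g hf hg /=.
  by move=> x Ux; apply: continuousM; [exact: hf|exact: hg].
have := hf; have := hg; move=> [g1 g2] [f1 f2]; split => [x Ux|i].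
  by apply: differentiableM; [exact: f1|exact: g1].
apply: (@class_C_eq _ _ _ (fun x => f x * partial i g x + g x * partial i f x)) => //.
  by move=> x Ux; rewrite partialM//; [exact: f1|exact: g1].
by apply: class_C_D => //; apply: ih; do ?[exact: class_C_pred]; [exact: g2|exact: f2].
Qed.

Lemma class_C_V k n (U : set 'rV[R]_k) f : open U -> (forall x, U x -> f x != 0) ->
  class_C n U f -> class_C n U (fun x => (f x)^-1).
Proof.
move=> oU f0; elim: n => [|n ih] hf /=.
  by move=> x Ux; apply: continuousV; [exact: f0|exact: hf].
have := hf; move=> [f1 f2]; split => [x Ux|i].
  by apply: differentiableV; [exact: f1|exact: f0].
apply: (@class_C_eq _ _ _ (fun x => (-1) * ((f x)^-1 * (f x)^-1) * partial i f x)) => //.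
  move=> x Ux; rewrite /partial [RHS]deriveV; last 2 first.
  - exact: f0.
  - by apply: diff_derivable; exact: f1.
  by rewrite /GRing.scale/= -exprVn expr2 mulN1r.
have fi := ih (class_C_pred hf).
apply: class_C_M; [by []| |exact: f2].
by apply: class_C_M; [by []|exact: class_C_cst|exact: class_C_M].
Qed.

Lemma class_C_powR k n (U : set 'rV[R]_k) f (s : R) : open U -> (forall x, U x -> 0 < f x) ->
  class_C n U f -> class_C n U (fun x => f x `^ s).
Proof.
(* Each derivative lowers the exponent by one, so the induction is uniform in s. *)
move=> oU f0; elim: n s => [|n ih] s hf.
  move=> x Ux.
  have /differentiable_continuous h : differentiable (fun y : R => y `^ s) (f x).
    by apply/derivable1_diffP; apply: derivable_powR; rewrite in_itv/= andbT f0.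
  by apply: (continuous_comp (hf x Ux) h).
have [f1 f2] := hf.
have dp x : U x -> derivable (fun y : R => y `^ s) (f x) 1.
  by move=> Ux; apply: derivable_powR; rewrite in_itv/= andbT f0.
split => [x Ux|i].
  by apply: (@differentiable_comp1 _ _ (fun y => y `^ s)); [exact: dp|exact: f1].
apply: (@class_C_eq _ _ _ (fun x => s * f x `^ (s - 1) * partial i f x)) => //.
  move=> x Ux; rewrite (@partial_comp1 _ _ i (fun y => y `^ s))//.
  - by rewrite powR_derive1// in_itv/= andbT f0.
  - exact: dp.
  - exact: f1.
apply: class_C_M; [by []| |exact: f2].
apply: class_C_M; [by []|exact: class_C_cst|].
by apply: ih; exact: class_C_pred.
Qed.

Lemma smooth_cst k (U : set 'rV[R]_k) (c : R) : smooth_on U (fun=> c).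
Proof. by move=> n; exact: class_C_cst. Qed.
Lemma smooth_entry k (U : set 'rV[R]_k) (j : 'I_k) : smooth_on U (fun x : 'rV[R]_k => x 0 j).
Proof. by move=> n; exact: class_C_entry. Qed.

Section Ops.
Context k (U : set 'rV[R]_k) (oU : open U).
Implicit Types f g : 'rV[R]_k -> R.

Lemma smooth_D f g : smooth_on U f -> smooth_on U g -> smooth_on U (fun x => f x + g x).
Proof. by move=> hf hg n; exact: class_C_D. Qed.
Lemma smooth_M f g : smooth_on U f -> smooth_on U g -> smooth_on U (fun x => f x * g x).
Proof. by move=> hf hg n; exact: class_C_M. Qed.
Lemma smooth_Z c f : smooth_on U f -> smooth_on U (fun x => c * f x).
Proof. by move=> hf; apply: smooth_M => //; exact: smooth_cst. Qed.
Lemma smooth_N f : smooth_on U f -> smooth_on U (fun x => - f x).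
Proof.
move=> hf; rewrite (_ : (fun x => - f x) = fun x => (-1) * f x); first exact: smooth_Z.
by apply/funext => x; rewrite mulN1r.
Qed.
Lemma smooth_B f g : smooth_on U f -> smooth_on U g -> smooth_on U (fun x => f x - g x).
Proof. by move=> hf hg; apply: smooth_D => //; exact: smooth_N. Qed.
Lemma smooth_V f : (forall x, U x -> f x != 0) -> smooth_on U f ->
  smooth_on U (fun x => (f x)^-1).
Proof. by move=> f0 hf n; exact: class_C_V. Qed.
Lemma smooth_powR f s : (forall x, U x -> 0 < f x) -> smooth_on U f ->
  smooth_on U (fun x => f x `^ s).
Proof. by move=> f0 hf n; exact: class_C_powR. Qed.
Lemma smooth_sum (I : Type) (r : seq I) (P : pred I) (f : I -> 'rV[R]_k -> R) :
  (forall a, P a -> smooth_on U (f a)) -> smooth_on U (fun y => \sum_(a <- r | P a) f a y).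
Proof.
move=> hf; elim: r => [|a r ih].
  rewrite (_ : (fun y => _) = fun=> 0); first exact: smooth_cst.
  by apply/funext => y; rewrite big_nil.
case: (boolP (P a)) => Pa.
  rewrite (_ : (fun y => _) = fun y => f a y + \sum_(a <- r | P a) f a y).
    by apply: smooth_D => //; exact: hf.
  by apply/funext => y; rewrite big_cons Pa.
by rewrite (_ : (fun y => _) = fun y => \sum_(a <- r | P a) f a y)//; apply/funext => y;
  rewrite big_cons (negbTE Pa).
Qed.
Lemma smooth_prod (I : Type) (r : seq I) (f : I -> 'rV[R]_k -> R) :
  (forall a, smooth_on U (f a)) -> smooth_on U (fun y => \prod_(a <- r) f a y).
Proof.
move=> hf; elim: r => [|a r ih].
  rewrite (_ : (fun y => _) = fun=> 1); first exact: smooth_cst.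
  by apply/funext => y; rewrite big_nil.
rewrite (_ : (fun y => _) = fun y => f a y * \prod_(a <- r) f a y).
  by apply: smooth_M => //; exact: hf.
by apply/funext => y; rewrite big_cons.
Qed.
Lemma smooth_partialsq f i j : smooth_on U f -> smooth_on U (partial i (partial j f)).
Proof. by move=> hf; do 2 apply: smooth_partial. Qed.

End Ops.

Lemma class_C_bigsum k n (U : set 'rV[R]_k) (I : Type) (r : seq I) (f : I -> 'rV[R]_k -> R) :
  open U -> (forall a, class_C n U (f a)) -> class_C n U (fun y => \sum_(a <- r) f a y).
Proof.
move=> oU hf; elim: r => [|a r ihr].
  rewrite (_ : (fun y => _) = fun=> 0); first exact: class_C_cst.
  by apply/funext => y; rewrite big_nil.
rewrite (_ : (fun y => _) = fun y => f a y + \sum_(a <- r) f a y).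
  exact: class_C_D.
by apply/funext => y; rewrite big_cons.
Qed.

(** The outer function is smooth of all orders, so the induction can pass to its partial derivatives
    without counting. The inner map is only C^n, which is what the bootstrap in [inverse_smooth] has
    at its disposal. *)
Lemma class_C_comp k N n (U : set 'rV[R]_k) (V : set 'rV[R]_N) (F : 'rV[R]_N -> R)
    (phi : 'rV[R]_k -> 'rV[R]_N) :
  open U -> smooth_on V F -> (forall a, class_C n U (fun x => phi x 0 a)) ->
  (forall x, U x -> V (phi x)) -> class_C n U (fun x => F (phi x)).
Proof.
move=> oU + + UV; elim: n F => [|n ih] F hF hphi /=.
  move=> x Ux; have := smooth_continuous hF (UV _ Ux) => cF.
  apply: (@continuous_comp _ _ _ phi F) => //.
  by apply: continuous_mx => a b; rewrite ord1; exact: hphi.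
have dphi a x : U x -> differentiable (fun y => phi y 0 a) x.
  by case: (hphi a) => h _; exact: h.
split => [x Ux|i].
  apply: differentiable_comp; last exact: smooth_diff hF (UV _ Ux).
  by apply: differentiable_rV => a; exact: dphi.
apply: (@class_C_eq _ _ _ (fun x => \sum_a partial a F (phi x) *
    partial i (fun y => phi y 0 a) x)) => //.
  move=> x Ux; rewrite partial_comp//; first exact: smooth_diff hF (UV _ Ux).
  by move=> a; exact: dphi.
apply: class_C_bigsum => // a; apply: class_C_M => //.
  by apply: ih; [exact: smooth_partial|move=> b; exact: class_C_pred].
by case: (hphi a) => _; exact.
Qed.

Lemma smooth_comp k N (U : set 'rV[R]_k) (V : set 'rV[R]_N) (F : 'rV[R]_N -> R)
    (phi : 'rV[R]_k -> 'rV[R]_N) :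
  open U -> smooth_on V F -> (forall a, smooth_on U (fun x => phi x 0 a)) ->
  (forall x, U x -> V (phi x)) -> smooth_on U (fun x => F (phi x)).
Proof. by move=> oU hF hphi UV n; apply: class_C_comp hF _ UV => // a; exact: hphi. Qed.

End Smooth.
Arguments smooth_partial {R k U f} i _.

(** * Mean value arguments: symmetry of second derivatives and the second derivative test *)

Section Lines.
Context {R : realType}.
Implicit Types (k N n : nat).

Lemma mean_value (phi dphi : R -> R) (a b : R) : a < b ->
  (forall t, a <= t <= b -> is_derive t 1 phi (dphi t)) ->
  exists2 c, a < c < b & phi b - phi a = dphi c * (b - a).
Proof.
move=> ab h; have [||c] := MVT (f := phi) (df := dphi) ab.
- by move=> t; rewrite in_itv/= => /andP[/ltW t1 /ltW t2]; apply: h; rewrite t1.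
- apply: derivable_within_continuous => t; rewrite in_itv/= => /h ht.
  exact: ex_derive.
by rewrite in_itv/= => hc E; exists c.
Qed.

Lemma is_derive_line (V : normedModType R) (f : V -> R) (x u : V) (t : R) :
  differentiable f (x + t *: u) ->
  is_derive t 1 (fun s => f (x + s *: u)) ('d f (x + t *: u) u).
Proof.
move=> df.
have hd : is_diff t (fun s : R => x + s *: u) (fun s => s *: u).
  have h1 : is_diff t (cst x : R -> V) 0 by exact: is_diff_cst.
  have h2 : is_diff t (fun s : R => s *: u) (fun s => s *: u) by exact: is_diff_scalel.
  have h3 : is_diff t (cst x + (fun s : R => s *: u)) (0 + (fun s => s *: u)).
    exact: is_diffD.
  by rewrite add0r in h3.
have hl : differentiable (fun s : R => x + s *: u) t by exact: ex_diff.
have dfl : differentiable (f \o (fun s : R => x + s *: u)) t.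
  exact: differentiable_comp.
split; first exact/diff_derivable.
rewrite (deriveE _ dfl).
have := diff_comp hl df => /(congr1 (fun h => h 1)) -> /=.
by rewrite (@diff_val _ _ _ _ _ _ _ hd) scale1r.
Qed.

(** Two applications of the mean value theorem, one per direction. The left side is symmetric in i
    and j, and this is the source of the symmetry of second derivatives. *)
Lemma second_difference k (U : set 'rV[R]_k) (f : 'rV[R]_k -> R) (i j : 'I_k) (x : 'rV[R]_k) (h : R) :
  smooth_on U f -> 0 < h ->
  (forall s t : R, 0 <= s <= h -> 0 <= t <= h ->
     U (x + s *: delta_mx 0 i + t *: delta_mx 0 j)) ->
  exists s t, [/\ 0 <= s <= h, 0 <= t <= h &
    f (x + h *: delta_mx 0 i + h *: delta_mx 0 j) - f (x + h *: delta_mx 0 i)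
    - f (x + h *: delta_mx 0 j) + f x =
    h ^+ 2 * partial j (partial i f) (x + s *: delta_mx 0 i + t *: delta_mx 0 j)].
Proof.
move=> sf h0 hU; set ei := delta_mx 0 i; set ej := delta_mx 0 j.
have hh : 0 <= h <= h by lra.
have h00 : 0 <= (0 : R) <= h by lra.
have dU s t : 0 <= s <= h -> 0 <= t <= h -> differentiable f (x + s *: ei + t *: ej).
  by move=> hs ht; apply: smooth_diff sf _; exact: hU.
pose phi s := f (x + h *: ej + s *: ei) - f (x + s *: ei).
have := @mean_value phi (fun s => partial i f (x + h *: ej + s *: ei) - partial i f (x + s *: ei)) 0 h h0.
case.
  move=> s hs.
  have d1 : differentiable f (x + h *: ej + s *: ei) by rewrite addrAC; exact: dU.
  have d2 : differentiable f (x + s *: ei).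
    by have := dU s 0 hs h00; rewrite scale0r addr0.
  rewrite !partialE//.
  exact: is_deriveB (is_derive_line d1) (is_derive_line d2).
move=> s /andP[/ltW s1 /ltW s2]; have hs : 0 <= s <= h by rewrite s1.
rewrite /phi scale0r !addr0 subr0 => E.
have := @mean_value (fun t => partial i f (x + s *: ei + t *: ej))
  (fun t => partial j (partial i f) (x + s *: ei + t *: ej)) 0 h h0.
case.
  move=> t ht.
  have d1 : differentiable (partial i f) (x + s *: ei + t *: ej).
    by apply: smooth_diff (smooth_partial i sf) _; exact: hU.
  by rewrite partialE//; exact: is_derive_line.
move=> t /andP[/ltW t1 /ltW t2]; have ht : 0 <= t <= h by rewrite t1.
rewrite scale0r addr0 subr0 => E2.
exists s, t; split => //.
rewrite (addrAC x (h *: ej) (h *: ei)) (addrAC x (h *: ej) (s *: ei)) E2 in E.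
by rewrite expr2 mulrC mulrA -E [in RHS]opprD opprK [in RHS]addrA.
Qed.

Lemma partialC k (U : set 'rV[R]_k) (f : 'rV[R]_k -> R) (i j : 'I_k) (x : 'rV[R]_k) :
  open U -> smooth_on U f -> U x ->
  partial i (partial j f) x = partial j (partial i f) x.
Proof.
move=> oU sf Ux; apply/eqP; rewrite -subr_eq0 -normr_eq0; apply/negPn/negP => ne.
set c := partial i (partial j f) x in ne; set d := partial j (partial i f) x in ne.
set e := `|c - d| / 2.
have e0 : 0 < e by rewrite divr_gt0// lt0r ne /=.
have sc : {for x, continuous (partial i (partial j f))}.
  by apply: smooth_continuous Ux; do 2 apply: smooth_partial.
have sd : {for x, continuous (partial j (partial i f))}.
  by apply: smooth_continuous Ux; do 2 apply: smooth_partial.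
have nU : \forall y \near x, U y by exact: open_nbhs_nbhs.
have n1 : \forall y \near x, `|c - partial i (partial j f) y| < e.
  by move/cvgrPdist_lt : sc; apply.
have n2 : \forall y \near x, `|d - partial j (partial i f) y| < e.
  by move/cvgrPdist_lt : sd; apply.
have n3 : nbhs x (U `&` ([set y | `|c - partial i (partial j f) y| < e] `&`
   [set y | `|d - partial j (partial i f) y| < e])).
  by apply: filterI; [exact: nU|apply: filterI; [exact: n1|exact: n2]].
have [r /= r0 hr] := (@nbhs_ballP R 'rV[R]_k x _).1 n3.
pose h := r / 4.
have h0 : 0 < h by rewrite divr_gt0.
have nd (a : 'I_k) s : 0 <= s <= h -> `|s *: (delta_mx 0 a : 'rV[R]_k)| <= h.
  move=> /andP[s0 sh]; rewrite /Num.Def.normr/= mx_normrE (bigmax_le _ (ltW h0))//= => i0 _.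
  rewrite !mxE normrM (ger0_norm s0).
  rewrite (le_trans _ sh)// ler_piMr// normr_nat.
  by case: (_ && _).
have bl (a b : 'I_k) s t : 0 <= s <= h -> 0 <= t <= h ->
    ball x r (x + s *: delta_mx 0 a + t *: delta_mx 0 b).
  move=> hs ht; rewrite -ball_normE /ball_ /= -addrA opprD addNKr normrN.
  apply: le_lt_trans (ler_normD _ _) _.
  have := nd a s hs; have := nd b t ht; rewrite /h; lra.
have [s [t [hs ht E]]] := second_difference (i := i) (j := j) sf h0 (fun s t hs ht => (hr _ (bl i j s t hs ht)).1).
have [s' [t' [hs' ht' E']]] := second_difference (i := j) (j := i) sf h0 (fun s t hs ht => (hr _ (bl j i s t hs ht)).1).
have EE : partial j (partial i f) (x + s *: delta_mx 0 i + t *: delta_mx 0 j) =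
          partial i (partial j f) (x + s' *: delta_mx 0 j + t' *: delta_mx 0 i).
  apply: (@mulfI _ (h ^+ 2)); first by rewrite expf_neq0// gt_eqF.
  rewrite (addrAC x (h *: delta_mx 0 j)) in E'.
  by apply: etrans (esym E) _; apply: etrans _ E'; congr (_ + _); exact: addrAC.
have [_ [_ q1]] := hr _ (bl i j s t hs ht).
have [_ [q2 _]] := hr _ (bl j i s' t' hs' ht').
rewrite /= in q1 q2; rewrite EE in q1; rewrite distrC in q1.
by have := le_lt_trans (ler_distD _ c d) (ltrD q2 q1); rewrite -splitr ltxx.
Qed.

Lemma local_max_partial2 k (U : set 'rV[R]_k) (f : 'rV[R]_k -> R) (i : 'I_k) (p : 'rV[R]_k) :
  open U -> smooth_on U f -> U p -> (forall x, U x -> f x <= f p) ->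
  partial i f p = 0 /\ partial i (partial i f) p <= 0.
Proof.
move=> oU sf Up mx; pose e : 'rV[R]_k := delta_mx 0 i.
have cl : {for 0, continuous (fun t : R => p + t *: e)}.
  apply: continuousD; first exact: cst_continuous.
  by apply: continuousZl; exact: cvg_id.
have n0 : \forall t \near (0:R), U (p + t *: e).
  have : nbhs (p + 0 *: e) U by rewrite scale0r addr0; exact: open_nbhs_nbhs.
  exact: cl.
have [r /= r0 hr] := (@nbhs_ballP R R 0 _).1 n0.
have Ut t : - r < t < r -> U (p + t *: e).
  by move=> ht; apply: hr; rewrite -ball_normE /ball_/= sub0r normrN ltr_norml.
have d1 t : - r < t < r -> is_derive t 1 (fun s : R => f (p + s *: e)) (partial i f (p + t *: e)).
  move=> /Ut ht; have df := smooth_diff sf ht; rewrite partialE//; exact: is_derive_line.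
have z0 : partial i f p = 0.
  have nr : - r <= r by lra.
  have h0 : - r < 0 < r by lra.
  have i0 : (0:R) \in `]- r, r[ by rewrite in_itv.
  have := derive1_at_max nr _ i0 => /(_ (fun s : R => f (p + s *: e))).
  case.
  - by move=> t; rewrite in_itv/= => /d1 ht; exact: ex_derive.
  - by move=> t; rewrite in_itv/= => /Ut ht; rewrite scale0r addr0; exact: mx.
  move=> _; have := @derive_val _ _ _ _ _ _ _ (d1 0 h0).
  by rewrite scale0r addr0 => ->.
split => //; rewrite leNgt; apply/negP => gt.
set c := partial i (partial i f) p in gt.
have dpi : differentiable (partial i f) p by exact: smooth_diff (smooth_partial i sf) Up.
have dd : is_derive (0:R) 1 (fun s : R => partial i f (p + s *: e)) c.
  have := @is_derive_line _ (partial i f) p e 0; rewrite scale0r addr0 => /(_ dpi).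
  by rewrite -partialE.
have dd' : differentiable (fun s : R => partial i f (p + s *: e)) (0:R).
  by apply/derivable1_diffP; exact: ex_derive.
(* Were the second derivative c positive, the first derivative at a small s > 0 would be at least c
   s / 2, by the differential with error c / 2. The mean value theorem would then lift f above its
   maximum. *)
have n1 := diff_eps dd' (divr_gt0 gt (ltr0Sn _ 1)); have [q /= q0 hq] := (@nbhs_ballP R R 0 _).1 n1.
pose b := Num.min r q / 2.
have b0 : 0 < b by rewrite divr_gt0// lt_min r0.
have bb : b < r /\ b < q.
  have h1 : Num.min r q <= r by rewrite ge_min lexx.
  have h2 : Num.min r q <= q by rewrite ge_min lexx orbT.
  by rewrite /b; split; lra.
have [cc /andP[c0 cb]] := @mean_value (fun s : R => f (p + s *: e))
  (fun t => partial i f (p + t *: e)) 0 b b0 (fun t ht => d1 t ltac:(lra)).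
rewrite scale0r addr0 subr0 => E.
have : partial i f (p + cc *: e) <= 0.
  rewrite -(pmulr_lle0 _ b0) -E subr_le0; apply: mx; apply: Ut; lra.
apply/negP; rewrite -ltNge.
have := hq cc; rewrite -ball_normE /ball_/= sub0r normrN gtr0_norm//.
move=> /(_ ltac:(lra)); rewrite scale0r addr0 z0 subr0.
rewrite deriv1E; last by apply/derivable1_diffP.
rewrite derive1E (@derive_val _ _ _ _ _ _ _ dd) subr0 (gtr0_norm c0) /GRing.scale/=.
rewrite ler_norml => /andP[+ _].
have : 0 < c * cc by rewrite mulr_gt0.
by lra.
Qed.

End Lines.

(** * Inner product of row vectors, Gram matrices, smoothness of the inverse matrix *)

Section Dot.
Context {R : realType}.
Implicit Types (k N n : nat).

Definition dot n (u v : 'rV[R]_n) : R := \sum_a u 0 a * v 0 a.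

Lemma dotE n (u v : 'rV[R]_n) : dot u v = (u *m v^T) 0 0.
Proof. by rewrite mxE; apply: eq_bigr => a _; rewrite mxE. Qed.
Lemma dotC n (u v : 'rV[R]_n) : dot u v = dot v u.
Proof. by apply: eq_bigr => a _; rewrite mulrC. Qed.
Lemma dotDl n (u v w : 'rV[R]_n) : dot (u + v) w = dot u w + dot v w.
Proof. by rewrite -big_split; apply: eq_bigr => a _; rewrite mxE mulrDl. Qed.
Lemma dotZl n c (u v : 'rV[R]_n) : dot (c *: u) v = c * dot u v.
Proof. by rewrite mulr_sumr; apply: eq_bigr => a _; rewrite mxE mulrA. Qed.
Lemma dotNl n (u v : 'rV[R]_n) : dot (- u) v = - dot u v.
Proof. by rewrite -scaleN1r dotZl mulN1r. Qed.
Lemma dotBl n (u v w : 'rV[R]_n) : dot (u - v) w = dot u w - dot v w.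
Proof. by rewrite dotDl dotNl. Qed.
Lemma dot0l n (u : 'rV[R]_n) : dot 0 u = 0.
Proof. by rewrite -(scale0r 0) dotZl mul0r. Qed.
Lemma dotDr n (u v w : 'rV[R]_n) : dot w (u + v) = dot w u + dot w v.
Proof. by rewrite dotC dotDl !(dotC w). Qed.
Lemma dotZr n c (u v : 'rV[R]_n) : dot v (c *: u) = c * dot v u.
Proof. by rewrite dotC dotZl (dotC v). Qed.
Lemma dotNr n (u v : 'rV[R]_n) : dot v (- u) = - dot v u.
Proof. by rewrite dotC dotNl (dotC v). Qed.
Lemma dotBr n (u v w : 'rV[R]_n) : dot w (u - v) = dot w u - dot w v.
Proof. by rewrite dotDr dotNr. Qed.
Lemma dot0r n (u : 'rV[R]_n) : dot u 0 = 0.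
Proof. by rewrite dotC dot0l. Qed.
Lemma dot_suml n (I : Type) (r : seq I) (F : I -> 'rV[R]_n) v :
  dot (\sum_(i <- r) F i) v = \sum_(i <- r) dot (F i) v.
Proof.
elim: r => [|i r ih]; first by rewrite !big_nil dot0l.
by rewrite !big_cons dotDl ih.
Qed.
Lemma dot_mul n N (u : 'rV[R]_n) (A : 'M[R]_(n, N)) v : dot (u *m A) v = dot u (v *m A^T).
Proof. by rewrite !dotE trmx_mul trmxK mulmxA. Qed.
Lemma dot_ge0 n (u : 'rV[R]_n) : 0 <= dot u u.
Proof. by apply: sumr_ge0 => a _; rewrite -expr2 sqr_ge0. Qed.
Lemma dot_eq0 n (u : 'rV[R]_n) : dot u u = 0 -> u = 0.
Proof.
move=> /eqP; rewrite psumr_eq0; last by move=> a _; rewrite -expr2 sqr_ge0.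
move=> /allP h; apply/rowP => a; rewrite mxE; apply/eqP.
by have := h a; rewrite mem_index_enum -expr2 sqrf_eq0; apply.
Qed.
Lemma dot_gt0 n (u : 'rV[R]_n) : u != 0 -> 0 < dot u u.
Proof.
by move=> u0; rewrite lt0r dot_ge0 andbT; apply: contraNneq u0 => /dot_eq0/eqP.
Qed.
Lemma dot_delta n (u : 'rV[R]_n) i : dot u (delta_mx 0 i) = u 0 i.
Proof.
rewrite /dot (bigD1 i)//= mxE !eqxx mulr1 big1 ?addr0// => j ji.
by rewrite mxE (negbTE ji) andbF mulr0.
Qed.
Lemma dot_row n N p (A : 'M[R]_(n, N)) (B : 'M[R]_(p, N)) i j :
  dot (row i A) (row j B) = (A *m B^T) i j.
Proof. by rewrite mxE; apply: eq_bigr => a _; rewrite !mxE. Qed.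

(** A kernel vector v of the Gram matrix satisfies |v C|^2 = 0, and independence of the rows then
    gives v = 0. *)
Lemma row_free_gram n N (C : 'M[R]_(n, N)) : row_free C -> C *m C^T \in unitmx.
Proof.
move=> fC; rewrite -row_free_unit -kermx_eq0; apply/eqP/row_matrixP => i; rewrite row0.
set v := row i _.
have : v *m (C *m C^T) = 0 by apply/eqP; rewrite -sub_kermx /v row_sub.
move=> v0; have : dot (v *m C) (v *m C) = 0.
  by rewrite dot_mul -!mulmxA v0 dot0r.
by move=> /dot_eq0/eqP; rewrite mulmx_free_eq0// => /eqP.
Qed.

Lemma smooth_det k (U : set 'rV[R]_k) n (g : 'rV[R]_k -> 'M[R]_n) : open U ->
  (forall i j, smooth_on U (fun x => g x i j)) -> smooth_on U (fun x => \det (g x)).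
Proof.
move=> oU h; apply: smooth_sum => // s _; apply: smooth_Z => //; exact: smooth_prod.
Qed.

(** Cramer's formula: determinant and cofactors are polynomials in the entries. *)
Lemma smooth_invmx k (U : set 'rV[R]_k) n (g : 'rV[R]_k -> 'M[R]_n) : open U ->
  (forall i j, smooth_on U (fun x => g x i j)) -> (forall x, U x -> g x \in unitmx) ->
  forall i j, smooth_on U (fun x => invmx (g x) i j).
Proof.
move=> oU h gu i j.
apply: (@smooth_eq _ _ _ (fun x => (\det (g x))^-1 * cofactor (g x) j i)) => //.
  by move=> x Ux; rewrite /invmx gu// !mxE.
apply: smooth_M => //.
  apply: smooth_V => //; last exact: smooth_det.
  by move=> x /gu; rewrite unitmxE unitfE.
apply: smooth_Z => //; apply: smooth_det => // a b.
rewrite (_ : (fun x => _) = fun x => g x (lift j a) (lift i b))//.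
by apply/funext => x; rewrite !mxE.
Qed.

Lemma mulmxr_continuous m n p (D : 'M[R]_(n, p)) : continuous (mulmxr D : 'M[R]_(m, n) -> _).
Proof.
move=> v; apply: continuous_mx => a b.
rewrite (_ : (fun y => _) = fun y : 'M[R]_(m, n) => \sum_j y a j * D j b).
  elim: (index_enum _) => [|j r ih].
    rewrite (_ : (fun y => _) = fun=> 0); first exact: cst_continuous.
    by apply/funext => y; rewrite big_nil.
  rewrite (_ : (fun y => _) = fun y : 'M[R]_(m, n) => y a j * D j b + \sum_(j <- r) y a j * D j b).
    apply: continuousD => //; apply: continuousM; last exact: cst_continuous.
    exact: coord_continuous.
  by apply/funext => y; rewrite big_cons.
by apply/funext => y; rewrite mxE.
Qed.

End Dot.

(** * Smoothness of a continuous map that becomes smooth after an immersion *)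

Section Inverse.
Context {R : realType}.
Implicit Types (k N n : nat).

(** The relation W (y x) = S x pins y down to first order: applying the left inverse D of the
    differential of W to the increments returns the increment of y, up to a small multiple of that
    same increment, which can be absorbed. *)
Lemma inverse_differentiable k N n (y : 'rV[R]_N -> 'rV[R]_k) (W : 'rV[R]_k -> 'rV[R]_n)
    (S : 'rV[R]_N -> 'rV[R]_n) (D : 'M[R]_(n, k)) x0 :
  {for x0, continuous y} -> differentiable W (y x0) -> differentiable S x0 ->
  (forall v, 'd W (y x0) v *m D = v) -> (\forall x \near x0, W (y x) = S x) ->
  differentiable y x0.
Proof.
move=> cy dW dS DW WS.
have cD := @mulmxr_continuous R 1 n k D.
have [K K0 hK] := linear_lipschitz cD.
have cdS : continuous ('d S x0) by exact: diff_continuous.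
have [K' K'0 hK'] := linear_lipschitz cdS.
pose L : {linear 'rV[R]_N -> 'rV[R]_k} := mulmxr D \o 'd S x0.
apply: (@eps_diff _ _ _ _ _ L).
  by move=> v; apply: continuous_comp; [exact: cdS|exact: cD].
move=> e e0.
have KK' : 0 < K * K' by rewrite mulr_gt0.
(* With a and h the increments of y and x, t <= 1/2 absorbs t |a| into |a| and yields |a| <= (e + 2
   K K') |h|; the second bound on t then makes t |a| at most e |h| / 2. *)
pose t := Num.min 2^-1 (e / (2 * (e + 2 * (K * K')))).
have den0 : 0 < 2 * (e + 2 * (K * K')) by lra.
have t0 : 0 < t by rewrite lt_min invr_gt0 ltr0n divr_gt0.
have t1 : t <= 2^-1 by rewrite /t ge_min lexx.
have t2 : t * (e + 2 * (K * K')) <= e / 2.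
  have : t <= e / (2 * (e + 2 * (K * K'))) by rewrite /t ge_min lexx orbT.
  rewrite ler_pdivlMr//; lra.
have n1 := diff_eps dW (divr_gt0 t0 K0).
have {}n1 : \forall x \near x0, `|W (y x) - W (y x0) - 'd W (y x0) (y x - y x0)|
   <= t / K * `|y x - y x0| by exact: (cy _ n1).
have n2 := diff_eps dS (divr_gt0 (divr_gt0 e0 (ltr0Sn _ 1)) K0).
have WS0 := nbhs_singleton WS.
near=> x.
have q1 : `|W (y x) - W (y x0) - 'd W (y x0) (y x - y x0)| <= t / K * `|y x - y x0|.
  by near: x.
have q2 : `|S x - S x0 - 'd S x0 (x - x0)| <= e / 2 / K * `|x - x0| by near: x.
have E : W (y x) = S x by near: x.
rewrite E WS0 in q1.
set a := y x - y x0 in q1 *; set h := x - x0 in q2 *.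
have p1 : `|(S x - S x0) *m D - a| <= t * `|a|.
  rewrite -[X in _ - X]DW -mulmxBl; apply: le_trans (hK _) _.
  by rewrite -ler_pdivlMl// (le_trans q1)// mulrA (mulrC K^-1).
have p2 : `|(S x - S x0) *m D - L h| <= e / 2 * `|h|.
  rewrite /L /= -mulmxBl; apply: le_trans (hK _) _.
  by rewrite -ler_pdivlMl// (le_trans q2)// mulrA (mulrC K^-1).
have p3 : `|L h| <= K * K' * `|h|.
  by rewrite /L/= -mulrA; apply: le_trans (hK _) _; rewrite ler_pM2l.
have p4 : `|a - L h| <= t * `|a| + e / 2 * `|h|.
  have -> : a - L h = ((S x - S x0) *m D - L h) - ((S x - S x0) *m D - a).
    by rewrite opprB [RHS]addrC addrA subrK.
  by apply: le_trans (ler_normB _ _) _; rewrite addrC lerD.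
have p5 : `|a| <= `|a - L h| + `|L h|.
  by rewrite -{1}(subrK (L h) a) ler_normD.
have h0 : 0 <= `|h| by [].
have a0 : 0 <= `|a| by [].
have p6 : t * `|a| <= 2^-1 * `|a| by rewrite ler_wpM2r.
have p7 : `|a| <= (e + 2 * (K * K')) * `|h| by lra.
have p8 : t * `|a| <= e / 2 * `|h|.
  apply: le_trans (_ : t * ((e + 2 * (K * K')) * `|h|) <= _).
    by rewrite ler_pM2l.
  by rewrite [leLHS]mulrA; apply: ler_wpM2r.
by lra.
Unshelve. all: by end_near. Qed.

Lemma diff_jac k n (W : 'rV[R]_k -> 'rV[R]_n) x v :
  (forall a, differentiable (fun y => W y 0 a) x) -> 'd W x v = v *m jac W x.
Proof.
move=> dW; have dWx := differentiable_rV dW.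
apply/rowP => a; rewrite mxE.
have da := differentiable_entry a (W x).
have := diff_comp dWx da => /(congr1 (fun h => h v)) /=.
rewrite (@diff_sum_partial _ n (fun z => z 0 a))//.
rewrite (bigD1 a)//= partial_entry eqxx mulr1 big1 ?addr0; last first.
  by move=> b ba; rewrite partial_entry (negbTE ba) mulr0.
move=> <-; rewrite (@diff_sum_partial _ k (fun z => W z 0 a))//.
by apply: eq_bigr => i _; rewrite mxE.
Qed.

Lemma smooth_jac k n (U : set 'rV[R]_k) (W : 'rV[R]_k -> 'rV[R]_n) i a :
  smooth_on U (fun x => W x 0 a) -> smooth_on U (fun x => jac W x i a).
Proof.
move=> h; rewrite (_ : (fun x => _) = partial i (fun x => W x 0 a)).
  exact: smooth_partial.
by apply/funext => x; rewrite mxE.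
Qed.

(** A bootstrap. With D the right inverse J^T (J J^T)^-1 of the Jacobian of W, the derivative of y
    at x is the derivative of S times D (y x). The right side is as regular as y, so each pass gains
    one order; the first pass is [inverse_differentiable]. *)
Lemma inverse_smooth k N n (O : set 'rV[R]_N) (U : set 'rV[R]_k) (y : 'rV[R]_N -> 'rV[R]_k)
    (W : 'rV[R]_k -> 'rV[R]_n) (S : 'rV[R]_N -> 'rV[R]_n) :
  open O -> open U -> (forall x, O x -> {for x, continuous y}) ->
  (forall x, O x -> U (y x)) -> (forall a, smooth_on U (fun z => W z 0 a)) ->
  (forall z, U z -> row_free (jac W z)) ->
  (forall a, smooth_on O (fun x => S x 0 a)) -> (forall x, O x -> W (y x) = S x) ->
  forall a, smooth_on O (fun x => y x 0 a).
Proof.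
move=> oO oU cy OU sW fW sS WS.
pose G z := jac W z *m (jac W z)^T.
pose D z := (jac W z)^T *m invmx (G z).
have JD z : U z -> jac W z *m D z = 1%:M.
  by move=> /fW/row_free_gram u; rewrite /D mulmxA mulmxV.
have sG i j : smooth_on U (fun z => G z i j).
  rewrite (_ : (fun z => _) = fun z => \sum_a jac W z i a * jac W z j a); last first.
    by apply/funext => z; rewrite mxE; apply: eq_bigr => a _; rewrite [X in _ * X]mxE.
  by apply: smooth_sum => // a _; apply: smooth_M => //; exact: smooth_jac.
have sD b a : smooth_on U (fun z => D z b a).
  rewrite (_ : (fun z => _) = fun z => \sum_c jac W z c b * invmx (G z) c a); last first.
    by apply/funext => z; rewrite mxE; apply: eq_bigr => c _; rewrite [X in X * _]mxE.
  apply: smooth_sum => // c _; apply: smooth_M => //; first exact: smooth_jac.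
  by apply: smooth_invmx => // z /fW/row_free_gram.
have dy x : O x -> differentiable y x.
  move=> Ox; apply: (@inverse_differentiable _ _ _ y W S (D (y x))).
  - exact: cy.
  - by apply: differentiable_rV => a; apply: smooth_diff (sW a) _; exact: OU.
  - by apply: differentiable_rV => a; exact: smooth_diff (sS a) Ox.
  - move=> v; rewrite diff_jac; last by move=> a; apply: smooth_diff (sW a) _; exact: OU.
    by rewrite -mulmxA JD ?mulmx1//; exact: OU.
  - by apply: filterS (open_nbhs_nbhs (conj oO Ox)) => z /WS.
have dya x a : O x -> differentiable (fun z => y z 0 a) x.
  move=> Ox; apply: (@differentiable_comp _ _ _ _ y (fun z : 'rV[R]_k => z 0 a)); first exact: dy.
  exact: differentiable_entry.
have pE i a x : O x -> partial i (fun z => y z 0 a) x =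
    \sum_b partial i (fun z => S z 0 b) x * D (y x) b a.
  move=> Ox.
  have -> : partial i (fun z => y z 0 a) x = (row i (jac y x) *m jac W (y x) *m D (y x)) 0 a.
    by rewrite -mulmxA JD ?mulmx1 ?mxE//; exact: OU.
  rewrite mxE; apply: eq_bigr => b _; congr (_ * _).
  rewrite mxE; transitivity (partial i (fun z => W (y z) 0 b) x).
    rewrite (@partial_comp _ _ _ _ (fun w => W w 0 b) y x).
    - by apply: eq_bigr => c _; rewrite !mxE mulrC.
    - by apply: smooth_diff (sW b) _; exact: OU.
    - by move=> c; exact: dya.
  apply: partial_near.
  by apply: filterS (open_nbhs_nbhs (conj oO Ox)) => z /WS ->.
suff main n' : forall a, class_C n' O (fun x => y x 0 a) by move=> a n'.
elim: n' => [|n' ih] a /=.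
  move=> x Ox; apply: (@continuous_comp _ _ _ y (fun z : 'rV[R]_k => z 0 a)); first exact: cy.
  exact: coord_continuous.
split => [x Ox|i]; first exact: dya.
apply: (@class_C_eq _ _ _ _ (fun x => \sum_b partial i (fun z => S z 0 b) x * D (y x) b a)) => //.
  by move=> x Ox; rewrite pE.
apply: class_C_bigsum => // b; apply: class_C_M => //.
  by apply: smooth_partial; exact: sS.
exact: (@class_C_comp _ _ _ _ O U (fun z => D z b a) y oO (sD b a) ih OU).
Qed.

End Inverse.

(** * Homogeneous functions and the spectrum of the sphere *)

Section Homogeneous.
Context {R : realType}.
Implicit Types (k N n : nat).

Definition punctured N : set 'rV[R]_N := [set x | x != 0].
Arguments punctured : clear implicits.

Definition lap N (F : 'rV[R]_N -> R) (x : 'rV[R]_N) : R :=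
  \sum_i partial i (partial i F) x.

(** This is |x|^p, written through the squared norm because that is smooth and positive off the
    origin. *)
Definition rpow N (p : R) (x : 'rV[R]_N) : R := dot x x `^ (p / 2).

Definition homogeneous N (t : R) (F : 'rV[R]_N -> R) : Prop :=
  forall (x : 'rV[R]_N) (c : R), x != 0 -> 0 < c -> F (c *: x) = c `^ t * F x.

Lemma open_punctured N : open (punctured N).
Proof.
rewrite (_ : punctured N = ~` [set 0]).
  apply: closed_openC; apply: accessible_closed_set1.
  by apply: hausdorff_accessible; exact: norm_hausdorff.
by apply/seteqP; split => x /eqP.
Qed.
Hint Resolve open_punctured : core.

Lemma near_punctured N (x : 'rV[R]_N) (P : 'rV[R]_N -> Prop) : x != 0 ->
  (forall y, y != 0 -> P y) -> \forall y \near x, P y.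
Proof.
move=> x0 h; have nx : nbhs x (punctured N) by exact: open_nbhs_nbhs.
exact: filterS nx.
Qed.

Lemma powRDgt (c r s : R) : 0 < c -> c `^ (r + s) = c `^ r * c `^ s.
Proof. by move=> c0; rewrite powRD// (gt_eqF c0) implybT. Qed.

Lemma smooth_sqn N (U : set 'rV[R]_N) : open U -> smooth_on U (fun x : 'rV[R]_N => dot x x).
Proof. by move=> oU; apply: smooth_sum => // a _; apply: smooth_M => //; exact: smooth_entry. Qed.

Lemma smooth_rpow N p : smooth_on (punctured N) (rpow p).
Proof.
apply: smooth_powR => //; first by move=> x /dot_gt0.
exact: smooth_sqn.
Qed.

Lemma differentiable_sqn N (x : 'rV[R]_N) : differentiable (fun x => dot x x) x.
Proof. by apply: (@smooth_diff _ _ setT) => //; apply: smooth_sqn; exact: openT. Qed.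

Lemma partial_sqn N (i : 'I_N) (x : 'rV[R]_N) : partial i (fun x => dot x x) x = 2 * x 0 i.
Proof.
rewrite /dot partial_sum; last first.
  by move=> a; apply: differentiableM; exact: differentiable_entry.
rewrite (bigD1 i)//= big1 ?addr0.
  rewrite partialM; try exact: differentiable_entry.
  by rewrite partial_entry eqxx mulr1 -mulr2n mulr_natl.
move=> j ji; rewrite partialM; try exact: differentiable_entry.
by rewrite partial_entry eq_sym (negbTE ji) !mulr0 addr0.
Qed.

Lemma partial_rpow N (i : 'I_N) p (x : 'rV[R]_N) : x != 0 ->
  partial i (rpow p) x = p * (x 0 i * rpow (p - 2) x).
Proof.
move=> /dot_gt0 x0.
rewrite (@partial_comp1 _ _ i (fun a => a `^ (p / 2)) (fun x => dot x x)).
- rewrite powR_derive1 ?in_itv/= ?andbT// partial_sqn /rpow.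
  rewrite (_ : (p - 2) / 2 = p / 2 - 1); last by field.
  by field.
- by apply: derivable_powR; rewrite in_itv/= andbT.
- exact: differentiable_sqn.
Qed.

Lemma rpowD N (p q : R) (x : 'rV[R]_N) : x != 0 -> rpow (p + q) x = rpow p x * rpow q x.
Proof. by move=> /dot_gt0 x0; rewrite /rpow mulrDl powRDgt. Qed.

Lemma rpow0 N (x : 'rV[R]_N) : rpow 0 x = 1.
Proof. by rewrite /rpow mul0r powRr0. Qed.

Lemma rpow2 N (x : 'rV[R]_N) : rpow 2 x = dot x x.
Proof. by rewrite /rpow divff// powRr1// dot_ge0. Qed.

Lemma rpow_gt0 N p (x : 'rV[R]_N) : x != 0 -> 0 < rpow p x.
Proof. by move=> /dot_gt0 x0; exact: powR_gt0. Qed.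

Lemma rpow_sqr N (x : 'rV[R]_N) : x != 0 -> rpow (-1) x * rpow (-1) x = (dot x x)^-1.
Proof.
move=> x0; rewrite -rpowD// (_ : -1 + -1 = - 2); last by ring.
by rewrite /rpow mulNr divff// powR_inv1// dot_ge0.
Qed.

Lemma rpow_unit N p (x : 'rV[R]_N) : dot x x = 1 -> rpow p x = 1.
Proof. by move=> x1; rewrite /rpow x1 powR1. Qed.

Lemma rpow_scale N p (x : 'rV[R]_N) c : x != 0 -> 0 < c -> rpow p (c *: x) = c `^ p * rpow p x.
Proof.
move=> x0 c0; rewrite /rpow dotZl dotZr mulrA powRM; last 2 first.
- by rewrite mulr_ge0// ltW.
- exact: dot_ge0.
congr (_ * _); rewrite powRM ?ltW// -powRDgt//; congr (_ `^ _); by field.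
Qed.

Lemma homogeneous_rpow N p : homogeneous p (@rpow N p).
Proof. by move=> x c x0 c0; exact: rpow_scale. Qed.

Lemma unit_neq0 N (x : 'rV[R]_N) : dot x x = 1 -> x != 0.
Proof. by move=> x1; apply: contra_eq_neq x1 => ->; rewrite dot0l eq_sym oner_eq0. Qed.

Lemma dot_normalize N (x : 'rV[R]_N) : x != 0 ->
  dot (rpow (-1) x *: x) (rpow (-1) x *: x) = 1.
Proof.
by move=> x0; rewrite dotZl dotZr mulrA rpow_sqr// mulVf// gt_eqF// dot_gt0.
Qed.

Lemma homogeneous_normalize N t (F : 'rV[R]_N -> R) x : homogeneous t F -> x != 0 ->
  F x = rpow t x * F (rpow (-1) x *: x).
Proof.
move=> hF x0; rewrite hF ?rpow_gt0// mulrA.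
suff -> : rpow t x * rpow (-1) x `^ t = 1 by rewrite mul1r.
by rewrite /rpow -powRrM -powRDgt ?dot_gt0// (_ : _ + _ = 0) ?powRr0//; field.
Qed.

Lemma homogeneousM N t s (F G : 'rV[R]_N -> R) : homogeneous t F -> homogeneous s G ->
  homogeneous (t + s) (fun x => F x * G x).
Proof. by move=> hF hG x c x0 c0; rewrite hF// hG// powRDgt//; ring. Qed.

Lemma scale_neq0 N (c : R) (x : 'rV[R]_N) : 0 < c -> x != 0 -> c *: x != 0.
Proof. by move=> c0 x0; rewrite scaler_eq0 negb_or gt_eqF. Qed.

Lemma homogeneous_partial N t (F : 'rV[R]_N -> R) (i : 'I_N) :
  smooth_on (punctured N) F -> homogeneous t F -> homogeneous (t - 1) (partial i F).
Proof.
move=> sF hF x c x0 c0.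
have cx0 := scale_neq0 c0 x0.
have dF y : y != 0 -> differentiable F y by move=> y0; exact: (smooth_diff sF y0).
have E1 : partial i (fun y => F (c *: y)) x = c * partial i F (c *: x).
  have dc a : differentiable (fun y : 'rV[R]_N => (c *: y) 0 a) x.
    rewrite (_ : (fun y => _) = fun y : 'rV[R]_N => c * y 0 a).
      by apply: differentiableM; [exact: (@differentiable_cst _ _ _ (c : R^o))|exact: differentiable_entry].
    by apply/funext => y; rewrite mxE.
  rewrite (@partial_comp _ _ _ i F (fun y => c *: y))//; last exact: dF.
  rewrite (bigD1 i)//= big1 ?addr0.
    rewrite (_ : (fun y => _) = fun y : 'rV[R]_N => c * y 0 i); last first.
      by apply/funext => y; rewrite mxE.
    by rewrite partialZ ?partial_entry ?eqxx ?mulr1 1?mulrC//; exact: differentiable_entry.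
  move=> a ai; rewrite (_ : (fun y => _) = fun y : 'rV[R]_N => c * y 0 a); last first.
    by apply/funext => y; rewrite mxE.
  rewrite partialZ; last exact: differentiable_entry.
  by rewrite partial_entry eq_sym (negbTE ai) !mulr0.
have E2 : partial i (fun y => F (c *: y)) x = c `^ t * partial i F x.
  rewrite -partialZ; last exact: dF.
  by apply: partial_near; apply: near_punctured => // y y0; exact: hF.
apply: (@mulfI _ c); first by rewrite gt_eqF.
rewrite -E1 E2 powRDgt// powRN powRr1; last exact: ltW.
by rewrite mulrA; congr (_ * _); field; rewrite gt_eqF.
Qed.

(** Both sides are the derivative at s = 0 of F ((1 + s) x) = (1 + s)^t F x. *)
Lemma euler N t (F : 'rV[R]_N -> R) (x : 'rV[R]_N) :
  smooth_on (punctured N) F -> homogeneous t F -> x != 0 ->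
  \sum_i x 0 i * partial i F x = t * F x.
Proof.
move=> sF hF x0; have dF : differentiable F x by exact: (smooth_diff sF x0).
rewrite -diff_sum_partial//.
have dF0 : differentiable F (x + 0 *: x) by rewrite scale0r addr0.
have := @derive_val _ _ _ _ _ _ _ (is_derive_line dF0).
rewrite scale0r addr0 => <-.
have hs : is_derive (0:R) 1 (fun s : R => 1 + s) 1.
  rewrite -[X in is_derive _ _ _ X]add0r.
  exact: (@is_deriveD _ _ _ (cst (1:R)) id (0:R) 1 0 1 (is_derive_cst _ _ _) (is_derive_id _ _)).
have h1 : (0:R) < 1 + 0 by rewrite addr0.
have dp : derivable (fun a : R => a `^ t) (1 + 0) 1.
  by apply: derivable_powR; rewrite in_itv/= andbT.
rewrite (@near_eq_derive _ _ _ _ (fun s : R => (1 + s) `^ t * F x)) ?oner_neq0//; last first.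
  have : \forall s \near (0:R), `|s| < 1 by exact: nbhs0_lt.
  apply: filterS => s; rewrite ltr_norml => /andP[s1 _]; have s0 : 0 < 1 + s by rewrite -ltrBlDl sub0r.
  by rewrite -hF//; congr F; rewrite scalerDl scale1r.
have hp : is_derive (1 + 0 : R) 1 (fun a : R => a `^ t) t.
  split => //; rewrite -derive1E powR_derive1 ?in_itv/= ?andbT//.
  by rewrite addr0 powR1 mulr1.
have hps : is_derive (0:R) 1 (fun s : R => (1 + s) `^ t) (t * 1) := is_derive1_comp hp hs.
have hF0 := is_deriveM hps (is_derive_cst (F x : R^o) (0:R) 1).
rewrite (@derive_val _ _ _ _ _ _ _ hF0) /= scaler0 add0r mulr1.
by rewrite /GRing.scale/= mulrC.
Qed.

End Homogeneous.
Arguments punctured {R} N.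

Opaque partial.

(** * Maximum principle for homogeneous functions and gaps in the spectrum *)

Section Gap.
Context {R : realType}.
Implicit Types (N : nat).
Hint Resolve open_punctured : core.

Lemma partialM_near N (U : set 'rV[R]_N) (i : 'I_N) (f g : 'rV[R]_N -> R) (x : 'rV[R]_N) :
  open U -> smooth_on U f -> smooth_on U g -> U x ->
  \forall y \near x, partial i (fun z => f z * g z) y = f y * partial i g y + g y * partial i f y.
Proof.
move=> oU sf sg Ux; have nU : nbhs x U by exact: open_nbhs_nbhs.
apply: filterS nU => y Uy; rewrite partialM//; [exact: (smooth_diff sf Uy)|exact: (smooth_diff sg Uy)].
Qed.

Lemma partial2M N (U : set 'rV[R]_N) (i : 'I_N) (f g : 'rV[R]_N -> R) (x : 'rV[R]_N) :
  open U -> smooth_on U f -> smooth_on U g -> U x ->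
  partial i (partial i (fun z => f z * g z)) x =
  f x * partial i (partial i g) x + g x * partial i (partial i f) x
  + 2 * (partial i f x * partial i g x).
Proof.
move=> oU sf sg Ux; rewrite (partial_near _ (partialM_near i oU sf sg Ux)).
have df := smooth_diff sf Ux; have dg := smooth_diff sg Ux.
have dfi := smooth_diff (smooth_partial i sf) Ux.
have dgi := smooth_diff (smooth_partial i sg) Ux.
rewrite partialD; last 2 first.
- exact: differentiableM.
- exact: differentiableM.
rewrite !partialM//; move: (f x) (g x) (partial i f x) (partial i g x).
by move: (partial i (partial i f) x) (partial i (partial i g) x) => a b c d e h; ring.
Qed.

Lemma lapM N (U : set 'rV[R]_N) (f g : 'rV[R]_N -> R) (x : 'rV[R]_N) :
  open U -> smooth_on U f -> smooth_on U g -> U x ->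
  lap (fun z => f z * g z) x = f x * lap g x + g x * lap f x
    + 2 * \sum_i partial i f x * partial i g x.
Proof.
move=> oU sf sg Ux; rewrite /lap !mulr_sumr -!big_split; apply: eq_bigr => i _.
exact: partial2M oU sf sg Ux.
Qed.

Lemma lap_near N (f g : 'rV[R]_N -> R) (U : set 'rV[R]_N) x : open U -> U x ->
  (forall y, U y -> f y = g y) -> lap f x = lap g x.
Proof.
move=> oU Ux fg; apply: eq_bigr => i _; apply: partial_near.
have nU : nbhs x U by exact: open_nbhs_nbhs.
apply: filterS nU => y Uy; apply: partial_near.
have nU : nbhs y U by exact: open_nbhs_nbhs.
exact: filterS nU.
Qed.

Lemma lapB N (U : set 'rV[R]_N) (f g : 'rV[R]_N -> R) (x : 'rV[R]_N) :
  open U -> smooth_on U f -> smooth_on U g -> U x ->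
  lap (fun z => f z - g z) x = lap f x - lap g x.
Proof.
move=> oU sf sg Ux; rewrite /lap -sumrB; apply: eq_bigr => i _.
have nU : nbhs x U by exact: open_nbhs_nbhs.
rewrite (@partial_near _ _ _ _ (fun y => partial i f y - partial i g y)).
  rewrite partialB//; [exact: (smooth_diff (smooth_partial i sf) Ux)|].
  exact: (smooth_diff (smooth_partial i sg) Ux).
apply: filterS nU => y Uy.
by rewrite partialB//; [exact: (smooth_diff sf Uy)|exact: (smooth_diff sg Uy)].
Qed.

Lemma lap_sum N (U : set 'rV[R]_N) (I : Type) (r : seq I) (f : I -> 'rV[R]_N -> R) (x : 'rV[R]_N) :
  open U -> (forall a, smooth_on U (f a)) -> U x ->
  lap (fun z => \sum_(a <- r) f a z) x = \sum_(a <- r) lap (f a) x.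
Proof.
move=> oU sf Ux; rewrite /lap exchange_big/=; apply: eq_bigr => i _.
have nU : nbhs x U by exact: open_nbhs_nbhs.
rewrite (@partial_near _ _ _ _ (fun y => \sum_(a <- r) partial i (f a) y)).
  by rewrite partial_sum// => a; exact: (smooth_diff (smooth_partial i (sf a)) Ux).
apply: filterS nU => y Uy.
by rewrite partial_sum// => a; exact: (smooth_diff (sf a) Uy).
Qed.

Lemma lapZ N (U : set 'rV[R]_N) (c : R) (f : 'rV[R]_N -> R) (x : 'rV[R]_N) :
  open U -> smooth_on U f -> U x -> lap (fun z => c * f z) x = c * lap f x.
Proof.
move=> oU sf Ux; rewrite (lapM oU (smooth_cst _ c) sf Ux).
rewrite [lap (fun=> c) x]big1; last first.
  move=> i _; rewrite (_ : partial i (fun=> c) = fun=> 0); first exact: partial_cst.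
  by apply/funext => y; exact: partial_cst.
rewrite big1 ?mulr0 ?addr0// => i _; rewrite (_ : partial i (fun=> c) x = 0) ?mul0r//; exact: partial_cst.
Qed.

Lemma lap_partial N (U : set 'rV[R]_N) (i : 'I_N) (f : 'rV[R]_N -> R) (x : 'rV[R]_N) :
  open U -> smooth_on U f -> U x -> lap (partial i f) x = partial i (lap f) x.
Proof.
move=> oU sf Ux; rewrite /lap partial_sum; last first.
  by move=> a; exact: (smooth_diff (smooth_partialsq a a sf) Ux).
apply: eq_bigr => j _.
have nU : nbhs x U by exact: open_nbhs_nbhs.
rewrite (@partial_near _ _ _ _ (partial i (partial j f))).
  by rewrite (partialC j i oU (smooth_partial j sf) Ux).
by apply: filterS nU => y Uy; rewrite (partialC j i oU sf Uy).
Qed.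

Lemma lap_rpow N p (x : 'rV[R]_N) : x != 0 ->
  lap (rpow p) x = p * (p + N%:R - 2) * rpow (p - 2) x.
Proof.
move=> x0; have E (i : 'I_N) : partial i (partial i (rpow p)) x =
    p * rpow (p - 2) x + p * (p - 2) * ((x 0 i * x 0 i) * rpow (p - 2 - 2) x).
  rewrite (@partial_near _ _ _ _ (fun y => p * (y 0 i * rpow (p - 2) y))); last first.
    by apply: near_punctured => // y y0; exact: partial_rpow.
  have ds : differentiable (rpow (p - 2)) x by exact: (smooth_diff (@smooth_rpow R N (p - 2)) x0).
  have de : differentiable (fun y : 'rV[R]_N => y 0 i) x by exact: differentiable_entry.
  rewrite partialZ; last exact: differentiableM.
  by rewrite partialM// partial_rpow// partial_entry eqxx mulr1; ring.
rewrite /lap (eq_bigr _ (fun i _ => E i)) big_split/= sumr_const card_ord -mulr_sumr.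
rewrite -mulr_suml -/(dot x x) -rpow2 -rpowD// (_ : 2 + (p - 2 - 2) = p - 2); last by ring.
by rewrite -mulr_natr; ring.
Qed.

(** Used in two directions: with t = 0 and p = s it turns an eigenfunction into a harmonic function
    of degree s, and with p = -t it turns a harmonic function of degree t into an eigenfunction of
    degree 0. The first-order cross term is evaluated by Euler's relation. *)
Lemma lap_rpowM N p t (G : 'rV[R]_N -> R) (x : 'rV[R]_N) :
  smooth_on (punctured N) G -> homogeneous t G -> x != 0 ->
  dot x x * lap (fun y => rpow p y * G y) x =
  rpow p x * (dot x x * lap G x + p * (p + N%:R - 2 + 2 * t) * G x).
Proof.
move=> sG hG x0; rewrite (lapM (@open_punctured R N) (@smooth_rpow R N p) sG x0) lap_rpow//.
have -> : \sum_i partial i (rpow p) x * partial i G x = p * rpow (p - 2) x * (t * G x).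
  rewrite -(euler sG hG x0) mulr_sumr; apply: eq_bigr => i _.
  by rewrite partial_rpow//; ring.
have -> : rpow p x = dot x x * rpow (p - 2) x.
  by rewrite -rpow2 -rpowD//; congr rpow; ring.
by ring.
Qed.

Lemma sphere_compact N : compact [set x : 'rV[R]_N | dot x x = 1].
Proof.
apply: bounded_closed_compact.
  exists 1; split; first exact: num_real.
  move=> r r1 x /= x1; rewrite /Num.Def.normr/= mx_normrE.
  apply: bigmax_le => [|[a i] _ /=]; first by rewrite ltW// (lt_trans ltr01).
  rewrite ord1; apply: le_trans (ltW r1).
  rewrite -(@ler_pXn2r _ 2)// ?nnegrE// expr1n -x1 /dot (bigD1 i)//= real_normK ?num_real//.
  by rewrite expr2 lerDl sumr_ge0// => j _; rewrite -expr2 sqr_ge0.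
rewrite (_ : [set x | _] = (fun x : 'rV[R]_N => dot x x) @^-1` [set 1])//.
apply: preimage_closed => //.
  by move=> x _; exact: differentiable_continuous (differentiable_sqn x).
Qed.

Lemma max_on_sphere N (F : 'rV[R]_N -> R) : (0 < N)%N ->
  (forall x, x != 0 -> {for x, continuous F}) ->
  exists2 p, dot p p = 1 & forall x, dot x x = 1 -> F x <= F p.
Proof.
move=> N0 cF; have := @compact_EVT_max _ R F [set x : 'rV[R]_N | dot x x = 1].
case.
- exists (delta_mx 0 (Ordinal N0)) => /=; by rewrite dot_delta mxE !eqxx.
- exact: sphere_compact.
- apply: continuous_in_subspaceT => x; rewrite inE /= => x1; apply: cF; exact: unit_neq0.
by move=> p; rewrite inE => p1 h; exists p => // x x1; apply: h; rewrite inE.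
Qed.

(** Let p be a maximum point on the unit sphere. By homogeneity F - F(p) |x|^t is at most 0
    everywhere, not only on the sphere, and vanishes at p. Its Laplacian at p equals - F(p) (t (t +
    N - 2) + mu), which is positive if F(p) > 0, against the second derivative test. *)
Lemma max_principle_le0 N t mu (F : 'rV[R]_N -> R) :
  smooth_on (punctured N) F -> homogeneous t F ->
  (forall x, x != 0 -> dot x x * lap F x = - mu * F x) ->
  t * (t + N%:R - 2) + mu < 0 -> forall x, x != 0 -> F x <= 0.
Proof.
move=> sF hF eF tmu x x0; rewrite leNgt; apply/negP => Fx.
have N0 : (0 < N)%N by case: N F sF hF eF tmu x x0 Fx => // F _ _ _ _ x; rewrite thinmx0 eqxx.
have [p p1 pmax] := max_on_sphere N0 (fun x x0 => smooth_continuous sF x0).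
have p0 := unit_neq0 p1.
have Fp : 0 < F p.
  apply: lt_le_trans (pmax _ (dot_normalize x0)).
  by move: Fx; rewrite (homogeneous_normalize hF x0) pmulr_rgt0// rpow_gt0.
pose H y := F y - F p * rpow t y.
have sr : smooth_on (punctured N) (fun y => F p * rpow t y) by apply: smooth_Z => //; exact: smooth_rpow.
have sH : smooth_on (punctured N) H by exact: smooth_B.
have Hp : H p = 0 by rewrite /H rpow_unit// mulr1 subrr.
have Hle y : punctured N y -> H y <= H p.
  move=> /= y0; rewrite Hp /H subr_le0 (homogeneous_normalize hF y0) mulrC.
  by rewrite ler_pM2r ?rpow_gt0//; apply: pmax; exact: dot_normalize.
have : lap H p <= 0.
  apply: sumr_le0 => i _.
  by have [] := local_max_partial2 i (@open_punctured R N) sH p0 Hle.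
rewrite (lapB (@open_punctured R N) sF sr p0) (lapZ _ (@open_punctured R N) (@smooth_rpow R N t) p0).
rewrite lap_rpow// rpow_unit// mulr1.
have := eF p p0; rewrite p1 mul1r => ->.
rewrite (_ : - mu * F p - F p * (t * (t + N%:R - 2)) = F p * - (t * (t + N%:R - 2) + mu)); last by ring.
by rewrite pmulr_rle0// oppr_le0 leNgt tmu.
Qed.

Lemma max_principle N t mu (F : 'rV[R]_N -> R) :
  smooth_on (punctured N) F -> homogeneous t F ->
  (forall x, x != 0 -> dot x x * lap F x = - mu * F x) ->
  t * (t + N%:R - 2) + mu < 0 -> forall x, x != 0 -> F x = 0.
Proof.
move=> sF hF eF tmu x x0; apply: le_anti; rewrite (max_principle_le0 sF hF eF tmu x0)/=.
have := @max_principle_le0 N t mu (fun y => -1 * F y).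
rewrite -[0 <= F x]oppr_le0 -[- F x]mulN1r => h; apply: h tmu x x0.
- exact: smooth_Z.
- by move=> y c y0 c0; rewrite hF//; ring.
- by move=> y y0; rewrite (lapZ _ (@open_punctured R N) sF y0) mulrCA eF//; ring.
Qed.

(** The punctured space is not convex, so points are joined through a basis vector. If x has a
    nonzero coordinate i and k differs from i, the segment from x to the k-th basis vector avoids
    the origin; with three coordinates one k serves both x and y. *)
Lemma constant_of_grad0 N (F : 'rV[R]_N -> R) : (2 < N)%N ->
  smooth_on (punctured N) F -> (forall i (x : 'rV[R]_N), x != 0 -> partial i F x = 0) ->
  forall x y : 'rV[R]_N, x != 0 -> y != 0 -> F x = F y.
Proof.
move=> N3 sF gF.
have key (x : 'rV[R]_N) (i k : 'I_N) : x 0 i != 0 -> k != i -> F x = F (delta_mx 0 k).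
  move=> xi ki; pose u := delta_mx 0 k - x.
  have p0 s : 0 <= s <= 1 -> x + s *: u != 0.
    move=> /andP[s0 s1]; have [s1'|s1'] := eqVneq s 1.
      rewrite s1' scale1r /u addrC subrK; apply/eqP => /matrixP/(_ 0 k)/eqP.
      by rewrite !mxE !eqxx oner_eq0.
    apply/eqP => /matrixP/(_ 0 i)/eqP; rewrite !mxE eqxx /= (eq_sym i) (negbTE ki).
    rewrite sub0r mulrN -{1}(mul1r (x 0 i)) -mulrBl mulf_eq0 (negbTE xi) orbF subr_eq0 eq_sym.
    by rewrite (negbTE s1').
  have [|c _] := @mean_value R (fun s => F (x + s *: u)) (fun=> 0) 0 1 ltr01.
    move=> s hs; have ds := smooth_diff sF (p0 s hs).
    have := is_derive_line ds; rewrite diff_sum_partial// big1// => a _.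
    by rewrite gF ?mulr0//; exact: p0.
  rewrite mul0r scale1r scale0r addr0 (addrC x u) /u subrK => /eqP; rewrite subr_eq0 => /eqP ->//.
have nz (x : 'rV[R]_N) : x != 0 -> exists i : 'I_N, x 0 i != 0.
  move=> x0; apply/existsP; apply: contraNT x0 => /existsPn h.
  by apply/eqP/rowP => i; rewrite mxE; apply/eqP; have := h i; rewrite negbK.
move=> x y /nz[i xi] /nz[j yj].
have [k] : exists k : 'I_N, k \notin [set i; j]%SET.
  apply/existsP; apply: contraLR N3 => /existsPn h; rewrite -leqNgt.
  have -> : N = #|[set i; j]%SET|.
    rewrite -[LHS]card_ord -cardsT; congr #|pred_of_set _|; apply/setP => k.
    by rewrite inE; have := h k; rewrite negbK => ->.
  by rewrite cards2; case: (_ != _).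
by rewrite !inE negb_or => /andP[ki kj]; rewrite (key x i k)// (key y j k).
Qed.

Lemma partial_entryM N (a k : 'I_N) (g : 'rV[R]_N -> R) (x : 'rV[R]_N) : differentiable g x ->
  partial a (fun y => y 0 k * g y) x = (a == k)%:R * g x + x 0 k * partial a g x.
Proof.
move=> dg; rewrite partialM//; last exact: differentiable_entry.
by rewrite partial_entry addrC mulrC.
Qed.

Definition rotation N (F : 'rV[R]_N -> R) (i j : 'I_N) (x : 'rV[R]_N) : R :=
  x 0 i * partial j F x - x 0 j * partial i F x.

Section Rotation.
Context N (F : 'rV[R]_N -> R) (sF : smooth_on (punctured N) F) (hF : homogeneous 0 F).
Context (lF : forall x, x != 0 -> lap F x = 0).
Let oP := @open_punctured R N.

Lemma smooth_rotation i j : smooth_on (punctured N) (rotation F i j).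
Proof.
by apply: smooth_B => //; apply: smooth_M => //; try exact: smooth_entry; exact: smooth_partial.
Qed.

Lemma homogeneous_rotation i j : homogeneous 0 (rotation F i j).
Proof.
move=> x c x0 c0; rewrite /rotation !(homogeneous_partial _ sF hF)// !mxE powRr0 sub0r.
by rewrite powR_inv1 ?ltW//; field; rewrite gt_eqF.
Qed.

(** Rotations commute with the Laplacian: each of the two products contributes the same cross term,
    twice the mixed second derivative, and they cancel. *)
Lemma lap_rotation i j (x : 'rV[R]_N) : x != 0 -> lap (rotation F i j) x = 0.
Proof.
move=> x0.
have se k : smooth_on (punctured N) (fun y : 'rV[R]_N => y 0 k) by exact: smooth_entry.
have le k : lap (fun y : 'rV[R]_N => y 0 k) x = 0.
  rewrite /lap big1// => a _; rewrite (_ : partial a (fun y : 'rV[R]_N => y 0 k) = fun=> (a == k)%:R).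
    exact: partial_cst.
  by apply/funext => y; exact: partial_entry.
have lp k : lap (partial k F) x = 0.
  rewrite (lap_partial k oP sF x0) (@partial_near _ _ _ _ (fun=> 0)).
    exact: partial_cst.
  by apply: near_punctured => // y /lF.
have sk k l : \sum_a partial a (fun y : 'rV[R]_N => y 0 k) x * partial a (partial l F) x
    = partial k (partial l F) x.
  rewrite (bigD1 k)//= big1 ?addr0 ?partial_entry ?eqxx ?mul1r// => a ak.
  by rewrite partial_entry (negbTE ak) mul0r.
rewrite (lapB oP (smooth_M oP (se i) (smooth_partial j sF)) (smooth_M oP (se j) (smooth_partial i sF)) x0).
have E k l : lap (fun y => y 0 k * partial l F y) x = 2 * partial k (partial l F) x.
  by apply: etrans (lapM oP (se k) (smooth_partial l sF) x0) _; rewrite lp le sk !mulr0 !add0r.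
by apply: etrans (congr2 _ (E i j) (congr1 _ (E j i))) _; rewrite (partialC i j oP sF x0) subrr.
Qed.

(** The coefficient is N - 1 - 1: one unit is lost because the partial derivatives have degree -1,
    one to the diagonal term; harmonicity removes the rest. For N other than 2, the gradient of F is
    thus controlled by the gradients of its rotation derivatives. *)
Lemma sum_partial_rotation l (x : 'rV[R]_N) : x != 0 ->
  \sum_j partial j (rotation F j l) x = (N%:R - 2) * partial l F x.
Proof.
move=> x0.
have d3 k : differentiable (partial k F) x by exact: (smooth_diff (smooth_partial k sF) x0).
have de k : differentiable (fun y : 'rV[R]_N => y 0 k) x by exact: differentiable_entry.
have E j : partial j (rotation F j l) x =
  (partial l F x + x 0 j * partial j (partial l F) x)
  - ((j == l)%:R * partial j F x + x 0 l * partial j (partial j F) x).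
  apply: etrans (partialB j (differentiableM (de j) (d3 l)) (differentiableM (de l) (d3 j))) _.
  congr (_ - _); apply: etrans (partial_entryM _ _ (d3 _)) _ => //.
  by rewrite eqxx mul1r.
have s1 : \sum_(j < N) partial l F x = N%:R * partial l F x.
  by rewrite sumr_const card_ord mulr_natl.
have s2 : \sum_j x 0 j * partial j (partial l F) x = (0 - 1) * partial l F x.
  exact: (euler (smooth_partial l sF) (homogeneous_partial l sF hF) x0).
have s3 : \sum_j (j == l)%:R * partial j F x = partial l F x.
  by rewrite (bigD1 l)//= eqxx mul1r big1 ?addr0// => j /negbTE ->; rewrite mul0r.
have s4 : \sum_j x 0 l * partial j (partial j F) x = 0.
  by rewrite -mulr_sumr [X in _ * X](lF x0) mulr0.
apply: etrans (eq_bigr _ (fun j _ => E j)) _.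
apply: etrans (sumrB _ _ _ _) _.
apply: etrans (congr2 (fun a b => a - b)
  (etrans (big_split _ _ _ _ _) (congr2 +%R s1 s2))
  (etrans (big_split _ _ _ _ _) (congr2 +%R s3 s4))) _.
by cbv beta; move: (partial l F x) => a; ring.
Qed.

(** A Bochner argument that replaces the maximum principle in degree 0. At a maximum point p of Q,
    lap Q is twice the sum of the squared gradients of the rotation derivatives, so these gradients
    vanish at p. Then the gradient of F vanishes at p by [sum_partial_rotation], so max Q = Q(p) =
    0, all rotation derivatives vanish identically, and the same lemma kills the gradient
    everywhere. *)
Lemma harmonic0_constant : (2 < N)%N -> forall x y : 'rV[R]_N, x != 0 -> y != 0 -> F x = F y.
Proof.
move=> N3; apply: constant_of_grad0 => // l x x0.
have N2 : N%:R - 2 != 0 :> R by rewrite subr_eq0 eqr_nat gtn_eqF.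
have gr l' (y : 'rV[R]_N) : y != 0 -> (forall j k, partial j (rotation F j k) y = 0) -> partial l' F y = 0.
  move=> y0 h; apply: (mulfI N2); rewrite mulr0 -sum_partial_rotation//.
  by apply: big1.
pose Q y := \sum_(ij : 'I_N * 'I_N) rotation F ij.1 ij.2 y * rotation F ij.1 ij.2 y.
have sQ : smooth_on (punctured N) Q.
  by apply: smooth_sum => // ij _; apply: smooth_M => //; exact: smooth_rotation.
have hQ : homogeneous 0 Q.
  move=> y c y0 c0; rewrite /Q mulr_sumr; apply: eq_bigr => ij _.
  by rewrite !homogeneous_rotation// powRr0 !mul1r.
have N0 : (0 < N)%N by apply: leq_trans N3.
have [p p1 pmax] := max_on_sphere N0 (fun x x0 => smooth_continuous sQ x0).
have p0 := unit_neq0 p1.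
have Qle y : punctured N y -> Q y <= Q p.
  move=> /= y0; rewrite (homogeneous_normalize hQ y0) rpow0 mul1r.
  by apply: pmax; exact: dot_normalize.
have lQ : lap Q p <= 0.
  by apply: sumr_le0 => i _; have [] := local_max_partial2 i oP sQ p0 Qle.
have srr ij : smooth_on (punctured N) (fun y => rotation F ij.1 ij.2 y * rotation F ij.1 ij.2 y).
  by apply: smooth_M => //; exact: smooth_rotation.
have dQ : lap Q p = \sum_ij 2 * \sum_a partial a (rotation F ij.1 ij.2) p ^+ 2.
  rewrite (lap_sum _ oP srr p0); apply: eq_bigr => ij _.
  rewrite (lapM oP (smooth_rotation _ _) (smooth_rotation _ _) p0) lap_rotation//.
  by rewrite mulr0 !add0r; congr (_ * _); apply: eq_bigr => a _; rewrite expr2.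
have sq0 ij : 0 <= 2 * \sum_a partial a (rotation F ij.1 ij.2) p ^+ 2.
  by rewrite mulr_ge0// sumr_ge0// => a _; exact: sqr_ge0.
have z0 : \sum_(ij : 'I_N * 'I_N) 2 * \sum_a partial a (rotation F ij.1 ij.2) p ^+ 2 = 0.
  by apply/eqP; rewrite eq_le -{1}dQ lQ/= sumr_ge0.
have zr i j a : partial a (rotation F i j) p = 0.
  move/eqP: z0; rewrite psumr_eq0; last by move=> ij _; exact: sq0.
  move=> /allP/(_ (i, j)); rewrite mem_index_enum /= => /(_ isT).
  rewrite mulf_eq0 pnatr_eq0 /= psumr_eq0; last by move=> b _; exact: sqr_ge0.
  by move=> /allP/(_ a); rewrite mem_index_enum /= => /(_ isT); rewrite sqrf_eq0 => /eqP.
have gp k : partial k F p = 0 by apply: gr.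
have Qp : Q p = 0 by rewrite /Q big1// => ij _; rewrite /rotation !gp !mulr0 subrr mulr0.
have rot0 i j (y : 'rV[R]_N) : y != 0 -> rotation F i j y = 0.
  move=> y0; have := Qle y y0; rewrite Qp => Qy.
  have : Q y == 0.
    by rewrite eq_le Qy /= sumr_ge0// => ij _; rewrite -expr2 sqr_ge0.
  rewrite psumr_eq0; last by move=> ij _; rewrite -expr2 sqr_ge0.
  move=> /allP/(_ (i, j)); rewrite mem_index_enum /= => /(_ isT).
  by rewrite mulf_eq0 orbb => /eqP.
apply: gr => // j k; rewrite (@partial_near _ _ _ _ (fun=> 0)); first exact: partial_cst.
by apply: near_punctured => // y y0; exact: rot0.
Qed.

End Rotation.

Section Spectrum.
Context N (N3 : (2 < N)%N).
Let oP := @open_punctured R N.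
Let N3R : 3 <= N%:R :> R. Proof. by rewrite ler_nat. Qed.

Lemma harmonic_partial (G : 'rV[R]_N -> R) i (x : 'rV[R]_N) : smooth_on (punctured N) G ->
  (forall x : 'rV[R]_N, x != 0 -> lap G x = 0) -> x != 0 -> lap (partial i G) x = 0.
Proof.
move=> sG lG x0; rewrite (lap_partial i oP sG x0) (@partial_near _ _ _ _ (fun=> 0)).
  exact: partial_cst.
by apply: near_punctured => // y /lG.
Qed.

Lemma euler0 t (G : 'rV[R]_N -> R) (x : 'rV[R]_N) : smooth_on (punctured N) G -> homogeneous t G ->
  t != 0 -> (forall i, partial i G x = 0) -> x != 0 -> G x = 0.
Proof.
move=> sG hG t0 gG x0; apply: (mulfI t0); rewrite mulr0 -(euler sG hG x0).
by apply: big1 => i _; rewrite gG mulr0.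
Qed.

(** The partial derivatives have degree t = s - 1 between -1 and 0, where t (t + N - 2) < 0 because
    N >= 3; the maximum principle kills them, and Euler's relation then kills G. *)
Lemma harmonic_lt1 s (G : 'rV[R]_N -> R) : smooth_on (punctured N) G -> homogeneous s G ->
  (forall x : 'rV[R]_N, x != 0 -> lap G x = 0) -> 0 < s < 1 -> forall x : 'rV[R]_N, x != 0 -> G x = 0.
Proof.
move=> sG hG lG /andP[s0 s1] x x0; apply: (euler0 sG hG) => //; first by rewrite gt_eqF.
move=> i; apply: (max_principle (mu := 0) (smooth_partial i sG) (homogeneous_partial i sG hG)) => //.
  by move=> y y0; rewrite harmonic_partial// mulr0 oppr0 mul0r.
by rewrite addr0 nmulr_rlt0; have := N3R; lra.
Qed.

(** One differentiation reaches a negative degree if s < 1, two if 1 < s < 2. At s = 1 the partial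
    derivatives have degree 0 and are constants, so G is linear, and evenness excludes it. *)
Lemma harmonic_even (s : R) (G : 'rV[R]_N -> R) : smooth_on (punctured N) G -> homogeneous s G ->
  (forall x : 'rV[R]_N, x != 0 -> lap G x = 0) -> (forall x : 'rV[R]_N, x != 0 -> G (- x) = G x) ->
  0 < s < 2 -> forall x : 'rV[R]_N, x != 0 -> G x = 0.
Proof.
move=> sG hG lG eG /andP[s0 s2] x x0; have [s1|s1|s1] := ltgtP s 1.
- by apply: (harmonic_lt1 sG hG) => //; rewrite s0.
- apply: (euler0 sG hG) => //; first by rewrite gt_eqF.
  move=> i; have sGi := smooth_partial i sG; have hGi := homogeneous_partial i sG hG.
  apply: (euler0 sGi hGi) => //; first by rewrite subr_eq0 gt_eqF.
  move=> j; have sGj := smooth_partial j sGi; have hGj := homogeneous_partial j sGi hGi.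
  apply: (max_principle (mu := 0) sGj hGj) => //.
    have lGi (y : 'rV[R]_N) (y0 : y != 0) := harmonic_partial i sG lG y0.
    by move=> y y0; rewrite (harmonic_partial j sGi lGi y0) mulr0 oppr0 mul0r.
  by rewrite addr0 nmulr_rlt0; have := N3R; lra.
- subst s; have hGi i := homogeneous_partial i sG hG.
  have E y : y != 0 -> G y = \sum_i y 0 i * partial i G x.
    move=> y0; rewrite -[LHS]mul1r -(euler sG hG y0); apply: eq_bigr => i _; congr (_ * _).
    have lGi (z : 'rV[R]_N) (z0 : z != 0) := harmonic_partial i sG lG z0.
    have hGi0 : homogeneous 0 (partial i G) by rewrite -(subrr 1).
    exact: (harmonic0_constant (smooth_partial i sG) hGi0 lGi N3 y0 x0).
  have x0' : - x != 0 by rewrite oppr_eq0.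
  have : G x = - G x.
    rewrite -{1}eG// (E _ x0') (E _ x0) -sumrN; apply: eq_bigr => i _.
    by rewrite mxE mulNr.
  by move=> h; have : 2 * G x = 0 by [lra]; lra.
Qed.

Section Eigen.
Context (F : 'rV[R]_N -> R) (mu : R) (sF : smooth_on (punctured N) F) (hF : homogeneous 0 F).
Context (eF : forall x, x != 0 -> dot x x * lap F x = - mu * F x).

Lemma eigen_neg : mu < 0 -> forall x : 'rV[R]_N, x != 0 -> F x = 0.
Proof. by move=> mu0; apply: (max_principle sF hF eF); rewrite mul0r add0r. Qed.

Lemma eigen_zero : mu = 0 -> forall x y : 'rV[R]_N, x != 0 -> y != 0 -> F x = F y.
Proof.
move=> mu0; apply: (harmonic0_constant sF hF _ N3) => x x0.
have : dot x x * lap F x = 0 by rewrite eF// mu0 oppr0 mul0r.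
by move/eqP; rewrite mulf_eq0 (gt_eqF (dot_gt0 x0)) => /eqP.
Qed.

(* F extends to a harmonic function of the degree s with s(s + N - 2) = mu. *)
Let s : R := (Num.sqrt ((N%:R - 2) ^+ 2 + 4 * mu) - (N%:R - 2)) / 2.

(** The last clause expresses that d (d + N - 2) increases with d > 0, so that a bound on mu becomes
    a bound on the degree. *)
Lemma eigen_degree : 0 < mu -> [/\ 0 < s, s * (s + N%:R - 2) = mu
  & forall d, 0 < d -> mu < d * (d + N%:R - 2) -> s < d].
Proof.
move=> mu0; pose a : R := N%:R - 2.
have a1 : 1 <= a by have := N3R; rewrite /a; lra.
have D0 : 0 <= a ^+ 2 + 4 * mu by rewrite addr_ge0 ?sqr_ge0// mulr_ge0// ltW.
have r2 := sqr_sqrtr D0; have r0 := sqrtr_ge0 (a ^+ 2 + 4 * mu).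
move: r2 r0; rewrite /s -/a; move: (Num.sqrt _) => r r2 r0.
have ra : a < r.
  by rewrite -(@ltr_pXn2r _ 2)// ?nnegrE//; lra.
have e1 : (r - a) / 2 * ((r - a) / 2 + N%:R - 2) = mu.
  have -> : (r - a) / 2 + N%:R - 2 = (r + a) / 2 by rewrite /a; field.
  have -> : (r - a) / 2 * ((r + a) / 2) = (r ^+ 2 - a ^+ 2) / 4 by field.
  by rewrite r2; field.
split => //; first by lra.
move=> d d0 hd; rewrite ltNge; apply/negP => hs.
suff : d * (d + N%:R - 2) <= mu by lra.
have aE : a = N%:R - 2 by []. clearbody a. rewrite -e1; by apply: ler_pM; lra.
Qed.

Let G (x : 'rV[R]_N) := rpow s x * F x.
Let sG : smooth_on (punctured N) G.
Proof. by apply: smooth_M => //; exact: smooth_rpow. Qed.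
Let hG : homogeneous s G.
Proof. by rewrite -[s]addr0; apply: homogeneousM => //; exact: homogeneous_rpow. Qed.
Let lG : s * (s + N%:R - 2) = mu -> forall x : 'rV[R]_N, x != 0 -> lap G x = 0.
Proof.
move=> es x x0; have : dot x x * lap G x = 0.
  rewrite (lap_rpowM s sF hF x0) eF// mulr0 addr0 es.
  by rewrite -mulrDl addNr mul0r mulr0.
by move/eqP; rewrite mulf_eq0 (gt_eqF (dot_gt0 x0)) => /eqP.
Qed.
Let G0 x : x != 0 -> G x = 0 -> F x = 0.
Proof. by move=> x0 /eqP; rewrite mulf_eq0 (gt_eqF (rpow_gt0 _ x0)) => /eqP. Qed.

Lemma eigen_gap1 : 0 < mu -> mu < N%:R - 1 -> forall x : 'rV[R]_N, x != 0 -> F x = 0.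
Proof.
move=> mu0 mu1 x x0; have [s0 es hs] := eigen_degree mu0.
apply: G0 => //; apply: (harmonic_lt1 sG hG) => //; first exact: lG.
by rewrite s0 hs//; have := N3R; lra.
Qed.

Lemma eigen_gap2 : 0 < mu -> mu < 2 * N%:R -> (forall x : 'rV[R]_N, x != 0 -> F (- x) = F x) ->
  forall x, x != 0 -> F x = 0.
Proof.
move=> mu0 mu1 eF' x x0; have [s0 es hs] := eigen_degree mu0.
apply: G0 => //; apply: (harmonic_even sG hG) => //; first exact: lG.
  by move=> y y0; rewrite /G eF'// /rpow dotNl dotNr opprK.
by rewrite s0 hs//; have := N3R; lra.
Qed.

End Eigen.
End Spectrum.

End Gap.

(** * Laplacians of lifted metrics *)

Section Laplacian.
Context {R : realType}.

(** Pure index algebra behind [laplacianE]: M stands for the inverse metric, T i p q for the i-th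
    derivative of the metric entry (p, q), u for the partial derivatives of a function and X for its
    gradient. The first-order terms of div grad on the left become the Christoffel term of the
    Hessian on the right. *)
Lemma laplacian_contraction n (M : 'I_n -> 'I_n -> R) (T : 'I_n -> 'I_n -> 'I_n -> R)
    (u X : 'I_n -> R) :
  (forall i j, M i j = M j i) -> (forall i p q, T i p q = T i q p) ->
  (forall q, X q = \sum_j M q j * u j) ->
  \sum_i (- \sum_p \sum_q M i p * T i p q * X q)
  + \sum_i \sum_j (2^-1 * \sum_d M i d * (T i d j + T j d i - T d i j)) * X j =
  - \sum_i \sum_j M i j *
      \sum_l (2^-1 * \sum_d M l d * (T i d j + T j d i - T d i j)) * u l.
Proof.
move=> sM sT XE.
(* Up to symmetry these are the only two full contractions; the three sums are -S1, S2 / 2 and S1 -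
   S2 / 2. *)
pose S1 := \sum_i \sum_j \sum_d M i j * T i j d * X d.
pose S2 := \sum_i \sum_j \sum_d M i j * T d i j * X d.
have e1 : \sum_i (- \sum_p \sum_q M i p * T i p q * X q) = - S1 by rewrite sumrN.
have e2 : \sum_i \sum_j (2^-1 * \sum_d M i d * (T i d j + T j d i - T d i j)) * X j = 2^-1 * S2.
  have h1 : \sum_i \sum_j \sum_d M i d * T i d j * X j = S1.
    by apply: eq_bigr => i _; rewrite exchange_big.
  have h2 : \sum_i \sum_j \sum_d M i d * T j d i * X j = S2.
    apply: eq_bigr => i _; rewrite exchange_big; apply: eq_bigr => j _.
    by apply: eq_bigr => d _; rewrite (sT d j i).
  have h3 : \sum_i \sum_j \sum_d M i d * T d i j * X j = S1.
    rewrite -h1; under eq_bigr do rewrite exchange_big/=.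
    rewrite exchange_big/=; apply: eq_bigr => d _.
    rewrite exchange_big/=; apply: eq_bigr => i _; apply: eq_bigr => j _.
    by rewrite (sM j d).
  transitivity (2^-1 * (S1 + S2 - S1)); last by congr (_ * _); ring.
  rewrite -{1}h1 -h2 -h3 -big_split -sumrB mulr_sumr; apply: eq_bigr => i _.
  rewrite -big_split -sumrB mulr_sumr; apply: eq_bigr => j _.
  rewrite -big_split -sumrB -mulrA mulr_suml; congr (_ * _); apply: eq_bigr => d _.
  by rewrite /= mulrBr mulrDr mulrBl mulrDl.
have e3 : \sum_i \sum_j M i j *
      \sum_l (2^-1 * \sum_d M l d * (T i d j + T j d i - T d i j)) * u l = S1 - 2^-1 * S2.
  have h1 : \sum_i \sum_j \sum_d M i j * T i d j * X d = S1.
    by apply: eq_bigr => i _; apply: eq_bigr => j _; apply: eq_bigr => d _; rewrite (sT i d j).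
  have h2 : \sum_i \sum_j \sum_d M i j * T j d i * X d = S1.
    rewrite exchange_big/=; apply: eq_bigr => i _; apply: eq_bigr => j _; apply: eq_bigr => d _.
    by rewrite (sM j i) (sT i d j).
  transitivity (2^-1 * (S1 + S1 - S2)); last by field.
  rewrite -{1}h1 -h2 /S2 -big_split -sumrB mulr_sumr; apply: eq_bigr => i _.
  rewrite -big_split -sumrB mulr_sumr; apply: eq_bigr => j _.
  rewrite -big_split -sumrB.
  transitivity (M i j * (2^-1 * \sum_d (T i d j + T j d i - T d i j) * X d)).
    congr (_ * _); rewrite mulr_sumr.
    transitivity (\sum_l \sum_d 2^-1 * (M d l * u l * (T i d j + T j d i - T d i j))).
      apply: eq_bigr => l _; rewrite -mulrA mulr_suml mulr_sumr; apply: eq_bigr => d _.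
      by rewrite (sM l d); ring.
    rewrite exchange_big/=; apply: eq_bigr => d _; rewrite -mulr_sumr -mulr_suml -XE.
    by congr (_ * _); rewrite mulrC.
  rewrite mulrCA; congr (_ * _); rewrite mulr_sumr; apply: eq_bigr => d _.
  by rewrite /=; ring.
by rewrite e1 e2 e3 opprB addrC.
Qed.

(** Differentiate g g^-1 = 1 and solve for the derivative of the inverse. *)
Lemma partial_invmx k n (U : set 'rV[R]_k) (g : 'rV[R]_k -> 'M[R]_n) (i : 'I_k) (x : 'rV[R]_k) a b :
  open U -> (forall p q, smooth_on U (fun y => g y p q)) -> (forall y, U y -> g y \in unitmx) ->
  U x ->
  partial i (fun y => invmx (g y) a b) x =
  - \sum_p \sum_q invmx (g x) a p * partial i (fun y => g y p q) x * invmx (g x) q b.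
Proof.
move=> oU sg ug Ux.
pose dM : 'M[R]_n := \matrix_(p, q) partial i (fun y => invmx (g y) p q) x.
pose dg : 'M[R]_n := \matrix_(p, q) partial i (fun y => g y p q) x.
have dsg p q : differentiable (fun y => g y p q) x by exact: (smooth_diff (sg p q) Ux).
have dsM p q : differentiable (fun y => invmx (g y) p q) x.
  exact: (smooth_diff (smooth_invmx oU sg ug p q) Ux).
have E : dg *m invmx (g x) + g x *m dM = 0.
  apply/matrixP => p q; rewrite [RHS]mxE mxE.
  have : partial i (fun y => \sum_c g y p c * invmx (g y) c q) x = 0.
    rewrite (@partial_near _ _ _ _ (fun=> (p == q)%:R)); first exact: partial_cst.
    have nU : nbhs x U by exact: open_nbhs_nbhs.
    apply: filterS nU => y /ug uy.
    by have := mulmxV uy => /matrixP/(_ p q); rewrite !mxE.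
  rewrite partial_sum; last by move=> c; apply: differentiableM.
  move=> <-; rewrite !mxE -big_split; apply: eq_bigr => c _.
  by rewrite [in LHS]/= ![in LHS]mxE partialM// addrC [X in _ + X]mulrC.
have dME : dM = - (invmx (g x) *m dg *m invmx (g x)).
  have := congr1 (mulmx (invmx (g x))) E; rewrite mulmx0 mulmxDr !mulmxA mulVmx ?ug// mul1mx.
  by rewrite addrC => /eqP; rewrite addr_eq0 => /eqP.
transitivity (dM a b); first by rewrite mxE.
rewrite dME mxE mxE exchange_big; congr (- _); apply: eq_bigr => q _.
by rewrite mxE mulr_suml; apply: eq_bigr => p _; rewrite [dg p q]mxE.
Qed.

(** The Laplacian becomes the trace of the covariant Hessian. In this form the Christoffel symbols
    enter only contracted with the derivatives of u, and a unit lift turns that contraction into an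
    orthogonal projection. *)
Lemma laplacianE n (U : set 'rV[R]_n) (g : 'rV[R]_n -> 'M[R]_n) (u : 'rV[R]_n -> R) (x : 'rV[R]_n) :
  open U -> (forall p q, smooth_on U (fun y => g y p q)) -> (forall y, U y -> g y \in unitmx) ->
  (forall y p q, U y -> g y p q = g y q p) -> smooth_on U u -> U x ->
  laplacian g u x = \sum_i \sum_j invmx (g x) i j *
    (partial i (partial j u) x - \sum_l christoffel g l i j x * partial l u x).
Proof.
move=> oU sg ug symg su Ux.
have symM p q : invmx (g x) p q = invmx (g x) q p.
  have -> : invmx (g x) p q = (invmx (g x))^T q p by rewrite mxE.
  rewrite trmx_inv; congr (invmx _ q p).
  by apply/matrixP => a b; rewrite mxE; exact: symg.
pose T i p q := partial i (fun y => g y p q) x.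
have symT i p q : T i p q = T i q p.
  apply: partial_near; have nU : nbhs x U by exact: open_nbhs_nbhs.
  by apply: filterS nU => y Uy; exact: symg.
pose X q := \sum_j invmx (g x) q j * partial j u x.
have := laplacian_contraction symM symT (fun q => erefl (X q)) => C.
have gE i : partial i (fun y => grad g u y 0 i) x =
   - (\sum_p \sum_q invmx (g x) i p * T i p q * X q)
   + \sum_j invmx (g x) i j * partial i (partial j u) x.
  rewrite (_ : (fun y => grad g u y 0 i) = fun y => \sum_j invmx (g y) i j * partial j u y); last first.
    by apply/funext => y; rewrite mxE.
  have dM j : differentiable (fun y => invmx (g y) i j) x.
    exact: (smooth_diff (smooth_invmx oU sg ug i j) Ux).
  have du j : differentiable (partial j u) x by exact: (smooth_diff (smooth_partial j su) Ux).
  rewrite partial_sum; last by move=> j; exact: differentiableM.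
  transitivity (\sum_j partial j u x * partial i (fun y => invmx (g y) i j) x
    + \sum_j invmx (g x) i j * partial i (partial j u) x).
    by rewrite -big_split; apply: eq_bigr => j _; rewrite partialM// addrC.
  congr (_ + _).
  transitivity (\sum_j - (\sum_p \sum_q invmx (g x) i p * T i p q * (invmx (g x) q j * partial j u x))).
    apply: eq_bigr => j _; rewrite (partial_invmx _ _ _ oU sg ug Ux) mulrN; congr (- _).
    rewrite mulr_sumr; apply: eq_bigr => p _; rewrite mulr_sumr; apply: eq_bigr => q _.
    by rewrite mulrC !mulrA.
  rewrite sumrN; congr (- _); rewrite exchange_big; apply: eq_bigr => p _.
  by rewrite exchange_big; apply: eq_bigr => q _; rewrite -mulr_sumr.
rewrite /laplacian /div big_split /= (eq_bigr _ (fun i _ => gE i)) big_split/= addrAC.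
transitivity (- (\sum_i \sum_j invmx (g x) i j * \sum_l christoffel g l i j x * partial l u x)
  + \sum_i \sum_j invmx (g x) i j * partial i (partial j u) x).
  congr (_ + _); rewrite -C; congr (_ + _).
  by apply: eq_bigr => i _; apply: eq_bigr => j _; congr (_ * _); rewrite mxE.
rewrite addrC -sumrB; apply: eq_bigr => i _; rewrite -sumrB; apply: eq_bigr => j _.
by rewrite mulrBr.
Qed.

End Laplacian.

(** * Vector-valued maps, gradients, Hessians and projections *)

Section VectorPartial.
Context {R : realType}.
Implicit Types (k N n : nat).

Definition vpartial k N (i : 'I_k) (f : 'rV[R]_k -> 'rV[R]_N) (x : 'rV[R]_k) : 'rV[R]_N :=
  \row_a partial i (fun y => f y 0 a) x.

Definition vsmooth k N (U : set 'rV[R]_k) (f : 'rV[R]_k -> 'rV[R]_N) : Prop :=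
  forall a, smooth_on U (fun x => f x 0 a).

Lemma vsmooth_partial k N (U : set 'rV[R]_k) (i : 'I_k) (f : 'rV[R]_k -> 'rV[R]_N) :
  vsmooth U f -> vsmooth U (vpartial i f).
Proof.
move=> sf a; rewrite (_ : (fun x => _) = partial i (fun y => f y 0 a)); first exact: smooth_partial.
by apply/funext => x; rewrite mxE.
Qed.

Lemma vsmooth_mul k N n (U : set 'rV[R]_k) (f : 'rV[R]_k -> 'rV[R]_N) (A : 'M[R]_(N, n)) :
  open U -> vsmooth U f -> vsmooth U (fun x => f x *m A).
Proof.
move=> oU sf a; rewrite (_ : (fun x => _) = fun x => \sum_b f x 0 b * A b a).
  by apply: smooth_sum => // b _; apply: smooth_M => //; exact: smooth_cst.
by apply/funext => x; rewrite mxE.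
Qed.

Lemma smooth_dot k N (U : set 'rV[R]_k) (f g : 'rV[R]_k -> 'rV[R]_N) :
  open U -> vsmooth U f -> vsmooth U g -> smooth_on U (fun x => dot (f x) (g x)).
Proof. by move=> oU sf sg; apply: smooth_sum => // a _; apply: smooth_M. Qed.

Lemma vpartial_mul k N n (U : set 'rV[R]_k) (i : 'I_k) (f : 'rV[R]_k -> 'rV[R]_N) (A : 'M[R]_(N, n)) x :
  vsmooth U f -> U x -> vpartial i (fun y => f y *m A) x = vpartial i f x *m A.
Proof.
move=> sf Ux; apply/rowP => a; rewrite !mxE.
rewrite (_ : (fun y => (f y *m A) 0 a) = fun y => \sum_b A b a * f y 0 b); last first.
  by apply/funext => y; rewrite mxE; apply: eq_bigr => b _; rewrite mulrC.
have df b : differentiable (fun y => f y 0 b) x by exact: (smooth_diff (sf b) Ux).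
rewrite partial_sum; last first.
  by move=> b; apply: differentiableM => //; exact: (@differentiable_cst _ _ _ (A b a : R^o)).
by apply: eq_bigr => b _; rewrite partialZ// mxE mulrC.
Qed.

Lemma partial_dot k N (U : set 'rV[R]_k) (i : 'I_k) (f g : 'rV[R]_k -> 'rV[R]_N) x :
  vsmooth U f -> vsmooth U g -> U x ->
  partial i (fun y => dot (f y) (g y)) x = dot (vpartial i f x) (g x) + dot (f x) (vpartial i g x).
Proof.
move=> sf sg Ux.
have df b : differentiable (fun y => f y 0 b) x by exact: (smooth_diff (sf b) Ux).
have dg b : differentiable (fun y => g y 0 b) x by exact: (smooth_diff (sg b) Ux).
rewrite /dot partial_sum; last by move=> b; apply: differentiableM.
rewrite -big_split; apply: eq_bigr => a _; apply: etrans (partialM i (df a) (dg a)) _.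
by rewrite addrC; congr (_ + _); rewrite /= [vpartial _ _ _ _ _]mxE// mulrC.
Qed.

Lemma vpartial_near k N (U : set 'rV[R]_k) (i : 'I_k) (f g : 'rV[R]_k -> 'rV[R]_N) x :
  open U -> U x -> (forall y, U y -> f y = g y) -> vpartial i f x = vpartial i g x.
Proof.
move=> oU Ux fg; apply/rowP => a; rewrite !mxE; apply: partial_near.
have nU : nbhs x U by exact: open_nbhs_nbhs.
by apply: filterS nU => y /fg ->.
Qed.

Lemma vpartialC k N (U : set 'rV[R]_k) (i j : 'I_k) (f : 'rV[R]_k -> 'rV[R]_N) x :
  open U -> vsmooth U f -> U x ->
  vpartial i (vpartial j f) x = vpartial j (vpartial i f) x.
Proof.
move=> oU sf Ux; apply/rowP => a; rewrite [LHS]mxE [RHS]mxE.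
have E l : (fun y => vpartial l f y 0 a) = partial l (fun y => f y 0 a).
  by apply/funext => y; rewrite mxE.
by rewrite (E i) (E j); exact: (partialC i j oU (sf a) Ux).
Qed.

Definition gradient N (F : 'rV[R]_N -> R) (z : 'rV[R]_N) : 'rV[R]_N := \row_a partial a F z.

Definition hessian N (F : 'rV[R]_N -> R) (z : 'rV[R]_N) : 'M[R]_N :=
  \matrix_(a, b) partial a (partial b F) z.

Lemma vsmooth_gradient N (U : set 'rV[R]_N) (F : 'rV[R]_N -> R) :
  smooth_on U F -> vsmooth U (gradient F).
Proof.
move=> sF a; rewrite (_ : (fun x => _) = partial a F); first exact: smooth_partial.
by apply/funext => x; rewrite mxE.
Qed.

Lemma vsmooth_id N (U : set 'rV[R]_N) : vsmooth U id.
Proof. by move=> a; exact: smooth_entry. Qed.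

Lemma vpartial_id N (b : 'I_N) (z : 'rV[R]_N) : vpartial b id z = delta_mx 0 b.
Proof. by apply/rowP => a; rewrite !mxE partial_entry eq_sym. Qed.

Lemma vpartial_gradient N (b : 'I_N) (F : 'rV[R]_N -> R) (z : 'rV[R]_N) :
  vpartial b (gradient F) z = row b (hessian F z).
Proof.
apply/rowP => a; rewrite [LHS]mxE [RHS]mxE [RHS]mxE; congr (partial b _ z).
by apply/funext => y; rewrite mxE.
Qed.

Lemma hessian_sym N (U : set 'rV[R]_N) (F : 'rV[R]_N -> R) (z : 'rV[R]_N) : open U ->
  smooth_on U F -> U z -> (hessian F z)^T = hessian F z.
Proof.
move=> oU sF Uz; apply/matrixP => a b; rewrite [LHS]mxE [LHS]mxE [RHS]mxE.
exact: (partialC b a oU sF Uz).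
Qed.

Lemma tr_hessian N (F : 'rV[R]_N -> R) (z : 'rV[R]_N) : \tr (hessian F z) = lap F z.
Proof. by apply: eq_bigr => a _; rewrite mxE. Qed.

Lemma mul_trmx N (u v : 'rV[R]_N) : u *m v^T = (dot u v)%:M.
Proof. by apply/matrixP => a b; rewrite !ord1 dotE [RHS]mxE eqxx. Qed.

Lemma mul_projection N (u z t : 'rV[R]_N) :
  u *m (1%:M - z^T *m z - t^T *m t) = u - dot u z *: z - dot u t *: t.
Proof. by rewrite !mulmxBr mulmx1 !mulmxA !mul_trmx !mul_scalar_mx. Qed.

Lemma projection_tr N (z t : 'rV[R]_N) :
  (1%:M - z^T *m z - t^T *m t)^T = 1%:M - z^T *m z - t^T *m t.
Proof. by rewrite !linearB/= trmx1 !trmx_mul !trmxK. Qed.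

Lemma mulmx_trmx_row n N (A : 'M[R]_(n, N)) (v : 'rV[R]_N) i j :
  (A *m v^T) i j = dot (row i A) v.
Proof. by rewrite mxE; apply: eq_bigr => a _; rewrite !mxE ord1. Qed.

(* If the rows of A and V together form a basis and are mutually orthogonal,
   the two orthogonal projections add up to the identity. *)
Lemma row_complement n q N (A : 'M[R]_(n, N)) (V : 'M[R]_(q, N)) (g : 'M[R]_n) (c : R) :
  c != 0 -> g \in unitmx -> A *m A^T = c^-1 *: g -> A *m V^T = 0 -> V *m V^T = 1%:M ->
  (n + q = N)%N -> c *: (A^T *m invmx g *m A) = 1%:M - V^T *m V.
Proof.
move=> c0 ug AA AV VV nN; subst N.
pose L := row_mx (c *: (A^T *m invmx g)) V^T.
have KL : col_mx A V *m L = 1%:M.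
  have VA : V *m A^T = 0 by rewrite -[LHS]trmxK trmx_mul trmxK AV trmx0.
  rewrite mul_col_row -!scalemxAr !mulmxA AA VA VV AV mul0mx scaler0.
  by rewrite -scalemxAl scalerA mulfV// scale1r mulmxV// scalar_mx_block.
have := mulmx1C KL; rewrite mul_row_col -scalemxAl => <-.
by rewrite addrK.
Qed.

Lemma row_jac k N (f : 'rV[R]_k -> 'rV[R]_N) i x : row i (jac f x) = vpartial i f x.
Proof. by apply/rowP => a; rewrite !mxE. Qed.

Lemma mul_trmx_row n N (u : 'rV[R]_N) (A : 'M[R]_(n, N)) d : (u *m A^T) 0 d = dot u (row d A).
Proof. by rewrite mxE; apply: eq_bigr => a _; rewrite !mxE. Qed.

End VectorPartial.
Arguments vsmooth_partial {R k N U} i {f} _.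
Arguments vsmooth_mul {R k N n U f} A _ _.

Opaque dot vpartial.

(** * Laplacian of a metric given by a unit lift *)

Section Lift.
Context {R : realType} (n N : nat) (U : set 'rV[R]_n) (oU : open U).
Context (psi : 'rV[R]_n -> 'rV[R]_N) (J : 'M[R]_N) (e c : R) (g : 'rV[R]_n -> 'M[R]_n).
Context (c0 : c != 0) (spsi : vsmooth U psi) (psi1 : forall x, U x -> dot (psi x) (psi x) = 1).
Context (JT : J^T = - J) (JJ : J *m J = - e%:M).

Local Notation D i := (vpartial i psi).
Local Notation DD i j := (vpartial i (vpartial j psi)).

(* The component of the i-th derivative of the lift along the fibre direction
   psi J. *)
Definition vert (i : 'I_n) (x : 'rV[R]_n) : R := dot (D i x) (psi x *m J).

Definition horiz (i : 'I_n) (x : 'rV[R]_n) : 'rV[R]_N := D i x - vert i x *: (psi x *m J).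

(** The vector whose products with [horiz] are, up to c, the Christoffel symbols of the first kind.
    The two corrections to the second derivative come from differentiating the products of [vert] in
    the metric. *)
Definition lift_hess (i j : 'I_n) (x : 'rV[R]_n) : 'rV[R]_N :=
  DD i j x - vert j x *: (D i x *m J) - vert i x *: (D j x *m J).

Context (gE : forall x i j, U x -> g x i j = c * (dot (D i x) (D j x) - vert i x * vert j x)).
Context (ug : forall x, U x -> g x \in unitmx).

Lemma dotJ (u v : 'rV[R]_N) : dot (u *m J) v = - dot u (v *m J).
Proof. by rewrite dot_mul JT mulmxN dotNr. Qed.

Lemma dotJJ (u v : 'rV[R]_N) : dot (u *m J) (v *m J) = e * dot u v.
Proof. by rewrite dotJ -mulmxA JJ mulmxN dotNr opprK mul_mx_scalar dotZr. Qed.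

Lemma dotJ_self (u : 'rV[R]_N) : dot u (u *m J) = 0.
Proof. by have := dotJ u u; rewrite dotC; lra. Qed.

Lemma dot_lift_partial i x : U x -> dot (D i x) (psi x) = 0.
Proof.
move=> Ux; have := partial_dot i spsi spsi Ux; rewrite [dot (psi x) _]dotC.
rewrite (@partial_near _ _ _ _ (fun=> 1)); last first.
  have nU : nbhs x U by exact: open_nbhs_nbhs.
  exact: filterS nU.
rewrite partial_cst; move: (dot _ _) => a; lra.
Qed.

Lemma dot_lift_hess_lift i j x : U x -> dot (DD i j x) (psi x) = - dot (D i x) (D j x).
Proof.
move=> Ux; have := partial_dot i (vsmooth_partial j spsi) spsi Ux.
rewrite (@partial_near _ _ _ _ (fun=> 0)); last first.
  have nU : nbhs x U by exact: open_nbhs_nbhs.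
  by apply: filterS nU => y; exact: dot_lift_partial.
rewrite partial_cst [dot (D j x) _]dotC; move: (dot _ _) (dot _ _) => a b; lra.
Qed.

Lemma smooth_vert i : smooth_on U (vert i).
Proof.
apply: smooth_dot => //; first exact: vsmooth_partial.
exact: vsmooth_mul.
Qed.

Lemma partial_vert i j x : U x ->
  partial i (vert j) x = dot (DD i j x) (psi x *m J) + dot (D j x) (D i x *m J).
Proof.
move=> Ux; rewrite (partial_dot i (vsmooth_partial j spsi) (vsmooth_mul J oU spsi) Ux).
by rewrite (vpartial_mul i J spsi Ux).
Qed.

Lemma dot_lift_hess_horiz i j m x : U x -> dot (lift_hess i j x) (horiz m x) =
  dot (DD i j x) (D m x) - vert m x * dot (DD i j x) (psi x *m J)
  - vert j x * dot (D i x *m J) (D m x) - vert i x * dot (D j x *m J) (D m x).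
Proof.
move=> Ux; rewrite /lift_hess /horiz.
have z a : dot (D a x *m J) (psi x *m J) = 0 by rewrite dotJJ dot_lift_partial// mulr0.
have := z i; have := z j.
move: (DD i j x) (D i x *m J) (D j x *m J) (D m x) (psi x *m J) => p q1 q2 r t zj zi.
move: (vert i x) (vert j x) (vert m x) => v1 v2 v3.
by rewrite !(dotBl, dotBr, dotZl, dotZr) zi zj; ring.
Qed.

Lemma vertE a x : vert a x = dot (D a x) (psi x *m J).
Proof. by []. Qed.

Lemma horizK a x : D a x = horiz a x + vert a x *: (psi x *m J).
Proof. by rewrite /horiz subrK. Qed.

Lemma horizE a x : horiz a x = D a x - vert a x *: (psi x *m J).
Proof. by []. Qed.

Lemma lift_hessE i j x : lift_hess i j x =
  DD i j x - vert j x *: (D i x *m J) - vert i x *: (D j x *m J).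
Proof. by []. Qed.

Opaque vert horiz lift_hess.

Lemma smooth_metric i j : smooth_on U (fun x => g x i j).
Proof.
apply: (@smooth_eq _ _ _ (fun x => c * (dot (D i x) (D j x) - vert i x * vert j x))) => //.
  by move=> x Ux; rewrite gE.
apply: smooth_Z => //; apply: smooth_B => //.
  by apply: smooth_dot => //; exact: vsmooth_partial.
by apply: smooth_M => //; exact: smooth_vert.
Qed.

Lemma metric_sym x i j : U x -> g x i j = g x j i.
Proof.
move=> Ux; rewrite (gE i j Ux) (gE j i Ux) (dotC (D j x)).
by move: (vert i x) (vert j x) (dot _ _) => a b d; rewrite (mulrC a).
Qed.

Lemma partial_metric m i j x : U x -> partial m (fun y => g y i j) x =
  c * (dot (DD m i x) (D j x) + dot (D i x) (DD m j x)
       - (vert i x * partial m (vert j) x + vert j x * partial m (vert i) x)).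
Proof.
move=> Ux.
rewrite (@partial_near _ _ _ _ (fun x => c * (dot (D i x) (D j x) - vert i x * vert j x))); last first.
  have nU : nbhs x U by exact: open_nbhs_nbhs.
  by apply: filterS nU => y Uy; exact: gE.
have dv l : differentiable (vert l) x by exact: (smooth_diff (smooth_vert l) Ux).
have sd := smooth_dot oU (vsmooth_partial i spsi) (vsmooth_partial j spsi).
have dd := smooth_diff sd Ux.
rewrite partialZ; last by apply: differentiableB => //; apply: differentiableM.
rewrite partialB//; last exact: differentiableM.
by rewrite partialM// (partial_dot m (vsmooth_partial i spsi) (vsmooth_partial j spsi) Ux).
Qed.

(** The alternating sum of metric derivatives with inner products replaced by free symbols: S for
    second against first derivatives, s for second derivatives against the fibre direction, w and w'
    for the skew products of first derivatives. Only their symmetries matter, and [ring] then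
    decides. *)
Lemma first_kind_algebra (S : 'I_n -> 'I_n -> 'I_n -> R) (s w : 'I_n -> 'I_n -> R)
    (v : 'I_n -> R) (w' : 'I_n -> 'I_n -> R) (i j m : 'I_n) :
  (forall a b d, S a b d = S b a d) -> (forall a b, s a b = s b a) ->
  (forall a b, w a b = - w b a) -> (forall a b, w' a b = w b a) ->
  c * (S i m j + S i j m - (v m * (s i j + w j i) + v j * (s i m + w m i)))
  + c * (S j m i + S j i m - (v m * (s j i + w i j) + v i * (s j m + w m j)))
  - c * (S m i j + S m j i - (v i * (s m j + w j m) + v j * (s m i + w i m))) =
  2 * (c * (S i j m - v m * s i j - v j * w' i m - v i * w' j m)).
Proof.
move=> hS hs hw hw'; rewrite !hw' (hS j i) (hS m i) (hS m j) (hs j i) (hs m i) (hs m j).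
by rewrite (hw j i) (hw i m) (hw j m); ring.
Qed.

Lemma metric_first_kind i j m x : U x ->
  partial i (fun y => g y m j) x + partial j (fun y => g y m i) x
  - partial m (fun y => g y i j) x = 2 * (c * dot (lift_hess i j x) (horiz m x)).
Proof.
move=> Ux; rewrite dot_lift_hess_horiz//.
have P l a b : partial l (fun y => g y a b) x =
  c * (dot (DD l a x) (D b x) + dot (DD l b x) (D a x)
    - (vert a x * (dot (DD l b x) (psi x *m J) + dot (D b x) (D l x *m J))
       + vert b x * (dot (DD l a x) (psi x *m J) + dot (D a x) (D l x *m J)))).
  apply: etrans (partial_metric l a b Ux) _.
  by rewrite (partial_vert l b Ux) (partial_vert l a Ux) (dotC (D a x) (DD l b x)).
apply: etrans (congr2 (fun a b => a - b) (congr2 +%R (P i m j) (P j m i)) (P m i j)) _.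
apply: (@first_kind_algebra (fun a b d => dot (DD a b x) (D d x))
  (fun a b => dot (DD a b x) (psi x *m J)) (fun a b => dot (D a x) (D b x *m J))
  (fun a => vert a x) (fun a b => dot (D a x *m J) (D b x))).
- by move=> a b d; rewrite (vpartialC a b oU spsi Ux).
- by move=> a b; rewrite (vpartialC a b oU spsi Ux).
- by move=> a b; rewrite -dotJ dotC.
- by move=> a b; rewrite dotC.
Qed.

Lemma christoffel_lift l i j x : U x ->
  christoffel g l i j x = \sum_d invmx (g x) l d * (c * dot (lift_hess i j x) (horiz d x)).
Proof.
move=> Ux; rewrite /christoffel mulr_sumr; apply: eq_bigr => d _.
by rewrite metric_first_kind// mulrCA mulKf// pnatr_eq0.
Qed.

Definition frame (x : 'rV[R]_n) : 'M[R]_(n, N) := \matrix_i horiz i x.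

(* c h^T g^-1 h is the orthogonal projection onto the horizontal space, i.e.
   the horizontal space has dimension n. *)
Definition frame_complete (x : 'rV[R]_n) : Prop :=
  c *: ((frame x)^T *m invmx (g x) *m frame x) =
  1%:M - (psi x)^T *m psi x - (psi x *m J)^T *m (psi x *m J).

(** The matrix on the right projects onto the span of the horizontal vectors, so the Levi-Civita
    connection is the flat second derivative, corrected as in [lift_hess], followed by a
    projection. *)
Lemma christoffel_frame i j x : U x ->
  \sum_l christoffel g l i j x *: horiz l x =
  lift_hess i j x *m (c *: ((frame x)^T *m invmx (g x) *m frame x)).
Proof.
move=> Ux; have gsym : (invmx (g x))^T = invmx (g x).
  by rewrite trmx_inv; congr invmx; apply/matrixP => a b; rewrite mxE metric_sym.
rewrite -scalemxAr !mulmxA mulmx_sum_row scaler_sumr; apply: eq_bigr => l _.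
rewrite scalerA rowK; congr (_ *: _); apply: etrans (christoffel_lift l i j Ux) _.
rewrite [in RHS]mxE mulr_sumr; apply: eq_bigr => d _.
by rewrite mul_trmx_row rowK -{2}gsym [in RHS]mxE mulrA mulrC; congr (_ * _).
Qed.

Lemma christoffel_horiz (w : 'rV[R]_N) i j x : U x ->
  \sum_l christoffel g l i j x * dot (horiz l x) w =
  dot (lift_hess i j x *m (c *: ((frame x)^T *m invmx (g x) *m frame x))) w.
Proof.
move=> Ux; rewrite -(christoffel_frame i j Ux) dot_suml.
by apply: eq_bigr => l _; rewrite dotZl.
Qed.

(** The hypothesis on e covers both situations: e = 1 for a complex structure, and vanishing [vert]
    for J = 0. *)
Lemma frame_gram x : U x -> (forall i j, e * (vert i x * vert j x) = vert i x * vert j x) ->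
  frame x *m (frame x)^T = c^-1 *: g x.
Proof.
move=> Ux ev; apply/matrixP => i j; rewrite -dot_row !rowK [RHS]mxE (gE i j Ux) mulKf//.
have E l : dot (D l x) (psi x *m J) = vert l x by [].
rewrite (horizE i) (horizE j) !(dotBl, dotBr, dotZl, dotZr) dotJJ psi1// (dotC (psi x *m J)) !E.
have := ev i j; move: (vert i x) (vert j x) (dot _ _) => a b d h.
by transitivity (d - a * b + (e * (a * b) - a * b)); [ring|rewrite h; ring].
Qed.

Lemma dot_horiz_lift i x : U x -> dot (horiz i x) (psi x) = 0.
Proof.
move=> Ux; by rewrite horizE dotBl dotZl dot_lift_partial// (dotC (psi x *m J)) dotJ_self mulr0 subr0.
Qed.

Lemma dot_horiz_liftJ i x : U x -> e * vert i x = vert i x -> dot (horiz i x) (psi x *m J) = 0.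
Proof.
move=> Ux ev; by rewrite horizE dotBl dotZl dotJJ psi1// mulr1 -vertE (mulrC (vert i x)) ev subrr.
Qed.

(** By dimension count, psi alone completes the horizontal vectors to a basis when J = 0. In the
    complex case that follows, psi and psi J are both needed, which is why there N = n + 2. *)
Lemma frame_complete_totally_real x : U x -> J = 0 -> (n + 1 = N)%N -> frame_complete x.
Proof.
move=> Ux J0 nN; have v0 i : vert i x = 0.
  by rewrite vertE J0 mulmx0 dot0r.
have V1 : psi x *m (psi x)^T = 1%:M by rewrite mul_trmx psi1.
have A0 : frame x *m (psi x)^T = 0.
  by apply/matrixP => i j; rewrite mulmx_trmx_row rowK dot_horiz_lift// mxE.
have := row_complement c0 (ug Ux) (frame_gram Ux _) A0 V1 nN; rewrite /frame_complete => ->.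
  by rewrite J0 !mulmx0 subr0.
by move=> i j; rewrite v0 mul0r mulr0.
Qed.

Lemma frame_complete_complex x : U x -> e = 1 -> (n + 2 = N)%N -> frame_complete x.
Proof.
move=> Ux e1 nN; pose V := col_mx (psi x) (psi x *m J).
have V1 : V *m V^T = 1%:M.
  rewrite tr_col_mx mul_col_row !mul_trmx psi1// dotJJ psi1// e1 mul1r dotJ_self.
  by rewrite (dotC (psi x *m J)) dotJ_self !raddf0 scalar_mx_block.
have A0 : frame x *m V^T = 0.
  rewrite tr_col_mx mul_mx_row -[RHS]row_mx0; congr row_mx.
    by apply/matrixP => i j; rewrite mulmx_trmx_row rowK dot_horiz_lift// mxE.
  by apply/matrixP => i j; rewrite mulmx_trmx_row rowK dot_horiz_liftJ ?e1 ?mul1r// mxE.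
have := row_complement c0 (ug Ux) (frame_gram Ux _) A0 V1 nN; rewrite /frame_complete => ->.
  by rewrite /V tr_col_mx mul_row_col opprD addrA.
by move=> i j; rewrite e1 mul1r.
Qed.

Section Function.
Let oP := @open_punctured R N.
Context (F : 'rV[R]_N -> R) (sF : smooth_on (punctured N) F).
Context (F0 : forall z : 'rV[R]_N, z != 0 -> dot z (gradient F z) = 0).
Context (FJ : forall z : 'rV[R]_N, z != 0 -> dot (z *m J) (gradient F z) = 0).

Lemma lift_neq0 x : U x -> psi x != 0.
Proof. by move=> /psi1/unit_neq0. Qed.

(** Differentiate the orthogonality of z and the gradient; [mulJ_hessian] does the same along z J.
    These evaluate the Hessian in the directions that the horizontal trace leaves out. *)
Lemma mul_hessian (z : 'rV[R]_N) : z != 0 -> z *m hessian F z = - gradient F z.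
Proof.
move=> z0; apply/rowP => b; rewrite [RHS]mxE.
have := partial_dot b (@vsmooth_id R N (punctured N)) (vsmooth_gradient sF) z0.
rewrite (@partial_near _ _ _ _ (fun=> 0)); last by apply: near_punctured => // y /F0.
rewrite partial_cst vpartial_id dotC dot_delta vpartial_gradient -mul_trmx_row (hessian_sym oP sF z0).
by move: (gradient F z 0 b) (_ 0 b) => p q; lra.
Qed.

Lemma mulJ_hessian (z : 'rV[R]_N) : z != 0 -> z *m J *m hessian F z = gradient F z *m J.
Proof.
move=> z0; apply/rowP => b.
have sJ := vsmooth_mul J (@open_punctured R N) (@vsmooth_id R N (punctured N)).
have := partial_dot b sJ (vsmooth_gradient sF) z0.
rewrite (@partial_near _ _ _ _ (fun=> 0)); last by apply: near_punctured => // y /FJ.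
rewrite partial_cst (vpartial_mul b J (@vsmooth_id R N (punctured N)) z0) vpartial_id dotJ.
rewrite dotC dot_delta vpartial_gradient -mul_trmx_row (hessian_sym oP sF z0).
by move: (_ 0 b) (_ 0 b) => p q; lra.
Qed.

Lemma partial_comp_lift j x : U x ->
  partial j (F \o psi) x = dot (D j x) (gradient F (psi x)).
Proof.
move=> Ux; have dF := smooth_diff sF (lift_neq0 Ux).
apply: etrans (partial_comp j dF (fun a => smooth_diff (spsi a) Ux)) _.
by rewrite dotE mxE; apply: eq_bigr => a _; rewrite !mxE mulrC.
Qed.

Lemma partial2_comp_lift i j x : U x ->
  partial i (partial j (F \o psi)) x =
  dot (DD i j x) (gradient F (psi x)) + dot (D j x) (D i x *m hessian F (psi x)).
Proof.
move=> Ux; rewrite (@partial_near _ _ _ _ (fun y => dot (D j y) (gradient F (psi y)))); last first.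
  have nU : nbhs x U by exact: open_nbhs_nbhs.
  by apply: filterS nU => y; exact: partial_comp_lift.
have sG : vsmooth U (fun y => gradient F (psi y)).
  move=> a; exact: (smooth_comp oU (vsmooth_gradient sF a) spsi lift_neq0).
apply: etrans (partial_dot i (vsmooth_partial j spsi) sG Ux) _; congr (_ + dot _ _).
apply/rowP => a; rewrite mxE.
have dG := smooth_diff (vsmooth_gradient sF a) (lift_neq0 Ux).
apply: etrans (partial_comp i dG (fun a => smooth_diff (spsi a) Ux)) _.
rewrite mxE; apply: eq_bigr => b _; rewrite mulrC; congr (_ * _); first by rewrite mxE.
by rewrite [RHS]mxE; congr (partial b _ _); apply/funext => y; rewrite mxE.
Qed.

(** The gradient of F is orthogonal to psi and psi J, so the projection in [christoffel_frame] does
    not affect its product with [lift_hess]. The second derivatives of psi cancel, the vertical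
    terms cancel by [mulJ_hessian], and the flat Hessian on horizontal vectors is left. *)
Lemma comp_lift_hess i j x : U x -> frame_complete x ->
  partial i (partial j (F \o psi)) x - \sum_l christoffel g l i j x * partial l (F \o psi) x =
  dot (horiz i x *m hessian F (psi x)) (horiz j x).
Proof.
move=> Ux fc; have z0 := lift_neq0 Ux.
have G0 := F0 z0; have GJ := FJ z0; have mH := mul_hessian z0; have mJH := mulJ_hessian z0.
have Hs := hessian_sym oP sF z0.
rewrite partial2_comp_lift//.
have DE := horizK; have e0 a : dot (D a x *m J) (gradient F (psi x)) = dot (horiz a x *m J) (gradient F (psi x)).
  rewrite DE mulmxDl dotDl -scalemxAl dotZl -mulmxA JJ mulmxN mul_mx_scalar dotNl dotZl G0.
  by rewrite mulr0 oppr0 mulr0 addr0.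
have uE l : partial l (F \o psi) x = dot (horiz l x) (gradient F (psi x)).
  by rewrite partial_comp_lift// DE dotDl dotZl GJ mulr0 addr0.
rewrite (eq_bigr (fun l => christoffel g l i j x * dot (horiz l x) (gradient F (psi x)))); last first.
  by move=> l _; rewrite uE.
rewrite (christoffel_horiz _ _ _ Ux) fc lift_hessE.
move: (e0 i) (e0 j); rewrite (DE i) (DE j).
move: (DD i j x) (horiz i x) (horiz j x) (vert i x) (vert j x) => dd h1 h2 v1 v2 {e0 uE}.
move: (psi x) (gradient F (psi x)) (hessian F (psi x)) z0 G0 GJ mH mJH Hs {DE fc} => z G H z0 G0 GJ mH mJH Hs.
move=> e1 e2; rewrite dot_mul projection_tr mul_projection (dotC G) G0 (dotC G) GJ !scale0r !subr0.
rewrite !dotBl !dotZl e1 e2 mulmxDl -scalemxAl mJH !(dotDl, dotDr, dotZl, dotZr).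
have q1 : dot h2 (G *m J) = - dot (h2 *m J) G by rewrite dotJ opprK.
have q2 : dot (z *m J) (h1 *m H) = - dot (h1 *m J) G.
  by rewrite dotC dot_mul Hs mJH dotJ opprK.
have q3 : dot (z *m J) (G *m J) = 0 by rewrite dotJJ G0 mulr0.
by rewrite q1 q2 q3 (dotC h2); ring.
Qed.

(** The horizontal trace of the Hessian is its full trace minus its values on psi and on psi J. Both
    vanish, since they reduce to the product of psi with the gradient of F. *)
Lemma laplacian_lift x : U x -> frame_complete x ->
  laplacian g (F \o psi) x = c^-1 * lap F (psi x).
Proof.
move=> Ux fc; have z0 := lift_neq0 Ux.
have su : smooth_on U (F \o psi) by exact: (smooth_comp oU sF spsi lift_neq0).
rewrite (laplacianE oU smooth_metric ug metric_sym su Ux).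
pose H := hessian F (psi x); pose A := frame x.
have rA a : row a A = horiz a x by exact: rowK.
transitivity (\tr (invmx (g x) *m (A *m H *m A^T))).
  apply: eq_bigr => i _; rewrite mxE; apply: eq_bigr => j _; congr (_ * _).
  apply: etrans (comp_lift_hess i j Ux fc) _; apply: etrans _ (dot_row (A *m H) A j i).
  rewrite (row_mul j A H) (rA i) (rA j) /H; clear rA.
  move: (horiz i x) (horiz j x) => h1 h2.
  by rewrite (dotC (h2 *m _)) (dot_mul h1) (hessian_sym oP sF z0).
have AE : A^T *m invmx (g x) *m A = c^-1 *: (1%:M - (psi x)^T *m psi x - (psi x *m J)^T *m (psi x *m J)).
  by rewrite -fc scalerA mulVf// scale1r.
have -> : \tr (invmx (g x) *m (A *m H *m A^T)) = \tr (A^T *m invmx (g x) *m A *m H).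
  by rewrite mulmxA mxtrace_mulC !mulmxA.
rewrite AE -scalemxAl mxtraceZ; congr (_ * _).
rewrite !mulmxBl mul1mx !linearB/= tr_hessian -!mulmxA.
rewrite [\tr ((psi x)^T *m _)]mxtrace_mulC [\tr ((psi x *m J)^T *m _)]mxtrace_mulC mulmxA mulJ_hessian// mul_hessian//.
rewrite !mul_trmx !mxtrace_scalar mulr1n dotNl (dotC (gradient _ _)) F0// oppr0 subr0.
by rewrite dotJJ dotC F0// mulr0 subr0.
Qed.

End Function.

End Lift.

Opaque partial dot vpartial vert horiz lift_hess.

(** * Normalization to the unit sphere, and derivatives of compositions *)

Section Normalize.
Context {R : realType}.
Implicit Types (k N n : nat).

(** The sign s is meant to be 1 or -1: a real line has two unit vectors, and lifts of real
    submanifolds may need either. *)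
Definition normalize N (s : R) (z : 'rV[R]_N) : 'rV[R]_N := (s * rpow (-1) z) *: z.

Lemma dot_normalize_sign N (s : R) (z : 'rV[R]_N) : s * s = 1 -> z != 0 ->
  dot (normalize s z) (normalize s z) = 1.
Proof.
move=> s1 z0; rewrite /normalize -scalerA dotZl dotZr mulrA s1 mul1r; exact: dot_normalize.
Qed.

Section Map.
Context k N (U : set 'rV[R]_k) (oU : open U) (f : 'rV[R]_k -> 'rV[R]_N) (s : R).
Context (sf : vsmooth U f) (f0 : forall x, U x -> f x != 0).

Lemma smooth_rpow_comp p : smooth_on U (fun x => rpow p (f x)).
Proof. exact: (smooth_comp oU (@smooth_rpow R N p) sf f0). Qed.

Lemma vsmooth_normalize : vsmooth U (fun x => normalize s (f x)).
Proof.
move=> a; rewrite (_ : (fun x => _) = fun x => s * rpow (-1) (f x) * f x 0 a); last first.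
  by apply/funext => x; rewrite mxE.
by apply: smooth_M => //; apply: smooth_Z => //; exact: smooth_rpow_comp.
Qed.

Lemma vpartial_normalize i x : U x ->
  vpartial i (fun y => normalize s (f y)) x =
  (s * rpow (-1) (f x)) *:
    (vpartial i f x - (dot (vpartial i f x) (f x) / dot (f x) (f x)) *: f x).
Proof.
move=> Ux; apply/rowP => a; rewrite mxE !(mxE, mxE).
rewrite (_ : (fun y => normalize s (f y) 0 a) = fun x => s * rpow (-1) (f x) * f x 0 a); last first.
  by apply/funext => y; rewrite mxE.
have z0 := f0 Ux.
have df b : differentiable (fun y => f y 0 b) x by exact: (smooth_diff (sf b) Ux).
have dr := smooth_diff (smooth_rpow_comp (-1)) Ux.
have dsr := smooth_diff (smooth_Z oU s (smooth_rpow_comp (-1))) Ux.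
rewrite (partialM i dsr (df a)) (partialZ i s dr).
have -> : partial i (fun y => rpow (-1) (f y)) x =
    - (rpow (-1) (f x) * (dot (vpartial i f x) (f x) / dot (f x) (f x))).
  apply: etrans (partial_comp i (smooth_diff (@smooth_rpow R N (-1)) z0) df) _.
  rewrite mulrCA -rpow_sqr// dotE mxE mulr_suml -sumrN; apply: eq_bigr => b _.
  rewrite partial_rpow// (_ : -1 - 2 = -1 + (-1 + -1)); last by ring.
  rewrite !rpowD// [X in _ = - (X * _)]mulrC !mxE.
  by move: (f x 0 b) (partial _ _ _) (rpow _ _) => p q r; ring.
by rewrite /=; move: (f x 0 a) (partial _ _ _) (rpow _ _) (dot _ _ / _) => p q r t; ring.
Qed.

(** The right side is the Fubini-Study formula in homogeneous coordinates, removing the components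
    along f and f J and dividing by |f|^2. The sign s occurs only squared. *)
Lemma metric_normalize (J : 'M[R]_N) i j x : s * s = 1 -> J^T = - J -> U x ->
  dot (vpartial i (fun y => normalize s (f y)) x) (vpartial j (fun y => normalize s (f y)) x)
  - vert (fun y => normalize s (f y)) J i x * vert (fun y => normalize s (f y)) J j x =
  (dot (vpartial i f x) (vpartial j f x)
   - dot (vpartial i f x) (f x) * dot (vpartial j f x) (f x) / dot (f x) (f x)
   - dot (vpartial i f x) (f x *m J) * dot (vpartial j f x) (f x *m J) / dot (f x) (f x))
  / dot (f x) (f x).
Proof.
move=> s1 JT Ux; rewrite !vertE !vpartial_normalize//; have z0 := f0 Ux.
have zJ : dot (f x) (f x *m J) = 0 := dotJ_self JT _.
have r2 := rpow_sqr z0; have d0 : dot (f x) (f x) != 0 by rewrite gt_eqF// dot_gt0.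
rewrite -scalemxAl; move: (vpartial i f x) (vpartial j f x) (rpow (-1) (f x)) r2 d0 zJ.
move: (f x *m J) (f x) => w z u v r r2 d0 zw.
rewrite !(dotZl, dotZr, dotBl, dotBr) (dotC z v) zw !mulr0 ?subr0.
have r2' : s * r * (s * r) = (dot z z)^-1 by rewrite mulrACA s1 mul1r.
have T p : s * r * (s * r * p) = p / dot z z by rewrite mulrA r2' mulrC.
rewrite !T; move: (dot u v) (dot u z) (dot v z) (dot u _) (dot v _) => a b d e h.
by move: d0 {r2 r2' zw T}; move: (dot z z) => q q0; field; exact: q0.
Qed.

End Map.

Section Comp.
Context k n N (U : set 'rV[R]_k) (oU : open U) (W : 'rV[R]_k -> 'rV[R]_n) (sW : vsmooth U W).
Context (V : set 'rV[R]_n) (oV : open V) (psi : 'rV[R]_n -> 'rV[R]_N) (sp : vsmooth V psi).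
Context (UV : forall x, U x -> V (W x)).

Lemma vsmooth_comp : vsmooth U (psi \o W).
Proof. by move=> a; exact: (smooth_comp oU (sp a) sW UV). Qed.

Lemma vpartial_comp j x : U x ->
  vpartial j (psi \o W) x = \sum_b vpartial j W x 0 b *: vpartial b psi (W x).
Proof.
move=> Ux; apply/rowP => a; rewrite mxE summxE.
have dW b : differentiable (fun y => W y 0 b) x := smooth_diff (sW b) Ux.
apply: etrans (partial_comp j (smooth_diff (sp a) (UV Ux)) dW) _.
by apply: eq_bigr => b _; rewrite mxE mulrC !(mxE, mxE).
Qed.

Lemma vpartial2_comp i j x : U x ->
  vpartial i (vpartial j (psi \o W)) x =
  \sum_b vpartial i (vpartial j W) x 0 b *: vpartial b psi (W x)
  + \sum_b \sum_d (vpartial i W x 0 b * vpartial j W x 0 d) *: vpartial b (vpartial d psi) (W x).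
Proof.
move=> Ux.
rewrite (vpartial_near i oU Ux (g := fun y => \sum_b vpartial j W y 0 b *: vpartial b psi (W y))); last first.
  by move=> y Uy; exact: vpartial_comp.
apply/rowP => a; rewrite mxE.
rewrite (_ : (fun y => _) = fun y => \sum_d vpartial j W y 0 d * vpartial d psi (W y) 0 a); last first.
  by apply/funext => y; rewrite summxE; apply: eq_bigr => b _; rewrite mxE.
have dW b : differentiable (fun y => W y 0 b) x := smooth_diff (sW b) Ux.
have dWj b : differentiable (fun y => vpartial j W y 0 b) x := smooth_diff (vsmooth_partial j sW b) Ux.
have dp d : differentiable (fun y => vpartial d psi (W y) 0 a) x.
  exact: (smooth_diff (smooth_comp oU (vsmooth_partial d sp a) sW UV) Ux).
rewrite partial_sum; last by move=> d; exact: differentiableM.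
have E d : partial i (fun y => vpartial j W y 0 d * vpartial d psi (W y) 0 a) x =
   vpartial i (vpartial j W) x 0 d * vpartial d psi (W x) 0 a
   + \sum_b vpartial i W x 0 b * vpartial j W x 0 d * vpartial b (vpartial d psi) (W x) 0 a.
  apply: etrans (partialM i (dWj d) (dp d)) _; rewrite addrC; congr (_ + _).
    by rewrite mulrC; congr (_ * _); rewrite [RHS]mxE.
  have dd := smooth_diff (vsmooth_partial d sp a) (UV Ux).
  rewrite (partial_comp i dd dW) mulr_sumr; apply: eq_bigr => b _.
  rewrite [vpartial i W x 0 b]mxE [in RHS]mulrAC mulrC; congr (_ * _).
  by rewrite mulrC; congr (_ * _); rewrite [RHS]mxE.
rewrite (eq_bigr _ (fun d _ => E d)) big_split /= [RHS]mxE !summxE; congr (_ + _).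
  by apply: eq_bigr => b _; rewrite [RHS]mxE.
rewrite exchange_big; apply: eq_bigr => b _; rewrite summxE; apply: eq_bigr => d _.
by rewrite [RHS]mxE.
Qed.

End Comp.
End Normalize.

(** * The Fubini-Study metric through unit lifts *)

Section Realify.
Context {R : realType} {m : nat}.
Implicit Types (z v w : 'rV[R[i]]_m.+1).

Definition realify z : 'rV[R]_(m.+1 + m.+1) :=
  row_mx (\row_i complex.Re (z 0 i)) (\row_i complex.Im (z 0 i)).

Definition cplx (x : 'rV[R]_(m.+1 + m.+1)) : 'rV[R[i]]_m.+1 :=
  \row_i Complex (x 0 (lshift m.+1 i)) (x 0 (rshift m.+1 i)).

(** Multiplication by i in real coordinates, acting on rows from the right: (x, y) goes to (-y,
    x). *)
Definition Jmx : 'M[R]_(m.+1 + m.+1) := block_mx 0 1%:M (- 1%:M) 0.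

Lemma realifyl z i : realify z 0 (lshift m.+1 i) = complex.Re (z 0 i).
Proof. by rewrite row_mxEl mxE. Qed.

Lemma realifyr z i : realify z 0 (rshift m.+1 i) = complex.Im (z 0 i).
Proof. by rewrite row_mxEr mxE. Qed.

Lemma realifyK : cancel realify cplx.
Proof. by move=> z; apply/rowP => i; rewrite mxE realifyl realifyr; case: (z 0 i). Qed.

Lemma eq_real (x y : 'rV[R]_(m.+1 + m.+1)) : (forall i, x 0 (lshift m.+1 i) = y 0 (lshift m.+1 i)) ->
  (forall i, x 0 (rshift m.+1 i) = y 0 (rshift m.+1 i)) -> x = y.
Proof. by move=> hl hr; apply/rowP => a; case: (split_ordP a) => i ->. Qed.

Lemma cplxK : cancel cplx realify.
Proof. by move=> x; apply: eq_real => i; rewrite ?realifyl ?realifyr mxE. Qed.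

Lemma mulJl (x : 'rV[R]_(m.+1 + m.+1)) i : (x *m Jmx) 0 (lshift m.+1 i) = - x 0 (rshift m.+1 i).
Proof.
rewrite -{1}(hsubmxK x) mul_row_block !mulmx0 add0r addr0 mulmxN !mulmx1 row_mxEl.
by rewrite !mxE.
Qed.

Lemma mulJr (x : 'rV[R]_(m.+1 + m.+1)) i : (x *m Jmx) 0 (rshift m.+1 i) = x 0 (lshift m.+1 i).
Proof.
rewrite -{1}(hsubmxK x) mul_row_block !mulmx0 add0r addr0 !mulmx1 row_mxEr.
by rewrite !mxE.
Qed.

Lemma JmxT : Jmx^T = - Jmx.
Proof. by rewrite /Jmx tr_block_mx !trmx0 trmx1 linearN/= trmx1 opp_block_mx !oppr0 opprK. Qed.

Lemma JmxJ : Jmx *m Jmx = - (1 : R)%:M.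
Proof.
rewrite /Jmx mulmx_block !mulmx0 !mul0mx !mul1mx mulNmx mulmx1 !addr0 !add0r.
by rewrite scalar_mx_block opp_block_mx !oppr0.
Qed.

Lemma realifyD z w : realify (z + w) = realify z + realify w.
Proof.
apply: eq_real => i; rewrite [RHS]mxE ?realifyl ?realifyr mxE.
  by case: (z 0 i) => a b; case: (w 0 i).
by case: (z 0 i) => a b; case: (w 0 i).
Qed.

Lemma realifyZ (c : R[i]) z :
  realify (c *: z) = complex.Re c *: realify z + complex.Im c *: (realify z *m Jmx).
Proof.
apply: eq_real => i.
  rewrite [RHS]mxE [X in _ = X + _]mxE [X in _ = _ + X]mxE mulJl !realifyl realifyr mxE.
  by case: c => a b; case: (z 0 i) => p q; rewrite /=; ring.
rewrite [RHS]mxE [X in _ = X + _]mxE [X in _ = _ + X]mxE mulJr !realifyr realifyl mxE.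
by case: c => a b; case: (z 0 i) => p q; rewrite /=; ring.
Qed.

Lemma realify0 : realify 0 = 0.
Proof. by apply: eq_real => i; rewrite [RHS]mxE ?realifyl ?realifyr mxE. Qed.

Lemma realify_eq0 z : (realify z == 0) = (z == 0).
Proof. by rewrite -realify0 (inj_eq (can_inj realifyK)). Qed.

Lemma hermE z w :
  herm z w = Complex (dot (realify z) (realify w)) (dot (realify z) (realify w *m Jmx)).
Proof.
have E (x y : 'rV[R]_(m.+1 + m.+1)) : dot x y = \sum_i (x 0 (lshift m.+1 i) * y 0 (lshift m.+1 i)
                              + x 0 (rshift m.+1 i) * y 0 (rshift m.+1 i)).
  rewrite dotE mxE big_split_ord big_split /=; congr (_ + _);
  by apply: eq_bigr => i _; rewrite mxE.
rewrite !E /herm; apply/eqP; rewrite eq_complex; apply/andP; split; apply/eqP.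
  rewrite raddf_sum /=; apply: eq_bigr => i _; rewrite !realifyl !realifyr.
  by case: (z 0 i) => a b; case: (w 0 i) => p q /=; ring.
rewrite raddf_sum /=; apply: eq_bigr => i _; rewrite mulJl mulJr !realifyl !realifyr.
by case: (z 0 i) => a b; case: (w 0 i) => p q /=; ring.
Qed.

Lemma fubini_studyE z v w : z != 0 ->
  let Z := realify z in let V := realify v in let W := realify w in
  fubini_study z v w =
  (dot V W - dot V Z * dot W Z / dot Z Z - dot V (Z *m Jmx) * dot W (Z *m Jmx) / dot Z Z) / dot Z Z.
Proof.
move=> z0 Z V W; have Z0 : Z != 0 by rewrite realify_eq0.
have d0 : dot Z Z != 0 by rewrite gt_eqF// dot_gt0.
have hzz : herm z z = Complex (dot Z Z) 0 by rewrite hermE (dotJ_self JmxT).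
have hor u : realify (horizontal z u) = realify u - (dot (realify u) Z / dot Z Z) *: Z
   - (dot (realify u) (Z *m Jmx) / dot Z Z) *: (Z *m Jmx).
  rewrite /horizontal -scaleN1r realifyD realifyZ /= oppr0 scale0r addr0 scaleN1r -addrA -opprD.
  congr (_ - _); rewrite realifyZ hzz hermE -/Z.
  have -> : Complex (dot (realify u) Z) (dot (realify u) (Z *m Jmx)) / Complex (dot Z Z) 0
     = Complex (dot (realify u) Z / dot Z Z) (dot (realify u) (Z *m Jmx) / dot Z Z).
    apply: (mulIf (_ : Complex (dot Z Z) 0 != 0)); first by rewrite eq_complex /= negb_and d0.
    rewrite divfK ?eq_complex /= ?negb_and ?d0//.
    by apply/eqP; rewrite eq_complex /= !mulr0 subr0 add0r !divfK// !eqxx.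
  by [].
rewrite /fubini_study hzz hermE !hor /=; congr (_ / _).
have q1 : dot Z (Z *m Jmx) = 0 by rewrite (dotJ_self JmxT).
have q2 : dot (Z *m Jmx) (Z *m Jmx) = dot Z Z by rewrite (dotJJ JmxT JmxJ) mul1r.
rewrite -/V -/W; move: d0 q1 q2; move: (Z *m Jmx) => t d0 q1 q2.
rewrite !(dotBl, dotBr, dotZl, dotZr) (dotC t Z) q1 q2 (dotC Z W) (dotC t W).
move: (dot V W) (dot V Z) (dot W Z) (dot V t) (dot W t) => a b d e h.
by move: d0 {q1 q2}; move: (dot Z Z) => q q0; field; exact: q0.
Qed.

Definition zlift (j : 'I_m.+1) (w : 'rV[R]_(m + m)) : 'rV[R]_(m.+1 + m.+1) :=
  realify (insert_at j 1 w).

Definition zdir (j : 'I_m.+1) (w : 'rV[R]_(m + m)) : 'rV[R]_(m.+1 + m.+1) :=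
  realify (insert_at j 0 w).

Lemma zlift_neq0 j (w : 'rV[R]_(m + m)) : zlift j w != 0.
Proof.
rewrite realify_eq0; apply/eqP => /rowP/(_ j); rewrite !mxE unlift_none => /eqP.
by rewrite oner_eq0.
Qed.

Lemma zliftE j (w : 'rV[R]_(m + m)) : zlift j w = zlift j 0 + zdir j w.
Proof.
rewrite /zlift /zdir -realifyD; congr realify; apply/rowP => i; rewrite !mxE.
by case: unliftP => [i' _|_]; rewrite ?addr0// !mxE; apply/eqP; rewrite eq_complex /= !add0r !eqxx.
Qed.

Lemma zdirE j (w : 'rV[R]_(m + m)) : zdir j w = \sum_a w 0 a *: zdir j (delta_mx 0 a).
Proof.
apply: eq_real => i; rewrite summxE.
  transitivity (\sum_a w 0 a * complex.Re (insert_at j 0 (delta_mx 0 a) 0 i)); last first.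
    by apply: eq_bigr => a _; rewrite [RHS]mxE /zdir realifyl.
  rewrite realifyl mxE; case E : (unlift j i) => [i'|] /=; last first.
    by rewrite big1// => a _; rewrite mxE E mulr0.
  rewrite (bigD1 (lshift m i'))//= mxE E /= mxE !eqxx mulr1 big1 ?addr0// => a ai.
  by rewrite mxE E /= mxE eq_sym (negbTE ai) andbF mulr0.
transitivity (\sum_a w 0 a * complex.Im (insert_at j 0 (delta_mx 0 a) 0 i)); last first.
  by apply: eq_bigr => a _; rewrite [RHS]mxE /zdir realifyr.
rewrite realifyr mxE; case E : (unlift j i) => [i'|] /=; last first.
  by rewrite big1// => a _; rewrite mxE E mulr0.
rewrite (bigD1 (rshift m i'))//= mxE E /= mxE !eqxx mulr1 big1 ?addr0// => a ai.
by rewrite mxE E /= mxE eq_sym (negbTE ai) andbF mulr0.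
Qed.

Lemma vsmooth_zlift j U : open U -> vsmooth U (zlift j).
Proof.
move=> oU a; have -> : (fun u => zlift j u 0 a) = fun x : 'rV[R]_(m + m) => zlift j 0 0 a +
    \sum_(b < m + m) x 0 b * zdir j (delta_mx 0 b) 0 a.
  apply/funext => x; rewrite zliftE mxE zdirE summxE; congr (_ + _); apply: eq_bigr => b _.
  by rewrite [LHS]mxE.
apply: smooth_D => //; first exact: smooth_cst.
apply: smooth_sum => // b _; apply: smooth_M => //; last exact: smooth_cst.
exact: smooth_entry.
Qed.

Lemma vpartial_zlift j b (w : 'rV[R]_(m + m)) : vpartial b (zlift j) w = zdir j (delta_mx 0 b).
Proof.
apply/rowP => a; rewrite [LHS]mxE.
have -> : (fun u => zlift j u 0 a) = fun x : 'rV[R]_(m + m) => zlift j 0 0 a +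
    \sum_(b < m + m) zdir j (delta_mx 0 b) 0 a * x 0 b.
  apply/funext => x; rewrite zliftE mxE zdirE summxE; congr (_ + _); apply: eq_bigr => d _.
  by rewrite [LHS]mxE mulrC.
have dc (t : R) : differentiable (fun=> t) w by exact: (@differentiable_cst _ _ _ (t : R^o)).
have de d : differentiable (fun x : 'rV[R]_(m + m) => x 0 d) w by exact: differentiable_entry.
have dm d : differentiable (fun x : 'rV[R]_(m + m) => zdir j (delta_mx 0 d) 0 a * x 0 d) w.
  exact: differentiableM.
rewrite partialD//; last exact: differentiable_bigsum.
rewrite partial_cst add0r partial_sum// (bigD1 b)//= big1 ?addr0; last first.
  by move=> d db; rewrite partialZ// partial_entry eq_sym (negbTE db) mulr0.
by rewrite partialZ// partial_entry eqxx mulr1.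
Qed.

Definition fs_lift (j : 'I_m.+1) (s : R) (w : 'rV[R]_(m + m)) : 'rV[R]_(m.+1 + m.+1) :=
  normalize s (zlift j w).

Section FSLift.
Context (j : 'I_m.+1) (s : R) (s1 : s * s = 1).
Let oT := @openT 'rV[R]_(m + m).
Let sz := vsmooth_zlift j oT.
Let z0 (w : 'rV[R]_(m + m)) (_ : setT w) := zlift_neq0 j w.

Lemma vsmooth_fs_lift : vsmooth setT (fs_lift j s).
Proof. by have := @vsmooth_normalize R _ _ setT oT (zlift j) s sz z0. Qed.

Lemma dot_fs_lift (w : 'rV[R]_(m + m)) : dot (fs_lift j s w) (fs_lift j s w) = 1.
Proof. exact: (dot_normalize_sign s1 (zlift_neq0 j w)). Qed.

(** The factor 1 is the constant c of the general lifted metrics, so that the results on lifts apply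
    verbatim to CP^m itself. *)
Lemma fs_chartE (w : 'rV[R]_(m + m)) a b : fs_chart j w a b =
  1 * (dot (vpartial a (fs_lift j s) w) (vpartial b (fs_lift j s) w)
       - vert (fs_lift j s) Jmx a w * vert (fs_lift j s) Jmx b w).
Proof.
rewrite mul1r mxE; have := @metric_normalize R _ _ setT oT (zlift j) s sz z0 Jmx a b w s1 JmxT I.
move=> /esym; apply: etrans.
rewrite fubini_studyE; last by rewrite -realify_eq0 zlift_neq0.
by rewrite !vpartial_zlift.
Qed.

End FSLift.
End Realify.

(** * Second fundamental forms computed in the unit sphere *)

Section FSFrame.
Context {R : realType} {m : nat} (j0 : 'I_m.+1) (s : R) (s1 : s * s = 1).
Let oT := @openT 'rV[R]_(m + m).
Let psi := fs_lift j0 s.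
Let G := fs_chart (R := R) j0.
Let F := frame psi Jmx.
Let n10 : (1 : R) != 0 := oner_neq0 R.
Let spsi := @vsmooth_fs_lift R m j0 s.
Let psi1 (w : 'rV[R]_(m + m)) (_ : setT w) := dot_fs_lift j0 s1 w.
Let gE (w : 'rV[R]_(m + m)) a b (_ : setT w) := fs_chartE j0 s1 w a b.

Lemma fs_frame_gram w : F w *m (F w)^T = G w.
Proof.
rewrite (frame_gram n10 psi1 JmxT JmxJ gE I); first by rewrite invr1 scale1r.
by move=> i j; rewrite mul1r.
Qed.

(** If v is in the kernel of the frame, the affine direction [zdir j0 v] is a combination of z and i
    z. Its coordinate j0 is 0 while that of z is 1, so the combination is trivial and v = 0. *)
Lemma fs_chart_unit w : G w \in unitmx.
Proof.
rewrite -fs_frame_gram; apply: row_free_gram.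
rewrite -kermx_eq0; apply/eqP/row_matrixP => i; rewrite row0.
set v := row i _; have vF : v *m F w = 0 by apply/eqP; rewrite -sub_kermx row_sub.
clearbody v.
have l0 : s * rpow (-1) (zlift j0 w) != 0.
  have s0 : s != 0 by apply: contra_eq_neq s1 => ->; rewrite mul0r eq_sym oner_eq0.
  by rewrite mulf_neq0// gt_eqF// rpow_gt0// zlift_neq0.
have [al [be E]] : exists al be, (s * rpow (-1) (zlift j0 w)) *: zdir j0 v =
    al *: zlift j0 w + be *: (zlift j0 w *m Jmx).
  have sz := @vsmooth_zlift R m j0 setT oT.
  have z0 (y : 'rV[R]_(m + m)) (_ : setT y) := zlift_neq0 j0 y.
  have hE a : exists p q, horiz psi Jmx a w = (s * rpow (-1) (zlift j0 w)) *: zdir j0 (delta_mx 0 a)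
      - p *: zlift j0 w - q *: (zlift j0 w *m Jmx).
    rewrite horizE; have := @vpartial_normalize R _ _ setT oT (zlift j0) s sz z0 a w I.
    rewrite -/(fs_lift j0 s) -/psi vpartial_zlift => ->.
    have pz : psi w = (s * rpow (-1) (zlift j0 w)) *: zlift j0 w by [].
    rewrite scalerBr scalerA pz -scalemxAl scalerA.
    by eexists; eexists; reflexivity.
  have /choice[p /choice[q hpq]] := hE.
  exists (\sum_a v 0 a * p a), (\sum_a v 0 a * q a).
  have := vF; rewrite mulmx_sum_row zdirE => h; apply/eqP; rewrite -subr_eq0 opprD addrA; apply/eqP.
  rewrite -[RHS]h scaler_sumr !scaler_suml -!sumrB; apply: eq_bigr => a _.
  by rewrite rowK hpq !scalerBr !scalerA; congr (_ *: _ - _ - _); rewrite mulrC.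
have zl : zlift j0 w 0 (lshift m.+1 j0) = 1 by rewrite realifyl mxE unlift_none.
have zr : zlift j0 w 0 (rshift m.+1 j0) = 0 by rewrite realifyr mxE unlift_none.
have dl : zdir j0 v 0 (lshift m.+1 j0) = 0 by rewrite realifyl mxE unlift_none.
have dr : zdir j0 v 0 (rshift m.+1 j0) = 0 by rewrite realifyr mxE unlift_none.
have al0 : al = 0.
  have := congr1 (fun x : 'rV[R]_(m.+1 + m.+1) => x 0 (lshift m.+1 j0)) E.
  by rewrite mxE [RHS]mxE [X in _ = X + _]mxE [X in _ = _ + X]mxE mulJl zl zr dl; lra.
have be0 : be = 0.
  have := congr1 (fun x : 'rV[R]_(m.+1 + m.+1) => x 0 (rshift m.+1 j0)) E.
  by rewrite mxE [RHS]mxE [X in _ = X + _]mxE [X in _ = _ + X]mxE mulJr zl zr dr; lra.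
move: E; rewrite al0 be0 !scale0r addr0 => /eqP; rewrite scaler_eq0 (negbTE l0) /= => /eqP d0.
apply/rowP => b; rewrite [RHS]mxE; move: d0; rewrite /zdir => /(congr1 cplx).
rewrite realifyK => /rowP d0; case: (split_ordP b) => b' ->.
  by have := d0 (lift j0 b'); rewrite !mxE liftK => /eqP; rewrite eq_complex /= => /andP[/eqP].
by have := d0 (lift j0 b'); rewrite !mxE liftK => /eqP; rewrite eq_complex /= => /andP[_ /eqP].
Qed.

Lemma fs_frame_complete w : (F w)^T *m invmx (G w) *m F w =
  1%:M - (psi w)^T *m psi w - (psi w *m Jmx)^T *m (psi w *m Jmx).
Proof.
have ug (y : 'rV[R]_(m + m)) (_ : setT y) := fs_chart_unit y.
rewrite -(frame_complete_complex oT n10 spsi psi1 JmxT JmxJ gE ug I erefl) ?scale1r//.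
by rewrite addn2 addSn addnS.
Qed.

Section Immersion.
Context (k : nat) (U : set 'rV[R]_k) (oU : open U) (W : 'rV[R]_k -> 'rV[R]_(m + m)) (sW : vsmooth U W).
Let UT x (_ : U x) : setT (W x) := I.
Let Psi := psi \o W.
Let H x := frame Psi Jmx x.

Lemma vert_comp i x : U x ->
  vert Psi Jmx i x = \sum_b vpartial i W x 0 b * vert psi Jmx b (W x).
Proof.
move=> Ux; rewrite vertE (vpartial_comp sW spsi UT i Ux) dot_suml.
by apply: eq_bigr => b _; rewrite dotZl vertE.
Qed.

Lemma frame_comp x : U x -> H x = jac W x *m F (W x).
Proof.
move=> Ux; apply/row_matrixP => i; rewrite row_mul row_jac rowK mulmx_sum_row.
rewrite horizE (vpartial_comp sW spsi UT i Ux) vert_comp// scaler_suml -sumrB; apply: eq_bigr => b _.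
by rewrite rowK [vpartial b psi _](horizK psi Jmx) scalerDr scalerA addrK.
Qed.

Lemma induced_metricE x : U x -> induced_metric G W x = H x *m (H x)^T.
Proof.
by move=> Ux; rewrite /induced_metric frame_comp// trmx_mul -fs_frame_gram !mulmxA.
Qed.

Lemma scalerB2 (V : lmodType R) (c v1 v2 : R) (x y z : V) :
  c *: (x - v1 *: y - v2 *: z) = c *: x - (c * v1) *: y - (c * v2) *: z.
Proof. by rewrite !scalerBr !scalerA. Qed.

Lemma lift_hess_comp i j x : U x -> lift_hess Psi Jmx i j x =
  \sum_b vpartial i (vpartial j W) x 0 b *: vpartial b psi (W x)
  + \sum_b \sum_d (vpartial i W x 0 b * vpartial j W x 0 d) *: lift_hess psi Jmx b d (W x).
Proof.
move=> Ux; rewrite lift_hessE (vpartial2_comp oU sW spsi UT i j Ux) !(vpartial_comp sW spsi UT _ Ux).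
rewrite !vert_comp// -!addrA; congr (_ + _).
have e1 : \sum_b \sum_d (vpartial i W x 0 b * vpartial j W x 0 d * vert psi Jmx d (W x)) *:
     (vpartial b psi (W x) *m Jmx) =
   (\sum_b vpartial j W x 0 b * vert psi Jmx b (W x)) *:
     ((\sum_b vpartial i W x 0 b *: vpartial b psi (W x)) *m Jmx).
  rewrite mulmx_suml scaler_sumr; apply: eq_bigr => b _.
  by rewrite -scalemxAl scalerA mulr_suml scaler_suml; apply: eq_bigr => d _; congr (_ *: _); ring.
have e2 : \sum_b \sum_d (vpartial i W x 0 b * vpartial j W x 0 d * vert psi Jmx b (W x)) *:
     (vpartial d psi (W x) *m Jmx) =
   (\sum_b vpartial i W x 0 b * vert psi Jmx b (W x)) *:
     ((\sum_b vpartial j W x 0 b *: vpartial b psi (W x)) *m Jmx).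
  rewrite exchange_big mulmx_suml scaler_sumr; apply: eq_bigr => b _.
  by rewrite -scalemxAl scalerA mulr_suml scaler_suml; apply: eq_bigr => d _; congr (_ *: _); ring.
rewrite -e1 -e2 addrA -!sumrB; apply: eq_bigr => b _; rewrite -!sumrB; apply: eq_bigr => d _.
rewrite lift_hessE; exact: esym (scalerB2 _ _ _ _ _ _).
Qed.

(** For a unit vector z, the projection onto the orthogonal complement of its complex line. *)
Definition hproj (z : 'rV[R]_(m.+1 + m.+1)) : 'M[R]_(m.+1 + m.+1) :=
  1%:M - z^T *m z - (z *m Jmx)^T *m (z *m Jmx).

(** Reading tangent vectors of CP^m in the horizontal frame removes the ambient Christoffel symbols:
    the covariant derivative is the corrected flat second derivative of the lifted immersion,
    projected off the fibre. *)
Lemma ambient_deriv_frame i j x : U x ->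
  ambient_deriv G W i j x *m F (W x) = lift_hess Psi Jmx i j x *m hproj (Psi x).
Proof.
move=> Ux; rewrite lift_hess_comp// mulmxDl.
have pD b : vpartial b psi (W x) *m hproj (Psi x) = horiz psi Jmx b (W x).
  rewrite mul_projection (dot_lift_partial oT spsi psi1 b I) scale0r subr0 -vertE.
  by rewrite [X in X - _](horizK psi Jmx) addrK.
have pA b d : lift_hess psi Jmx b d (W x) *m hproj (Psi x) =
    \sum_l christoffel G l b d (W x) *: horiz psi Jmx l (W x).
  rewrite (christoffel_frame oT spsi psi1 JmxT JmxJ gE b d I) scale1r.
  by rewrite fs_frame_complete.
rewrite mulmx_suml.
have -> : \sum_b (vpartial i (vpartial j W) x 0 b *: vpartial b psi (W x)) *m hproj (Psi x) =
   \sum_a vpartial i (vpartial j W) x 0 a *: horiz psi Jmx a (W x).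
  by apply: eq_bigr => b _; rewrite -scalemxAl pD.
have -> : (\sum_b \sum_d (vpartial i W x 0 b * vpartial j W x 0 d) *: lift_hess psi Jmx b d (W x))
     *m hproj (Psi x) =
   \sum_a (\sum_b \sum_d christoffel G a b d (W x) * jac W x i b * jac W x j d) *: horiz psi Jmx a (W x).
  rewrite mulmx_suml; transitivity (\sum_b \sum_d \sum_a
     (christoffel G a b d (W x) * jac W x i b * jac W x j d) *: horiz psi Jmx a (W x)).
    apply: eq_bigr => b _; rewrite mulmx_suml; apply: eq_bigr => d _.
    rewrite -scalemxAl pA scaler_sumr; apply: eq_bigr => a _; rewrite scalerA; congr (_ *: _).
    have J1 l c : jac W x l c = vpartial l W x 0 c by rewrite -row_jac [RHS]mxE.
    by rewrite !J1; ring.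
  apply: etrans (eq_bigr _ (fun b _ => exchange_big _ _ _ _ _ _)) _.
  rewrite exchange_big; apply: eq_bigr => a _; rewrite scaler_suml; apply: eq_bigr => b _.
  by rewrite scaler_suml.
rewrite mulmx_sum_row -big_split; apply: eq_bigr => a _; rewrite /= rowK -scalerDl; congr (_ *: _).
Transparent vpartial.
rewrite [LHS]mxE; congr (_ + _); rewrite [RHS]mxE; congr (partial i _ x).
by apply/funext => y; rewrite mxE.
Qed.
Opaque vpartial.

Lemma second_ff_frame i j x : U x ->
  second_ff G W x i j *m F (W x) =
  lift_hess Psi Jmx i j x *m hproj (Psi x) - lift_hess Psi Jmx i j x *m hproj (Psi x)
    *m ((H x)^T *m invmx (induced_metric G W x) *m H x).
Proof.
move=> Ux; rewrite -ambient_deriv_frame// /second_ff /normal_part mulmxBl; congr (_ - _).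
rewrite -{1}fs_frame_gram frame_comp// trmx_mul !mulmxA; congr (_ *m _ *m _ *m _ *m _).
Qed.

(** In the frame G becomes the flat product, and the contraction of g_ij nu is tr (g^-1 g)
    |nu|^2. *)
Lemma second_ff_sqnormE x (nu : 'rV[R]_(m.+1 + m.+1)) : U x ->
  induced_metric G W x \in unitmx ->
  (forall i j, second_ff G W x i j *m F (W x) = induced_metric G W x i j *: nu) ->
  second_ff_sqnorm G W x = k%:R * dot nu nu.
Proof.
move=> Ux ug hs; rewrite /second_ff_sqnorm.
have symg i j : induced_metric G W x i j = induced_metric G W x j i.
  by rewrite induced_metricE// -!dot_row dotC.
have hn i j i' j' : (second_ff G W x i j *m G (W x) *m (second_ff G W x i' j')^T) 0 0 =
    induced_metric G W x i j * induced_metric G W x i' j' * dot nu nu.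
  rewrite -fs_frame_gram mulmxA -mulmxA -trmx_mul -dotE !hs dotZl dotZr; exact: mulrA.
move: hn symg ug; move: (induced_metric G W x) => g hn symg ug.
transitivity (\sum_i \sum_j invmx g i j * g i j * dot nu nu).
  apply: eq_bigr => i _; rewrite exchange_big; apply: eq_bigr => i' _ /=.
  transitivity (\sum_j (j == i')%:R * (invmx g i i' * g i j * dot nu nu)).
    apply: eq_bigr => j _.
    have <- : (invmx g *m g) j i' = (j == i')%:R by rewrite mulVmx// mxE.
    rewrite mxE mulr_suml; apply: eq_bigr => j' _.
    by rewrite hn (symg i' j'); ring.
  by rewrite (bigD1 i')//= eqxx mul1r big1 ?addr0// => j /negbTE ->; rewrite mul0r.
under eq_bigr do rewrite -mulr_suml.
rewrite -mulr_suml; congr (_ * _).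
transitivity (\tr (invmx g *m g)); last by rewrite mulVmx// mxtrace1.
by apply: eq_bigr => i _; rewrite mxE; apply: eq_bigr => j _; rewrite (symg j i).
Qed.

End Immersion.
End FSFrame.

(** * Metric, Laplacian and second fundamental form of the model submanifolds *)

Section Model.
Context {R : realType} {m : nat}.

(* The lifts al a + be (eta B) of a k-dimensional submanifold of CP^m, where eta
   is a unit vector of R^N: either the submanifold is totally real, N = k + 1,
   and J = 0; or it is complex, the coefficient of a is zero and J is the complex
   structure of R^N = C^(N/2).  The vector a below stands for
   al a. *)
Definition lift_model (k N : nat) (B : 'M[R]_(N, m.+1 + m.+1)) (J : 'M[R]_N) (e be : R)
    (a : 'rV[R]_(m.+1 + m.+1)) : Prop :=
  [/\ B *m B^T = 1%:M, a *m B^T = 0, J^T = - J, J *m J = - e%:M & be != 0] /\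
  ([/\ J = 0, (k + 1 = N)%N, B *m Jmx *m B^T = 0 & a *m Jmx *m B^T = 0] \/
   [/\ e = 1, (k + 2 = N)%N, B *m Jmx = J *m B, a = 0 & be = 1]).

Context (j0 : 'I_m.+1) (s : R) (s1 : s * s = 1).
Context (k N : nat) (B : 'M[R]_(N, m.+1 + m.+1)) (J : 'M[R]_N) (e be : R).
Context (a : 'rV[R]_(m.+1 + m.+1)) (mod : lift_model k B J e be a).
Context (U : set 'rV[R]_k) (oU : open U) (W : 'rV[R]_k -> 'rV[R]_(m + m)) (sW : vsmooth U W).
Context (eta : 'rV[R]_k -> 'rV[R]_N) (seta : vsmooth U eta).
Context (eta1 : forall x, U x -> dot (eta x) (eta x) = 1).
Context (lift : forall x, U x -> fs_lift j0 s (W x) = a + be *: (eta x *m B)).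

Let G := fs_chart (R := R) j0.
Let Psi := fs_lift j0 s \o W.
Let BB : B *m B^T = 1%:M. Proof. by case: mod => -[]. Qed.
Let aB : a *m B^T = 0. Proof. by case: mod => -[]. Qed.
Let JT : J^T = - J. Proof. by case: mod => -[]. Qed.
Let JJ : J *m J = - e%:M. Proof. by case: mod => -[]. Qed.
Let be0 : be != 0. Proof. by case: mod => -[]. Qed.

Let dotB (u v : 'rV[R]_N) : dot (u *m B) (v *m B) = dot u v.
Proof. by rewrite dot_mul -mulmxA BB mulmx1. Qed.

Let dotaB (u : 'rV[R]_N) : dot (u *m B) a = 0.
Proof. by rewrite dot_mul aB dot0r. Qed.

Lemma subr_scale0 (V : lmodType R) (v1 v2 : R) (x y z : V) :
  v1 = 0 -> v2 = 0 -> x - v1 *: y - v2 *: z = x.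
Proof. by move=> -> ->; rewrite !scale0r !subr0. Qed.

Lemma second_ff_algebra (V : lmodType R) (y p z : V) (b c d : R) : b * d = - (c * b^-1) ->
  b *: y + c *: p - b *: (y - d *: z) = c *: (p - b^-1 *: z).
Proof.
move=> hd; rewrite !scalerBr !scalerA hd scaleNr opprK opprD addrA.
by rewrite [b *: y + _]addrC addrK.
Qed.

Lemma mulmxB2 (n p q : nat) (b c : R) (x y z : 'M[R]_(n, p)) (A : 'M[R]_(p, q)) :
  (x - b *: y - c *: z) *m A = x *m A - b *: (y *m A) - c *: (z *m A).
Proof. by rewrite !mulmxBl -!scalemxAl. Qed.

Lemma projection_idem (n : nat) (z t : 'rV[R]_n) : dot z z = 1 -> dot t t = 1 -> dot z t = 0 ->
  let P := 1%:M - z^T *m z - t^T *m t in P *m P = P.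
Proof.
move=> zz tt zt P; apply/row_matrixP => i; rewrite row_mul rowE !mul_projection.
move: (delta_mx 0 i) => u; rewrite !(dotBl, dotZl) zz tt zt (dotC t) zt.
by rewrite !mulr0 !mulr1 !subr0 !subrr !scale0r !subr0.
Qed.

Lemma model_partial i x : U x -> vpartial i Psi x = be *: (vpartial i eta x *m B).
Proof.
move=> Ux; rewrite (vpartial_near i oU Ux (g := fun y => a + eta y *m (be *: B))); last first.
  by move=> y Uy; rewrite /Psi /= lift// -scalemxAr.
rewrite scalemxAr -(vpartial_mul i (be *: B) seta Ux); apply/rowP => b.
Transparent vpartial.
rewrite !mxE (_ : (fun y => _) = fun y => a 0 b + (eta y *m (be *: B)) 0 b); last first.
  by apply/funext => y; rewrite mxE.
have dm := smooth_diff (vsmooth_mul (be *: B) oU seta b) Ux.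
have dc : differentiable (fun=> a 0 b) x by exact: (@differentiable_cst _ _ _ (a 0 b : R^o)).
by rewrite (partialD i dc dm) partial_cst add0r.
Qed.
Opaque vpartial.

Lemma model_partial2 i j x : U x ->
  vpartial i (vpartial j Psi) x = be *: (vpartial i (vpartial j eta) x *m B).
Proof.
move=> Ux; rewrite (vpartial_near i oU Ux (g := fun y => vpartial j eta y *m (be *: B))); last first.
  by move=> y Uy; rewrite model_partial// -scalemxAr.
by rewrite (vpartial_mul i _ (vsmooth_partial j seta) Ux) -scalemxAr.
Qed.

(** In the totally real case both sides are 0, in the complex case be = 1; one formula then serves
    both. *)
Lemma model_vert i x : U x -> vert Psi Jmx i x = be ^+ 2 * vert eta J i x.
Proof.
move=> Ux; rewrite !vertE model_partial// /Psi /= lift// dotZl mulmxDl dotDr -scalemxAl dotZr.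
case: mod => _ [[J0 _ BJB aJB]|[e1 _ BJ a0 b1]].
  rewrite (dot_mul _ B) aJB dot0r dot_mul -!mulmxA (mulmxA B) BJB mulmx0 dot0r J0 mulmx0 dot0r.
  by rewrite !mulr0 addr0 mulr0.
by rewrite a0 mul0mx dot0r add0r b1 -mulmxA BJ mulmxA dotB; ring.
Qed.

Lemma model_vert_real i x : J = 0 -> vert eta J i x = 0.
Proof. by move=> J0; rewrite vertE J0 mulmx0 dot0r. Qed.

Lemma model_horiz i x : U x -> horiz Psi Jmx i x = be *: (horiz eta J i x *m B).
Proof.
move=> Ux; rewrite !horizE model_partial// model_vert//.
case: mod => _ [[J0 _ _ _]|[e1 _ BJ a0 b1]].
  by rewrite model_vert_real// mulr0 !scale0r !subr0.
rewrite /Psi /= lift// a0 add0r b1 expr1n mul1r !scale1r mulmxBl; congr (_ - _).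
by rewrite -scalemxAl -!mulmxA BJ.
Qed.

Lemma model_frame x : U x -> frame Psi Jmx x = be *: (frame eta J x *m B).
Proof.
move=> Ux; apply/row_matrixP => i.
by rewrite linearZ /= row_mul !rowK model_horiz.
Qed.

Lemma model_metric x i j : U x -> induced_metric G W x i j =
  be ^+ 2 * (dot (vpartial i eta x) (vpartial j eta x) - vert eta J i x * vert eta J j x).
Proof.
move=> Ux; rewrite (induced_metricE j0 s1 sW Ux) model_frame// linearZ /= -scalemxAl -scalemxAr scalerA.
rewrite mxE -expr2; congr (_ * _); rewrite trmx_mul mulmxA -(mulmxA _ B) BB mulmx1 -dot_row !rowK.
rewrite !horizE; have v1 l : dot (vpartial l eta x) (eta x *m J) = vert eta J l x by rewrite vertE.
rewrite !(dotBl, dotBr, dotZl, dotZr) (dotC (eta x *m J)) !v1 (dotJJ JT JJ) eta1//.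
case: mod => _ [[J0 _ _ _]|[e1 _ BJ a0 b1]].
  by rewrite !model_vert_real// !mul0r !subr0.
by rewrite e1; move: (dot _ _) (vert _ _ _ _) (vert _ _ _ _) => p q r; ring.
Qed.

Context (ug : forall x, U x -> induced_metric G W x \in unitmx).

Let b20 : be ^+ 2 != 0. Proof. by rewrite expf_neq0. Qed.

Lemma model_frame_complete x : U x -> frame_complete eta J (be ^+ 2) (induced_metric G W) x.
Proof.
move=> Ux; have gE y i j (Uy : U y) := model_metric i j Uy.
case: mod => _ [[J0 kN _ _]|[e1 kN BJ a0 b1]].
  exact: (frame_complete_totally_real oU b20 seta eta1 JT JJ gE ug Ux J0 kN).
exact: (frame_complete_complex oU b20 seta eta1 JT JJ gE ug Ux e1 kN).
Qed.

Lemma model_laplacian (F : 'rV[R]_N -> R) x : smooth_on (punctured N) F ->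
  (forall z : 'rV[R]_N, z != 0 -> dot z (gradient F z) = 0) ->
  (forall z : 'rV[R]_N, z != 0 -> dot (z *m J) (gradient F z) = 0) ->
  U x -> laplacian (induced_metric G W) (F \o eta) x = (be ^+ 2)^-1 * lap F (eta x).
Proof.
move=> sF F0 FJ Ux; have gE y i j (Uy : U y) := model_metric i j Uy.
exact: (laplacian_lift oU b20 seta eta1 JT JJ gE ug sF F0 FJ Ux (model_frame_complete Ux)).
Qed.

Lemma model_projection x : U x ->
  (frame Psi Jmx x)^T *m invmx (induced_metric G W x) *m frame Psi Jmx x =
  B^T *m (1%:M - (eta x)^T *m eta x - (eta x *m J)^T *m (eta x *m J)) *m B.
Proof.
move=> Ux; rewrite -(model_frame_complete Ux) model_frame//.
move: (frame eta J x) (invmx _) => f h.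
transitivity (be ^+ 2 *: (B^T *m f^T *m h *m f *m B)).
  by rewrite [(_ *: _)^T]linearZ /= trmx_mul -!scalemxAl -scalemxAr scalerA -expr2 !mulmxA.
by rewrite -scalemxAr -scalemxAl !mulmxA.
Qed.

(** A Euclidean sphere of radius be has second fundamental form - g eta / be, with eta carried into
    the ambient space by B. Removing the component normal to the unit sphere adds g Psi, whence the
    normal vector on the right; its squared norm is be^-2 - 1. *)
Lemma model_second_ff_real i j x : J = 0 -> B *m Jmx *m B^T = 0 -> a *m Jmx *m B^T = 0 -> U x ->
  second_ff G W x i j *m frame (fs_lift j0 s) Jmx (W x) =
  induced_metric G W x i j *: (Psi x - be^-1 *: (eta x *m B)).
Proof.
move=> J0 BJB aJB Ux; apply: etrans (second_ff_frame j0 s1 oU sW i j Ux) _.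
have v0 l : vert Psi Jmx l x = 0 by rewrite model_vert// model_vert_real// mulr0.
have -> : lift_hess Psi Jmx i j x = be *: (vpartial i (vpartial j eta) x *m B).
  exact: etrans (etrans (lift_hessE _ _ _ _ _) (subr_scale0 _ _ _ (v0 j) (v0 i))) (model_partial2 i j Ux).
rewrite (model_projection Ux) J0 mulmx0 trmx0 mul0mx subr0.
set X := vpartial i _ x.
have XP : dot (be *: (X *m B)) (Psi x) = be ^+ 2 * dot X (eta x).
  by rewrite /Psi /= lift// dotZl dotDr dotaB add0r dotZr dotB; ring.
have XJ : dot (be *: (X *m B)) (Psi x *m Jmx) = 0.
  rewrite /Psi /= lift// mulmxDl dotZl dotDr -scalemxAl dotZr.
  rewrite (dot_mul _ B) aJB dot0r (dot_mul _ B) -!mulmxA (mulmxA B) BJB mulmx0 dot0r.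
  by rewrite mulr0 addr0 mulr0.
have gX : be ^+ 2 * dot X (eta x) = - induced_metric G W x i j.
  rewrite (dot_lift_hess_lift oU seta eta1 i j Ux) (model_metric i j Ux) (model_vert_real i x J0) mul0r subr0.
  by rewrite mulrN.
rewrite mul_projection XP XJ scale0r subr0 gX scaleNr opprK.
have PB : Psi x *m B^T = be *: eta x.
  by rewrite /Psi /= lift// mulmxDl aB add0r -scalemxAl -mulmxA BB mulmx1.
have XB : (be *: (X *m B)) *m B^T = be *: X by rewrite -scalemxAl -mulmxA BB mulmx1.
have pe (u : 'rV[R]_N) : u *m (1%:M - (eta x)^T *m eta x) = u - dot u (eta x) *: eta x.
  by rewrite mulmxBr mulmx1 mulmxA mul_trmx mul_scalar_mx.
rewrite -!mulmxA !mulmxA mulmxDl XB -scalemxAl PB -(mulmxA _ _ B) mulmxDl.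
rewrite -!scalemxAl !mulmxA !pe eta1// scale1r subrr mul0mx !scaler0 addr0.
rewrite mulmxBl -scalemxAl; apply: second_ff_algebra.
by rewrite -mulNr -gX; field.
Qed.

(** [lift_hess] stays in the image of B because B is complex linear. On that image the projection
    off the fibre is already the tangential projection, so nothing normal is left. *)
Lemma model_second_ff_complex i j x : e = 1 -> B *m Jmx = J *m B -> a = 0 -> be = 1 -> U x ->
  second_ff G W x i j *m frame (fs_lift j0 s) Jmx (W x) = 0.
Proof.
move=> e1 BJ a0 b1 Ux; rewrite (second_ff_frame j0 s1 oU sW i j Ux) (model_projection Ux).
have PE : Psi x = eta x *m B by rewrite /Psi /= lift// a0 add0r b1 scale1r.
have PJ : Psi x *m Jmx = eta x *m J *m B by rewrite PE -mulmxA BJ mulmxA.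
have [X ->] : exists X : 'rV[R]_N, lift_hess Psi Jmx i j x = X *m B.
  exists (lift_hess eta J i j x).
  rewrite !lift_hessE (model_partial2 i j Ux) (model_vert i Ux) (model_vert j Ux) (model_partial i Ux) (model_partial j Ux) b1 expr1n !mul1r !scale1r.
  have e3 l : vpartial l eta x *m B *m Jmx = vpartial l eta x *m J *m B by rewrite -!mulmxA BJ.
  rewrite (e3 i) (e3 j); exact: esym (mulmxB2 _ _ _ _ _ _).
pose P := 1%:M - (eta x)^T *m eta x - (eta x *m J)^T *m (eta x *m J).
have P1 (u : 'rV[R]_N) : u *m B *m hproj (Psi x) = u *m P *m B.
  by rewrite /hproj PJ PE !mul_projection !dotB !mulmxBl -!scalemxAl.
have PP : P *m P = P.
  by apply: projection_idem; rewrite ?eta1// ?(dotJJ JT JJ) ?eta1// ?e1 ?mulr1// (dotJ_self JT).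
rewrite P1 -/P; move: P PP {P1} => P PP.
by rewrite !mulmxA -(mulmxA _ B) BB mulmx1 -(mulmxA X P P) PP subrr.
Qed.

Lemma model_sigma x : U x -> second_ff_sqnorm G W x = k%:R * (be ^- 2 - 1).
Proof.
move=> Ux; have Psi1 : dot (Psi x) (Psi x) = 1 := dot_fs_lift j0 s1 (W x).
case: mod => _ [[J0 _ BJB aJB]|[e1 _ BJ a0 b1]].
  apply: etrans (second_ff_sqnormE s1 sW Ux (ug Ux) (fun i j => model_second_ff_real i j J0 BJB aJB Ux)) _.
  have PB : dot (Psi x) (eta x *m B) = be.
    by rewrite /Psi /= lift// dotDl (dotC a) dotaB add0r dotZl dotB eta1// mulr1.
  have EB : dot (eta x *m B) (eta x *m B) = 1 by rewrite dotB eta1.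
  rewrite -/Psi; congr (_ * _); move: (Psi x) (eta x *m B) Psi1 PB EB => p q pp pq qq.
  by rewrite !(dotBl, dotBr, dotZl, dotZr) pp (dotC q) pq qq; field.
have h i j : second_ff G W x i j *m frame (fs_lift j0 s) Jmx (W x) = induced_metric G W x i j *: 0.
  by rewrite scaler0 model_second_ff_complex.
rewrite (second_ff_sqnormE s1 sW Ux (ug Ux) h) dot0l b1 expr1n invr1 subrr.
by [].
Qed.

End Model.

(** * Points of CP^m as projectors *)

Section CPBasics.
Context {R : realType} {m : nat}.
Implicit Types (p q : CP R m) (z w : 'rV[R[i]]_m.+1).
Local Notation RV := 'rV[R]_(m.+1 + m.+1).

Lemma is_class_neq0 p z : is_class p z -> z != 0.
Proof.
case: p => L /= hL; rewrite /is_class /= => E; move: hL; rewrite E dim_vline.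
by case: (z != 0).
Qed.

Lemma is_classZ p z (c : R[i]) : c != 0 -> is_class p z -> is_class p (c *: z).
Proof.
move=> c0; rewrite /is_class => ->; apply/eqP; rewrite eqEsubv; apply/andP; split.
  by apply/vlineP; exists c^-1; rewrite scalerA mulVf// scale1r.
by apply/vlineP; exists c.
Qed.

Lemma is_class_inj p q z : is_class p z -> is_class q z -> p = q.
Proof. by move=> hp hq; apply: val_inj; rewrite hp hq. Qed.

Lemma is_class_scale p z w : is_class p z -> is_class p w ->
  exists2 c : R[i], c != 0 & w = c *: z.
Proof.
move=> hp hw; have w0 := is_class_neq0 hw.
have : w \in <[z]>%VS by rewrite -hp hw memv_line.
move=> /vlineP[c wE]; exists c => //.
by apply: contraNneq w0 => c0; rewrite wE c0 scale0r.
Qed.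

Lemma is_class_pick p : is_class p (vpick (val p)).
Proof.
have v0 : vpick (val p) != 0.
  rewrite vpick0; apply/negP => /eqP h; have := valP p; by rewrite h dimv0.
rewrite /is_class; apply/eqP; rewrite eq_sym eqEdim; apply/andP; split.
  by rewrite -memvE memv_pick.
by rewrite dim_vline v0 (eqP (valP p)).
Qed.

Definition mkCP z (z0 : z != 0) : CP R m :=
  exist _ <[z]>%VS (introT eqP (etrans (dim_vline z) (congr1 nat_of_bool z0))).

Lemma mkCP_class z (z0 : z != 0) : is_class (mkCP z0) z.
Proof. by []. Qed.

Lemma in_chartE j p z : is_class p z -> in_chart j p = (z 0 j != 0).
Proof.
move=> hz; have [c c0 ->] := is_class_scale (is_class_pick p) hz.
by rewrite /in_chart mxE mulf_eq0 (negbTE c0).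
Qed.

Lemma coord_class j p z : is_class p z -> in_chart j p ->
  insert_at j 1 (Defs.coord j p) = (z 0 j)^-1 *: z.
Proof.
move=> hz hj; have [c c0 ->] := is_class_scale (is_class_pick p) hz.
apply/rowP => i; rewrite !mxE; case: unliftP => [i' ->|->].
  rewrite row_mxEl row_mxEr !mxE invfM.
  rewrite [RHS]mulrACA mulVf// mul1r mulrC; by case: (_ * _).
by rewrite mulVf// mulf_neq0.
Qed.

Lemma coord_is_class j p : in_chart j p -> is_class p (insert_at j 1 (Defs.coord j p)).
Proof.
move=> hj; rewrite (coord_class (is_class_pick p) hj); apply: is_classZ; last exact: is_class_pick.
by rewrite invr_eq0.
Qed.

(** The orthogonal projector onto the complex line of x, seen as a real plane. *)
Definition proj (x : RV) : 'M[R]_(m.+1 + m.+1) :=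
  (dot x x)^-1 *: (x^T *m x + (x *m Jmx)^T *m (x *m Jmx)).

Lemma projE (x : RV) a b :
  proj x a b = (x 0 a * x 0 b + (x *m Jmx) 0 a * (x *m Jmx) 0 b) / dot x x.
Proof.
rewrite mxE mulrC; congr (_ / _); rewrite mxE; congr (_ + _).
  by rewrite mxE big_ord1 mxE.
by rewrite mxE big_ord1 [X in X * _]mxE.
Qed.

Lemma proj_comb (x : RV) (s t : R) : s ^+ 2 + t ^+ 2 != 0 -> x != 0 ->
  proj (s *: x + t *: (x *m Jmx)) = proj x.
Proof.
move=> st x0; have d0 : dot x x != 0 by rewrite gt_eqF// dot_gt0.
have dE : dot (s *: x + t *: (x *m Jmx)) (s *: x + t *: (x *m Jmx)) = (s ^+ 2 + t ^+ 2) * dot x x.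
  rewrite !(dotDl, dotDr, dotZl, dotZr) (dotJJ JmxT JmxJ) (dotC (x *m Jmx)) (dotJ_self JmxT).
  ring.
apply/matrixP => a b; rewrite !projE dE.
have JE : (s *: x + t *: (x *m Jmx)) *m Jmx = s *: (x *m Jmx) - t *: x.
  by rewrite mulmxDl -!scalemxAl -mulmxA JmxJ mulmxN mulmx1 scalerN.
rewrite JE !mxE; move: (x 0 a) (x 0 b) ((x *m Jmx) 0 a) ((x *m Jmx) 0 b) => p q r u.
move: d0 {dE}; move: (dot x x) => d d0; field.
by rewrite d0.
Qed.

Lemma proj_realifyZ (c : R[i]) z : c != 0 -> z != 0 ->
  proj (realify (c *: z)) = proj (realify z).
Proof.
move=> c0 z0; rewrite realifyZ proj_comb ?realify_eq0//.
case: c c0 => s t; rewrite eq_complex /= negb_and => /orP st; apply/eqP => h.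
have : s ^+ 2 == 0 /\ t ^+ 2 == 0.
  by have := sqr_ge0 s; have := sqr_ge0 t; split; apply/eqP; lra.
by rewrite !sqrf_eq0 => -[s0 t0]; case: st; rewrite ?s0 ?t0.
Qed.

(** [CP] is a bare type of lines; these matrices stand in for its points wherever continuity,
    compactness or differentiability is used, independently of any chart. *)
Definition projCP p : 'M[R]_(m.+1 + m.+1) := proj (realify (vpick (val p))).

Lemma projCP_class p z : is_class p z -> projCP p = proj (realify z).
Proof.
move=> hz; have [c c0 ->] := is_class_scale (is_class_pick p) hz.
by rewrite proj_realifyZ// (is_class_neq0 (is_class_pick p)).
Qed.

Local Notation lj j := (lshift m.+1 j).
Local Notation rj j := (rshift m.+1 j).

Lemma proj_ll z i j : proj (realify z) (lj i) (lj j) =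
  complex.Re (z 0 i * conjc (z 0 j)) / dot (realify z) (realify z).
Proof.
rewrite projE !mulJl !realifyl !realifyr; congr (_ / _).
by case: (z 0 i) => a b; case: (z 0 j) => c d /=; ring.
Qed.

Lemma proj_rl z i j : proj (realify z) (rj i) (lj j) =
  complex.Im (z 0 i * conjc (z 0 j)) / dot (realify z) (realify z).
Proof.
rewrite projE mulJl mulJr !realifyl !realifyr; congr (_ / _).
by case: (z 0 i) => a b; case: (z 0 j) => c d /=; ring.
Qed.

Lemma proj_chart j p : in_chart j p = (projCP p (lj j) (lj j) != 0).
Proof.
have hz := is_class_pick p; rewrite (in_chartE j hz) (projCP_class hz) proj_ll.
have d0 : dot (realify (vpick (val p))) (realify (vpick (val p))) != 0.
  by rewrite gt_eqF// dot_gt0// realify_eq0 (is_class_neq0 hz).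
rewrite mulf_eq0 invr_eq0 (negbTE d0) orbF; case: (vpick (val p) 0 j) => a b /=.
rewrite eq_complex /= mulrN opprK -!expr2 paddr_eq0 ?sqr_ge0// !sqrf_eq0.
by [].
Qed.

(** From z_i / z_j = z_i conj(z_j) / |z_j|^2: affine coordinates are rational in the projector,
    which is how smoothness passes from projectors to charts. *)
Lemma coordl j p i : Defs.coord j p 0 (lshift m i) =
  projCP p (lj (lift j i)) (lj j) / projCP p (lj j) (lj j).
Proof.
have hz := is_class_pick p; rewrite row_mxEl mxE (projCP_class hz) !proj_ll.
have d0 : dot (realify (vpick (val p))) (realify (vpick (val p))) != 0.
  by rewrite gt_eqF// dot_gt0// realify_eq0 (is_class_neq0 hz).
rewrite invfM invrK mulrACA mulVf// mulr1; move: (_ 0 (lift j i)) (_ 0 j) => [a b] [c d].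
by rewrite /= !(mulrN, opprK) mulrDl !mulrA -!expr2; ring.
Qed.

Lemma coordr j p i : Defs.coord j p 0 (rshift m i) =
  projCP p (rj (lift j i)) (lj j) / projCP p (lj j) (lj j).
Proof.
have hz := is_class_pick p; rewrite row_mxEr mxE (projCP_class hz) proj_rl proj_ll.
have d0 : dot (realify (vpick (val p))) (realify (vpick (val p))) != 0.
  by rewrite gt_eqF// dot_gt0// realify_eq0 (is_class_neq0 hz).
rewrite invfM invrK mulrACA mulVf// mulr1; move: (_ 0 (lift j i)) (_ 0 j) => [a b] [c d].
by rewrite /= !(mulrN, opprK) -!expr2; ring.
Qed.

Lemma exists_chart p : exists j, in_chart j p.
Proof.
have z0 := is_class_neq0 (is_class_pick p); apply/existsP; apply: contraNT z0 => /existsPn h.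
by apply/eqP/rowP => i; rewrite mxE; apply/eqP; have := h i; rewrite negbK.
Qed.

Lemma projCP_inj : injective projCP.
Proof.
move=> p q E; have [j hj] := exists_chart p.
have hj' : in_chart j q by rewrite proj_chart -E -proj_chart.
apply: (is_class_inj (coord_is_class hj)).
have -> : Defs.coord j p = Defs.coord j q.
  by apply/rowP => a; case: (split_ordP a) => i ->; rewrite ?coordl ?coordr E.
exact: coord_is_class.
Qed.

Lemma projCP_zlift j p : in_chart j p -> projCP p = proj (zlift j (Defs.coord j p)).
Proof. by move=> /coord_is_class/projCP_class. Qed.

Lemma smooth_proj k (U : set 'rV[R]_k) (Y : 'rV[R]_k -> RV) a b : open U -> vsmooth U Y ->
  (forall x, U x -> Y x != 0) -> smooth_on U (fun x => proj (Y x) a b).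
Proof.
move=> oU sY Y0; have sJ := vsmooth_mul Jmx oU sY.
rewrite (_ : (fun x => _) = fun x => (Y x 0 a * Y x 0 b + (Y x *m Jmx) 0 a * (Y x *m Jmx) 0 b)
   * (dot (Y x) (Y x))^-1); last by apply/funext => x; rewrite projE.
apply: smooth_M => //; first by apply: smooth_D => //; apply: smooth_M.
apply: smooth_V => //; last exact: smooth_dot.
by move=> x /Y0 h; rewrite gt_eqF// dot_gt0.
Qed.

Section Continuity.
Context {M : topologicalType} {k : nat} (f : M -> CP R m).

Lemma immersion_smooth (P : local_param k f) : vsmooth (dom P) (immersion P).
Proof. by move=> a; exact: par_smooth. Qed.

Lemma projCP_param (P : local_param k f) x : dom P x ->
  projCP (f (par P x)) = proj (zlift (chart P) (immersion P x)).
Proof. by move=> /par_chart; exact: projCP_zlift. Qed.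

(** Near a point of M the claim is read in a parametrization, where the projector is smooth;
    neighbourhoods return to M because parametrizations are open maps. *)
Lemma projCP_continuous a b : immersed_submanifold k f -> continuous (fun y : M => projCP (f y) a b).
Proof.
move=> [_ cov] q; have [P [x dx <-]] := cov q.
have sp : smooth_on (dom P) (fun x => proj (zlift (chart P) (immersion P x)) a b).
  apply: smooth_proj; first exact: dom_open.
    move=> c; apply: (smooth_comp (@dom_open _ _ _ _ _ P) (@vsmooth_zlift R m (chart P) setT (@openT _) c)) => //.
    exact: immersion_smooth.
  by move=> y _; exact: zlift_neq0.
have cp := smooth_continuous sp dx.
move=> A /=; rewrite (projCP_param dx) => hA.
have nA : nbhs x (fun y => A (proj (zlift (chart P) (immersion P y)) a b)) by exact: cp.
have nd : nbhs x (dom P) by apply: open_nbhs_nbhs; split => //; exact: dom_open.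
have : nbhs x (dom P `&` (fun y => A (proj (zlift (chart P) (immersion P y)) a b))).
  by apply: filterI; [exact: nd|exact: nA].
rewrite nbhsE => -[V [oV Vx] VA].
have oI : open (par P @` V) by apply: par_open => //; move=> y /VA[].
rewrite /= nbhsE; exists (par P @` V); first by split => //; exists x.
by move=> _ [y Vy <-] /=; have [dy] := VA y Vy; rewrite projCP_param.
Qed.

End Continuity.
End CPBasics.

(** * Second eigenvalue of the model spaces *)

Section LapOrthogonal.
Context {R : realType} {N : nat}.
Let oP := @open_punctured R N.

Lemma orthogonal_neq0 (T : 'M[R]_N) (z : 'rV[R]_N) : T *m T^T = 1%:M -> z != 0 -> z *m T != 0.
Proof.
move=> TT z0; apply: contraNneq z0 => h.
by rewrite -(mulmx1 z) -TT mulmxA h mul0mx.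
Qed.

Lemma lap_orthogonal (F : 'rV[R]_N -> R) (T : 'M[R]_N) z : smooth_on (punctured N) F ->
  T *m T^T = 1%:M -> z != 0 -> lap (fun y => F (y *m T)) z = lap F (z *m T).
Proof.
move=> sF TT z0.
have sT := @vsmooth_mul R _ _ _ (punctured N) id T oP (@vsmooth_id R N (punctured N)).
have T0 y : punctured N y -> punctured N (y *m T) by exact: orthogonal_neq0.
have pE a G y : smooth_on (punctured N) G -> y != 0 ->
    partial a (fun y => G (y *m T)) y = \sum_b T a b * partial b G (y *m T).
  move=> sG y0; have dG := smooth_diff sG (T0 y y0).
  apply: etrans (partial_comp a dG (fun b => smooth_diff (sT b) y0)) _.
  apply: eq_bigr => b _; rewrite mulrC; congr (_ * _).
  have := congr1 (fun v : 'rV[R]_N => v 0 b) (vpartial_mul a T (@vsmooth_id R N (punctured N)) y0).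
  Transparent vpartial.
  rewrite [LHS]mxE => ->; rewrite vpartial_id mxE (bigD1 a)//= mxE !eqxx mul1r big1 ?addr0//.
  by move=> c ca; rewrite mxE (negbTE ca) andbF mul0r.
Opaque vpartial.
have E a : partial a (partial a (fun y => F (y *m T))) z =
    \sum_b T a b * \sum_c T a c * partial c (partial b F) (z *m T).
  rewrite (@partial_near _ _ _ _ (fun y => \sum_b T a b * partial b F (y *m T))); last first.
    by apply: near_punctured => // y y0; exact: pE.
  have db b : differentiable (fun y => partial b F (y *m T)) z.
    exact: (smooth_diff (smooth_comp oP (smooth_partial b sF) sT T0) z0).
  rewrite partial_sum; last first.
    by move=> b; apply: differentiableM => //; exact: (@differentiable_cst _ _ _ (T a b : R^o)).
  apply: eq_bigr => b _; rewrite (partialZ a (T a b) (db b)); congr (_ * _).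
  exact: (pE a (partial b F) z (smooth_partial b sF) z0).
have -> : lap (fun y => F (y *m T)) z = \tr (T *m hessian F (z *m T) *m T^T).
  apply: eq_bigr => a _; rewrite E mxE; apply: eq_bigr => b _.
  rewrite [X in _ = _ * X]mxE mulrC; congr (_ * _); rewrite mxE; apply: eq_bigr => c _.
  by rewrite [X in _ = _ * X]mxE.
by rewrite mxtrace_mulC mulmxA (mulmx1C TT) mul1mx tr_hessian.
Qed.

Lemma lap_scale (F : 'rV[R]_N -> R) d z : smooth_on (punctured N) F -> homogeneous 0 F ->
  z != 0 -> 0 < d -> dot (d *: z) (d *: z) * lap F (d *: z) = dot z z * lap F z.
Proof.
move=> sF hF z0 d0; rewrite dotZl dotZr.
have h i : partial i (partial i F) (d *: z) = d ^- 2 * partial i (partial i F) z.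
  have hp := homogeneous_partial i (smooth_partial i sF) (homogeneous_partial i sF hF).
  rewrite hp// (_ : 0 - 1 - 1 = - 2%:R); last by ring.
  by rewrite powR_invn ?ltW.
have -> : lap F (d *: z) = d ^- 2 * lap F z.
  by rewrite {2}/lap mulr_sumr; apply: eq_bigr => i _; exact: h.
by move: (dot z z) (lap F z) => p q; field; rewrite gt_eqF.
Qed.

Lemma lap_similarity (F : 'rV[R]_N -> R) (T : 'M[R]_N) c x : smooth_on (punctured N) F ->
  homogeneous 0 F -> T *m T^T = 1%:M -> 0 < c -> x != 0 ->
  (forall z : 'rV[R]_N, z != 0 -> F (z *m T) = F z) ->
  dot (c *: (x *m T)) (c *: (x *m T)) * lap F (c *: (x *m T)) = dot x x * lap F x.
Proof.
move=> sF hF TT c0 x0 FT; have xT0 := orthogonal_neq0 TT x0.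
apply: etrans (lap_scale sF hF xT0 c0) _.
have -> : dot (x *m T) (x *m T) = dot x x by rewrite dot_mul -mulmxA TT mulmx1.
have E : lap F (x *m T) = lap F x.
  by rewrite -(lap_orthogonal sF TT x0); exact: (@lap_near _ _ (fun y => F (y *m T)) F _ x oP x0 FT).
by rewrite E.
Qed.

End LapOrthogonal.

Section LaplacianNear.
Context {R : realType}.

Lemma laplacian_near n (U : set 'rV[R]_n) (g : 'rV[R]_n -> 'M[R]_n) (u v : 'rV[R]_n -> R) x :
  open U -> U x -> (forall y, U y -> u y = v y) -> laplacian g u x = laplacian g v x.
Proof.
move=> oU Ux uv.
have pE y i : U y -> partial i u y = partial i v y.
  move=> Uy; apply: partial_near; have nU : nbhs y U by exact: open_nbhs_nbhs.
  exact: filterS nU.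
have gE y : U y -> grad g u y = grad g v y.
  by move=> Uy; apply/rowP => i; rewrite !mxE; apply: eq_bigr => j _; rewrite pE.
have gx : grad g u x = grad g v x := gE x Ux.
have dE i : partial i (fun y => grad g u y 0 i) x = partial i (fun y => grad g v y 0 i) x.
  apply: partial_near; have nU : nbhs x U by exact: open_nbhs_nbhs.
  apply: filterS nU => y Uy; exact: (congr1 (fun w : 'rV[R]_n => w 0 i) (gE y Uy)).
rewrite /laplacian; move: (grad g u) (grad g v) gx dE => X Y XY dE.
by rewrite /div; apply: eq_bigr => i _; rewrite dE XY.
Qed.

(** Applied along z J, it turns the invariance of [Psi] along the fibre into orthogonality of the
    gradient. *)
Lemma gradient_line N (F : 'rV[R]_N -> R) (z v : 'rV[R]_N) : smooth_on (punctured N) F -> z != 0 ->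
  (forall t, F (z + t *: v) = F z) -> dot v (gradient F z) = 0.
Proof.
move=> sF z0 hF; have dF : differentiable F z by exact: (smooth_diff sF z0).
have dF0 : differentiable F (z + 0 *: v) by rewrite scale0r addr0.
have := @derive_val _ _ _ _ _ _ _ (is_derive_line dF0).
rewrite (_ : (fun s => F (z + s *: v)) = cst (F z)); last by apply/funext => t; rewrite hF.
rewrite derive_cst scale0r addr0 diff_sum_partial// dotE mxE => E.
transitivity (\sum_b v 0 b * partial b F z); last by rewrite -E.
by apply: eq_bigr => b _; rewrite !mxE.
Qed.

End LaplacianNear.

(** * Eigenvalues of L on a submanifold parametrized by punctured R^N *)

Section ModelSpace.
Context {R : realType} {m k : nat} {M : topologicalType} (f : M -> CP R m).
Context (fi : immersed_submanifold k f).
Context (N : nat) (B : 'M[R]_(N, m.+1 + m.+1)) (J : 'M[R]_N) (e be : R).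
Context (a : 'rV[R]_(m.+1 + m.+1)) (mod : lift_model k B J e be a).
Context (Psi : 'rV[R]_N -> M).

Definition model_lift (x : 'rV[R]_N) : 'rV[R]_(m.+1 + m.+1) := a + be *: (normalize 1 x *m B).

Context (PsiE : forall x : 'rV[R]_N, x != 0 -> projCP (f (Psi x)) = proj (model_lift x)).
Context (Psi_scale : forall (x : 'rV[R]_N) (c : R), x != 0 -> 0 < c -> Psi (c *: x) = Psi x).
Context (Psi_J : forall (x : 'rV[R]_N) (t : R), x != 0 -> Psi (x + t *: (x *m J)) = Psi x).
Context (Psi_surj : forall p, exists2 x : 'rV[R]_N, x != 0 & Psi x = p).
Context (Psi_continuous : forall x : 'rV[R]_N, x != 0 -> {for x, continuous Psi}).
Context (Psi_fiber : forall x y : 'rV[R]_N, x != 0 -> y != 0 -> Psi x = Psi y ->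
  exists (c : R) (T : 'M[R]_N), [/\ 0 < c, T *m T^T = 1%:M, y = c *: (x *m T)
    & forall z : 'rV[R]_N, z != 0 -> Psi (z *m T) = Psi z]).
Context (Psi_lift : forall (P : local_param k f) x, dom P x ->
  exists (U : set 'rV[R]_k) (s : R) (eta : 'rV[R]_k -> 'rV[R]_N),
   [/\ open U, U x, U `<=` dom P & s * s = 1] /\
   [/\ vsmooth U eta, forall y, U y -> dot (eta y) (eta y) = 1,
     forall y, U y -> fs_lift (chart P) s (immersion P y) = a + be *: (eta y *m B) &
     forall y, U y -> Psi (eta y) = par P y]).

Let oP := @open_punctured R N.

Lemma model_lift_neq0 x : x != 0 -> model_lift x != 0.
Proof.
case: mod => -[BB aB _ _ be0] _ x0; apply/eqP => h.
have : model_lift x *m B^T = be *: normalize 1 x.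
  by rewrite mulmxDl aB add0r -scalemxAl -mulmxA BB mulmx1.
rewrite h mul0mx => /esym/eqP; rewrite scaler_eq0 (negbTE be0) /= scaler_eq0 (negbTE x0) orbF.
by rewrite mul1r gt_eqF// rpow_gt0.
Qed.

Lemma vsmooth_model_lift : vsmooth (punctured N) model_lift.
Proof.
have sn := @vsmooth_normalize R _ _ _ oP id 1 (@vsmooth_id R N (punctured N)) (fun x x0 => x0).
move=> b; rewrite (_ : (fun x => _) = fun x => a 0 b + be * (normalize 1 x *m B) 0 b); last first.
  by apply/funext => x; rewrite mxE [X in _ + X]mxE.
apply: smooth_D => //; first exact: smooth_cst.
by apply: smooth_Z => //; exact: vsmooth_mul.
Qed.

(** The immersion has independent derivatives and the Fubini-Study metric is nondegenerate, so the
    rows of the Jacobian, read in the horizontal frame, remain independent and their Gram matrix is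
    invertible. *)
Lemma metric_unit (P : local_param k f) x : dom P x -> metric P x \in unitmx.
Proof.
move=> dx; have fj := par_immersion dx; rewrite /metric.
set G := fs_chart _; set W := immersion P.
have s1 : (1 : R) * 1 = 1 by rewrite mulr1.
pose F := frame (fs_lift (chart P) 1) Jmx (W x).
have FF : F *m F^T = G (W x) := fs_frame_gram (chart P) s1 (W x).
have uG : G (W x) \in unitmx := fs_chart_unit (chart P) s1 (W x).
rewrite /induced_metric -FF mulmxA -mulmxA -trmx_mul; apply: row_free_gram.
rewrite -kermx_eq0; apply/eqP/row_matrixP => i; rewrite row0.
have := row_sub i (kermx (jac W x *m F)); rewrite sub_kermx => /eqP h.
have : row i (kermx (jac W x *m F)) *m jac W x *m G (W x) = 0.
  by rewrite -FF !mulmxA -(mulmxA _ _ F) h mul0mx.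
move=> /(congr1 (mulmx^~ (invmx (G (W x))))); rewrite mulmxK// mul0mx => /eqP.
by rewrite mulmx_free_eq0// => /eqP.
Qed.

(** Smoothness of u is known only in parametrizations, so [Psi] is factored locally as par followed
    after phi. Here phi is continuous because par is open, and smooth by [inverse_smooth], since
    composing it with the immersion gives the affine coordinates of an explicit projector. *)
Lemma smooth_pullback (u : M -> R) : smooth_function k f u ->
  smooth_on (punctured N) (u \o Psi).
Proof.
move=> su; apply: smooth_local => x0 /= x00.
have [P [y0 dy0 Py0]] := fi.2 (Psi x0).
pose O := [set x : 'rV[R]_N | x != 0 /\ (par P @` dom P) (Psi x)].
have odom : open (dom P) := @dom_open _ _ _ _ _ P.
have oimg V : V `<=` dom P -> open V -> open (par P @` V) by exact: (@par_open _ _ _ _ _ P).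
have nO x : O x -> nbhs x O.
  move=> [xn hx].
  have n1 : nbhs x (punctured N) by exact: open_nbhs_nbhs.
  have n2 : nbhs (Psi x) (par P @` dom P).
    by apply: open_nbhs_nbhs; split => //; exact: oimg.
  have n3 : nbhs x (Psi @^-1` (par P @` dom P)) by exact: (Psi_continuous xn n2).
  exact: (filterI n1 n3).
have oO : open O by rewrite openE => x /nO.
(* Off O, phi takes arbitrary values; only its restriction to the open set O is used. *)
have /choice[phi hphi] : forall x, exists y, O x -> dom P y /\ par P y = Psi x.
  move=> x; have [[xn [y dy Py]]|nx] := pselect (O x); first by exists y.
  by exists 0.
have cphi x : O x -> {for x, continuous phi}.
  move=> Ox A nA; have [dx Px] := hphi x Ox.
  have nd : nbhs (phi x) (dom P) by exact: open_nbhs_nbhs.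
  have : nbhs (phi x) (dom P `&` A) by exact: (filterI nd nA).
  rewrite nbhsE => -[V [oV Vx] VA].
  have oI : open (par P @` V) by apply: oimg => // y /VA[].
  have nI : nbhs (Psi x) (par P @` V).
    by apply: open_nbhs_nbhs; split => //; exists (phi x).
  have nx : nbhs x (Psi @^-1` (par P @` V)) by exact: (Psi_continuous Ox.1 nI).
  apply: filterS (filterI (nO x Ox) nx) => y [Oy [w Vw Pw]] /=.
  have [dy Py] := hphi y Oy.
  have <- : w = phi y.
    apply: (@par_inj _ _ _ _ _ P); rewrite ?inE//; first by case: (VA w Vw).
    by rewrite Pw Py.
  by case: (VA w Vw).
pose S x := Defs.coord (chart P) (f (Psi x)).
have WS x : O x -> immersion P (phi x) = S x.
  by move=> Ox; rewrite /immersion (hphi x Ox).2.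
have sub_O : O `<=` punctured N by move=> x [].
have spr b c : smooth_on O (fun x => proj (model_lift x) b c).
  by apply: smooth_sub sub_O _; apply: smooth_proj => //; [exact: vsmooth_model_lift|exact: model_lift_neq0].
have hch x : O x -> proj (model_lift x) (lshift m.+1 (chart P)) (lshift m.+1 (chart P)) != 0.
  move=> Ox; have [dx Px] := hphi x Ox.
  by rewrite -PsiE ?(sub_O x Ox)// -proj_chart -Px; exact: par_chart.
have sS b : smooth_on O (fun x => S x 0 b).
  case: (split_ordP b) => i ->.
    apply: (@smooth_eq _ _ _ (fun x => proj (model_lift x) (lshift m.+1 (lift (chart P) i)) (lshift m.+1 (chart P))
      * (proj (model_lift x) (lshift m.+1 (chart P)) (lshift m.+1 (chart P)))^-1)) => //.
      by move=> x Ox; rewrite coordl PsiE// (sub_O x Ox).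
    by apply: smooth_M => //; exact: smooth_V.
  apply: (@smooth_eq _ _ _ (fun x => proj (model_lift x) (rshift m.+1 (lift (chart P) i)) (lshift m.+1 (chart P))
    * (proj (model_lift x) (lshift m.+1 (chart P)) (lshift m.+1 (chart P)))^-1)) => //.
    by move=> x Ox; rewrite coordr PsiE// (sub_O x Ox).
  by apply: smooth_M => //; exact: smooth_V.
have sphi := inverse_smooth oO odom cphi (fun x Ox => (hphi x Ox).1) (immersion_smooth P)
  (@par_immersion _ _ _ _ _ P) sS WS.
exists O; split; first by split => //; exists y0.
apply: (@smooth_eq _ _ _ (fun x => (u \o par P) (phi x))) => //.
  by move=> x Ox; rewrite /= (hphi x Ox).2.
exact: (smooth_comp oO (su P) sphi (fun x Ox => (hphi x Ox).1)).
Qed.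

Lemma smooth_descend (u : M -> R) : smooth_on (punctured N) (u \o Psi) -> smooth_function k f u.
Proof.
move=> sF P; apply: smooth_local => x dx.
have [U [s [eta [[oU Ux Ud s1] [seta eta1 _ PE]]]]] := Psi_lift dx.
exists U; split => //; apply: (@smooth_eq _ _ _ (fun y => (u \o Psi) (eta y))) => //.
  by move=> y Uy; rewrite /= PE.
by apply: (smooth_comp oU sF seta) => y Uy; exact: unit_neq0 (eta1 y Uy).
Qed.

Section Pullback.
Context (u : M -> R) (sF : smooth_on (punctured N) (u \o Psi)).

Lemma pullback_homogeneous : homogeneous 0 (u \o Psi).
Proof. by move=> x c x0 c0; rewrite /= Psi_scale// powRr0 mul1r. Qed.

Lemma pullback_euler (z : 'rV[R]_N) : z != 0 -> dot z (gradient (u \o Psi) z) = 0.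
Proof.
move=> z0; have := euler sF pullback_homogeneous z0; rewrite mul0r => <-.
by rewrite dotE mxE; apply: eq_bigr => b _; rewrite !mxE.
Qed.

Lemma pullback_J (z : 'rV[R]_N) : z != 0 -> dot (z *m J) (gradient (u \o Psi) z) = 0.
Proof. by move=> z0; apply: gradient_line => // t; rewrite /= Psi_J. Qed.

(** Representatives of one point differ by a scaling and an orthogonal map that [Psi] does not see,
    so |x|^2 lap may be evaluated at any of them, in particular at the one supplied by a local
    lift. *)
Lemma lap_fiber (x y : 'rV[R]_N) : x != 0 -> y != 0 -> Psi x = Psi y ->
  dot x x * lap (u \o Psi) x = dot y y * lap (u \o Psi) y.
Proof.
move=> x0 y0 /(Psi_fiber x0 y0)[c [T [c0 TT yE PT]]].
have FT (z : 'rV[R]_N) : z != 0 -> (u \o Psi) (z *m T) = (u \o Psi) z.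
  by move=> z0; rewrite /= PT.
by rewrite yE; exact: esym (lap_similarity sF pullback_homogeneous TT c0 x0 FT).
Qed.

Lemma model_L (P : local_param k f) x (y : 'rV[R]_N) : dom P x -> y != 0 -> Psi y = par P x ->
  laplacian (metric P) (u \o par P) x + (sigma_sqnorm P x + k%:R) * (u \o par P) x =
  be ^- 2 * (dot y y * lap (u \o Psi) y + k%:R * u (par P x)).
Proof.
move=> dx y0 yx; have [U [s [eta [[oU Ux Ud s1] [seta eta1 le PE]]]]] := Psi_lift dx.
have sW : vsmooth U (immersion P) by move=> b; apply: smooth_sub Ud _; exact: immersion_smooth.
have ug z : U z -> induced_metric (fs_chart (chart P)) (immersion P) z \in unitmx.
  by move=> Uz; apply: metric_unit; exact: Ud.
have be0 : be != 0 by case: mod => -[].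
have EL : laplacian (metric P) (u \o par P) x = (be ^+ 2)^-1 * lap (u \o Psi) (eta x).
  apply: etrans (@laplacian_near _ _ U _ _ ((u \o Psi) \o eta) _ oU Ux _) _.
    by move=> z Uz; rewrite /= PE.
  exact: (model_laplacian s1 mod oU sW seta eta1 le ug sF pullback_euler pullback_J Ux).
have ES : sigma_sqnorm P x = k%:R * (be ^- 2 - 1).
  exact: (model_sigma s1 mod oU sW seta eta1 le ug Ux).
have eta0 := unit_neq0 (eta1 x Ux).
have EQ : lap (u \o Psi) (eta x) = dot y y * lap (u \o Psi) y.
  by rewrite -[LHS]mul1r -(eta1 x Ux); apply: lap_fiber => //; rewrite PE.
rewrite EL ES EQ /=; move: (dot y y * _) (u _) => p q.
by field.
Qed.

End Pullback.

(* The eigenvalue mu of the Laplacian in the model corresponds to the eigenvalue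
   (mu - k) / be^2 of L. *)
Theorem second_eigenvalue (mu2 : R) (F2 : 'rV[R]_N -> R) :
  0 <= mu2 -> smooth_on (punctured N) F2 ->
  (forall x y : 'rV[R]_N, x != 0 -> y != 0 -> Psi x = Psi y -> F2 x = F2 y) ->
  (forall x : 'rV[R]_N, x != 0 -> dot x x * lap F2 x = - mu2 * F2 x) ->
  (exists x y : 'rV[R]_N, [/\ x != 0, y != 0 & F2 x != F2 y]) ->
  (forall (F : 'rV[R]_N -> R) (mu : R), smooth_on (punctured N) F -> homogeneous 0 F ->
    (forall x y : 'rV[R]_N, x != 0 -> y != 0 -> Psi x = Psi y -> F x = F y) -> mu < mu2 ->
    (forall x : 'rV[R]_N, x != 0 -> dot x x * lap F x = - mu * F x) ->
    (mu = 0 -> forall x y : 'rV[R]_N, x != 0 -> y != 0 -> F x = F y) /\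
    (mu != 0 -> forall x : 'rV[R]_N, x != 0 -> F x = 0)) ->
  is_nth_eigenvalue k f 2 ((mu2 - k%:R) / be ^+ 2).
Proof.
move=> mu20 sF2 F2P eF2 [x1 [x2 [x10 x20 x12]]] gap.
have be0 : be != 0 by case: mod => -[].
have b2 : 0 < be ^+ 2 by rewrite exprn_even_gt0.
have /choice[xi hxi] : forall p, exists x : 'rV[R]_N, x != 0 /\ Psi x = p.
  by move=> p; have [x] := Psi_surj p; exists x.
pose u2 p := F2 (xi p).
have u2E x : x != 0 -> u2 (Psi x) = F2 x.
  by move=> x0; apply: F2P => //; have [] := hxi (Psi x).
have su2 : smooth_on (punctured N) (u2 \o Psi).
  by apply: (@smooth_eq _ _ _ F2) => // x x0; rewrite /= u2E.
have su1 : smooth_on (punctured N) ((fun=> 1) \o Psi) by exact: smooth_cst.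
have eig (u : M -> R) mu : smooth_on (punctured N) (u \o Psi) ->
    (forall x : 'rV[R]_N, x != 0 -> dot x x * lap (u \o Psi) x = - mu * u (Psi x)) ->
    in_eigenspace k f ((mu - k%:R) / be ^+ 2) u.
  move=> su eu; split; first exact: smooth_descend.
  exists (fun p => - ((mu - k%:R) / be ^+ 2) * u p); last by move=> p; rewrite mulNr addNr.
  move=> P x dx; have [y0 yE] := hxi (par P x).
  have := model_L su dx y0 yE; rewrite /= => ->; rewrite eu// yE.
  by move: (u _) => p; field.
pose l (n : nat) : R := if n == 1%N then - k%:R / be ^+ 2 else (mu2 - k%:R) / be ^+ 2.
pose us (n : nat) : M -> R := if n == 1%N then fun=> 1 else u2.
have l12 : l 1%N <= l 2%N.
  by rewrite /l /= ler_pM2r ?invr_gt0// lerDr.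
have sum2 (P : pred nat) (g : nat -> R) : \sum_(1 <= i < 3 | P i) g i =
   (if P 1%N then g 1%N else 0) + (if P 2%N then g 2%N else 0).
  by rewrite big_mkcond /= big_nat_recl// big_nat1.
exists l, us; split.
- move=> i; rewrite /l /us; case: eqP => [_ _|_ _].
    rewrite -[- k%:R](add0r (- k%:R)) ; apply: eig => // x x0.
    rewrite oppr0 mul0r [lap _ _]big1 ?mulr0// => b _.
    rewrite (@partial_near _ _ _ _ (fun=> 0)); first exact: partial_cst.
    by apply: near_punctured => // y y0; exact: partial_cst.
  apply: (eig u2 mu2 su2) => x x0.
  have E : lap (u2 \o Psi) x = lap F2 x by exact: (@lap_near _ _ (u2 \o Psi) F2 _ x oP x0 u2E).
  by rewrite E (u2E x x0) (eF2 x x0).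
- move=> c hc; have E x : x != 0 -> c 1%N + c 2%N * F2 x = 0.
    by move=> x0; have := hc (Psi x); rewrite sum2 /us /= mulr1 u2E.
  have c2 : c 2%N = 0.
    have h : c 2%N * (F2 x1 - F2 x2) = 0 by have := E x1 x10; have := E x2 x20; lra.
    by move/eqP: h; rewrite mulf_eq0 subr_eq0 (negbTE x12) orbF => /eqP.
  have c1 : c 1%N = 0 by have := E x1 x10; rewrite c2 mul0r addr0.
  by move=> [|[|[|i]]].
- move=> [|[|[|i]]] [|[|[|j]]] //.
- move=> mu w mul hw.
  have [sw [v Lv vw]] := hw; have sF := smooth_pullback sw.
  (* This inverts mu |-> (mu - k) / be^2. *)
  pose mu' := k%:R + be ^+ 2 * mu.
  have mulm : mu' < mu2.
    move: mul; rewrite /l /= ltr_pdivlMr// => h; rewrite /mu' mulrC; lra.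
  have eF (x : 'rV[R]_N) : x != 0 -> dot x x * lap (w \o Psi) x = - mu' * (w \o Psi) x.
    move=> x0; have [P [y dy Py]] := fi.2 (Psi x).
    have := model_L sF dy x0 (esym Py); rewrite -(Lv P y dy) Py => h.
    have := vw (Psi x); rewrite h /mu' /=; move: (dot x x * _) (w _) => p q hp.
    have : be ^+ 2 * (be ^- 2 * (p + k%:R * q) + mu * q) = 0 by rewrite hp mulr0.
    by rewrite mulrDr mulrA mulfV ?gt_eqF// mul1r; lra.
  have [g0 g1] := gap _ mu' sF (@pullback_homogeneous w) (fun x y _ _ (h : Psi x = Psi y) => congr1 w h) mulm eF.
  have l2 : (l 2%N == mu) = false by rewrite gt_eqF.
  have l1 : (l 1%N == mu) = (mu' == 0).
    rewrite /l /= /mu' addrC addr_eq0 -[in RHS]eqr_opp opprK.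
    by apply/eqP/eqP => [<-|h]; [field|rewrite -h; field].
  (* As mu lies below the second term, the selected sum contains at most index 1, and does so
     exactly when mu' = 0. Then w is constant, hence a multiple of the first eigenfunction;
     otherwise w vanishes and the sum is empty. *)
  have [m0|m0] := eqVneq mu' 0.
    exists (fun=> w (Psi x1)) => p; rewrite sum2 l2 l1 m0 eqxx /us /= mulr1 addr0.
    by have [y0 <-] := hxi p; exact: (g0 m0).
  exists (fun=> 0) => p; rewrite sum2 l2 l1 (negbTE m0) addr0.
  by have [y0 <-] := hxi p; exact: (g1 m0).
- by [].
Qed.

End ModelSpace.

Section Harmonics.
Context {R : realType} {N : nat}.
Let oP := @open_punctured R N.

Lemma eigen_below1 (F : 'rV[R]_N -> R) mu : (2 < N)%N -> smooth_on (punctured N) F ->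
  homogeneous 0 F -> mu < N%:R - 1 ->
  (forall x : 'rV[R]_N, x != 0 -> dot x x * lap F x = - mu * F x) ->
  (mu = 0 -> forall x y : 'rV[R]_N, x != 0 -> y != 0 -> F x = F y) /\
  (mu != 0 -> forall x : 'rV[R]_N, x != 0 -> F x = 0).
Proof.
move=> N3 sF hF mu1 eF; split; first by move=> mu0; exact: (eigen_zero N3 sF hF eF mu0).
rewrite neq_lt => /orP[mu0|mu0]; first exact: (eigen_neg sF hF eF mu0).
exact: (eigen_gap1 N3 sF hF eF mu0 mu1).
Qed.

Lemma eigen_below2 (F : 'rV[R]_N -> R) mu : (2 < N)%N -> smooth_on (punctured N) F ->
  homogeneous 0 F -> (forall x : 'rV[R]_N, x != 0 -> F (- x) = F x) -> mu < 2 * N%:R ->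
  (forall x : 'rV[R]_N, x != 0 -> dot x x * lap F x = - mu * F x) ->
  (mu = 0 -> forall x y : 'rV[R]_N, x != 0 -> y != 0 -> F x = F y) /\
  (mu != 0 -> forall x : 'rV[R]_N, x != 0 -> F x = 0).
Proof.
move=> N3 sF hF evF mu1 eF; split; first by move=> mu0; exact: (eigen_zero N3 sF hF eF mu0).
rewrite neq_lt => /orP[mu0|mu0]; first exact: (eigen_neg sF hF eF mu0).
exact: (eigen_gap2 N3 sF hF eF mu0 mu1 evF).
Qed.

Lemma harmonic_eigen (G : 'rV[R]_N -> R) (d mu : R) x : smooth_on (punctured N) G ->
  homogeneous d G -> lap G x = 0 -> x != 0 -> mu = d * (d + N%:R - 2) ->
  dot x x * lap (fun y => rpow (- d) y * G y) x = - mu * (rpow (- d) x * G x).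
Proof.
move=> sG hG lG x0 ->; rewrite (lap_rpowM (- d) sG hG x0) lG mulr0 add0r.
by move: (rpow _ _) (G x) => p q; ring.
Qed.

Lemma smooth_harmonic (G : 'rV[R]_N -> R) d : smooth_on (punctured N) G ->
  smooth_on (punctured N) (fun y => rpow (- d) y * G y).
Proof. by move=> sG; apply: smooth_M => //; exact: smooth_rpow. Qed.

Lemma lapD (U : set 'rV[R]_N) (f g : 'rV[R]_N -> R) (x : 'rV[R]_N) :
  open U -> smooth_on U f -> smooth_on U g -> U x ->
  lap (fun z => f z + g z) x = lap f x + lap g x.
Proof.
move=> oU sf sg Ux; rewrite (_ : (fun z => f z + g z) = fun z => f z - (-1) * g z); last first.
  by apply/funext => z; rewrite mulN1r opprK.
by rewrite (lapB oU sf (smooth_Z oU (-1) sg) Ux) (lapZ _ oU sg Ux) mulN1r opprK.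
Qed.

Lemma lap_entry (i : 'I_N) (x : 'rV[R]_N) : lap (fun y : 'rV[R]_N => y 0 i) x = 0.
Proof.
apply: big1 => j _; rewrite (_ : partial j (fun y : 'rV[R]_N => y 0 i) = fun=> (j == i)%:R); first exact: partial_cst.
by apply/funext => y; exact: partial_entry.
Qed.

Lemma lap_entryM (i j : 'I_N) (x : 'rV[R]_N) : i != j ->
  lap (fun y : 'rV[R]_N => y 0 i * y 0 j) x = 0.
Proof.
move=> ij; rewrite (@lapM _ _ setT _ _ _ (@openT _) (@smooth_entry _ _ _ _) (@smooth_entry _ _ _ _))//.
rewrite !lap_entry !mulr0 !add0r big1 ?mulr0// => l _; rewrite !partial_entry.
by have [->|] := eqVneq l i; rewrite ?(negbTE ij) ?mulr0 ?mul0r.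
Qed.

Lemma homogeneous_entry (i : 'I_N) : homogeneous 1 (fun y : 'rV[R]_N => y 0 i).
Proof. by move=> x c x0 c0; rewrite mxE powRr1// ltW. Qed.

End Harmonics.

(** * Unit lifts of local parametrizations *)

Section Lifts.
Context {R : realType} {m k : nat} {M : topologicalType} (f : M -> CP R m).

Lemma vsmooth_unit_lift (P : local_param k f) s :
  vsmooth (dom P) (fun y => fs_lift (chart P) s (immersion P y)).
Proof.
have oP := @dom_open _ _ _ _ _ P.
exact: (@vsmooth_comp R k (m + m) (m.+1 + m.+1) (dom P) oP (immersion P) (immersion_smooth P)
  setT (fs_lift (chart P) s) (vsmooth_fs_lift (chart P) s) (fun _ _ => I)).
Qed.

Lemma fs_lift_scale j (s : R) (w : 'rV[R]_(m + m)) : fs_lift j s w = s *: fs_lift j 1 w.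
Proof. by rewrite /fs_lift /normalize scalerA mul1r. Qed.

(** The lift of sign 1 is the unit representative whose chart coordinate is a positive real number;
    this fixes its phase. *)
Lemma fs_lift_chart (P : local_param k f) y : dom P y ->
  fs_lift (chart P) 1 (immersion P y) 0 (rshift m.+1 (chart P)) = 0 /\
  0 < fs_lift (chart P) 1 (immersion P y) 0 (lshift m.+1 (chart P)).
Proof.
move=> dy; pose z := zlift (chart P) (immersion P y).
have E b : fs_lift (chart P) 1 (immersion P y) 0 b = rpow (-1) z * z 0 b by rewrite mxE mul1r.
rewrite !E {2 4}/z /zlift realifyr realifyl !mxE unlift_none /= mulr0 mulr1; split=> //.
exact/rpow_gt0/zlift_neq0.
Qed.

Lemma fs_lift_phase (P : local_param k f) y (X : 'rV[R]_(m.+1 + m.+1)) : dom P y ->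
  dot X X = 1 -> is_class (f (par P y)) (cplx X) ->
  exists s t : R, s ^+ 2 + t ^+ 2 = 1 /\
    fs_lift (chart P) 1 (immersion P y) = s *: X + t *: (X *m Jmx).
Proof.
move=> dy X1 hX; pose j := chart P; pose w := immersion P y.
have hw : is_class (f (par P y)) (insert_at j 1 w).
  by apply: coord_is_class; exact: par_chart.
have [c c0 wE] := is_class_scale hX hw.
have E : zlift j w = complex.Re c *: X + complex.Im c *: (X *m Jmx).
  by rewrite /zlift wE realifyZ cplxK.
pose r := rpow (-1) (zlift j w).
exists (r * complex.Re c), (r * complex.Im c).
have F : fs_lift j 1 w = (r * complex.Re c) *: X + (r * complex.Im c) *: (X *m Jmx).
  by rewrite /fs_lift /normalize mul1r -/r E scalerDr !scalerA.
split=> //; have := dot_fs_lift j (mulr1 1) w; rewrite F.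
rewrite !(dotDl, dotDr, dotZl, dotZr) (dotJJ JmxT JmxJ) (dotC (X *m Jmx)) (dotJ_self JmxT) X1.
by move=> <-; ring.
Qed.

(** A phase that carries a real vector to one whose chart coordinate is real and positive must be
    real. So the normalized lift agrees with v up to a sign, namely that of the chart coordinate of
    v. *)
Lemma fs_lift_real (P : local_param k f) y (v : 'rV[R]_m.+1) : dom P y ->
  dot v v = 1 -> is_class (f (par P y)) (complexify v) ->
  exists s : R, [/\ s * s = 1, fs_lift (chart P) s (immersion P y) = row_mx v 0 &
    0 < s * v 0 (chart P)].
Proof.
move=> dy v1 hv; pose X : 'rV[R]_(m.+1 + m.+1) := row_mx v 0.
have X1 : dot X X = 1 by rewrite dotE tr_row_mx mul_row_col trmx0 mulmx0 addr0 -dotE.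
have hX : is_class (f (par P y)) (cplx X).
  by rewrite (_ : cplx X = complexify v)//; apply/rowP => i; rewrite [LHS]mxE row_mxEl row_mxEr !mxE.
have [s [t [st E]]] := fs_lift_phase dy X1 hX.
have [] := fs_lift_chart dy; rewrite E => h1 h2.
have e1 : (s *: X + t *: (X *m Jmx)) 0 (rshift m.+1 (chart P)) = t * v 0 (chart P).
  by rewrite [LHS]mxE mxE [X in _ + X]mxE mulJr row_mxEr row_mxEl mxE mulr0 add0r.
have e2 : (s *: X + t *: (X *m Jmx)) 0 (lshift m.+1 (chart P)) = s * v 0 (chart P).
  by rewrite [LHS]mxE mxE [X in _ + X]mxE mulJl row_mxEr row_mxEl mxE oppr0 mulr0 addr0.
move: h1 h2; rewrite e1 e2 => h1 h2; have v0 : v 0 (chart P) != 0.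
  by apply: contraTneq h2 => ->; rewrite mulr0 ltxx.
have t0 : t = 0 by move/eqP: h1; rewrite mulf_eq0 (negbTE v0) orbF => /eqP.
have s1 : s * s = 1 by rewrite -st t0; ring.
exists s; split=> //; rewrite fs_lift_scale E t0 scale0r addr0 scalerA s1 scale1r.
by [].
Qed.

End Lifts.

Section LiftFromLocal.
Context {R : realType} {m k : nat} {M : topologicalType} (f : M -> CP R m).
Context (N : nat) (B : 'M[R]_(N, m.+1 + m.+1)) (J : 'M[R]_N) (e be : R).
Context (a : 'rV[R]_(m.+1 + m.+1)) (mod : lift_model k B J e be a) (Psi : 'rV[R]_N -> M).

(** The point xi can be read off from the lift as be^-1 L B^T, so existence at each point already
    gives a smooth eta, provided that the sign s does not vary over U. *)
Lemma lift_from_local (P : local_param k f) (U : set 'rV[R]_k) (s : R) :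
  open U -> U `<=` dom P -> s * s = 1 ->
  (forall y, U y -> exists xi : 'rV[R]_N, [/\ dot xi xi = 1,
    fs_lift (chart P) s (immersion P y) = a + be *: (xi *m B) & Psi xi = par P y]) ->
  exists eta : 'rV[R]_k -> 'rV[R]_N,
   [/\ vsmooth U eta, forall y, U y -> dot (eta y) (eta y) = 1,
     forall y, U y -> fs_lift (chart P) s (immersion P y) = a + be *: (eta y *m B) &
     forall y, U y -> Psi (eta y) = par P y].
Proof.
move=> oU Ud s1 h; case: mod => -[BB aB _ _ be0] _.
pose L y := fs_lift (chart P) s (immersion P y).
have sL : vsmooth U L.
  by move=> b; exact: smooth_sub Ud (@vsmooth_unit_lift _ _ _ _ _ P s b).
have E y xi : L y = a + be *: (xi *m B) -> be^-1 *: (L y *m B^T) = xi.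
  move=> ->; rewrite mulmxDl aB add0r -scalemxAl -mulmxA BB mulmx1 scalerA mulVf// scale1r.
  by [].
exists (fun y => be^-1 *: (L y *m B^T)); split.
- move=> b; rewrite (_ : (fun y => _) = fun y => be^-1 * (L y *m B^T) 0 b); last first.
    by apply/funext => y; rewrite mxE.
  by apply: smooth_Z => //; exact: (vsmooth_mul B^T oU sL).
- by move=> y /h[xi [x1 /E -> _]].
- by move=> y /h[xi [x1 xE _]]; rewrite (E _ _ xE).
- by move=> y /h[xi [x1 /E -> px]].
Qed.

End LiftFromLocal.

Lemma normalize_homogeneous {R : realType} N (x : 'rV[R]_N) c : x != 0 -> 0 < c ->
  normalize 1 (c *: x) = normalize 1 x.
Proof.
move=> x0 c0; rewrite /normalize rpow_scale// scalerA; congr (_ *: _).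
by rewrite powRN powRr1 ?ltW// !mul1r mulrAC mulVf ?mul1r// gt_eqF.
Qed.

(** * Parametrizing an embedded model by its lifts *)

Section Embedded.
Context {R : realType} {m k : nat} {M : topologicalType} (f : M -> CP R m).
Context (fc : closed_submanifold k f) (finj : injective f).
Context (N : nat) (B : 'M[R]_(N, m.+1 + m.+1)) (J : 'M[R]_N) (e be : R).
Context (a : 'rV[R]_(m.+1 + m.+1)) (mod : lift_model k B J e be a).
Local Notation X := (model_lift B be a).

Lemma cplx_neq0 (x : 'rV[R]_(m.+1 + m.+1)) : x != 0 -> cplx x != 0.
Proof. by move=> x0; rewrite -realify_eq0 cplxK. Qed.

Lemma model_lift_scale (x : 'rV[R]_N) c : x != 0 -> 0 < c -> X (c *: x) = X x.
Proof. by move=> x0 c0; rewrite /model_lift normalize_homogeneous. Qed.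

Lemma exists_model_param : (0 < N)%N ->
  (forall q, range f q <-> exists2 x : 'rV[R]_N, x != 0 & is_class q (cplx (X x))) ->
  exists Psi : 'rV[R]_N -> M,
   (forall x : 'rV[R]_N, x != 0 -> is_class (f (Psi x)) (cplx (X x))) /\
   (forall p, exists2 x : 'rV[R]_N, x != 0 & Psi x = p).
Proof.
move=> N0 rf.
have key (x : 'rV[R]_N) : x != 0 -> exists p, is_class (f p) (cplx (X x)).
  move=> x0; have X0 := cplx_neq0 (model_lift_neq0 mod x0).
  have [p _ pE] : range f (mkCP X0) by apply/rf; exists x => //; exact: mkCP_class.
  by exists p; rewrite pE; exact: mkCP_class.
have /choice[Psi hPsi] : forall x, exists p, x != 0 -> is_class (f p) (cplx (X x)).
  move=> x; have [x0|] := boolP (x != 0); first by have [p] := key x x0; exists p.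
  (* At x = 0 any point of M will do; a nonzero vector, available since N > 0, shows that there is
     one. *)
  have [|p _] := key (const_mx 1); last by exists p.
  apply/eqP => /rowP/(_ (Ordinal N0)); rewrite !mxE => /eqP.
  by rewrite oner_eq0.
exists Psi; split=> // p.
have [x x0 hx] : exists2 x : 'rV[R]_N, x != 0 & is_class (f p) (cplx (X x)).
  by apply/rf; exists p.
by exists x => //; apply: finj; exact: is_class_inj (hPsi x x0) hx.
Qed.

Context (Psi : 'rV[R]_N -> M).
Context (PsiX : forall x : 'rV[R]_N, x != 0 -> is_class (f (Psi x)) (cplx (X x))).

Lemma embedded_projE (x : 'rV[R]_N) : x != 0 -> projCP (f (Psi x)) = proj (X x).
Proof. by move=> x0; rewrite (projCP_class (PsiX x0)) cplxK. Qed.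

Lemma embedded_scale (x : 'rV[R]_N) c : x != 0 -> 0 < c -> Psi (c *: x) = Psi x.
Proof.
move=> x0 c0; apply: finj; apply: is_class_inj (PsiX x0).
by rewrite -(model_lift_scale x0 c0); apply: PsiX; exact: scale_neq0.
Qed.

(* A continuous injection of a compact space into a Hausdorff space is closed. *)
Lemma embedded_continuous (x : 'rV[R]_N) : x != 0 -> {for x, continuous Psi}.
Proof.
move=> x0 A; rewrite nbhsE => -[V [oV Vx] VA].
pose g y := projCP (f y).
have cg : continuous g by move=> y; apply: continuous_mx => b c; exact: projCP_continuous fc.1 _.
have cK : compact (~` V).
  rewrite -(setTI (~` V)); apply: compact_closedI; first exact: fc.2.
  by rewrite closedC.
have clgK : closed (g @` (~` V)).
  apply: compact_closed; first exact: norm_hausdorff.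
  by apply: continuous_compact => //; exact: continuous_subspaceT.
have cX : {for x, continuous (fun y : 'rV[R]_N => proj (X y))}.
  apply: continuous_mx => b c.
  apply: (smooth_continuous (U := punctured N)) => //.
  apply: smooth_proj; first exact: open_punctured.
    exact: (vsmooth_model_lift B be a).
  exact: (model_lift_neq0 mod).
have ngx : (~` (g @` (~` V))) (proj (X x)).
  move=> [y nVy]; rewrite -(embedded_projE x0) => /projCP_inj/finj yE.
  by apply: nVy; rewrite yE.
have n1 : nbhs x ((fun y : 'rV[R]_N => proj (X y)) @^-1` (~` (g @` (~` V)))).
  by apply: cX; apply: open_nbhs_nbhs; split => //; rewrite openC.
have n2 : nbhs x (punctured N) by apply: open_nbhs_nbhs; split=> //; exact: open_punctured.
apply: filterS (filterI n1 n2) => y [h y0]; apply: VA; apply: contrapT => nVy; apply: h.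
by exists (Psi y) => //; exact: embedded_projE.
Qed.

End Embedded.

Section RealModel.
Context {R : realType} {m k N : nat} (B0 : 'M[R]_(N, m.+1)) (a0 : 'rV[R]_m.+1) (be : R).
Context (BB : B0 *m B0^T = 1%:M) (aB : a0 *m B0^T = 0) (be0 : be != 0) (kN : (k + 1 = N)%N).
Context (ab1 : dot a0 a0 + be ^+ 2 = 1).

Let B : 'M[R]_(N, m.+1 + m.+1) := row_mx B0 0.
Let a : 'rV[R]_(m.+1 + m.+1) := row_mx a0 0.

Definition real_lift (x : 'rV[R]_N) : 'rV[R]_m.+1 := a0 + be *: (normalize 1 x *m B0).

Lemma real_lift_model : lift_model k B 0 0 be a.
Proof.
have BJ (p : nat) (C : 'M[R]_(p, m.+1)) : row_mx C 0 *m Jmx *m B^T = 0.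
  rewrite mul_row_block tr_row_mx mul_row_col !mulmx0 !mul0mx !addr0 mul0mx add0r.
  by rewrite mulmx1 trmx0 mulmx0.
split; last by left; split=> //; exact: BJ.
split=> //.
- by rewrite tr_row_mx mul_row_col trmx0 mulmx0 addr0.
- by rewrite tr_row_mx mul_row_col trmx0 mulmx0 addr0.
- by rewrite trmx0 oppr0.
- by rewrite mul0mx raddf0 oppr0.
Qed.

Lemma model_real_lift x : model_lift B be a x = row_mx (real_lift x) 0.
Proof.
by rewrite /model_lift /real_lift mul_mx_row mulmx0 scale_row_mx scaler0 add_row_mx addr0.
Qed.

Lemma cplx_row_mx (v : 'rV[R]_m.+1) : cplx (row_mx v 0) = complexify v.
Proof. by apply/rowP => i; rewrite [LHS]mxE row_mxEl row_mxEr !mxE. Qed.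

Lemma dot_real_lift x : x != 0 -> dot (real_lift x) (real_lift x) = 1.
Proof.
move=> x0; rewrite /real_lift; set n := normalize 1 x.
have h1 : dot (n *m B0) a0 = 0 by rewrite dot_mul aB dot0r.
have h2 : dot (n *m B0) (n *m B0) = 1.
  by rewrite dot_mul -mulmxA BB mulmx1; exact: dot_normalize_sign (mulr1 1) x0.
rewrite !(dotDl, dotDr, dotZl, dotZr) (dotC a0 (n *m B0)) h1 h2 -[RHS]ab1; ring.
Qed.

(** Multiplying by the transpose of B0 isolates the spherical part, and the remainder compares a0
    with s a0. A sign -1 thus survives only if a0 = 0, which separates the extrinsic sphere from the
    real projective space. *)
Lemma real_lift_inj s x y : x != 0 -> y != 0 -> s * s = 1 -> real_lift y = s *: real_lift x ->
  (s = 1 \/ a0 = 0) /\ exists2 c, 0 < c & y = c *: (s *: x).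
Proof.
move=> x0 y0 s1 E; pose nx := normalize 1 x; pose ny := normalize 1 y.
have lB z : real_lift z *m B0^T = be *: normalize 1 z.
  by rewrite mulmxDl aB add0r -scalemxAl -mulmxA BB mulmx1.
have En : ny = s *: nx.
  apply: (scalerI be0); rewrite -lB E -scalemxAl lB !scalerA; congr (_ *: _); ring.
have Ea : a0 = s *: a0.
  move: E; rewrite /real_lift -/nx -/ny En scalerDr -!scalemxAl !scalerA (mulrC be s).
  by move/addIr.
split.
  have [->|sn] := eqVneq s 1; [by left|right].
  have : (1 - s) *: a0 = 0 by rewrite scalerBl scale1r -Ea subrr.
  by move/eqP; rewrite scaler_eq0 subr_eq0 eq_sym (negbTE sn) /= => /eqP.
exists (rpow 1 y * rpow (-1) x); first by rewrite mulr_gt0 ?rpow_gt0.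
have : rpow 1 y *: ny = y.
  by rewrite /ny /normalize scalerA mul1r -rpowD// addrN rpow0 scale1r.
move=> yE; rewrite -{1}yE En /nx /normalize !scalerA mul1r; congr (_ *: _); ring.
Qed.

(** The complex factor between two real vectors may be replaced by its real part, and unit length
    makes that a sign. *)
Lemma complexify_class (q : CP R m) (u v : 'rV[R]_m.+1) : is_class q (complexify u) ->
  is_class q (complexify v) -> dot u u = 1 -> dot v v = 1 -> exists2 s : R, s * s = 1 & v = s *: u.
Proof.
move=> hu hv u1 v1; have [c c0 E] := is_class_scale hu hv.
have Ev : v = complex.Re c *: u.
  apply/rowP => i; have /rowP/(_ i) := E; rewrite !mxE; case: (c) => p q' /= [-> _].
  by rewrite mulr0 subr0.
exists (complex.Re c) => //; move: v1; rewrite {1 2}Ev dotZl dotZr u1 mulr1.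
by [].
Qed.

End RealModel.

Lemma is_class_complexifyZ {R : realType} {m : nat} (q : CP R m) (c : R) (v : 'rV[R]_m.+1) :
  c != 0 -> is_class q (complexify v) -> is_class q (complexify (c *: v)).
Proof.
move=> c0 h; have -> : complexify (c *: v) = Complex c 0 *: complexify v.
  by apply/rowP => i; rewrite !mxE /GRing.mul /= !mul0r !mulr0 subr0 addr0.
by apply: is_classZ h; rewrite eq_complex /= eqxx andbT.
Qed.

(** * Real, spherical and complex submanifolds *)

Section RealCases.
Context {R : realType} {m k : nat} {M : topologicalType} (f : M -> CP R m) (k2 : (2 <= k)%N).

Lemma open_pos (D : set 'rV[R]_k) (g : 'rV[R]_k -> R) : open D -> smooth_on D g ->
  open (D `&` [set y | 0 < g y]).
Proof.
move=> oD sg; rewrite openE => y [Dy gy].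
have n1 : nbhs y D by exact: open_nbhs_nbhs.
have n2 : nbhs (g y) [set t : R | 0 < t] by apply: open_nbhs_nbhs; split=> //; exact: open_gt.
exact: (filterI n1 (smooth_continuous sg Dy n2)).
Qed.

Lemma normalize_scale N (x : 'rV[R]_N) : normalize 1 x = rpow (-1) x *: x.
Proof. by rewrite /normalize mul1r. Qed.

Section Data.
Context (B0 : 'M[R]_(k.+1, m.+1)) (a0 : 'rV[R]_m.+1) (be : R).
Context (BB : B0 *m B0^T = 1%:M) (aB : a0 *m B0^T = 0) (be0 : be != 0).
Context (ab1 : dot a0 a0 + be ^+ 2 = 1).
Let kN : (k + 1 = k.+1)%N := addn1 k.
Let mod := real_lift_model BB aB be0 kN.
Local Notation B := (row_mx B0 0 : 'M[R]_(k.+1, m.+1 + m.+1)).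
Local Notation a := (row_mx a0 0 : 'rV[R]_(m.+1 + m.+1)).
Local Notation X := (real_lift B0 a0 be).

(** Common to the double covering and the extrinsic sphere: a point of M determines its real lift
    itself and not only up to sign, so M is a round sphere. The second eigenfunction is a linear
    coordinate, with mu2 = k. The last hypothesis asks for a sign of the lift that is constant near
    each point. *)
Lemma real_sphere_eigenvalue (Psi : 'rV[R]_k.+1 -> M) : immersed_submanifold k f ->
  (forall x : 'rV[R]_k.+1, x != 0 -> is_class (f (Psi x)) (complexify (X x))) ->
  (forall (x : 'rV[R]_k.+1) (c : R), x != 0 -> 0 < c -> Psi (c *: x) = Psi x) ->
  (forall p : M, exists2 x : 'rV[R]_k.+1, x != 0 & Psi x = p) ->
  (forall x : 'rV[R]_k.+1, x != 0 -> {for x, continuous Psi}) ->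
  (forall x y : 'rV[R]_k.+1, x != 0 -> y != 0 -> Psi x = Psi y -> X x = X y) ->
  (forall (P : local_param k f) x, dom P x -> exists (U : set 'rV[R]_k) (s : R),
    [/\ open U, U x, U `<=` dom P, s * s = 1 & forall (y : 'rV[R]_k) (xi : 'rV[R]_k.+1),
      U y -> xi != 0 -> Psi xi = par P y ->
      fs_lift (chart P) s (immersion P y) = row_mx (X xi) 0]) ->
  is_nth_eigenvalue k f 2 0.
Proof.
move=> fi PsiC Psi_scale Psi_surj cPsi Psi_inj Psi_lift.
have PsiX (x : 'rV[R]_k.+1) : x != 0 -> is_class (f (Psi x)) (cplx (model_lift B be a x)).
  by move=> x0; rewrite model_real_lift cplx_row_mx; exact: PsiC.
have fiber (x y : 'rV[R]_k.+1) : x != 0 -> y != 0 -> Psi x = Psi y ->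
    exists2 c : R, 0 < c & y = c *: x.
  move=> x0 y0 h; have E : X y = 1 *: X x by rewrite scale1r (Psi_inj x y).
  have [_ [c c0 yE]] := real_lift_inj BB aB be0 x0 y0 (mulr1 1) E.
  by exists c => //; rewrite yE scale1r.
pose F2 (y : 'rV[R]_k.+1) := rpow (- 1) y * y 0 ord0.
have sF2 : smooth_on (punctured k.+1) F2 by apply: smooth_harmonic; exact: smooth_entry.
have e1 : k%:R = 1 * (1 + k.+1%:R - 2) :> R by rewrite -natr1; ring.
have hF2 : homogeneous 0 F2.
  have := homogeneousM (@homogeneous_rpow R k.+1 (- 1)) (@homogeneous_entry R k.+1 ord0).
  by rewrite addNr.
rewrite (_ : 0 = (k%:R - k%:R) / be ^+ 2); last by rewrite subrr mul0r.
apply: (second_eigenvalue fi mod (Psi := Psi) _ _ _ _ _ _ _ (F2 := F2)) => //.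
- by move=> x x0; rewrite (projCP_class (PsiX x x0)) cplxK.
- by move=> x t _; rewrite mulmx0 scaler0 addr0.
- move=> x y x0 y0 /(fiber x y x0 y0)[c c0 yE]; exists c, 1%:M.
  by split=> //; rewrite ?trmx1 ?mulmx1// => z _; rewrite mulmx1.
- move=> P x dx; have [U [s [oU Ux Ud s1 h]]] := Psi_lift P x dx.
  exists U, s; have [|eta [h1 h2 h3 h4]] := lift_from_local mod (Psi := Psi) oU Ud s1.
    move=> y Uy; have [z z0 zy] := Psi_surj (par P y).
    exists (normalize 1 z); split.
    - exact: dot_normalize_sign (mulr1 1) z0.
    - by rewrite (h y z Uy z0 zy) -model_real_lift.
    - by rewrite normalize_scale Psi_scale// rpow_gt0.
  by exists eta.
- by move=> x y x0 y0 /(fiber x y x0 y0)[c c0 ->]; rewrite (hF2 x c x0 c0) powRr0 mul1r.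
- move=> x x0; apply: (harmonic_eigen _ _ _ x0 e1); [exact: smooth_entry|exact: homogeneous_entry|].
  exact: lap_entry.
- exists (delta_mx 0 ord0), (- delta_mx 0 ord0).
  have d0 : delta_mx 0 ord0 != 0 :> 'rV[R]_k.+1.
    by apply/eqP => /rowP/(_ ord0); rewrite !mxE !eqxx => /eqP; rewrite oner_eq0.
  split=> //; first by rewrite oppr_eq0.
  rewrite /F2 /rpow dotNl dotNr opprK -/(rpow (- 1) _); have := @rpow_gt0 R _ (- 1) _ d0.
  move: (rpow _ _) => r r0; rewrite !mxE !eqxx /=; apply/eqP; lra.
- move=> F mu sF hF _ mu1 eF; apply: (eigen_below1 _ sF hF _ eF); first by rewrite ltnS.
  by rewrite -natr1 addrK.
Qed.

Lemma open_fs_lift_dot (P : local_param k f) (s : R) (w : 'rV[R]_(m.+1 + m.+1)) :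
  open (dom P `&` [set y | 0 < s * dot (fs_lift (chart P) 1 (immersion P y)) w]).
Proof.
have oP := @dom_open _ _ _ _ _ P.
apply: open_pos => //; apply: smooth_Z => //.
have sw : vsmooth (dom P) (fun=> w) by move=> b; exact: smooth_cst.
exact: (smooth_dot oP (@vsmooth_unit_lift _ _ _ _ _ P 1) sw).
Qed.

(** The offset a0 settles the sign: all lifts X have the same positive product with a0, so of two
    opposite unit vectors only one is a lift, and the sign of the normalized lift is read from its
    product with a0, locally constant by continuity. *)
Lemma extrinsic_sphere_eigenvalue : closed_submanifold k f -> injective f -> a0 != 0 ->
  (forall q, range f q <-> exists2 x : 'rV[R]_k.+1, x != 0 & is_class q (complexify (X x))) ->
  is_nth_eigenvalue k f 2 0.
Proof.
move=> fc finj a00 rf.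
have [|Psi [PsiX Psi_surj]] := exists_model_param (f := f) finj mod (ltn0Sn k).
  move=> q; split=> [/rf[x x0 hx]|[x x0 hx]].
    by exists x => //; rewrite model_real_lift cplx_row_mx.
  by apply/rf; exists x => //; move: hx; rewrite model_real_lift cplx_row_mx.
have PsiC (x : 'rV[R]_k.+1) : x != 0 -> is_class (f (Psi x)) (complexify (X x)).
  by move=> x0; have := PsiX x x0; rewrite model_real_lift cplx_row_mx.
have X1 (x : 'rV[R]_k.+1) : x != 0 -> dot (X x) (X x) = 1 by exact: dot_real_lift.
have da : 0 < dot a0 a0 by exact: dot_gt0.
have Xa x : dot (X x) a0 = dot a0 a0.
  by rewrite /real_lift dotDl dotZl dot_mul aB dot0r mulr0 addr0.
apply: (real_sphere_eigenvalue fc.1 PsiC) => //.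
- exact: (embedded_scale finj PsiX).
- exact: (embedded_continuous fc finj mod PsiX).
- move=> x y x0 y0 h; have hy := PsiC y y0; rewrite -h in hy.
  have [s s1 E] := complexify_class (PsiC x x0) hy (X1 x x0) (X1 y y0).
  have : dot (X y) a0 = s * dot (X x) a0 by rewrite E dotZl.
  rewrite !Xa => hs; have {}hs : s = 1.
    by apply: (mulIf (negbT (gt_eqF da))); rewrite mul1r -hs.
  by rewrite E hs scale1r.
- move=> P x dx.
  have lift y : dom P y -> exists s : R, [/\ s * s = 1,
      0 < s * dot (fs_lift (chart P) 1 (immersion P y)) a &
      forall xi : 'rV[R]_k.+1, xi != 0 -> Psi xi = par P y ->
        fs_lift (chart P) s (immersion P y) = row_mx (X xi) 0].
    move=> dy; have [z z0 zy] := Psi_surj (par P y).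
    have hz := PsiC z z0; rewrite zy in hz.
    have [s [s1 E _]] := fs_lift_real dy (X1 z z0) hz.
    exists s; split=> //.
      rewrite -dotZl -fs_lift_scale E dotE tr_row_mx mul_row_col mul0mx addr0 -dotE Xa.
      by [].
    move=> xi xi0 xiy; have hxi := PsiC xi xi0; rewrite xiy in hxi.
    have [t [t1 E' _]] := fs_lift_real dy (X1 xi xi0) hxi.
    have : t * s = 1.
      have : s *: fs_lift (chart P) t (immersion P y) = t *: fs_lift (chart P) s (immersion P y).
        by rewrite (fs_lift_scale _ t) (fs_lift_scale _ s) !scalerA (mulrC s).
      rewrite E E' !scale_row_mx => /eq_row_mx[h _].
      have : dot (s *: X xi) a0 = dot (t *: X z) a0 by rewrite h.
      rewrite !dotZl !Xa => hst.
      have -> : t = s by apply: (mulIf (negbT (gt_eqF da))); rewrite hst.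
      by [].
    move=> ts; have -> : s = t by rewrite -[s]mul1r -t1 -mulrA ts mulr1.
    by [].
  have [s [s1 sx h]] := lift x dx.
  exists (dom P `&` [set y | 0 < s * dot (fs_lift (chart P) 1 (immersion P y)) a]), s.
  split=> //; first exact: open_fs_lift_dot.
  move=> y xi [dy sy]; have [t [t1 ty ht]] := lift y dy.
  suff -> : s = t by exact: ht.
  move: sy ty => /=; move: (dot (fs_lift (chart P) 1 (immersion P y)) a) => d sy ty.
  have : (s - t) * (s + t) = 0 by have := s1; have := t1; lra.
  move=> /eqP; rewrite mulf_eq0 subr_eq0 addr_eq0 => /orP[/eqP//|/eqP st].
  by move: sy; rewrite st mulNr; lra.
Qed.

End Data.

(** Opposite vectors give the same point, so only even functions descend and linear ones are lost.
    The harmonic quadratic x_0 x_1, divided by |x|^2, realizes the first remaining value 2 (k +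
    1). *)
Lemma real_projective_eigenvalue (B0 : 'M[R]_(k.+1, m.+1)) : B0 *m B0^T = 1%:M ->
  closed_submanifold k f -> injective f ->
  (forall q, range f q <-> exists2 x : 'rV[R]_k.+1, x != 0 & is_class q (complexify (x *m B0))) ->
  is_nth_eigenvalue k f 2 (k%:R + 2).
Proof.
move=> BB fc finj rf.
have aB : (0 : 'rV[R]_m.+1) *m B0^T = 0 by rewrite mul0mx.
have ab1 : dot (0 : 'rV[R]_m.+1) 0 + 1 ^+ 2 = 1 by rewrite dot0l add0r expr1n.
have mod := real_lift_model BB aB (oner_neq0 R) (addn1 k).
pose X := real_lift B0 0 1.
have XE x : X x = rpow (-1) x *: (x *m B0).
  by rewrite /X /real_lift add0r scale1r normalize_scale -scalemxAl.
have r0 (x : 'rV[R]_k.+1) : x != 0 -> rpow (-1) x != 0 by move=> x0; rewrite gt_eqF ?rpow_gt0.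
have [|Psi [PsiX Psi_surj]] := exists_model_param (f := f) finj mod (ltn0Sn k).
  move=> q; split=> [/rf[x x0 hx]|[x x0]].
    by exists x => //; rewrite model_real_lift cplx_row_mx -/X XE; apply: is_class_complexifyZ; rewrite ?r0.
  rewrite model_real_lift cplx_row_mx -/X XE => hx; apply/rf; exists x => //.
  rewrite -[x *m B0]scale1r -(mulVf (r0 x x0)) -scalerA; apply: is_class_complexifyZ hx.
  by rewrite invr_eq0 r0.
have PsiC (x : 'rV[R]_k.+1) : x != 0 -> is_class (f (Psi x)) (complexify (X x)).
  by move=> x0; have := PsiX x x0; rewrite model_real_lift cplx_row_mx.
have X1 (x : 'rV[R]_k.+1) : x != 0 -> dot (X x) (X x) = 1 by exact: dot_real_lift.
have Psi_scale (x : 'rV[R]_k.+1) c : x != 0 -> 0 < c -> Psi (c *: x) = Psi x.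
  exact: (embedded_scale finj PsiX).
have Psi_sign (x : 'rV[R]_k.+1) s : x != 0 -> s * s = 1 -> Psi (s *: x) = Psi x.
  move=> x0 s1; have s0 : s != 0.
    by apply/eqP => h; move: s1; rewrite h mulr0 => /esym/eqP; rewrite oner_eq0.
  have sx0 : s *: x != 0 by rewrite scaler_eq0 negb_or s0.
  apply: finj; apply: is_class_inj (PsiC _ sx0) _.
  have -> : X (s *: x) = s *: X x; last by apply: is_class_complexifyZ => //; exact: PsiC.
  by rewrite !XE -scalemxAl !scalerA /rpow dotZl dotZr (mulrA s) s1 mul1r mulrC.
have fiber (x y : 'rV[R]_k.+1) : x != 0 -> y != 0 -> Psi x = Psi y ->
    exists (c s : R), [/\ 0 < c, s * s = 1 & y = c *: (s *: x)].
  move=> x0 y0 h; have hy := PsiC y y0; rewrite -h in hy.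
  have [s s1 E] := complexify_class (PsiC x x0) hy (X1 x x0) (X1 y y0).
  have [_ [c c0 yE]] := real_lift_inj BB aB (oner_neq0 R) x0 y0 s1 E.
  by exists c, s.
pose i1 : 'I_k.+1 := inord 1.
have i01 : (ord0 : 'I_k.+1) != i1.
  by apply/eqP => /(congr1 val) /=; rewrite inordK// ltnW.
pose G (y : 'rV[R]_k.+1) := y 0 ord0 * y 0 i1.
pose F2 (y : 'rV[R]_k.+1) := rpow (- (1 + 1)) y * G y.
have sG : smooth_on (punctured k.+1) G.
  by apply: smooth_M; [exact: open_punctured|exact: smooth_entry|exact: smooth_entry].
have hG : homogeneous (1 + 1) G := homogeneousM (@homogeneous_entry R k.+1 ord0) (@homogeneous_entry R k.+1 i1).
have sF2 : smooth_on (punctured k.+1) F2 by exact: smooth_harmonic.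
have e1 : 2 * k.+1%:R = (1 + 1) * ((1 + 1) + k.+1%:R - 2) :> R by ring.
have hF2 : homogeneous 0 F2.
  have := homogeneousM (@homogeneous_rpow R k.+1 (- (1 + 1))) hG.
  by rewrite addNr.
rewrite (_ : k%:R + 2 = (2 * k.+1%:R - k%:R) / 1 ^+ 2); last by rewrite -natr1; field.
have X0 (x : 'rV[R]_k.+1) : x != 0 -> - x != 0 by rewrite oppr_eq0.
have F2s (x : 'rV[R]_k.+1) s : s * s = 1 -> F2 (s *: x) = F2 x.
  move=> s1; rewrite /F2 /G /rpow dotZl dotZr (mulrA s) s1 mul1r; congr (_ * _).
  by rewrite !mxE mulrACA s1 mul1r.
apply: (second_eigenvalue fc.1 mod (Psi := Psi) _ _ _ _ _ _ _ (F2 := F2)) => //.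
- by move=> x x0; rewrite (projCP_class (PsiX x x0)) cplxK.
- by move=> x t _; rewrite mulmx0 scaler0 addr0.
- exact: (embedded_continuous fc finj mod PsiX).
- move=> x y x0 y0 /(fiber x y x0 y0)[c [s [c0 s1 yE]]]; exists c, s%:M.
  split=> //; first by rewrite tr_scalar_mx -scalar_mxM s1.
    by rewrite mul_mx_scalar.
  by move=> z z0; rewrite mul_mx_scalar Psi_sign.
(* Since the offset is 0, the sign of the lift can be moved into eta, so the sign 1 serves on the
   whole domain. *)
- move=> P x dx; have oP := @dom_open _ _ _ _ _ P.
  exists (dom P), 1; have [|eta [h1 h2 h3 h4]] := lift_from_local mod (Psi := Psi) oP (@subset_refl _ (dom P)) (mulr1 1).
    move=> y dy; have [z z0 zy] := Psi_surj (par P y).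
    have hz := PsiC z z0; rewrite zy in hz.
    have [s [s1 E _]] := fs_lift_real dy (X1 z z0) hz.
    have n0 : normalize 1 z != 0 by apply: unit_neq0; exact: dot_normalize_sign (mulr1 1) z0.
    exists (s *: normalize 1 z); split.
    - by rewrite dotZl dotZr mulrA s1 mul1r; exact: dot_normalize_sign (mulr1 1) z0.
    - have -> : fs_lift (chart P) 1 (immersion P y) = s *: row_mx (X z) 0.
        by rewrite -E (fs_lift_scale _ s) scalerA s1 scale1r.
      rewrite row_mx0 add0r scale1r mul_mx_row mulmx0 scale_row_mx scaler0 XE normalize_scale.
      by rewrite -!scalemxAl.
    - by rewrite Psi_sign// normalize_scale Psi_scale// rpow_gt0.
  by exists eta; split; [split=> //; exact: mulr1|split].
- move=> x y x0 y0 /(fiber x y x0 y0)[c [s [c0 s1 ->]]].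
  rewrite hF2//; first by rewrite powRr0 mul1r F2s.
  by rewrite scaler_eq0 negb_or x0 andbT; apply: contra_eqN s1 => /eqP ->; rewrite mulr0 eq_sym oner_eq0.
- move=> x x0; apply: (harmonic_eigen sG hG _ x0 e1).
  exact: lap_entryM.
(* The quadratic vanishes at e_0 and not at e_0 + e_1. *)
- pose d1 : 'rV[R]_k.+1 := delta_mx 0 ord0; pose d2 : 'rV[R]_k.+1 := d1 + delta_mx 0 i1.
  have e0 : d1 0 ord0 = 1 by rewrite mxE !eqxx.
  have e2 : d2 0 ord0 = 1 by rewrite mxE e0 mxE (negbTE i01) andbF addr0.
  have e3 : d2 0 i1 = 1 by rewrite mxE !mxE !eqxx eq_sym (negbTE i01) andbF add0r.
  have e4 : d1 0 i1 = 0 by rewrite mxE eq_sym (negbTE i01) andbF.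
  have n1 (d : 'rV[R]_k.+1) : d 0 ord0 = 1 -> d != 0.
    by move=> h; apply/eqP => d0; move/eqP: h; rewrite d0 mxE eq_sym oner_eq0.
  exists d1, d2; split; [exact: n1|exact: n1|].
  have := @rpow_gt0 R _ (- (1 + 1)) _ (n1 d2 e2).
  by rewrite /F2 /G e0 e2 e3 e4 !mulr1 !mulr0; move: (rpow _ d2) => r pr; rewrite lt_eqF.
- move=> F mu sF hF FP mu1 eF; apply: (eigen_below2 _ sF hF _ mu1 eF); first by rewrite ltnS.
  move=> x x0; apply: FP => //; first exact: X0.
  by rewrite -scaleN1r Psi_sign// mulrNN mulr1.
Qed.

End RealCases.

(** * Standard subspaces and the double covering *)

Section Standard.
Context {R : realType} {m k : nat} (km : (k <= m)%N).

Definition incl : 'M[R]_(k.+1, m.+1) := pid_mx k.+1.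

Lemma incl_unitary : incl *m incl^T = 1%:M.
Proof. by rewrite tr_pid_mx mul_pid_mx minnn (minn_idPr _) ?pid_mx_1. Qed.

Lemma incl_supp (x : 'rV[R]_k.+1) (i : 'I_m.+1) : (k < i)%N -> (x *m incl) 0 i = 0.
Proof.
move=> ki; rewrite mxE big1// => j _; rewrite mxE; case: eqP => [ji|_]; last by rewrite mulr0.
by have := ltn_ord j; rewrite ji ltnS leqNgt ki.
Qed.

Lemma inclK (v : 'rV[R]_m.+1) : (forall i : 'I_m.+1, (k < i)%N -> v 0 i = 0) ->
  v *m incl^T *m incl = v.
Proof.
move=> hv; rewrite -mulmxA tr_pid_mx mul_pid_mx !minnn.
apply/rowP => i; rewrite mxE (bigD1 i)//= big1 => [|j ji]; last first.
  by rewrite mxE (_ : (j == i :> nat) = false) ?mulr0//; exact: negbTE ji.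
rewrite mxE eqxx ltnS addr0; case: leqP => [_|ki]; first by rewrite mulr1.
by rewrite mulr0 hv.
Qed.

Lemma standard_RPE (q : CP R m) : standard_RP k q <->
  exists2 x : 'rV[R]_k.+1, x != 0 & is_class q (complexify (x *m incl)).
Proof.
split=> [[v [v0 hv hq]]|[x x0 hq]].
  exists (v *m incl^T); last by rewrite inclK.
  by apply: contraNneq v0 => h; rewrite -(inclK hv) h mul0mx.
exists (x *m incl); split=> //; last by move=> i; exact: incl_supp.
by apply: contraNneq x0 => h; rewrite -[x]mulmx1 -incl_unitary mulmxA h mul0mx.
Qed.

Lemma standard_sphereE (v : 'rV[R]_m.+1) : standard_sphere k v <->
  dot v v = 1 /\ forall i : 'I_m.+1, (k < i)%N -> v 0 i = 0.
Proof.
Transparent dot.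
have -> : dot v v = \sum_i v 0 i ^+ 2 by apply: eq_bigr => i _; rewrite expr2.
by [].
Opaque dot.
Qed.

(** Its image in M will be a closed set to be avoided: off it, the j-th coordinate of the covering
    vector has the sign of s. *)
Lemma compact_half_sphere (j : 'I_m.+1) (s : R) :
  compact [set v : 'rV[R]_m.+1 | standard_sphere k v /\ s * v 0 j <= 0].
Proof.
(* A sum of squares that vanishes exactly on the sphere, so that membership becomes a single closed
   inequality. *)
pose phi (v : 'rV[R]_m.+1) := (\sum_i v 0 i * v 0 i - 1) * (\sum_i v 0 i * v 0 i - 1)
  + \sum_(i < m.+1 | (k < i)%N) v 0 i * v 0 i.
have oT := @openT 'rV[R]_m.+1.
have sM i : smooth_on setT (fun v : 'rV[R]_m.+1 => v 0 i * v 0 i).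
  by apply: smooth_M => //; exact: smooth_entry.
have sphi : smooth_on setT phi.
  have s1 : smooth_on setT (fun v : 'rV[R]_m.+1 => \sum_i v 0 i * v 0 i - 1).
    by apply: smooth_B => //; [apply: smooth_sum => // i _|exact: smooth_cst].
  by apply: smooth_D => //; [exact: smooth_M|apply: smooth_sum => // i _].
have sl : smooth_on setT (fun v : 'rV[R]_m.+1 => s * v 0 j).
  by apply: smooth_Z => //; exact: smooth_entry.
have phi0 v : standard_sphere k v <-> phi v <= 0.
  have q0 i : 0 <= v 0 i * v 0 i by rewrite -expr2 sqr_ge0.
  have E : \sum_i v 0 i ^+ 2 = \sum_i v 0 i * v 0 i by apply: eq_bigr => i _; rewrite expr2.
  rewrite /standard_sphere /= E /phi; split=> [[-> h]|h].
    by rewrite subrr mul0r add0r big1// => i /h ->; rewrite mul0r.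
  have a0 : 0 <= (\sum_i v 0 i * v 0 i - 1) * (\sum_i v 0 i * v 0 i - 1).
    by rewrite -expr2 sqr_ge0.
  have b0 : 0 <= \sum_(i < m.+1 | (k < i)%N) v 0 i * v 0 i by exact: sumr_ge0.
  have h1 : (\sum_i v 0 i * v 0 i - 1) * (\sum_i v 0 i * v 0 i - 1) = 0 by lra.
  have h2 : \sum_(i < m.+1 | (k < i)%N) v 0 i * v 0 i = 0 by lra.
  split; first by move/eqP: h1; rewrite mulf_eq0 orbb subr_eq0 => /eqP.
  by move=> i ki; have /eqP := psumr_eq0P (fun i _ => q0 i) h2 ki; rewrite mulf_eq0 orbb => /eqP.
have -> : [set v : 'rV[R]_m.+1 | standard_sphere k v /\ s * v 0 j <= 0] =
    [set v : 'rV[R]_m.+1 | forall i, `[-1, 1]%classic (v ord0 i)] `&`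
    (phi @^-1` [set t | t <= 0] `&` (fun v : 'rV[R]_m.+1 => s * v 0 j) @^-1` [set t | t <= 0]).
  apply/seteqP; split=> [v [/phi0 h1 h2]|v [_ [/phi0 h1 h2]]] //; split=> // i /=.
  have /phi0[E _] := h1; have : v 0 i ^+ 2 <= 1.
    by rewrite -E (bigD1 i)//= lerDl sumr_ge0// => l _; rewrite sqr_ge0.
  by rewrite in_itv /= expr2; move: (v 0 i) => t; nra.
apply: compact_closedI; first exact: (@rV_compact R m.+1 (fun=> `[-1, 1]%classic) (fun=> @segment_compact R _ _)).
apply: closedI.
  by apply: (preimage_closed _ (@closed_le _ 0)) => y _; exact: smooth_continuous sphi I.
by apply: (preimage_closed _ (@closed_le _ 0)) => y _; exact: smooth_continuous sl I.
Qed.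

End Standard.

Section DoubleCover.
Context {R : realType} {m k : nat} {M : topologicalType} (f : M -> CP R m).
Context (k2 : (2 <= k)%N) (km : (k <= m)%N).

(** The map f does not distinguish antipodal points, so the sign of the lift has to be read on M
    itself, through h. *)
Theorem double_cover_eigenvalue : immersed_submanifold k f -> is_double_cover k f ->
  is_nth_eigenvalue k f 2 0.
Proof.
move=> fi [h [ch bh hf]]; have [_ hi hs] := bh.
pose B0 := @incl R m k.
have BB : B0 *m B0^T = 1%:M by exact: incl_unitary.
have aB : (0 : 'rV[R]_m.+1) *m B0^T = 0 by rewrite mul0mx.
have ab1 : dot (0 : 'rV[R]_m.+1) 0 + 1 ^+ 2 = 1 by rewrite dot0l add0r expr1n.
pose X := real_lift B0 0 1.
have XE x : X x = normalize 1 x *m B0 by rewrite /X /real_lift add0r scale1r.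
have X1 (x : 'rV[R]_k.+1) : x != 0 -> dot (X x) (X x) = 1 by exact: dot_real_lift.
have XS (x : 'rV[R]_k.+1) : x != 0 -> standard_sphere k (X x).
  by move=> x0; apply/standard_sphereE; split; [exact: X1|move=> i; rewrite XE; exact: incl_supp].
have Psi_inj (x y : 'rV[R]_k.+1) : x != 0 -> y != 0 -> h (X x) = h (X y) -> X x = X y.
  by move=> x0 y0; apply: hi; rewrite inE; exact: XS.
have surj p : exists2 z : 'rV[R]_k.+1, z != 0 & h (X z) = p.
  have [v Sv <-] := hs p I; have [v1 hv] := (standard_sphereE v).1 Sv.
  have vE : v *m B0^T *m B0 = v by exact: inclK.
  have n1 : dot (v *m B0^T) (v *m B0^T) = 1 by rewrite dot_mul trmxK vE.
  exists (v *m B0^T); first exact: unit_neq0.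
  by rewrite XE normalize_scale rpow_unit// scale1r vE.
apply: (real_sphere_eigenvalue k2 BB aB (oner_neq0 R) (Psi := h \o X) fi) => //.
- by move=> x x0; apply: hf; exact: XS.
- by move=> x c x0 c0; rewrite /= !XE normalize_homogeneous.
- move=> x x0 A nA.
  have cX : {for x, continuous X}.
    apply: continuous_mx => b c; rewrite (ord1 b).
    apply: (smooth_continuous (U := punctured k.+1)) => //.
    rewrite (_ : (fun y => _) = fun y => (normalize 1 y *m B0) 0 c); last first.
      by apply/funext => y; rewrite XE.
    apply: vsmooth_mul; first exact: open_punctured.
    exact: (@vsmooth_normalize R _ _ _ (@open_punctured R k.+1) id 1 (@vsmooth_id R _ _) (fun x x0 => x0)).
  have nS : nbhs (X x) [set v | standard_sphere k v -> A (h v)].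
    exact: ((subspace_continuousP _ _).1 ch (X x) (XS x x0) A nA).
  have n1 : nbhs x [set y | standard_sphere k (X y) -> A (h (X y))] := cX _ nS.
  have n2 : nbhs x (punctured k.+1) by apply: open_nbhs_nbhs; split=> //; exact: open_punctured.
  have n3 : nbhs x [set y | A (h (X y))].
    by apply: filterS (filterI n1 n2) => y [hy y0]; apply: hy; exact: XS.
  exact: n3.
- move=> P x dx; pose j := chart P.
  have lift y xi : dom P y -> xi != 0 -> h (X xi) = par P y -> exists s : R, [/\ s * s = 1,
      fs_lift j s (immersion P y) = row_mx (X xi) 0 & 0 < s * X xi 0 j].
    move=> dy xi0 xiy; have hxi := hf _ (XS xi xi0); rewrite xiy in hxi.
    exact: fs_lift_real dy (X1 xi xi0) hxi.
  have [z z0 zx] := surj (par P x); have [s [s1 Es sj]] := lift x z dx z0 zx.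
  (* Vectors that would give the lift a sign other than s. Their image in M is compact, hence
     closed, and misses the point at hand; on the rest of the domain the sign is constantly s. *)
  pose K := [set v : 'rV[R]_m.+1 | standard_sphere k v /\ s * v 0 j <= 0].
  have clK : closed (h @` K).
    apply: compact_closed; first exact: fi.1.
    apply: continuous_compact; last exact: compact_half_sphere.
    by apply: continuous_subspaceW ch => v [].
  have oP := @dom_open _ _ _ _ _ P.
  exists (dom P `&` par P @^-1` (~` (h @` K))), s; split=> //.
  + rewrite openE => y [dy nK].
    have cy : {for y, continuous (par P)}.
      by have := @par_continuous _ _ _ _ _ P; rewrite continuous_open_subspace//; apply; rewrite inE.
    have n1 : nbhs y (dom P) by exact: open_nbhs_nbhs.
    have n2 : nbhs (par P y) (~` (h @` K)) by apply: open_nbhs_nbhs; split=> //; exact: closed_openC.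
    have n3 : nbhs y (par P @^-1` (~` (h @` K))) := cy _ n2.
    exact: filterI n1 n3.
  + split=> //= -[v [Sv sv]]; rewrite -zx => /hi hv.
    by move: sv; rewrite hv ?inE//; [rewrite leNgt sj|exact: XS].
  + move=> y xi [dy nK] xi0 xiy; have [t [t1 Et tj]] := lift y xi dy xi0 xiy.
    suff -> : s = t by [].
    have sxi : 0 < s * X xi 0 j.
      rewrite ltNge; apply/negP => hle; apply: nK; exists (X xi) => //.
      by split=> //; exact: XS.
    have : (s - t) * (s + t) = 0 by have := s1; have := t1; lra.
    move=> /eqP; rewrite mulf_eq0 subr_eq0 addr_eq0 => /orP[/eqP//|/eqP st].
    by move: sxi; rewrite st mulNr; lra.
Qed.

End DoubleCover.

(** * Complex projective subspaces *)

Section ComplexCase.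
Context {R : realType} {m l : nat} {M : topologicalType} (f : M -> CP R m).
Context (l1 : (1 <= l)%N) (lm : (l <= m)%N).
Local Notation k := (2 * l)%N.
Local Notation N := (l.+1 + l.+1)%N.
Local Notation J := (@Jmx R l).

Definition cincl : 'M[R]_(N, m.+1 + m.+1) := block_mx incl 0 0 incl.
Local Notation B := cincl.

Lemma cinclJ : B *m Jmx = J *m B.
Proof.
rewrite /B /Jmx !mulmx_block !mul0mx !mulmx0 !mulmxN !mulNmx !mulmx1 !mul1mx !addr0 !add0r.
by rewrite ?oppr0 ?addr0 ?add0r.
Qed.

Lemma cincl_model : lift_model k B J 1 1 0.
Proof.
have II : @incl R m l *m incl^T = 1%:M by exact: incl_unitary.
split; last first.
  by right; split=> //; [rewrite mul2n -addnn addn2 addSn addnS|exact: cinclJ].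
split=> //.
- by rewrite /B tr_block_mx mulmx_block !trmx0 !mul0mx !mulmx0 !addr0 !add0r II -scalar_mx_block.
- by rewrite mul0mx.
- exact: JmxT.
- exact: JmxJ.
Qed.
Let mod := cincl_model.
Let BB : B *m B^T = 1%:M. Proof. by case: mod => -[]. Qed.

Lemma cplx_comb n (s t : R) (v : 'rV[R]_(n.+1 + n.+1)) :
  cplx (s *: v + t *: (v *m Jmx)) = Complex s t *: cplx v.
Proof. by apply: (can_inj realifyK); rewrite cplxK realifyZ cplxK. Qed.

Lemma cplxZ n (s : R) (v : 'rV[R]_(n.+1 + n.+1)) : cplx (s *: v) = Complex s 0 *: cplx v.
Proof. by rewrite -cplx_comb scale0r addr0. Qed.

Lemma cincl_supp (x : 'rV[R]_N) (i : 'I_m.+1) : (l < i)%N -> cplx (x *m B) 0 i = 0.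
Proof.
move=> li; rewrite mxE -[x]hsubmxK mul_row_block !mulmx0 addr0 add0r row_mxEl row_mxEr.
by rewrite !incl_supp.
Qed.

Lemma cinclK (z : 'rV[R[i]]_m.+1) : (forall i : 'I_m.+1, (l < i)%N -> z 0 i = 0) ->
  realify z *m B^T *m B = realify z.
Proof.
move=> hz; rewrite tr_block_mx !trmx0 /realify !mul_row_block !mulmx0 !addr0 !add0r.
by congr row_mx; apply: inclK => // i li; rewrite mxE hz.
Qed.

Lemma standard_CPE (q : CP R m) : standard_CP l q <->
  exists2 x : 'rV[R]_N, x != 0 & is_class q (cplx (x *m B)).
Proof.
split=> [hq|[x x0 hx] z].
  pose z := vpick (val q); have hz : is_class q z := is_class_pick q.
  have z0 := is_class_neq0 hz.
  have E : realify z *m B^T *m B = realify z by apply: cinclK => i; apply: hq; exact: memv_pick.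
  exists (realify z *m B^T); last by rewrite E realifyK.
  by apply: contraNneq z0 => h; rewrite -realify_eq0 -E h mul0mx.
rewrite hx => /vlineP[c ->] i li; by rewrite mxE cincl_supp// mulr0.
Qed.

(** Functions on CP^l are invariant under unit complex numbers, in particular even. Here N = 2 l + 2
    = k + 2, so the first even value 2 N gives 2 N - k = k + 4; it has to be attained by a
    phase-invariant function. *)
Lemma complex_projective_eigenvalue : closed_submanifold k f -> injective f ->
  range f = standard_CP l -> is_nth_eigenvalue k f 2 (k%:R + 4).
Proof.
move=> fc finj rf.
pose X := model_lift B 1 0.
have XE x : X x = rpow (-1) x *: (x *m B).
  by rewrite /X /model_lift add0r scale1r normalize_scale -scalemxAl.
have r0 (x : 'rV[R]_N) : x != 0 -> rpow (-1) x != 0 by move=> x0; rewrite gt_eqF ?rpow_gt0.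
have complex0 (s : R) : s != 0 -> Complex s 0 != 0 by rewrite eq_complex /= eqxx andbT.
have classX (q : CP R m) (x : 'rV[R]_N) : x != 0 ->
    is_class q (cplx (X x)) <-> is_class q (cplx (x *m B)).
  move=> x0; rewrite XE cplxZ; split=> h; last exact/is_classZ/h/complex0/r0.
  have := is_classZ (complex0 _ (invr_neq0 (r0 x x0))) h.
  by rewrite -cplxZ -cplxZ scalerA mulVf ?r0// scale1r.
have N0 : (0 < N)%N by rewrite addSn.
have [|Psi [PsiX Psi_surj]] := exists_model_param (f := f) finj mod N0.
  move=> q; rewrite rf; apply: iff_trans (standard_CPE q) _.
  by split=> -[x x0 /(classX q x x0) h]; exists x.
have PsiB (x : 'rV[R]_N) : x != 0 -> is_class (f (Psi x)) (cplx (x *m B)).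
  by move=> x0; apply/classX => //; exact: PsiX.
have comb_neq0 (x : 'rV[R]_N) (s t : R) : x != 0 -> Complex s t != 0 -> s *: x + t *: (x *m J) != 0.
  move=> x0 st; rewrite -[_ + _]cplxK realify_eq0 cplx_comb scaler_eq0 negb_or st.
  exact: cplx_neq0.
have Psi_comb (x : 'rV[R]_N) (s t : R) : x != 0 -> Complex s t != 0 ->
    Psi (s *: x + t *: (x *m J)) = Psi x.
  move=> x0 st; apply: finj; apply: is_class_inj (PsiB _ (comb_neq0 x s t x0 st)) _.
  rewrite mulmxDl -!scalemxAl -mulmxA -cinclJ mulmxA cplx_comb.
  exact: is_classZ (PsiB x x0).
have Psi_scale (x : 'rV[R]_N) c : x != 0 -> 0 < c -> Psi (c *: x) = Psi x.
  exact: (embedded_scale finj PsiX).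
have st0 (s t : R) : s ^+ 2 + t ^+ 2 = 1 -> Complex s t != 0.
  move=> st; apply/eqP => -[s0 t0]; move: st; rewrite s0 t0 expr0n addr0 => /eqP.
  by rewrite eq_sym oner_eq0.
have dot_comb n (x : 'rV[R]_(n.+1 + n.+1)) (s t : R) :
    dot (s *: x + t *: (x *m Jmx)) (s *: x + t *: (x *m Jmx)) = (s ^+ 2 + t ^+ 2) * dot x x.
  rewrite !(dotDl, dotDr, dotZl, dotZr) (dotJJ JmxT JmxJ) (dotC (x *m Jmx)) (dotJ_self JmxT).
  ring.
have n1 (x : 'rV[R]_N) : x != 0 -> dot (normalize 1 x) (normalize 1 x) = 1.
  by move=> x0; exact: dot_normalize_sign (mulr1 1) x0.
have Xn x : X x = normalize 1 x *m B by rewrite /X /model_lift add0r scale1r.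
have X1 (x : 'rV[R]_N) : x != 0 -> dot (X x) (X x) = 1.
  by move=> x0; rewrite Xn dot_mul -mulmxA BB mulmx1 n1.
have XJ x (s t : R) : s *: X x + t *: (X x *m Jmx) =
    (s *: normalize 1 x + t *: (normalize 1 x *m J)) *m B.
  by rewrite !Xn mulmxDl -!scalemxAl -!mulmxA cinclJ.
have fiber (x y : 'rV[R]_N) : x != 0 -> y != 0 -> Psi x = Psi y ->
    exists (c s t : R), [/\ 0 < c, s ^+ 2 + t ^+ 2 = 1 & y = c *: (s *: x + t *: (x *m J))].
  move=> x0 y0 h; have hy := PsiX y y0; rewrite -h in hy.
  have [[s t] _] := is_class_scale (PsiX x x0) hy; rewrite -cplx_comb => /(can_inj cplxK) E.
  have st : s ^+ 2 + t ^+ 2 = 1.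
    by have := X1 y y0; rewrite -/X in E; rewrite E dot_comb X1// mulr1.
  have En : normalize 1 y = s *: normalize 1 x + t *: (normalize 1 x *m J).
    have : normalize 1 y *m B *m B^T = (s *: normalize 1 x + t *: (normalize 1 x *m J)) *m B *m B^T.
      by congr (_ *m _); rewrite -XJ -Xn -E.
    by rewrite -!mulmxA BB !mulmx1.
  exists (rpow 1 y * rpow (-1) x), s, t; split=> //; first by rewrite mulr_gt0 ?rpow_gt0.
  have yE : rpow 1 y *: normalize 1 y = y.
    by rewrite normalize_scale scalerA -rpowD// addrN rpow0 scale1r.
  rewrite -{1}yE En !normalize_scale -scalemxAl !scalerA (mulrC s) (mulrC t) -!scalerA.
  by rewrite -scalerDr.
pose L (i : 'I_l.+1) : 'I_N := lshift l.+1 i.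
pose r (i : 'I_l.+1) : 'I_N := rshift l.+1 i.
pose i1 : 'I_l.+1 := inord 1.
have i01 : (ord0 : 'I_l.+1) != i1.
  by apply/eqP => /(congr1 val) /=; rewrite inordK.
have L01 : L ord0 != L i1 by apply: contraNneq i01 => /lshift_inj ->.
have r01 : r ord0 != r i1 by apply: contraNneq i01 => /rshift_inj ->.
(* This is Re (z_0 conj(z_1)), harmonic and invariant under z |-> (s + i t) z with s^2 + t^2 = 1. *)
pose G (y : 'rV[R]_N) := y 0 (L ord0) * y 0 (L i1) + y 0 (r ord0) * y 0 (r i1).
pose F2 (y : 'rV[R]_N) := rpow (- (1 + 1)) y * G y.
have oP := @open_punctured R N.
have sM (i j : 'I_N) : smooth_on (punctured N) (fun y : 'rV[R]_N => y 0 i * y 0 j).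
  by apply: smooth_M => //; exact: smooth_entry.
have sG : smooth_on (punctured N) G by apply: smooth_D.
have hG : homogeneous (1 + 1) G.
  move=> x c x0 c0.
  have h i j := homogeneousM (@homogeneous_entry R N i) (@homogeneous_entry R N j) x0 c0.
  by rewrite /G mulrDr -!h.
have lG (x : 'rV[R]_N) : x != 0 -> lap G x = 0.
  move=> x0; rewrite (lapD oP (sM _ _) (sM _ _) x0) !lap_entryM ?addr0//.
have sF2 : smooth_on (punctured N) F2 by exact: smooth_harmonic.
have e1 : 2 * N%:R = (1 + 1) * ((1 + 1) + N%:R - 2) :> R by ring.
have hF2 : homogeneous 0 F2.
  have := homogeneousM (@homogeneous_rpow R N (- (1 + 1))) hG.
  by rewrite addNr.
have F2s (x : 'rV[R]_N) s t : s ^+ 2 + t ^+ 2 = 1 -> F2 (s *: x + t *: (x *m J)) = F2 x.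
  move=> st; rewrite /F2 /rpow dot_comb st mul1r; congr (_ * _).
  have El i : (s *: x + t *: (x *m J)) 0 (L i) = s * x 0 (L i) - t * x 0 (r i).
    by rewrite [LHS]mxE mxE [X in _ + X]mxE mulJl mulrN.
  have Er i : (s *: x + t *: (x *m J)) 0 (r i) = s * x 0 (r i) + t * x 0 (L i).
    by rewrite [LHS]mxE mxE [X in _ + X]mxE mulJr.
  rewrite /G !El !Er -[RHS]mul1r -st.
  by move: (x 0 (L ord0)) (x 0 (L i1)) (x 0 (r ord0)) (x 0 (r i1)) => p q p' q'; ring.
rewrite (_ : k%:R + 4 = (2 * N%:R - k%:R) / 1 ^+ 2); last first.
  by rewrite (natrD _ l.+1 l.+1) (natrM _ 2 l) -natr1; field.
apply: (second_eigenvalue fc.1 mod (Psi := Psi) _ _ _ _ _ _ _ (F2 := F2)) => //.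
- by move=> x x0; rewrite (projCP_class (PsiX x x0)) cplxK.
- move=> x t x0; rewrite -[x in x + _]scale1r Psi_comb//.
  by apply/eqP => -[/eqP]; rewrite oner_eq0.
- exact: (embedded_continuous fc finj mod PsiX).
(* Multiplication by the unit complex number s + i t is the orthogonal matrix s + t J. *)
- move=> x y x0 y0 /(fiber x y x0 y0)[c [s [t [c0 st yE]]]]; exists c, (s%:M + t *: J).
  have TE (z : 'rV[R]_N) : z *m (s%:M + t *: J) = s *: z + t *: (z *m J).
    by rewrite mulmxDr mul_mx_scalar -scalemxAr.
  split=> //; last 2 first.
  + by rewrite TE.
  + by move=> z z0; rewrite TE Psi_comb// st0.
  have -> : (s%:M + t *: J)^T = s%:M - t *: J.
    by rewrite linearD /= tr_scalar_mx [(t *: J)^T]linearZ /= JmxT scalerN.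
  have JJ : t *: J *m (t *: J) = - (t ^+ 2)%:M.
    by rewrite -scalemxAl -scalemxAr JmxJ scalerA -expr2 scalerN scale_scalar_mx mulr1.
  rewrite mulmxDl !mulmxBr JJ mul_scalar_mx mul_mx_scalar mul_scalar_mx opprK.
  by rewrite scale_scalar_mx addrA subrK -expr2 -raddfD st.
- move=> P x dx; have oD := @dom_open _ _ _ _ _ P.
  exists (dom P), 1; have [|eta [h1 h2 h3 h4]] := lift_from_local mod (Psi := Psi) oD (@subset_refl _ (dom P)) (mulr1 1).
    move=> y dy; have [z z0 zy] := Psi_surj (par P y).
    have hz := PsiX z z0; rewrite zy in hz.
    have [s [t [st E]]] := fs_lift_phase dy (X1 z z0) hz.
    have nz : normalize 1 z != 0 by apply: unit_neq0; exact: n1.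
    exists (s *: normalize 1 z + t *: (normalize 1 z *m J)); split.
    - by rewrite dot_comb st mul1r n1.
    - by rewrite E XJ add0r scale1r.
    - by rewrite Psi_comb ?st0// normalize_scale Psi_scale// rpow_gt0.
  by exists eta; split; [split=> //; exact: mulr1|split].
- move=> x y x0 y0 /(fiber x y x0 y0)[c [s [t [c0 st ->]]]].
  by rewrite hF2 ?comb_neq0 ?st0// powRr0 mul1r F2s.
- by move=> x x0; apply: (harmonic_eigen sG hG _ x0 e1); exact: lG.
- pose d1 : 'rV[R]_N := delta_mx 0 (L ord0); pose d2 : 'rV[R]_N := d1 + delta_mx 0 (L i1).
  have Lr i j : (r i == L j) = false by rewrite eq_rlshift.
  have e0 : d1 0 (L ord0) = 1 by rewrite mxE !eqxx.
  have e2 : d2 0 (L ord0) = 1 by rewrite mxE e0 mxE (negbTE L01) andbF addr0.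
  have e3 : d2 0 (L i1) = 1 by rewrite mxE !mxE !eqxx (eq_sym (L i1)) (negbTE L01) andbF add0r.
  have e4 : d1 0 (L i1) = 0 by rewrite mxE (eq_sym (L i1)) (negbTE L01) andbF.
  have e5 i : d1 0 (r i) = 0 by rewrite mxE Lr andbF.
  have e6 i : d2 0 (r i) = 0 by rewrite mxE e5 mxE Lr andbF addr0.
  have nz (d : 'rV[R]_N) : d 0 (L ord0) = 1 -> d != 0.
    by move=> h; apply/eqP => d0; move/eqP: h; rewrite d0 mxE eq_sym oner_eq0.
  exists d1, d2; split; [exact: nz|exact: nz|].
  have := @rpow_gt0 R _ (- (1 + 1)) _ (nz d2 e2).
  rewrite /F2 /G e0 e2 e3 e4 !e5 !e6 !mulr1 !mulr0 !addr0 mulr0 mulr1; move: (rpow _ d2) => q pq.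
  by rewrite lt_eqF.
- move=> F mu sF hF FP mu1 eF; apply: (eigen_below2 _ sF hF _ mu1 eF).
    by rewrite addSn addnS !ltnS addn_gt0 l1.
  (* Evenness is invariance under the phase -1. *)
  move=> x x0; apply: FP => //; first by rewrite oppr_eq0.
  have := Psi_comb x (-1) 0 x0; rewrite scale0r addr0 scaleN1r; apply.
  by apply/eqP => -[/eqP]; rewrite oppr_eq0 oner_eq0.
Qed.

End ComplexCase.

(** * Distance in real projective space *)

Section ProjectorDerivative.
Context {R : realType} {m : nat}.
Implicit Types A Z V : 'rV[R]_(m.+1 + m.+1).
Local Notation j x := (x *m Jmx).

(* The derivative of proj at Z in the direction V. *)
Definition dproj Z V : 'M[R]_(m.+1 + m.+1) := \matrix_(a, b)
  ((V 0 a * Z 0 b + Z 0 a * V 0 b + j V 0 a * j Z 0 b + j Z 0 a * j V 0 b) / dot Z Z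
  - (Z 0 a * Z 0 b + j Z 0 a * j Z 0 b) * (2 * dot V Z) / dot Z Z ^+ 2).

Definition hor Z V := V - (dot V Z / dot Z Z) *: Z - (dot V (j Z) / dot Z Z) *: j Z.

Definition qform A (Q : 'M[R]_(m.+1 + m.+1)) : R := (A *m Q *m A^T) 0 0.

Lemma outerE (x y : 'rV[R]_(m.+1 + m.+1)) a b : (x^T *m y) a b = x 0 a * y 0 b.
Proof. by rewrite mxE big_ord1 mxE. Qed.

Lemma mulJJ (x : 'rV[R]_(m.+1 + m.+1)) : j (j x) = - x.
Proof. by rewrite -mulmxA JmxJ mulmxN mulmx1. Qed.

Lemma lincombE (x y z : 'rV[R]_(m.+1 + m.+1)) (s t : R) a :
  (x - s *: y - t *: z) 0 a = x 0 a - s * y 0 a - t * z 0 a.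
Proof. by rewrite !mxE. Qed.

Lemma addmxE (p q : nat) (x y : 'M[R]_(p, q)) a b : (x + y) a b = x a b + y a b.
Proof. by rewrite mxE. Qed.

Lemma hor_ortho Z V : Z != 0 -> dot (hor Z V) Z = 0 /\ dot (hor Z V) (j Z) = 0.
Proof.
move=> /dot_gt0 n0; rewrite /hor !dotBl !dotZl (dotJJ JmxT JmxJ) (dotC (j Z)) (dotJ_self JmxT).
by rewrite mul1r mulr0 subr0 !mulfVK ?gt_eqF// subrr mulr0 subr0 subrr.
Qed.

Lemma dot_hor Z V : Z != 0 -> dot (hor Z V) (hor Z V) =
  dot V V - dot V Z * dot V Z / dot Z Z - dot V (j Z) * dot V (j Z) / dot Z Z.
Proof.
move=> Z0; have [h1 h2] := hor_ortho V Z0.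
rewrite {2}/hor !dotBr !dotZr h1 h2 !mulr0 !subr0 /hor !dotBl !dotZl !(dotC _ V).
by rewrite (mulrAC (dot V Z)) (mulrAC (dot V (j Z))).
Qed.

(** The projector does not change along Z and J Z, so only the horizontal part of V contributes. *)
Lemma dprojE Z V : Z != 0 -> let h := hor Z V in dproj Z V =
  (dot Z Z)^-1 *: (h^T *m Z + Z^T *m h + (j h)^T *m j Z + (j Z)^T *m j h).
Proof.
move=> /dot_gt0 n0 h; apply/matrixP => a b; rewrite mxE [RHS]mxE !addmxE !outerE.
have -> : j h = j V - (dot V Z / dot Z Z) *: j Z - (- (dot V (j Z) / dot Z Z)) *: Z.
  by rewrite /h /hor !mulmxBl -!scalemxAl mulJJ scalerN scaleNr.
rewrite /h /hor !lincombE.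
move: (dot Z Z) n0 (dot V Z) (dot V (j Z)) (V 0 a) (V 0 b) (Z 0 a) (Z 0 b) (j V 0 a) (j V 0 b) (j Z 0 a) (j Z 0 b).
by move=> n n0 v w Va Vb Za Zb Va' Vb' Za' Zb'; field; rewrite gt_eqF.
Qed.

Lemma tr_outer (x y z w : 'rV[R]_(m.+1 + m.+1)) :
  \tr (x^T *m y *m (z^T *m w)^T) = dot y w * dot x z.
Proof.
rewrite trmx_mul trmxK mulmxA -(mulmxA x^T) mul_trmx mul_mx_scalar -scalemxAl mxtraceZ.
by rewrite mxtrace_mulC mul_trmx mxtrace_scalar (dotC x) mulr1n.
Qed.

(** Four outer products, mutually orthogonal and each of squared norm |h|^2 |Z|^2, make up the
    derivative. This is the origin of the factor 4 between the squared speed of the projector and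
    that of the curve. *)
Lemma dproj_sqnorm Z V : Z != 0 ->
  \sum_a \sum_b dproj Z V a b ^+ 2 = 4 * (dot (hor Z V) (hor Z V) / dot Z Z).
Proof.
move=> Z0; have [h1 h2] := hor_ortho V Z0; have /= E := dprojE V Z0.
move: (hor Z V) h1 h2 E => h h1 h2 E; have n0 := dot_gt0 Z0.
have -> : \sum_a \sum_b dproj Z V a b ^+ 2 = \tr (dproj Z V *m (dproj Z V)^T).
  by apply: eq_bigr => a _; rewrite [RHS]mxE; apply: eq_bigr => b _; rewrite [X in _ = _ * X]mxE expr2.
rewrite E [(_ *: _)^T]linearZ /= -scalemxAl -scalemxAr !mxtraceZ.
have trD (P Q : 'M[R]_(m.+1 + m.+1)) : (P + Q)^T = P^T + Q^T by rewrite linearD.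
rewrite !trD !(mulmxDl, mulmxDr) !mxtraceD !tr_outer.
have z1 : dot Z (j Z) = 0 by exact: dotJ_self JmxT Z.
have h3 : dot h (j h) = 0 by exact: dotJ_self JmxT h.
have e1 : dot Z h = 0 by rewrite dotC.
have e2 : dot (j Z) h = 0 by rewrite dotC.
have e3 : dot (j h) h = 0 by rewrite dotC.
have e4 : dot (j Z) Z = 0 by rewrite dotC.
have e5 : dot (j h) Z = 0 by rewrite (dotJ JmxT) h2 oppr0.
have e6 : dot Z (j h) = 0 by rewrite dotC.
have e7 : dot (j h) (j Z) = 0 by rewrite (dotJJ JmxT JmxJ) mul1r.
have e8 : dot (j Z) (j h) = 0 by rewrite dotC.
have e9 x : dot (j x) (j x) = dot x x by rewrite (dotJJ JmxT JmxJ) mul1r.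
rewrite !(h1, h2, z1, h3, e1, e2, e3, e4, e5, e6, e7, e8, e9).
by field; rewrite gt_eqF.
Qed.

Lemma qform_outer A (x y : 'rV[R]_(m.+1 + m.+1)) : qform A (x^T *m y) = dot A x * dot A y.
Proof. by rewrite /qform mulmxA -mulmxA !mul_trmx -scalar_mxM mxE (dotC y). Qed.

Lemma qformD A Q Q' : qform A (Q + Q') = qform A Q + qform A Q'.
Proof. by rewrite /qform mulmxDr mulmxDl mxE. Qed.

Lemma qformZ A c Q : qform A (c *: Q) = c * qform A Q.
Proof. by rewrite /qform -scalemxAr -scalemxAl mxE. Qed.

Lemma qform_proj A Z : qform A (proj Z) = (dot A Z ^+ 2 + dot A (j Z) ^+ 2) / dot Z Z.
Proof. by rewrite /proj qformZ qformD !qform_outer mulrC !expr2. Qed.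

(* Bessel's inequality for the orthogonal vectors Z, JZ, h, Jh. *)
Lemma bessel A Z h : dot A A = 1 -> Z != 0 -> dot h Z = 0 -> dot h (j Z) = 0 ->
  dot A h ^+ 2 + dot A (j h) ^+ 2 <= dot h h * (1 - qform A (proj Z)).
Proof.
move=> A1 Z0 h1 h2; have n0 := dot_gt0 Z0.
have [->|hn] := eqVneq h 0; first by rewrite mul0mx !dot0r mul0r expr0n addr0.
have H0 := dot_gt0 hn.
have z1 : dot Z (j Z) = 0 by exact: dotJ_self JmxT Z.
have h3 : dot h (j h) = 0 by exact: dotJ_self JmxT h.
have e1 : dot Z h = 0 by rewrite dotC.
have e2 : dot (j Z) h = 0 by rewrite dotC.
have e3 : dot (j h) h = 0 by rewrite dotC.
have e4 : dot (j Z) Z = 0 by rewrite dotC.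
have e5 : dot (j h) Z = 0 by rewrite (dotJ JmxT) h2 oppr0.
have e6 : dot Z (j h) = 0 by rewrite dotC.
have e7 : dot (j h) (j Z) = 0 by rewrite (dotJJ JmxT JmxJ) mul1r.
have e8 : dot (j Z) (j h) = 0 by rewrite dotC.
have e9 x : dot (j x) (j x) = dot x x by rewrite (dotJJ JmxT JmxJ) mul1r.
pose X := A - (dot A Z / dot Z Z) *: Z - (dot A (j Z) / dot Z Z) *: j Z
  - (dot A h / dot h h) *: h - (dot A (j h) / dot h h) *: j h.
have : 0 <= dot X X by exact: dot_ge0.
have -> : dot X X = 1 - qform A (proj Z) - (dot A h ^+ 2 + dot A (j h) ^+ 2) / dot h h.
  rewrite qform_proj /X !(dotBl, dotBr, dotZl, dotZr).
  rewrite (dotC Z A) (dotC (j Z) A) (dotC h A) (dotC (j h) A).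
  rewrite !(h1, h2, z1, h3, e1, e2, e3, e4, e5, e6, e7, e8, e9) A1.
  by move: (dot Z Z) (dot h h) (dot A Z) (dot A (j Z)) (dot A h) (dot A (j h)) n0 H0 => n H p q u v n0 H0; field; rewrite !gt_eqF.
by rewrite subr_ge0 ler_pdivrMr// mulrC.
Qed.

(** With y the value of the form at the projector, Cauchy-Schwarz separates the components of A
    along Z, J Z, whose squares sum to |Z|^2 y, from those along h, J h, which Bessel bounds by
    |h|^2 (1 - y). The factor y (1 - y) is exactly what the derivative of arccos (sqrt y)
    compensates. *)
Lemma dproj_bound A Z V : dot A A = 1 -> Z != 0 -> qform A (dproj Z V) ^+ 2 <=
  4 * (qform A (proj Z) * (1 - qform A (proj Z))) * (dot (hor Z V) (hor Z V) / dot Z Z).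
Proof.
move=> A1 Z0; set y := qform A (proj Z); have [h1 h2] := hor_ortho V Z0; have /= E := dprojE V Z0.
move: (hor Z V) h1 h2 E => h h1 h2 E; have n0 := dot_gt0 Z0.
have hB := bessel A1 Z0 h1 h2; rewrite -/y in hB.
rewrite E qformZ !qformD !qform_outer.
have yE : y = (dot A Z ^+ 2 + dot A (j Z) ^+ 2) / dot Z Z by exact: qform_proj.
move: (dot A h) (dot A (j h)) (dot A Z) (dot A (j Z)) (dot h h) (dot Z Z) n0 hB yE => p q u w H n n0 hB yE.
have yn : u ^+ 2 + w ^+ 2 = n * y by rewrite yE; field; rewrite gt_eqF.
have CS : (p * u + q * w) ^+ 2 <= (p ^+ 2 + q ^+ 2) * (u ^+ 2 + w ^+ 2).
  by rewrite -subr_ge0 (_ : _ - _ = (p * w - q * u) ^+ 2) ?sqr_ge0//; ring.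
have y0 : 0 <= y by rewrite yE divr_ge0 ?addr_ge0 ?sqr_ge0// ltW.
have le1 : (p * u + q * w) ^+ 2 <= H * (1 - y) * (n * y).
  by apply: le_trans CS _; rewrite yn ler_wpM2r// mulr_ge0// ltW.
rewrite (_ : (n^-1 * _) ^+ 2 = 4 / n ^+ 2 * (p * u + q * w) ^+ 2); last by field; rewrite gt_eqF.
rewrite (_ : 4 * (y * (1 - y)) * (H / n) = 4 / n ^+ 2 * (H * (1 - y) * (n * y))); last by field; rewrite gt_eqF.
by rewrite ler_wpM2l// divr_ge0 ?exprn_ge0 ?ltW.
Qed.

End ProjectorDerivative.

(** * Functions of one variable of class C^1 on a set *)

Section C1on.
Context {R : realType}.
Implicit Types (I : set R) (f g : R -> R).

Definition C1on I f : Prop :=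
  forall s, I s -> derivable f s 1 /\ {for s, continuous (derive1 f)}.

Lemma is_derive_derive1 f (s : R) : derivable f s 1 -> is_derive s 1 f (derive1 f s).
Proof. by move=> df; rewrite derive1E; apply: DeriveDef. Qed.

Lemma derive1_val f (s d : R) : is_derive s 1 f d -> derive1 f s = d.
Proof. by move=> h; rewrite derive1E (@derive_val _ _ _ _ _ _ _ h). Qed.

Lemma C1on_derive I f g : open I -> (forall s, I s -> is_derive s 1 f (g s)) ->
  (forall s, I s -> {for s, continuous g}) -> C1on I f.
Proof.
move=> oI fg cg s Is; split; first by have := fg s Is; case.
have E u : I u -> derive1 f u = g u by move=> /fg; exact: derive1_val.
move=> A; rewrite (E s Is) => nA.
have n1 : nbhs s (g @^-1` A) := cg s Is A nA.
have n2 : nbhs s I by exact: open_nbhs_nbhs.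
have n3 : nbhs s [set u | A (derive1 f u)].
  by apply: filterS (filterI n1 n2) => u [gu Iu] /=; rewrite E.
exact: n3.
Qed.

Lemma C1on_is_derive I f (s : R) : C1on I f -> I s -> is_derive s 1 f (derive1 f s).
Proof. by move=> h /h[d _]; exact: is_derive_derive1. Qed.

Lemma derivable_continuous f (s : R) : derivable f s 1 -> {for s, continuous f}.
Proof. by move=> /derivable1_diffP; exact: differentiable_continuous. Qed.

Lemma C1on_continuous I f s : C1on I f -> I s -> {for s, continuous f}.
Proof. by move=> h /h[d _]; exact: derivable_continuous. Qed.

Lemma C1on_eq I f g : open I -> (forall s, I s -> f s = g s) -> C1on I f -> C1on I g.
Proof.
move=> oI fg cf; apply: (@C1on_derive I g (derive1 f)) => // [s Is|s /cf[]//].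
have := C1on_is_derive cf Is; apply: near_eq_is_derive.
have n2 : nbhs s I by exact: open_nbhs_nbhs.
by apply: filterS n2 => u /fg.
Qed.

Lemma C1on_sub I I' f : I' `<=` I -> C1on I f -> C1on I' f.
Proof. by move=> h cf s /h/cf. Qed.

Lemma C1on_cst I c : open I -> C1on I (fun=> c).
Proof.
by move=> oI; apply: (@C1on_derive I _ (fun=> 0)) => // s _; exact: cst_continuous.
Qed.

Lemma C1on_D I f g : open I -> C1on I f -> C1on I g -> C1on I (fun s => f s + g s).
Proof.
move=> oI cf cg; apply: (@C1on_derive I _ (fun s => derive1 f s + derive1 g s)) => // s Is.
  exact: is_deriveD (C1on_is_derive cf Is) (C1on_is_derive cg Is).
exact: cvgD (cf s Is).2 (cg s Is).2.
Qed.

Lemma C1on_M I f g : open I -> C1on I f -> C1on I g -> C1on I (fun s => f s * g s).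
Proof.
move=> oI cf cg.
apply: (@C1on_derive I _ (fun s => f s * derive1 g s + g s * derive1 f s)) => // s Is.
  exact: is_deriveM (C1on_is_derive cf Is) (C1on_is_derive cg Is).
apply: cvgD; apply: cvgM.
- exact: C1on_continuous cf Is.
- exact: (cg s Is).2.
- exact: C1on_continuous cg Is.
- exact: (cf s Is).2.
Qed.

Lemma C1on_Z I c f : open I -> C1on I f -> C1on I (fun s => c * f s).
Proof. by move=> oI cf; apply: C1on_M => //; exact: C1on_cst. Qed.

Lemma C1on_N I f : open I -> C1on I f -> C1on I (fun s => - f s).
Proof.
move=> oI cf; apply: (@C1on_eq I (fun s => -1 * f s)) => //; last exact: C1on_Z.
by move=> s _; rewrite mulN1r.
Qed.

Lemma C1on_V I f : open I -> (forall s, I s -> f s != 0) -> C1on I f -> C1on I (fun s => (f s)^-1).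
Proof.
move=> oI f0 cf.
have cV s : I s -> {for s, continuous (fun s => (f s)^-1)}.
  by move=> Is; apply: cvgV; [exact: f0|exact: C1on_continuous cf Is].
apply: (@C1on_derive I _ (fun s => - ((f s)^-1 * (f s)^-1) * derive1 f s)) => // s Is.
  have d := (cf s Is).1; apply: DeriveDef; first exact: derivableV (f0 s Is) d.
  by rewrite (deriveV (f0 s Is) d) derive1E -expr2 exprVn.
apply: cvgM; last exact: (cf s Is).2.
by apply: cvgN; apply: cvgM; exact: cV.
Qed.

Lemma C1on_sum I (J : Type) (r : seq J) (f : J -> R -> R) : open I -> (forall a, C1on I (f a)) ->
  C1on I (fun s => \sum_(a <- r) f a s).
Proof.
move=> oI cf; elim: r => [|a r ih].
  by apply: (@C1on_eq I (fun=> 0)) => //; [move=> s _; rewrite big_nil|exact: C1on_cst].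
apply: (@C1on_eq I (fun s => f a s + \sum_(a <- r) f a s)) => //; last exact: C1on_D.
by move=> s _; rewrite big_cons.
Qed.

Lemma continuous_bigsum (J : Type) (r : seq J) (f : J -> R -> R) (s : R) :
  (forall a, {for s, continuous (f a)}) -> {for s, continuous (fun u => \sum_(a <- r) f a u)}.
Proof.
move=> cf; elim: r => [|a r ih].
  by rewrite (_ : (fun u => _) = cst 0); [exact: cst_continuous|apply/funext => u; rewrite big_nil].
rewrite (_ : (fun u => _) = fun u => f a u + \sum_(a <- r) f a u).
  exact: cvgD (cf a) ih.
by apply/funext => u; rewrite big_cons.
Qed.

Lemma is_derive_bigsum (J : Type) (r : seq J) (f : J -> R -> R) (d : J -> R) (s : R) :
  (forall a, is_derive s 1 (f a) (d a)) ->
  is_derive s 1 (fun s => \sum_(a <- r) f a s) (\sum_(a <- r) d a).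
Proof.
move=> h; elim: r => [|a r ih].
  rewrite big_nil (_ : (fun s => _) = cst 0); first exact: is_derive_cst.
  by apply/funext => u; rewrite big_nil.
rewrite big_cons (_ : (fun s => _) = (f a + (fun s => \sum_(a <- r) f a s))); first exact: is_deriveD.
by apply/funext => u; rewrite big_cons.
Qed.

Lemma is_derive_div (f g : R -> R) (df dg s : R) : g s != 0 -> is_derive s 1 f df ->
  is_derive s 1 g dg -> is_derive s 1 (fun s => f s / g s) (df / g s - f s * dg / g s ^+ 2).
Proof.
move=> g0 hf hg.
have hV : is_derive s 1 (fun s => (g s)^-1) (- dg / g s ^+ 2).
  have dg' : derivable g s 1 by case: hg.
  apply: DeriveDef; first exact: derivableV g0 dg'.
  rewrite (deriveV g0 dg') (@derive_val _ _ _ _ _ _ _ hg) scaleNr mulNr; congr (- _).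
  exact: mulrC.
apply: is_derive_eq (is_deriveM hf hV) _.
rewrite /GRing.scale /=; by field.
Qed.

Lemma derivable_div (f g : R -> R) (s : R) : g s != 0 -> derivable f s 1 -> derivable g s 1 ->
  derivable (fun s => f s / g s) s 1.
Proof.
move=> g0 df dg.
by have [] := is_derive_div g0 (is_derive_derive1 df) (is_derive_derive1 dg).
Qed.

End C1on.

(** * The speed of a curve in terms of its projectors *)

Section Speed.
Context {R : realType} {m : nat}.
Local Notation RV := 'rV[R]_(m.+1 + m.+1).
Local Notation j x := (x *m Jmx).

Lemma is_derive_mulJ (Z : R -> RV) (V : RV) (s : R) a :
  (forall b, is_derive s 1 (fun u => Z u 0 b) (V 0 b)) ->
  is_derive s 1 (fun u => j (Z u) 0 a) (j V 0 a).
Proof.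
move=> h; case: (split_ordP a) => i ->.
  rewrite mulJl (_ : (fun u => _) = fun u => - Z u 0 (rshift m.+1 i)); first exact: is_deriveN.
  by apply/funext => u; rewrite mulJl.
rewrite mulJr (_ : (fun u => _) = fun u => Z u 0 (lshift m.+1 i)); first exact: h.
by apply/funext => u; rewrite mulJr.
Qed.

Lemma is_derive_sqn (Z : R -> RV) (V : RV) (s : R) :
  (forall b, is_derive s 1 (fun u => Z u 0 b) (V 0 b)) ->
  is_derive s 1 (fun u => dot (Z u) (Z u)) (2 * dot V (Z s)).
Proof.
Transparent dot.
move=> h; rewrite /dot mulr_sumr; apply: is_derive_bigsum => b.
apply: is_derive_eq (is_deriveM (h b) (h b)) _.
by rewrite /GRing.scale /=; ring.
Opaque dot.
Qed.

Lemma is_derive_proj (Z : R -> RV) (V : RV) (s : R) a b :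
  (forall b, is_derive s 1 (fun u => Z u 0 b) (V 0 b)) -> Z s != 0 ->
  is_derive s 1 (fun u => proj (Z u) a b) (dproj (Z s) V a b).
Proof.
move=> h Z0; have hJ c := is_derive_mulJ c h.
rewrite (_ : (fun u => _) = fun u => (Z u 0 a * Z u 0 b + j (Z u) 0 a * j (Z u) 0 b) / dot (Z u) (Z u)); last first.
  by apply/funext => u; rewrite projE.
have n0 : dot (Z s) (Z s) != 0 by rewrite gt_eqF// dot_gt0.
have hn := is_deriveD (is_deriveM (h a) (h b)) (is_deriveM (hJ a) (hJ b)).
apply: is_derive_eq (is_derive_div n0 hn (is_derive_sqn h)) _.
rewrite /dproj [RHS]mxE /GRing.scale /=.
congr (_ / _ - _ / _).
by ring.
Qed.

Lemma C1on_proj (I : set R) (Z : R -> RV) a b : open I -> (forall b, C1on I (fun u => Z u 0 b)) ->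
  (forall s, I s -> Z s != 0) -> C1on I (fun u => proj (Z u) a b).
Proof.
move=> oI h Z0.
have hJ c : C1on I (fun u => j (Z u) 0 c).
  case: (split_ordP c) => i ->.
    apply: (@C1on_eq _ I (fun u => - Z u 0 (rshift m.+1 i))) => //; last exact: C1on_N.
    by move=> u _; rewrite mulJl.
  apply: (@C1on_eq _ I (fun u => Z u 0 (lshift m.+1 i))) => // u _.
  by rewrite mulJr.
have hn : C1on I (fun u => dot (Z u) (Z u)).
Transparent dot.
  by apply: C1on_sum => // c; apply: C1on_M.
Opaque dot.
apply: (@C1on_eq _ I (fun u => (Z u 0 a * Z u 0 b + j (Z u) 0 a * j (Z u) 0 b) * (dot (Z u) (Z u))^-1)) => //.
  by move=> u _; rewrite projE.
have hP : C1on I (fun u => Z u 0 a * Z u 0 b + j (Z u) 0 a * j (Z u) 0 b).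
  exact: C1on_D oI (C1on_M oI (h a) (h b)) (C1on_M oI (hJ a) (hJ b)).
apply: (C1on_M oI hP).
by apply: C1on_V => // s Is; rewrite gt_eqF// dot_gt0// Z0.
Qed.

Lemma zlift_entry i (w : 'rV[R]_(m + m)) b :
  zlift i w 0 b = zlift i 0 0 b + \sum_a w 0 a * zdir i (delta_mx 0 a) 0 b.
Proof.
by rewrite zliftE mxE zdirE summxE; congr (_ + _); apply: eq_bigr => a _; rewrite [LHS]mxE.
Qed.

Lemma is_derive_zlift i (w : R -> 'rV[R]_(m + m)) (v : 'rV[R]_(m + m)) (s : R) b :
  (forall a, is_derive s 1 (fun u => w u 0 a) (v 0 a)) ->
  is_derive s 1 (fun u => zlift i (w u) 0 b) (zdir i v 0 b).
Proof.
move=> h; rewrite (_ : (fun u => _) = fun u => zlift i 0 0 b +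
    \sum_a w u 0 a * zdir i (delta_mx 0 a) 0 b); last by apply/funext => u; rewrite zlift_entry.
have hS : is_derive s 1 (fun u => \sum_a w u 0 a * zdir i (delta_mx 0 a) 0 b)
    (\sum_a v 0 a * zdir i (delta_mx 0 a) 0 b).
  apply: is_derive_bigsum => a.
  apply: is_derive_eq (is_deriveM (h a) (is_derive_cst (zdir i (delta_mx 0 a) 0 b : R) s 1)) _.
  by rewrite scaler0 add0r /GRing.scale /= mulrC.
apply: is_derive_eq (is_deriveD (is_derive_cst (zlift i 0 0 b : R) s 1) hS) _.
by rewrite add0r zdirE summxE; apply: eq_bigr => a _; rewrite [RHS]mxE.
Qed.

Lemma C1on_zlift (I : set R) i (w : R -> 'rV[R]_(m + m)) b : open I ->
  (forall a, C1on I (fun u => w u 0 a)) -> C1on I (fun u => zlift i (w u) 0 b).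
Proof.
move=> oI h; apply: (@C1on_eq _ I (fun u => zlift i 0 0 b +
    \sum_a w u 0 a * zdir i (delta_mx 0 a) 0 b)) => //.
  by move=> u _; rewrite -zlift_entry.
apply: C1on_D => //; first exact: C1on_cst.
by apply: C1on_sum => // a; apply: C1on_M => //; exact: C1on_cst.
Qed.

Lemma fs_chart_sqnorm i (w v : 'rV[R]_(m + m)) : (v *m fs_chart i w *m v^T) 0 0 =
  dot (hor (zlift i w) (zdir i v)) (hor (zlift i w) (zdir i v)) / dot (zlift i w) (zlift i w).
Proof.
set Z := zlift i w; have Z0 : Z != 0 := zlift_neq0 i w.
pose D : 'M[R]_(m + m, m.+1 + m.+1) := \matrix_a zdir i (delta_mx 0 a).
have DE : v *m D = zdir i v.
  by rewrite zdirE mulmx_sum_row; apply: eq_bigr => a _; rewrite rowK.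
have -> : fs_chart i w = (dot Z Z)^-1 *: (D *m D^T - (dot Z Z)^-1 *: ((D *m Z^T) *m (D *m Z^T)^T)
    - (dot Z Z)^-1 *: ((D *m (j Z)^T) *m (D *m (j Z)^T)^T)).
  have op (x : RV) a b : ((D *m x^T) *m (D *m x^T)^T) a b =
      dot (zdir i (delta_mx 0 a)) x * dot (zdir i (delta_mx 0 b)) x.
    by rewrite mxE big_ord1 mulmx_trmx_row [X in _ * X]mxE mulmx_trmx_row !rowK.
  have opp (X Y : 'M[R]_(m + m)) a b : (X - Y) a b = X a b - Y a b by rewrite !mxE.
  have opZ (c : R) (X : 'M[R]_(m + m)) a b : (c *: X) a b = c * X a b by rewrite mxE.
  apply/matrixP => a b; rewrite [LHS]mxE fubini_studyE; last by rewrite -realify_eq0.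
  rewrite opZ !opp !opZ !op -dot_row !rowK -/(zlift i w) -/Z -/(zdir i _) -/(zdir i _).
  rewrite [LHS]mulrC; congr (_ * (_ - _ - _)); exact: mulrC.
have tE (x : RV) : v *m (D *m x^T *m (D *m x^T)^T) *m v^T = (dot (zdir i v) x ^+ 2)%:M.
  rewrite trmx_mul trmxK !mulmxA DE -(mulmxA _ D^T) -trmx_mul DE mul_trmx -mulmxA mul_trmx.
  by rewrite -scalar_mxM (dotC x) expr2.
have tD : v *m (D *m D^T) *m v^T = (dot (zdir i v) (zdir i v))%:M.
  by rewrite !mulmxA DE -mulmxA -trmx_mul DE mul_trmx.
rewrite -scalemxAr -scalemxAl !mulmxBr !mulmxBl -!scalemxAr -!scalemxAl !tE tD dot_hor//.
rewrite !mxE /= !mulr1n -!expr2 [LHS]mulrC; congr ((_ - _ - _) / _); exact: mulrC.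
Qed.

Definition proj_curve (gamma : R -> CP R m) a b (s : R) : R := projCP (gamma s) a b.

Lemma chart_atP (p : CP R m) : in_chart (chart_at p) p.
Proof.
rewrite /chart_at; case: pickP => [//|h]; have [i hi] := exists_chart p.
by rewrite h in hi.
Qed.

(** [speed] is computed in a chart that may jump with t. The chart stays valid near t because a
    diagonal entry of the projector remains nonzero, and the result mentions only the derivative of
    the projector. *)
Lemma speed_dproj (gamma : R -> CP R m) (t : R) : (forall a b, derivable (proj_curve gamma a b) t 1) ->
  exists Z V : RV, [/\ Z != 0, projCP (gamma t) = proj Z,
    forall a b, derive1 (proj_curve gamma a b) t = dproj Z V a b &
    speed gamma t = Num.sqrt (dot (hor Z V) (hor Z V) / dot Z Z)].
Proof.
move=> dP; pose i := chart_at (gamma t); have hi : in_chart i (gamma t) := chart_atP _.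
have c0 : proj_curve gamma (lshift m.+1 i) (lshift m.+1 i) t != 0 by rewrite /proj_curve -proj_chart.
have near_i : \forall s \near t, in_chart i (gamma s).
  have cP := derivable_continuous (dP (lshift m.+1 i) (lshift m.+1 i)).
  have nO : nbhs (proj_curve gamma (lshift m.+1 i) (lshift m.+1 i) t) [set x : R | x != 0].
    by apply: open_nbhs_nbhs; split=> //; exact: open_neq.
  have n1 : nbhs t (proj_curve gamma (lshift m.+1 i) (lshift m.+1 i) @^-1` [set x : R | x != 0]) := cP _ nO.
  by apply: filterS n1 => s /=; rewrite proj_chart.
pose w s := Defs.coord i (gamma s).
pose v : 'rV[R]_(m + m) := \row_a derive1 (curve_coord gamma i a) t.
have dw a : is_derive t 1 (fun u => w u 0 a) (v 0 a).
  rewrite mxE; apply: is_derive_derive1; rewrite /curve_coord.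
  case: (split_ordP a) => b ->.
    rewrite (_ : (fun s => _) = fun s => proj_curve gamma (lshift m.+1 (lift i b)) (lshift m.+1 i) s /
      proj_curve gamma (lshift m.+1 i) (lshift m.+1 i) s); last by apply/funext => s; rewrite coordl.
    exact: derivable_div c0 (dP _ _) (dP _ _).
  rewrite (_ : (fun s => _) = fun s => proj_curve gamma (rshift m.+1 (lift i b)) (lshift m.+1 i) s /
      proj_curve gamma (lshift m.+1 i) (lshift m.+1 i) s); last by apply/funext => s; rewrite coordr.
  exact: derivable_div c0 (dP _ _) (dP _ _).
exists (zlift i (w t)), (zdir i v); split.
- exact: zlift_neq0.
- exact: projCP_zlift.
- move=> a b; apply: derive1_val.
  have := is_derive_proj a b (fun b => is_derive_zlift i b dw) (zlift_neq0 i (w t)).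
  apply: near_eq_is_derive; apply: filterS near_i => s hs.
  by rewrite /proj_curve (projCP_zlift hs).
- by rewrite -fs_chart_sqnorm.
Qed.

End Speed.

(** * Lower bound for the length of a curve *)

Section LowerBound.
Context {R : realType} {m : nat} (gamma : R -> CP R m) (A : 'rV[R]_(m.+1 + m.+1)) (A1 : dot A A = 1).
Local Notation RV := 'rV[R]_(m.+1 + m.+1).

Lemma C1_curve_proj (t : R) : C1_curve gamma -> 0 <= t <= 1 ->
  exists I : set R, [/\ open I, I t & forall a b, C1on I (proj_curve gamma a b)].
Proof.
move=> hg t01; have [i hi] := hg t t01.
pose Q := [set s : R | in_chart i (gamma s) /\ forall a, derivable (curve_coord gamma i a) s 1 /\
  {for s, continuous (derive1 (curve_coord gamma i a))}].
have IQ : Q° `<=` Q by exact: interior_subset.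
exists Q°; split=> [||a b]; [exact: open_interior|exact: hi|].
apply: (@C1on_eq _ _ (fun s => proj (zlift i (Defs.coord i (gamma s))) a b)).
- exact: open_interior.
- by move=> s /IQ[hs _]; rewrite /proj_curve (projCP_zlift hs).
- apply: C1on_proj; first exact: open_interior.
    by move=> c; apply: C1on_zlift; [exact: open_interior|move=> d s /IQ[_]; exact].
  by move=> s _; exact: zlift_neq0.
Qed.

(** The squared modulus of the Hermitian product of A with a unit representative of the point: the
    cosine squared of the angle between them. *)
Definition overlap (s : R) : R := qform A (projCP (gamma s)).

Lemma qform_proj_bound (Z : RV) : Z != 0 -> 0 <= qform A (proj Z) <= 1.
Proof.
move=> Z0; have n0 := dot_gt0 Z0; rewrite qform_proj; apply/andP; split.
  by rewrite divr_ge0 ?addr_ge0 ?sqr_ge0 ?ltW.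
have h := dot_ge0 (hor Z A); rewrite dot_hor// A1 in h.
rewrite -subr_ge0; apply: le_trans h _; rewrite le_eqVlt; apply/orP; left; apply/eqP.
by field; rewrite gt_eqF.
Qed.

Lemma overlap_bound s : 0 <= overlap s <= 1.
Proof.
apply: qform_proj_bound; rewrite realify_eq0; exact: is_class_neq0 (is_class_pick (gamma s)).
Qed.

Lemma qform_sum (Q : 'M[R]_(m.+1 + m.+1)) : qform A Q = \sum_a \sum_b (A 0 b * A 0 a) * Q b a.
Proof.
rewrite /qform mxE; apply: eq_bigr => a _; rewrite mxE mulr_suml; apply: eq_bigr => b _.
by rewrite mxE mulrAC.
Qed.

Lemma C1on_overlap I : open I -> (forall a b, C1on I (proj_curve gamma a b)) -> C1on I overlap.
Proof.
move=> oI h.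
apply: (@C1on_eq _ I (fun s => \sum_a \sum_b (A 0 b * A 0 a) * proj_curve gamma b a s)) => //.
  by move=> s _; rewrite /overlap qform_sum.
by apply: C1on_sum => // a; apply: C1on_sum => // b; exact: C1on_Z.
Qed.

Lemma derive1_overlap s : (forall a b, derivable (proj_curve gamma a b) s 1) ->
  is_derive s 1 overlap (qform A (\matrix_(a, b) derive1 (proj_curve gamma a b) s)).
Proof.
move=> h; rewrite (_ : overlap = fun s => \sum_a \sum_b (A 0 b * A 0 a) * proj_curve gamma b a s); last first.
  by apply/funext => u; rewrite /overlap qform_sum.
rewrite qform_sum; apply: is_derive_bigsum => a; apply: is_derive_bigsum => b.
apply: is_derive_eq (is_deriveM (is_derive_cst (A 0 b * A 0 a : R) s 1) (is_derive_derive1 (h b a))) _.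
by rewrite scaler0 addr0 mxE.
Qed.

(** The speed written without a chart, with the 4 of [dproj_sqnorm] divided out. Its continuity is
    visible, and that provides integrability. *)
Definition proj_speed (s : R) : R :=
  Num.sqrt (\sum_a \sum_b derive1 (proj_curve gamma a b) s ^+ 2 / 4).

Lemma speedE s : (forall a b, derivable (proj_curve gamma a b) s 1) -> speed gamma s = proj_speed s.
Proof.
move=> h; have [Z [V [Z0 _ dE ->]]] := speed_dproj h; congr Num.sqrt.
have e : \sum_a \sum_b derive1 (proj_curve gamma a b) s ^+ 2 / 4 = (\sum_a \sum_b dproj Z V a b ^+ 2) / 4.
  by rewrite mulr_suml; apply: eq_bigr => a _; rewrite mulr_suml; apply: eq_bigr => b _; rewrite dE.
by rewrite e dproj_sqnorm// mulrAC mulfV ?mul1r.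
Qed.

Lemma overlap_derive_bound s : (forall a b, derivable (proj_curve gamma a b) s 1) ->
  derive1 overlap s ^+ 2 <= 4 * (overlap s * (1 - overlap s)) * speed gamma s ^+ 2.
Proof.
move=> h; have [Z [V [Z0 PZ dE ->]]] := speed_dproj h.
rewrite (derive1_val (derive1_overlap h)) sqr_sqrtr; last first.
  by rewrite divr_ge0 ?dot_ge0.
rewrite /overlap PZ (_ : (\matrix_(a, b) derive1 (proj_curve gamma a b) s) = dproj Z V); last first.
  by apply/matrixP => a b; rewrite [LHS]mxE dE.
exact: dproj_bound.
Qed.

Section Angle.
Context (hg : C1_curve gamma) (la : R) (la0 : 0 < la) (la1 : la < 1).

(** For la = 1 this would be twice the angle arccos (sqrt y), as 2 y - 1 is the cosine of the double
    angle. The factor la < 1 keeps the argument inside the open interval where [acos] is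
    differentiable, even when the curve meets the line of A or its orthogonal complement. *)
Definition angle (s : R) : R := acos (la * (2 * overlap s - 1)).

Definition angle_speed (s : R) : R :=
  - (Num.sqrt (1 - (la * (2 * overlap s - 1)) ^+ 2))^-1 * (la * (2 * derive1 overlap s)).

Lemma angle_arg s : -1 < la * (2 * overlap s - 1) < 1.
Proof.
have /andP[y0 y1] := overlap_bound s; move: (overlap s) y0 y1 => y y0 y1.
have h1 : 0 <= la * y by rewrite mulr_ge0// ltW.
have h2 : 0 <= la * (1 - y) by rewrite mulr_ge0 ?subr_ge0// ltW.
have -> : la * (2 * y - 1) = la * y - la * (1 - y) by ring.
have h3 : la * y + la * (1 - y) = la by ring.
move: (la * y) (la * (1 - y)) h1 h2 h3 => u v h1 h2 h3.
by apply/andP; split; have := la1; lra.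
Qed.

Lemma angle_arg_sqr s : 0 < 1 - (la * (2 * overlap s - 1)) ^+ 2.
Proof.
have /andP[] := angle_arg s; move: (la * _) => x h1 h2.
rewrite (_ : 1 - x ^+ 2 = (1 - x) * (1 + x)); last by ring.
by rewrite mulr_gt0; lra.
Qed.

Lemma is_derive_angle s : derivable overlap s 1 -> is_derive s 1 angle (angle_speed s).
Proof.
move=> d; have d2 : is_derive s 1 (fun u => la * (2 * overlap u - 1)) (la * (2 * derive1 overlap s)).
  have h := is_derive_derive1 d.
  have h1 := is_deriveD (is_deriveM (is_derive_cst (2 : R) s 1) h) (is_derive_cst (- 1 : R) s 1).
  apply: is_derive_eq (is_deriveM (is_derive_cst (la : R) s 1) h1) _.
  by rewrite !scaler0 !addr0.
have da := is_derive1_acos (angle_arg s).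
exact: (@is_derive1_comp R (@acos R) (fun u => la * (2 * overlap u - 1)) s _ _ da d2).
Qed.

Lemma overlap_C1 t : 0 <= t <= 1 -> [/\ derivable overlap t 1, {for t, continuous (derive1 overlap)} &
  forall a b, derivable (proj_curve gamma a b) t 1 /\ {for t, continuous (derive1 (proj_curve gamma a b))}].
Proof.
move=> t01; have [I [oI It h]] := C1_curve_proj hg t01.
have [h1 h2] := C1on_overlap oI h It.
by split; [exact: h1|exact: h2|move=> a b; exact: (h a b t It)].
Qed.

Lemma continuous_angle_speed t : 0 <= t <= 1 -> {for t, continuous angle_speed}.
Proof.
move=> t01; have [d c _] := overlap_C1 t01; have cy := derivable_continuous d.
have cx : {for t, continuous (fun s => la * (2 * overlap s - 1))}.
  apply: cvgM; first exact: cvg_cst.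
  by apply: cvgB; [apply: cvgM; [exact: cvg_cst|exact: cy]|exact: cvg_cst].
apply: cvgM; last first.
  by apply: cvgM; [exact: cvg_cst|apply: cvgM; [exact: cvg_cst|exact: c]].
apply: cvgN; apply: cvgV; first by rewrite gt_eqF// sqrtr_gt0 angle_arg_sqr.
apply: (@continuous_comp _ _ _ (fun s => 1 - (la * (2 * overlap s - 1)) ^+ 2) Num.sqrt).
  apply: cvgB; first exact: cvg_cst.
  by apply: cvgM; exact: cx.
exact: sqrt_continuous.
Qed.

Lemma continuous_proj_speed t : 0 <= t <= 1 -> {for t, continuous proj_speed}.
Proof.
move=> t01; have [_ _ h] := overlap_C1 t01.
apply: (@continuous_comp _ _ _ (fun s => \sum_a \sum_b derive1 (proj_curve gamma a b) s ^+ 2 / 4) Num.sqrt).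
  apply: continuous_bigsum => a; apply: continuous_bigsum => b; apply: cvgM; last exact: cvg_cst.
  by apply: cvgM; exact: (h a b).2.
exact: sqrt_continuous.
Qed.

(** Since 4 y (1 - y) = 1 - (2 y - 1)^2, after squaring the claim reduces to la^2 <= 1: the
    difference of the two sides is 4 S^2 (1 - la) (1 + la). *)
Lemma angle_speed_le t : 0 <= t <= 1 -> angle_speed t <= 2 * proj_speed t.
Proof.
move=> t01; have [d c h] := overlap_C1 t01.
rewrite -speedE; last by move=> a b; exact: (h a b).1.
have S0 : 0 <= speed gamma t by exact: sqrtr_ge0.
have hb := overlap_derive_bound (fun a b => (h a b).1).
apply: le_trans (ler_norm _) _; rewrite -ler_sqr ?nnegrE ?mulr_ge0//.
have p0 := angle_arg_sqr t; have /andP[y0 y1] := overlap_bound t.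
rewrite real_normK ?num_real// /angle_speed exprMn sqrrN exprVn (sqr_sqrtr (ltW p0)).
rewrite [leLHS]mulrC ler_pdivrMr//.
move: (speed gamma t) S0 (overlap t) (derive1 overlap t) y0 y1 hb p0 => S S0 y d' y0 y1 hb p0.
have e1 : (la * (2 * d')) ^+ 2 <= 4 * la ^+ 2 * (4 * (y * (1 - y)) * S ^+ 2).
  rewrite (_ : (la * (2 * d')) ^+ 2 = 4 * la ^+ 2 * d' ^+ 2); last by ring.
  by rewrite ler_wpM2l// mulr_ge0 ?sqr_ge0.
apply: le_trans e1 _; rewrite -subr_ge0.
rewrite (_ : _ - _ = 4 * S ^+ 2 * ((1 - la) * (1 + la))); last by ring.
by apply: mulr_ge0; [rewrite mulr_ge0 ?sqr_ge0|apply: mulr_ge0; have := la0; have := la1; lra].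
Qed.

Lemma angle_le_length : angle 1 - angle 0 <= 2 * curve_length gamma.
Proof.
have within (f : R -> R) : (forall t : R, 0 <= t <= 1 -> {for t, continuous f}) ->
    {within `[0, 1], continuous f}.
  move=> h; apply: continuous_in_subspaceT => t; rewrite inE /= in_itv /=; exact: h.
have ci (f : R -> R) : (forall t : R, 0 <= t <= 1 -> {for t, continuous f}) ->
    lebesgue_measure.-integrable `[0, 1] (EFin \o f).
  by move=> h; apply: continuous_compact_integrable; [exact: segment_compact|exact: within].
have cA t : 0 <= t <= 1 -> {for t, continuous angle}.
  move=> t01; have [d _ _] := overlap_C1 t01.
  by apply: derivable_continuous; case: (is_derive_angle d).
(* On the interval [speed] may be replaced by [proj_speed], which is continuous there. *)
have -> : curve_length gamma = \int[lebesgue_measure]_(t in `[0, 1]) proj_speed t.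
  apply: eq_Rintegral => t; rewrite inE /= in_itv /= => t01.
  by have [_ _ h] := overlap_C1 t01; apply: speedE => a b; exact: (h a b).1.
have -> : angle 1 - angle 0 = \int[lebesgue_measure]_(t in `[0, 1]) angle_speed t.
  rewrite /Rintegral (@continuous_FTC2 _ angle_speed angle)//.
  - by apply: within; exact: continuous_angle_speed.
  - split.
    + move=> t; rewrite in_itv /= => /andP[t0 t1].
      have [d _ _] := @overlap_C1 t (introT andP (conj (ltW t0) (ltW t1))).
      by case: (is_derive_angle d).
    + by apply: cvg_at_right_filter; apply: cA; rewrite lexx ler01.
    + by apply: cvg_at_left_filter; apply: cA; rewrite lexx ler01.
  - move=> t; rewrite in_itv /= => /andP[t0 t1].
    have [d _ _] := @overlap_C1 t (introT andP (conj (ltW t0) (ltW t1))).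
    exact: derive1_val (is_derive_angle d).
rewrite -RintegralZl//; last by apply: ci; exact: continuous_proj_speed.
apply: le_Rintegral => //.
- by apply: ci; exact: continuous_angle_speed.
- apply: ci => t t01; apply: cvgM; first exact: cvg_cst.
  exact: continuous_proj_speed.
- by move=> t; rewrite /= in_itv /=; exact: angle_speed_le.
Qed.

End Angle.
End LowerBound.

(** * Great circles as curves in projective space *)

Section Geodesic.
Context {R : realType} {m : nat}.
Implicit Types v : 'rV[R]_m.+1.
Local Notation real v := (row_mx v 0 : 'rV[R]_(m.+1 + m.+1)).

Lemma dot_real (u v : 'rV[R]_m.+1) : dot (real u) (real v) = dot u v.
Proof. by rewrite dotE tr_row_mx mul_row_col mul0mx addr0 -dotE. Qed.

Lemma dot_realJ (u v : 'rV[R]_m.+1) : dot (real u) (real v *m Jmx) = 0.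
Proof.
by rewrite mul_row_block !mulmx0 !mul0mx !addr0 mulmx1 dotE tr_row_mx mul_row_col trmx0 mulmx0 mul0mx addr0 mxE.
Qed.

Lemma complexify_neq0 v : v != 0 -> complexify v != 0.
Proof.
apply: contraNneq => /rowP h; apply/eqP/rowP => i; have := h i; rewrite !mxE.
by case.
Qed.

Lemma realify_complexify v : realify (complexify v) = real v.
Proof.
by rewrite /realify; congr row_mx; apply/rowP => i; rewrite !mxE.
Qed.

Lemma projCP_complexify (q : CP R m) v : is_class q (complexify v) -> projCP q = proj (real v).
Proof. by move=> h; rewrite (projCP_class h) realify_complexify. Qed.

Section Curve.
Context (a e : 'rV[R]_m.+1) (th : R) (th0 : 0 <= th) (a1 : dot a a = 1) (ae : dot a e = 0).
Context (e1 : dot e e = 1 \/ th = 0).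

(** A great circle of constant speed th leaving a in the direction e. The alternative th = 0 in [e1]
    allows for coinciding endpoints, where no unit direction is available and the curve stays at
    a. *)
Definition geod (t : R) : 'rV[R]_m.+1 := cos (th * t) *: a + sin (th * t) *: e.
Definition geod' (t : R) : 'rV[R]_m.+1 := (- th * sin (th * t)) *: a + (th * cos (th * t)) *: e.

Lemma geodE t i : geod t 0 i = cos (th * t) * a 0 i + sin (th * t) * e 0 i.
Proof. by rewrite !mxE. Qed.

Lemma geod'E t i : geod' t 0 i = (- th * sin (th * t)) * a 0 i + (th * cos (th * t)) * e 0 i.
Proof. by rewrite !mxE. Qed.

Lemma dot_geod t : dot (geod t) (geod t) = 1.
Proof.
rewrite /geod !(dotDl, dotDr, dotZl, dotZr) (dotC e a) a1 ae.
case: e1 => [->|->]; first by rewrite -[RHS](cos2Dsin2 (th * t)); ring.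
by rewrite mul0r cos0 sin0; ring.
Qed.

Lemma dot_geod' t : dot (geod' t) (geod' t) = th ^+ 2 /\ dot (geod' t) (geod t) = 0.
Proof.
rewrite /geod /geod' !(dotDl, dotDr, dotZl, dotZr) (dotC e a) a1 ae.
case: e1 => [->|->]; last by split; ring.
split; last by ring.
rewrite -[RHS]mulr1 -[X in _ = _ * X](cos2Dsin2 (th * t)); ring.
Qed.

Lemma is_derive_geod (t : R) i : is_derive t 1 (fun s => geod s 0 i) (geod' t 0 i).
Proof.
rewrite geod'E (_ : (fun s => _) = fun s => cos (th * s) * a 0 i + sin (th * s) * e 0 i); last first.
  by apply/funext => s; rewrite geodE.
have hl : is_derive t 1 (fun s : R => th * s) th.
  apply: is_derive_eq (is_deriveM (is_derive_cst (th : R) t 1) (is_derive_id t 1)) _.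
  by rewrite scaler0 addr0 /GRing.scale /= mulr1.
have hc : is_derive t 1 (fun s : R => cos (th * s)) (- sin (th * t) * th).
  exact: (@is_derive1_comp R (@cos R) (fun s => th * s) t _ _ (is_derive_cos _) hl).
have hs : is_derive t 1 (fun s : R => sin (th * s)) (cos (th * t) * th).
  exact: (@is_derive1_comp R (@sin R) (fun s => th * s) t _ _ (is_derive_sin _) hl).
have hca := is_deriveM hc (is_derive_cst (a 0 i : R) t 1).
have hse := is_deriveM hs (is_derive_cst (e 0 i : R) t 1).
apply: is_derive_eq (is_deriveD hca hse) _.
by rewrite !scaler0 !add0r /GRing.scale /=; ring.
Qed.

Lemma C1on_geod i : C1on setT (fun s => geod s 0 i).
Proof.
apply: (@C1on_derive _ _ _ (fun s => geod' s 0 i)); first exact: openT.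
  by move=> s _; exact: is_derive_geod.
move=> s _; rewrite (_ : (fun s => _) =
  fun s => (- th * sin (th * s)) * a 0 i + (th * cos (th * s)) * e 0 i); last first.
  by apply/funext => u; rewrite geod'E.
have cl : {for s, continuous (fun u : R => th * u)} by apply: cvgM; [exact: cvg_cst|exact: cvg_id].
apply: cvgD; apply: cvgM; try exact: cvg_cst.
  apply: cvgM; first exact: cvg_cst.
  exact: (@continuous_comp _ _ _ (fun u : R => th * u) (@sin R) s cl (@continuous_sin R _)).
apply: cvgM; first exact: cvg_cst.
exact: (@continuous_comp _ _ _ (fun u : R => th * u) (@cos R) s cl (@continuous_cos R _)).
Qed.

Lemma geod_neq0 t : geod t != 0.
Proof. exact: unit_neq0 (dot_geod t). Qed.

Definition geod_CP (t : R) : CP R m := mkCP (complexify_neq0 (geod_neq0 t)).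

Lemma geod_class t : is_class (geod_CP t) (complexify (geod t)).
Proof. exact: mkCP_class. Qed.

Lemma geod_C1_curve : C1_curve geod_CP.
Proof.
move=> t _; have [i hi] := exists_chart (geod_CP t); exists i.
have iE s : in_chart i (geod_CP s) = (geod s 0 i != 0).
  rewrite (in_chartE i (geod_class s)) mxE.
  by rewrite eq_complex /= eqxx andbT.
pose I := [set s | geod s 0 i != 0].
have oI : open I.
  rewrite openE => s Is.
  have nO : nbhs (geod s 0 i) [set x : R | x != 0] by apply: open_nbhs_nbhs; split=> //; exact: open_neq.
  have n1 : nbhs s ((fun s => geod s 0 i) @^-1` [set x : R | x != 0]) :=
    C1on_continuous (C1on_geod i) Logic.I nO.
  exact: n1.
have cc c : C1on I (curve_coord geod_CP i c).
  have cg d : C1on I (fun s => geod s 0 d) by exact: C1on_sub (C1on_geod d).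
  case: (split_ordP c) => d ->.
    apply: (@C1on_eq _ I (fun s => geod s 0 (lift i d) * (geod s 0 i)^-1)) => //.
      move=> s Is; rewrite /curve_coord coordl (projCP_class (geod_class s)) !proj_ll.
      have g0 : geod s 0 i != 0 := Is.
      rewrite realify_complexify dot_real dot_geod ![complexify _ 0 _]mxE /= !divr1.
      by rewrite !mul0r !subr0; field.
    by apply: C1on_M => //; exact: C1on_V.
  apply: (@C1on_eq _ I (fun s => 0)) => //; last exact: C1on_cst.
  move=> s Is; rewrite /curve_coord coordr (projCP_class (geod_class s)) proj_rl.
  by rewrite ![complexify _ 0 _]mxE /= mul0r oppr0 mulr0 addr0 !mul0r.
have nI : nbhs t I by apply: open_nbhs_nbhs; split=> //; rewrite /I /= -iE.
apply: filterS nI => s Is; split; first by rewrite iE.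
by move=> c; exact: cc.
Qed.

Lemma geod_speed t : speed geod_CP t = th.
Proof.
have dZ (s : R) c : is_derive s 1 (fun u : R => real (geod u) 0 c) (real (geod' s) 0 c).
  case: (split_ordP c) => i ->.
    rewrite row_mxEl (_ : (fun u => _) = fun u => geod u 0 i); first exact: is_derive_geod.
    by apply/funext => u; rewrite row_mxEl.
  rewrite row_mxEr (_ : (fun u : R => _) = cst 0); first by rewrite mxE; exact: is_derive_cst.
  by apply/funext => u; rewrite row_mxEr mxE.
have n1 s : dot (real (geod s)) (real (geod s)) = 1 by rewrite dot_real dot_geod.
have Z0 s : real (geod s) != 0 by exact: unit_neq0.
have dP c d : is_derive t 1 (proj_curve geod_CP c d) (dproj (real (geod t)) (real (geod' t)) c d).
  rewrite (_ : proj_curve geod_CP c d = fun s => proj (real (geod s)) c d).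
    exact: is_derive_proj (dZ t) (Z0 t).
  by apply/funext => s; rewrite /proj_curve (projCP_complexify (geod_class s)).
rewrite speedE; last by move=> c d; case: (dP c d).
have [h1 h2] := dot_geod' t.
rewrite /proj_speed (_ : \sum_a0 \sum_b _ = th ^+ 2); first by rewrite sqrtr_sqr ger0_norm.
transitivity ((\sum_c \sum_d dproj (real (geod t)) (real (geod' t)) c d ^+ 2) / 4).
  rewrite mulr_suml; apply: eq_bigr => c _; rewrite mulr_suml; apply: eq_bigr => d _.
  by rewrite (derive1_val (dP c d)).
rewrite (dproj_sqnorm _ (Z0 t)) (dot_hor _ (Z0 t)) n1 !dot_real h1 h2 dot_realJ.
by field.
Qed.

Lemma geod_length : curve_length geod_CP = th.
Proof.
transitivity (\int[@lebesgue_measure R]_(t in `[0, 1]) th).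
  by apply: eq_Rintegral => t _; exact: geod_speed.
rewrite (@Rintegral_cst _ _ _ (@lebesgue_measure R))//.
have h : lebesgue_measure (`[0, 1]%classic : set R) = 1%E.
  by rewrite lebesgue_measure_itv /= lte_fin ltr01 sube0.
by rewrite -[RHS]mulr1; congr (_ * _); exact: (congr1 fine h).
Qed.

End Curve.
End Geodesic.

Section Trigonometry.
Context {R : realType}.

(** By the addition formula cos (phi - eps) is at least cos eps cos phi. With la = cos eps this
    bounds by eps the angle lost through the factor la. *)
Lemma acos_mul_cos (eps phi : R) : 0 < eps < pi / 2 -> 0 <= phi <= pi ->
  phi - eps <= acos (cos eps * cos phi).
Proof.
move=> /andP[e0 e1] /andP[p0 p1].
have ce : 0 <= cos eps by rewrite ltW// cos_gt0_pihalf// e1 andbT; have := @pi_gt0 R; lra.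
have hb : -1 <= cos eps * cos phi <= 1.
  have := cos_le1 eps; have := cos_le1 phi; have := cos_geN1 phi.
  by move: (cos eps) (cos phi) ce => x y x0 y1 y2 x1; apply/andP; split; nra.
rewrite leNgt; apply/negP => h.
have a0 := acos_ge0 hb; have ap := acos_lepi hb.
have : cos (phi - eps) < cos (acos (cos eps * cos phi)).
  rewrite ltr_cos ?in_itv /= ?a0 ?ap//; apply/andP; split; lra.
rewrite acosK; last by rewrite in_itv.
rewrite cosB mulrC; have := @sin_ge0_pi R phi; rewrite p0 p1 => /(_ isT) s1.
have s2 : 0 <= sin eps by rewrite ltW// sin_gt0_pihalf// e0.
have := mulr_ge0 s1 s2; move: (sin phi * sin eps) (cos eps * cos phi) => x y; lra.
Qed.

Lemma acos_pihalf (c : R) : 0 <= c <= 1 -> 0 <= acos c <= pi / 2.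
Proof.
move=> /andP[c0 c1]; have hc : -1 <= c <= 1 by rewrite c1 andbT; lra.
rewrite acos_ge0//= leNgt; apply/negP => h.
have : cos (acos c) < cos (pi / 2).
  rewrite ltr_cos// ?in_itv /= ?acos_ge0 ?acos_lepi//.
  by apply/andP; split; have := @pi_gt0 R; lra.
by rewrite acosK ?in_itv//= cos_pihalf ltNge c0.
Qed.

End Trigonometry.

(** * Distance and geodesic spheres in the standard real projective space *)

Section Distance.
Context {R : realType} {m : nat}.
Local Notation real v := (row_mx v 0 : 'rV[R]_(m.+1 + m.+1)).

Definition supp (n : nat) (v : 'rV[R]_m.+1) : Prop := forall i : 'I_m.+1, (n < i)%N -> v 0 i = 0.

Lemma suppD n u v (s t : R) : supp n u -> supp n v -> supp n (s *: u + t *: v).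
Proof. by move=> hu hv i ni; rewrite !mxE hu// hv// !mulr0 addr0. Qed.

Lemma suppZ n v (s : R) : supp n v -> supp n (s *: v).
Proof. by move=> hv i ni; rewrite !mxE hv// mulr0. Qed.

Lemma overlap_class (q : CP R m) (a b : 'rV[R]_m.+1) : is_class q (complexify b) ->
  dot b b = 1 -> qform (real a) (projCP q) = dot a b ^+ 2.
Proof.
move=> hq b1; rewrite (projCP_complexify hq) qform_proj !dot_real dot_realJ b1.
by rewrite expr0n addr0 divr1.
Qed.

Lemma dot_unit_le1 (a b : 'rV[R]_m.+1) : dot a a = 1 -> dot b b = 1 -> `|dot a b| <= 1.
Proof.
move=> a1 b1; have := dot_ge0 (b - dot a b *: a).
rewrite !(dotBl, dotBr, dotZl, dotZr) a1 b1 (dotC b a) => h.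
rewrite -ler_sqr ?nnegrE// real_normK ?num_real// expr1n expr2.
by move: (dot a b) h => x h; lra.
Qed.

Section Pair.
Context (n : nat) (p q : CP R m) (a b : 'rV[R]_m.+1).
Context (a1 : dot a a = 1) (b1 : dot b b = 1) (sa : supp n a) (sb : supp n b).
Context (ha : is_class p (complexify a)) (hb : is_class q (complexify b)).
Let c := `|dot a b|.
Let th := acos c.
Let c01 : 0 <= c <= 1. Proof. by rewrite normr_ge0 dot_unit_le1. Qed.
Let thb : 0 <= th <= pi / 2. Proof. exact: acos_pihalf. Qed.
Let cth : cos th = c.
Proof. by rewrite acosK// in_itv /=; have /andP[h ->] := c01; rewrite andbT; lra. Qed.

Lemma curve_length_ge (gamma : R -> CP R m) : C1_curve gamma -> gamma 0 = p -> gamma 1 = q ->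
  th <= curve_length gamma.
Proof.
move=> hg g0 g1; have A1 : dot (real a) (real a) = 1 by rewrite dot_real.
have /andP[t0 t1] := thb; have pp := @pi_gt0 R.
have L0 : 0 <= curve_length gamma by apply: Rintegral_ge0 => t _; exact: sqrtr_ge0.
(* With la = cos eps the angle starts at eps and ends at least at 2 th - eps, so twice the length is
   at least 2 th - 2 eps. Taking eps as half the supposed gap, this equals th plus the length, a
   contradiction. *)
rewrite leNgt; apply/negP => hL; pose eps := (th - curve_length gamma) / 2.
have e0 : 0 < eps by rewrite /eps; lra.
have e1 : eps < pi / 2 by rewrite /eps; lra.
have ee : 0 < eps < pi / 2 by rewrite e0.
have ce : 0 < cos eps by rewrite cos_gt0_pihalf// e1 andbT; lra.
have ce1 : cos eps < 1.
  by rewrite -[ltRHS](@cos0 R) ltr_cos ?in_itv /= ?lexx ?(ltW pp)//; apply/andP; split; lra.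
have := angle_le_length A1 hg ce ce1.
rewrite /angle /overlap g0 g1 (overlap_class _ ha a1) (overlap_class _ hb b1) a1 expr1n.
have -> : 2 * (1 : R) - 1 = 1 by ring.
rewrite mulr1 cosK; last by rewrite in_itv /=; apply/andP; split; lra.
have -> : 2 * dot a b ^+ 2 - 1 = cos (th *+ 2).
  by rewrite cos_mulr2n cth real_normK ?num_real// mulr_natl.
have h2 : 0 <= th *+ 2 <= pi by rewrite mulr2n; apply/andP; split; lra.
have := acos_mul_cos ee h2; move: (acos _) => x; rewrite mulr2n => hx hy.
move: hx hy; rewrite /eps; lra.
Qed.

Lemma exists_curve_length : exists gamma : R -> CP R m, [/\ C1_curve gamma, gamma 0 = p,
  gamma 1 = q, forall t : R, 0 <= t <= 1 -> standard_RP n (gamma t) & th = curve_length gamma].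
Proof.
have /andP[t0 t1] := thb; have pp := @pi_gt0 R.
(* Replacing b by its opposite if necessary makes the product with a equal to its absolute value;
   the shorter of the two arcs is then taken. *)
have [s s1 sc] : exists2 s : R, s * s = 1 & s * dot a b = c.
  have [h|h] := leP 0 (dot a b); [exists 1|exists (-1)]; rewrite ?mulr1 ?mulrNN ?mulr1// /c.
    by rewrite mul1r ger0_norm.
  by rewrite mulN1r ltr0_norm.
have s0 : s != 0 by apply: contra_eqN s1 => /eqP ->; rewrite mulr0 eq_sym oner_eq0.
pose b' := s *: b; have b'1 : dot b' b' = 1 by rewrite dotZl dotZr b1 mulr1.
have ab' : dot a b' = c by rewrite dotZr.
have hb' : is_class q (complexify b') by exact: is_class_complexifyZ.
have sb' : supp n b' by exact: suppZ.
(* The normalized component of b' orthogonal to a. If sin th = 0 then th = 0, since th <= pi / 2,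
   and the constant curve is used. *)
clearbody b'; pose e := (sin th)^-1 *: (b' - c *: a).
have ae : dot a e = 0 by rewrite dotZr dotBr dotZr a1 ab' mulr1 subrr mulr0.
have dd : dot (b' - c *: a) (b' - c *: a) = sin th ^+ 2.
  rewrite !(dotBl, dotBr, dotZl, dotZr) a1 b'1 (dotC b' a) ab' sin2cos2 cth; ring.
have se : supp n e.
  by apply: suppZ; rewrite -scaleNr -[b' in b' + _]scale1r; exact: suppD.
have [sz|sn] := eqVneq (sin th) 0.
  have th0 : th = 0.
    apply/eqP; rewrite eq_le t0 andbT leNgt; apply/negP => tp.
    have : 0 < sin th by apply: sin_gt0_pi; apply/andP; split; lra.
    by rewrite sz ltxx.
  have ba : b' = c *: a.
    by apply/eqP; rewrite -subr_eq0; apply/eqP/dot_eq0; rewrite dd sz expr0n.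
  have c1 : c = 1 by rewrite -cth th0 cos0.
  have e1 : dot e e = 1 \/ th = 0 by right.
  have gE t : geod a e th t = a by rewrite /geod th0 mul0r cos0 sin0 scale1r scale0r addr0.
  exists (geod_CP a1 ae e1); split.
  - exact: geod_C1_curve.
  - by apply: is_class_inj (geod_class _ _ _ _) _; rewrite gE.
  - by apply: is_class_inj (geod_class _ _ _ _) _; rewrite gE -[a]scale1r -c1 -ba.
  - move=> t _; exists a; split; [exact: unit_neq0|exact: sa|].
    by have := geod_class a1 ae e1 t; rewrite gE.
  - by rewrite geod_length.
have e1 : dot e e = 1 \/ th = 0.
  by left; rewrite dotZl dotZr dd; field.
exists (geod_CP a1 ae e1); split.
- exact: geod_C1_curve.
- apply: is_class_inj (geod_class _ _ _ _) _.
  by rewrite /geod mulr0 cos0 sin0 scale1r scale0r addr0.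
- apply: is_class_inj (geod_class _ _ _ _) _.
  by rewrite /geod mulr1 cth /e scalerA mulfV// scale1r addrCA subrr addr0.
- move=> t _; exists (geod a e th t); split; [exact: geod_neq0|exact: suppD|exact: geod_class].
- by rewrite geod_length.
Qed.

(** The lower bound holds for every curve in CP^m, and the great circle attaining it has real
    vectors supported on the first coordinates, so it stays in RP^n. *)
Lemma intrinsic_dist_RP : intrinsic_dist (standard_RP n) p q = th.
Proof.
rewrite /intrinsic_dist; set E := [set s | _].
have Eth : E th by exact: exists_curve_length.
have lbE : lbound E th by move=> s [gamma [hg g0 g1 _ ->]]; exact: curve_length_ge.
apply/eqP; rewrite eq_le; apply/andP; split.
  by apply: ge_inf => //; exists th.
by apply: lb_le_inf => //; exists th.
Qed.

End Pair.

(** Distance r means that the product of a and b is cos r up to sign. As cos r > 0, the right choice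
    between b and -b removes the absolute value, so the sphere in RP^n lifts to a small sphere
    around a. *)
Lemma geodesic_sphere_RP n (p q : CP R m) (a : 'rV[R]_m.+1) (r : R) : dot a a = 1 -> supp n a ->
  is_class p (complexify a) -> 0 < r < pi / 2 ->
  geodesic_sphere (standard_RP n) p r q <->
  exists b, [/\ dot b b = 1, supp n b, is_class q (complexify b) & dot a b = cos r].
Proof.
move=> a1 sa ha /andP[r0 r1]; have pp := @pi_gt0 R.
have cr : 0 < cos r by rewrite cos_gt0_pihalf// r1 andbT; lra.
have rpi : r \in `[0, pi] by rewrite in_itv /=; apply/andP; split; lra.
split=> [[[x [x0 sx hx]] dr]|[b [b1 sb hb ab]]]; last first.
  split; first by exists b; split=> //; exact: unit_neq0.
  by rewrite (intrinsic_dist_RP a1 b1 sa sb ha hb) ab gtr0_norm// cosK.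
pose b := rpow (-1) x *: x; have b1 : dot b b = 1 by exact: dot_normalize.
have sb : supp n b by exact: suppZ.
have hb : is_class q (complexify b).
  by apply: is_class_complexifyZ => //; rewrite gt_eqF ?rpow_gt0.
have := intrinsic_dist_RP a1 b1 sa sb ha hb; rewrite dr => rE.
have hc : `|dot a b| = cos r.
  rewrite rE acosK// in_itv /= dot_unit_le1// andbT.
  by apply: le_trans (normr_ge0 _); lra.
have [h|h] := leP 0 (dot a b).
  by exists b; split=> //; rewrite -hc ger0_norm.
exists (-1 *: b); split.
- by rewrite dotZl dotZr mulrA mulrNN !mul1r.
- exact: suppZ.
- by apply: is_class_complexifyZ => //; rewrite oppr_eq0 oner_eq0.
- by rewrite dotZr mulN1r -hc ltr0_norm.
Qed.

End Distance.

(** * An orthonormal basis of the complement of a unit vector *)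

Section Householder.
Context {R : realType}.

Lemma reflection_idem (n : nat) (P : 'M[R]_n) (t c : R) : P *m P = t *: P -> c * c * t = c + c ->
  (1%:M - c *: P) *m (1%:M - c *: P) = 1%:M.
Proof.
move=> PP ct; rewrite mulmxBl mul1mx mulmxBr mulmx1 -scalemxAl -scalemxAr PP !scalerA ct scalerDl.
by move: (c *: P) => X; rewrite (opprD X X) (addrA X) subrr add0r opprK subrK.
Qed.

(** The Householder reflection exchanging [al] with the first basis vector is a symmetric orthogonal
    matrix with first row [al]; its other rows are the basis sought. *)
Lemma orthogonal_complement (n : nat) (al : 'rV[R]_(1 + n)) : dot al al = 1 ->
  exists B1 : 'M[R]_(n, 1 + n),
  [/\ B1 *m B1^T = 1%:M, al *m B1^T = 0 & B1^T *m B1 = 1%:M - al^T *m al].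
Proof.
move=> al1; pose d : 'rV[R]_(1 + n) := delta_mx 0 (lshift n 0).
have d1 : dot d d = 1 by rewrite dot_delta mxE !eqxx.
pose w := al - d; pose H : 'M[R]_(1 + n) := 1%:M - (2 / dot w w) *: (w^T *m w).
have ww : dot w w = 2 - 2 * dot al d.
  by rewrite !(dotBl, dotBr) al1 d1 (dotC d al); ring.
have HT : H^T = H.
  by rewrite /H linearB /= trmx1 [(_ *: _)^T]linearZ /= trmx_mul trmxK.
have HH : H *m H = 1%:M.
  have [w0|w0] := eqVneq w 0; first by rewrite /H w0 mulmx0 scaler0 subr0 mulmx1.
  have wn : dot w w != 0 by rewrite gt_eqF// dot_gt0.
  have E : (w^T *m w) *m (w^T *m w) = dot w w *: (w^T *m w).
    by rewrite mulmxA -(mulmxA w^T) mul_trmx mul_mx_scalar -scalemxAl.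
  apply: (reflection_idem E); field; exact: wn.
have dH : d *m H = al.
  rewrite /H mulmxBr mulmx1 -scalemxAr mulmxA mul_trmx mul_scalar_mx scalerA.
  have dw : dot d w = dot al d - 1 by rewrite dotBr d1 dotC.
  have [w0|w0] := eqVneq w 0; first by rewrite w0 scaler0 subr0; move/eqP: w0; rewrite subr_eq0 => /eqP.
  have wn : dot w w != 0 by rewrite gt_eqF// dot_gt0.
  rewrite (_ : _ * _ = -1); first by rewrite scaleN1r opprK /w addrC subrK.
  rewrite dw; move: wn; rewrite ww; move: (dot al d) => x xn; field.
  by move: xn; rewrite (_ : 2 - 2 * x = 2 * (1 - x))//; ring.
have uH : usubmx H = al.
  by rewrite -dH -rowE; apply/rowP => i; rewrite [RHS]mxE [LHS]mxE.
have HE : H = col_mx al (dsubmx H) by rewrite -uH vsubmxK.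
have [h1 h2] : al *m (dsubmx H)^T = 0 /\ dsubmx H *m (dsubmx H)^T = 1%:M.
  have : H *m H^T = 1%:M by rewrite HT.
  by rewrite {1 2}HE tr_col_mx mul_col_row scalar_mx_block => /eq_block_mx[].
exists (dsubmx H); split=> //.
have : H^T *m H = 1%:M by rewrite HT.
by rewrite {1 2}HE tr_col_mx mul_row_col => <-; rewrite addrC addKr.
Qed.

End Householder.

Section ExtrinsicSphere.
Context {R : realType} {m k : nat} {M : topologicalType} (f : M -> CP R m).
Context (k2 : (2 <= k)%N) (km : (k.+1 <= m)%N).

(** The unit vectors b of R^(k+2) whose product with a is cos r are cos r a + sin r y, with y a unit
    vector orthogonal to a. The rows of [B0] are an orthonormal basis of that orthogonal complement,
    so the sphere is the model with offset cos r a and be = sin r. *)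
Lemma geodesic_sphere_eigenvalue (p : CP R m) (r : R) : closed_submanifold k f ->
  injective f -> standard_RP k.+1 p -> 0 < r < pi / 2 ->
  range f = geodesic_sphere (standard_RP k.+1) p r -> is_nth_eigenvalue k f 2 0.
Proof.
move=> fc finj [x [x0 sx hx]] r01 rf.
pose a := rpow (-1) x *: x; have a1 : dot a a = 1 by exact: dot_normalize.
have sa : supp k.+1 a by exact: suppZ.
have ha : is_class p (complexify a).
  by apply: is_class_complexifyZ => //; rewrite gt_eqF ?rpow_gt0.
clearbody a; have /andP[r0 r1] := r01; have pp := @pi_gt0 R.
have cr : 0 < cos r by rewrite cos_gt0_pihalf// r1 andbT; lra.
have sr : 0 < sin r by rewrite sin_gt0_pihalf// r0.
have sr0 : sin r != 0 by rewrite gt_eqF.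
pose I0 : 'M[R]_(k.+2, m.+1) := incl.
have II : I0 *m I0^T = 1%:M by exact: incl_unitary.
have IK v : supp k.+1 v -> v *m I0^T *m I0 = v by exact: inclK.
pose al := a *m I0^T.
have al1 : dot al al = 1 by rewrite dot_mul trmxK IK.
have [B1 [BB1 aB1 B1B]] := orthogonal_complement (n := k.+1) al1.
pose B0 : 'M[R]_(k.+1, m.+1) := (B1 : 'M[R]_(k.+1, k.+2)) *m I0.
have BB : B0 *m B0^T = 1%:M.
  by rewrite /B0 trmx_mul mulmxA -(mulmxA _ I0) II mulmx1 BB1.
have aB : a *m B0^T = 0 by rewrite /B0 trmx_mul mulmxA aB1.
have aB' : (cos r *: a) *m B0^T = 0 by rewrite -scalemxAl aB scaler0.
have BK v : supp k.+1 v -> v *m B0^T *m B0 = v - dot a v *: a.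
  move=> sv; rewrite /B0 trmx_mul !mulmxA -(mulmxA _ B1^T) B1B mulmxBr mulmx1 mulmxBl IK//.
  congr (_ - _); rewrite mulmxA mul_trmx dot_mul trmxK IK// (dotC v) mul_scalar_mx -scalemxAl.
  by rewrite IK.
have ab1 : dot (cos r *: a) (cos r *: a) + sin r ^+ 2 = 1.
  by rewrite dotZl dotZr a1 mulr1 -expr2 cos2Dsin2.
have a00 : cos r *: a != 0 by rewrite scaler_eq0 negb_or gt_eqF//= unit_neq0.
apply: (extrinsic_sphere_eigenvalue k2 BB aB' sr0 ab1 fc finj a00) => q.
rewrite rf; apply: iff_trans (geodesic_sphere_RP q a1 sa ha r01) _; split.
  move=> [b [b1 sb hb ab]]; pose y := (sin r)^-1 *: (b *m B0^T).
  have yB : y *m B0 = (sin r)^-1 *: (b - cos r *: a) by rewrite /y -scalemxAl BK// ab.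
  have y1 : dot y y = 1.
    rewrite /y dotZl dotZr dot_mul trmxK BK// dotBr dotZr b1 (dotC b) ab -expr2 -sin2cos2.
    by field.
  exists y; first exact: unit_neq0.
  rewrite /real_lift normalize_scale rpow_unit// scale1r yB (scalerA (sin r)) mulfV// scale1r.
  by rewrite addrC subrK.
move=> [y y0 hy]; exists (real_lift B0 (cos r *: a) (sin r) y); split=> //.
- exact: dot_real_lift.
- have sB (z : 'rV[R]_k.+1) : supp k.+1 (z *m B0).
    by move=> i ki; rewrite /B0 mulmxA incl_supp.
  by rewrite /real_lift -[cos r *: a]scale1r; apply: suppD => //; exact: suppZ.
- by rewrite /real_lift dotDr !dotZr a1 mulr1 (dotC a) dot_mul aB dot0r mulr0 addr0.
Qed.

End ExtrinsicSphere.

Theorem proposition5p1 (R : realType) (m k : nat) (M : topologicalType)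
    (f : M -> CP R m) (hk : (2 <= k)%N)
    (hclosed : closed_submanifold k f) (hconn : connected [set: M])
    (humb : totally_umbilical k f) :
  [/\ (forall l : nat, (l <= m)%N -> k = (2 * l)%N ->
         embedded_onto f (standard_CP l) ->
         is_nth_eigenvalue k f 2 (k%:R + 4)),
      ((k <= m)%N -> embedded_onto f (standard_RP k) ->
         is_nth_eigenvalue k f 2 (k%:R + 2)),
      ((k <= m)%N -> is_double_cover k f ->
         is_nth_eigenvalue k f 2 0)
    & (forall (p : CP R m) (r : R), (k.+1 <= m)%N -> standard_RP k.+1 p ->
         0 < r < pi / 2 ->
         embedded_onto f (geodesic_sphere (standard_RP k.+1) p r) ->
         is_nth_eigenvalue k f 2 0)].
Proof.
split.
- move=> l lm kl [finj rf]; subst k.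
  by apply: complex_projective_eigenvalue => //; case: l hk {lm hclosed humb rf}.
- move=> km [finj rf]; apply: (real_projective_eigenvalue hk (incl_unitary km)) => // q.
  by rewrite rf; exact: standard_RPE.
- by move=> km; exact: double_cover_eigenvalue hk km hclosed.1.
- by move=> p r km hp r01 [finj rf]; exact: (geodesic_sphere_eigenvalue hk km hclosed finj hp r01 rf).
Qed.
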